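(* Let $\Omega\subset\mathbb{C}$ be a domain, let $N\ge 2$ be an integer, and let $g:\overline{\Omega}\times\Omega\to\mathbb{R}$ be of class $C^2$ and symmetric ($g(w,z)=g(z,w)$ for all $w,z\in\Omega$). Define $h:\Omega\to\mathbb{R}$, $h(z)=g(z,z)$, and on $\{z=(z_1,\dots,z_N)\in\Omega^N: z_j\ne z_k\text{ for } j\ne k\}$ define \[ H_\Omega(z)=\frac1{2\pi}\sum_{\substack{j,k=1\\ j\ne k}}^N\log\frac1{|z_j-z_k|}-\sum_{\substack{j,k=1\\ j\ne k}}^N g(z_j,z_k)-\sum_{k=1}^N g(z_k,z_k). \] Consider the Hamiltonian system \[ \dot z_k(t)=-i\nabla_{z_k}H_\Omega(z(t)),\qquad k=1,\dots,N. \tag{HS} \] If $a_0\in\Omega$ is a stable critical point of $h$, then there exists $r_0>0$ such that for each $0<r\le r_0$, (HS) has a periodic solution $z^r=(z^r_1,\dots,z^r_N)$ with minimal period $T_r=4\pi^2r^2/(N-1)$ such that $z^r_k(t)=z^r_1(t+(k-1)T_r/N)$ for every $k=1,\dots,N$. Moreover, there exist $a_r\in\Omega$ with $a_r\to a_0$ as $r\to 0$ such that the rescaled function \[ u^r_1(t):=\frac1r\big(z^r_1(T_rt/2\pi)-a_r\big) \] satisfies $u^r_1\to u_0$, where $u_0(t)=e^{it}$, in $H^1(\mathbb{R}/2\pi\mathbb{Z},\mathbb{C})$ as $r\to0$.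
   Context: Here $\mathbb{C}$ is identified with $\mathbb{R}^2$, $i$ is the imaginary unit and $\nabla_{z_k}$ denotes the (real) gradient with respect to the $k$-th complex variable. A critical point $a\in\Omega$ of $h$ with $h(a)=c$ is called stable if it is an isolated critical point and its critical group $H_*(h^c,h^c\setminus\{a\})$ is nontrivial, where $h^c=\{z\in\Omega: h(z)\le c\}$ and $H_*$ denotes (singular) homology. $H^1(\mathbb{R}/2\pi\mathbb{Z},\mathbb{C})$ is the Sobolev space of $2\pi$-periodic absolutely continuous functions with square integrable derivative. *)

(* Defs.v *)
(* C is identified with R*R (R : realType). *)
From HB Require Import structures.
From mathcomp Require Import all_boot all_order all_algebra.
From mathcomp Require Import all_classical all_reals all_analysis.
Set Implicit Arguments. Unset Strict Implicit. Unset Printing Implicit Defensive.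
Import Order.TTheory GRing.Theory Num.Theory.
Import numFieldNormedType.Exports.
Local Open Scope classical_set_scope.
Local Open Scope ring_scope.

Section Defs.
Variable R : realType.

Definition pt := (R * R)%type.

Definition csq (p : pt) : R := p.1 ^+ 2 + p.2 ^+ 2.
Definition cabs (p : pt) : R := Num.sqrt (csq p).
(* multiplication by -i : -i (a + i b) = b - i a *)
Definition mul_mi (p : pt) : pt := (p.2, - p.1).

Definition grad (f : pt -> R) (p : pt) : pt :=
  ('D_((1, 0) : pt) f p, 'D_((0, 1) : pt) f p).

Definition pt2 := (pt * pt)%type.

Definition e4 (j : 'I_4) : pt2 :=
  match val j with
  | 0 => ((1, 0), (0, 0))
  | 1 => ((0, 1), (0, 0))
  | 2 => ((0, 0), (1, 0))
  | _ => ((0, 0), (0, 1))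
  end.

Definition cont_ext (U D : set pt2) (F : pt2 -> R) : Prop :=
  exists G : pt2 -> R, {within D, continuous G} /\ (forall x, U x -> G x = F x).

Definition C2_closO_O (O : set pt) (g : pt2 -> R) : Prop :=
  let U := O `*` O in
  let D := closure O `*` O in
  [/\ forall x, U x -> forall i j : 'I_4,
        derivable g x (e4 i) /\ derivable ('D_(e4 i) g) x (e4 j),
      {within D, continuous g},
      forall i : 'I_4, cont_ext U D ('D_(e4 i) g) &
      forall i j : 'I_4, cont_ext U D ('D_(e4 j) ('D_(e4 i) g))].

Definition H_Omega (N : nat) (g : pt2 -> R) (z : 'I_N -> pt) : R :=
  (2 * pi)^-1 * (\sum_(j < N) \sum_(k < N | j != k) ln ((cabs (z j - z k))^-1))
  - (\sum_(j < N) \sum_(k < N | j != k) g (z j, z k))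
  - \sum_(k < N) g (z k, z k).

Definition upd (N : nat) (z : 'I_N -> pt) (k : 'I_N) (p : pt) : 'I_N -> pt :=
  fun j => if j == k then p else z j.

Definition grad_k (N : nat) (F : ('I_N -> pt) -> R) (z : 'I_N -> pt) (k : 'I_N) : pt :=
  grad (fun p => F (upd z k p)) (z k).

Definition solves_HS (N : nat) (O : set pt) (g : pt2 -> R) (z : 'I_N -> R -> pt) : Prop :=
  forall t : R,
    (forall k, O (z k t)) /\ (forall j k, j != k -> z j t != z k t) /\
    forall k, derivable (z k) t 1 /\
      derive1 (z k) t = mul_mi (grad_k (H_Omega g) (fun j => z j t) k).

Definition is_period (N : nat) (z : 'I_N -> R -> pt) (T : R) : Prop :=
  forall k t, z k (t + T) = z k t.

Definition minimal_period (N : nat) (z : 'I_N -> R -> pt) (T : R) : Prop :=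
  0 < T /\ is_period z T /\ forall T', 0 < T' < T -> ~ is_period z T'.

Definition sublevel (O : set pt) (h : pt -> R) (c : R) : set pt :=
  [set z | O z /\ h z <= c].

Definition isolated_crit (O : set pt) (h : pt -> R) (a : pt) : Prop :=
  O a /\ grad h a = 0 /\
  exists2 e : R, 0 < e & forall z, O z -> z != a -> `|z - a| < e -> grad h z != 0.

Definition stdsimp (n : nat) : set 'rV[R]_n.+1 :=
  [set x | (forall i, 0 <= x 0 i) /\ \sum_i x 0 i = 1].
Arguments stdsimp n : clear implicits.

(* singular n-simplices: maps Delta^n -> R^2 (only their values on Delta^n matter) *)
Definition simplex (n : nat) := 'rV[R]_n.+1 -> pt.

Definition sing_in (X : set pt) (n : nat) (s : simplex n) : Prop :=
  {within stdsimp n, continuous s} /\ s @` stdsimp n `<=` X.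

Definition face (n : nat) (i : 'I_n.+2) (x : 'rV[R]_n.+1) : 'rV[R]_n.+2 :=
  \row_j (match unlift i j with Some j' => x 0 j' | None => 0 end).

(* a singular chain is a finite formal Z-combination, represented by a list *)
Definition chain (n : nat) := seq (int * simplex n).

Definition coef (n : nat) (c : chain n) (s : simplex n) : int :=
  \sum_(p <- c | `[< forall x, stdsimp n x -> p.2 x = s x >]) p.1.

Definition chain_in (X : set pt) (n : nat) (c : chain n) : Prop :=
  forall p, p \in c -> sing_in X p.2.

Definition bdry (n : nat) (c : chain n.+1) : chain n :=
  flatten [seq [seq (((-1) ^+ (val i)) * p.1, p.2 \o face i) | i : 'I_n.+2] | p <- c].

Definition rel_cycle (A : set pt) (n : nat) : chain n -> Prop :=
  match n with
  | 0 => fun _ => True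
  | m.+1 => fun c => forall s, coef (bdry c) s != 0 -> s @` stdsimp m `<=` A
  end.

Definition rel_homology_nontrivial (X A : set pt) (n : nat) : Prop :=
  exists c : chain n, chain_in X c /\ rel_cycle A c /\
    ~ (exists (d : chain n.+1) (e : chain n), chain_in X d /\ chain_in A e /\
         forall s, coef c s = coef (bdry d) s + coef e s).

(* stable critical point : isolated, with nontrivial critical group *)
Definition stable_crit (O : set pt) (h : pt -> R) (a : pt) : Prop :=
  isolated_crit O h a /\
  exists n, rel_homology_nontrivial (sublevel O h (h a)) (sublevel O h (h a) `\ a) n.

Definition H1sq (v : R -> pt) : \bar R :=
  (\int[lebesgue_measure]_(t in `[0%R, (2 * pi)%R]) (csq (v t) + csq (derive1 v t))%:E)%E.

End Defs.

(* Main.v *)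
(* Lyapunov-Schmidt reduction. With [z_k (t) = a + r u (2 pi t / T_r + 2 pi k / N)] the system becomes
   an autonomous equation [u' = i Y a r u] whose limit for [r = 0] has the rotating polygon
   [u0 t = e^(it)] as a solution. The linearization at [u0] decouples over the characters of the
   cyclic shift into planar systems with constant coefficients; its kernel is spanned by [i u0] and
   the constants, and its cokernel by [u0] and the constants. A contraction therefore gives, for [a]
   near [a_0] and small [r], a curve [u = u0 + v] with [v = O(r)] solving the equation up to a
   multiple of [u0] and a constant vector, Lipschitz in [a]. Autonomy kills the first multiplier, and
   the second one is a multiple of the gradient of the reduced action [a |-> Phi (a, r, u)], which is
   [C^1]-close to an affine function of [h] as [r -> 0].

   It remains to see that a gradient [C^0]-close to that of [h] vanishes near [a_0] when the critical
   group is nontrivial. If it did not, the descent along it, followed by a retraction onto [h <= c],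
   would deform [h <= c] into [h <= c] minus [a_0] while keeping the boundary of a given relative
   cycle away from [a_0], so that the cycle is trivial by the prism construction. *)
Require Import Defs.
From HB Require Import structures.
From mathcomp Require Import all_boot all_order all_algebra.
From mathcomp Require Import all_classical all_reals all_analysis.
From mathcomp Require Import measurable_realfun zify ring lra.
Set Implicit Arguments. Unset Strict Implicit. Unset Printing Implicit Defensive.
Import Order.TTheory GRing.Theory Num.Theory.
Import numFieldNormedType.Exports.
Local Open Scope classical_set_scope.
Local Open Scope ring_scope.

(** As [g] is only of class C^2, the curve [u] is never differentiated in [a]: it enters through
    Lipschitz bounds and expansions of first order with a quadratic remainder, the form of [taylor2]
    and of the hypotheses of [nontrivial_zero]. The normalization of [v] (mean zero, orthogonal to
    [i u0]) makes the residual of the equation orthogonal to the difference of any two corrections,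
    so that the gradient of the reduced action is its explicit partial derivative in [a]. The
    eigenvalues [sl l] of the linearization are never computed: the planar systems are solved for
    every real parameter, and the constants and rotations select their components by being
    eigenfunctions of [Cop]. The deformation is a finite iteration of explicit descent steps scaled
    by the homotopy time. The retraction converges because away from [a_0] the distance travelled is
    paid for by the decrease of [h], while near [a_0] it is small. Zeros of the reduced gradient may
    be many; [a_r] is chosen almost closest to [a_0], which yields the convergence with a single
    threshold [r0]. *)

Section Continuity.
Context {R : realType} {T : topologicalType}.
Implicit Types f g : T -> R.

Lemma ctD f g : continuous f -> continuous g -> continuous (fun x => f x + g x).
Proof. by move=> cf cg x; exact: cvgD (cf x) (cg x). Qed.

Lemma ctN f : continuous f -> continuous (fun x => - f x).
Proof. by move=> cf x; exact: cvgN (cf x). Qed.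

Lemma ctM f g : continuous f -> continuous g -> continuous (fun x => f x * g x).
Proof. by move=> cf cg x; exact: cvgM (cf x) (cg x). Qed.

Lemma ct_cst (S : topologicalType) (a : S) : continuous (fun _ : T => a).
Proof. by move=> x; exact: cvg_cst. Qed.

Lemma ctX n f : continuous f -> continuous (fun x => f x ^+ n).
Proof.
move=> cf; elim: n => [|n IH].
  by under [X in continuous X]funext do rewrite expr0; exact: ct_cst.
by under [X in continuous X]funext do rewrite exprS; exact: ctM.
Qed.

Lemma ctV f : (forall x, f x != 0) -> continuous f -> continuous (fun x => (f x)^-1).
Proof. by move=> f0 cf x; exact: cvgV (f0 x) (cf x). Qed.

Lemma ct_sum (I : Type) (r : seq I) (P : pred I) (F : I -> T -> R) :
  (forall i, continuous (F i)) -> continuous (fun x => \sum_(i <- r | P i) F i x).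
Proof.
move=> cF; elim: r => [|i r IH].
  have -> : (fun x => \sum_(i <- [::] | P i) F i x) = fun=> 0.
    by apply/funext => x; rewrite big_nil.
  exact: ct_cst.
have -> : (fun x => \sum_(j <- i :: r | P j) F j x) =
  (fun x => (if P i then F i x else 0) + \sum_(j <- r | P j) F j x).
  by apply/funext => x; rewrite big_cons; case: (P i); rewrite ?add0r.
apply: ctD => //; case: (P i) => //; exact: ct_cst.
Qed.

Lemma ct_comp (S S' : topologicalType) (h : S -> S') (f : T -> S) :
  continuous h -> continuous f -> continuous (fun x => h (f x)).
Proof. by move=> ch cf x; apply: continuous_comp; [exact: cf | exact: ch]. Qed.

Lemma ct_pair (S S' : topologicalType) (f : T -> S) (g : T -> S') :
  continuous f -> continuous g -> continuous (fun x => (f x, g x)).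
Proof. by move=> cf cg x; apply: cvg_pair; [exact: cf | exact: cg]. Qed.

Lemma ct_fst (S S' : topologicalType) (f : T -> S * S') :
  continuous f -> continuous (fun x => (f x).1).
Proof. by move=> cf x; apply: (cvg_comp _ _ (cf x)); exact: cvg_fst. Qed.

Lemma ct_snd (S S' : topologicalType) (f : T -> S * S') :
  continuous f -> continuous (fun x => (f x).2).
Proof. by move=> cf x; apply: (cvg_comp _ _ (cf x)); exact: cvg_snd. Qed.

Lemma ct_cos f : continuous f -> continuous (fun x => cos (f x)).
Proof. by apply: ct_comp; exact: continuous_cos. Qed.

Lemma ct_sin f : continuous f -> continuous (fun x => sin (f x)).
Proof. by apply: ct_comp; exact: continuous_sin. Qed.

End Continuity.

Lemma ct_id (T : topologicalType) : continuous (fun x : T => x).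
Proof. by move=> x. Qed.

(** Works on the head symbol of the function. A hypothesis [continuous h] is matched in its unfolded
    form, pointwise with [continuous_at]. *)
Ltac ctn := repeat match goal with
  | H : ?P |- ?P => exact H
  | |- continuous (fun x => x) => apply: ct_id
  | |- continuous (fun _ => ?c) => exact: (@ct_cst _ _ c)
  | |- continuous (fun x => @?f x + @?g x) => apply: (@ctD _ _ f g)
  | |- continuous (fun x => - @?f x) => apply: (@ctN _ _ f)
  | |- continuous (fun x => @?f x * @?g x) => apply: (@ctM _ _ f g)
  | |- continuous (fun x => @?f x ^+ _) => apply: (@ctX _ _ _ f)
  | |- continuous (fun x => cos (@?f x)) => apply: (@ct_cos _ _ f)
  | |- continuous (fun x => sin (@?f x)) => apply: (@ct_sin _ _ f)
  | |- continuous (fun x => (@?f x, @?g x)) => apply: (@ct_pair _ _ _ f g)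
  | |- continuous (fun x => (@?f x).1) => apply: (@ct_fst _ _ _ f)
  | |- continuous (fun x => (@?f x).2) => apply: (@ct_snd _ _ _ f)
  | |- continuous (fun x => \sum_(i <- _ | _) _) => apply: ct_sum => ?
  | H : forall s, continuous_at s ?h |- continuous (fun x => ?h (@?f x)) =>
      apply: (@ct_comp _ _ _ h f H)
  | H : forall y s, continuous_at s (?h y) |- continuous (fun x => ?h ?z (@?f x)) =>
      apply: (@ct_comp _ _ _ (h z) f (H z))
  | H : forall _, continuous _ |- _ => apply: H
  end.

(* [lra] inspects the whole context; discarding the quantified hypotheses first keeps it fast. *)
Ltac slra := repeat match goal with
  | H : forall _, _ |- _ => clear H
  | x := _ |- _ => clearbody x
  end; lra.

Lemma bool_natE {R : realType} : (true%:R = 1 :> R) * (false%:R = 0 :> R).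
Proof. by []. Qed.

(** * Derivatives, antiderivatives and means on the real line *)

Section Derivatives.
Context {R : realType}.
Implicit Types f g F : R -> R.

Definition Deriv f f' := forall t : R, is_derive t (1 : R) f (f' t).

Lemma Deriv_ext f f' g' : Deriv f f' -> f' =1 g' -> Deriv f g'.
Proof. by move=> Df e t; rewrite -e. Qed.

Lemma Deriv_extl f g f' : Deriv f f' -> f =1 g -> Deriv g f'.
Proof. by move=> Df /funext <-. Qed.

Lemma Deriv_cst (a : R) : Deriv (fun=> a) (fun=> 0).
Proof. by move=> t; exact: is_derive_cst. Qed.

Lemma Deriv_id : Deriv (fun t => t) (fun=> 1).
Proof. by move=> t; exact: is_derive_id. Qed.

Lemma DerivD f g f' g' : Deriv f f' -> Deriv g g' ->
  Deriv (fun t => f t + g t) (fun t => f' t + g' t).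
Proof. by move=> Df Dg t; exact: is_deriveD. Qed.

Lemma DerivN f f' : Deriv f f' -> Deriv (fun t => - f t) (fun t => - f' t).
Proof. by move=> Df t; exact: is_deriveN. Qed.

Lemma DerivM f g f' g' : Deriv f f' -> Deriv g g' ->
  Deriv (fun t => f t * g t) (fun t => f t * g' t + g t * f' t).
Proof. by move=> Df Dg t; exact: is_deriveM. Qed.

Lemma Deriv_comp f g f' g' : Deriv f f' -> Deriv g g' ->
  Deriv (fun t => f (g t)) (fun t => f' (g t) * g' t).
Proof. by move=> Df Dg t; exact: is_derive1_comp. Qed.

Lemma Deriv_shift f f' s : Deriv f f' -> Deriv (fun t => f (t + s)) (fun t => f' (t + s)).
Proof.
move=> Df; apply: (@Deriv_ext _ (fun t => f' (t + s) * (1 + 0))); last first.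
  by move=> t; rewrite addr0 mulr1.
by apply: (Deriv_comp Df); apply: DerivD; [exact: Deriv_id|exact: Deriv_cst].
Qed.

Lemma Deriv_cos : Deriv cos (fun t => - sin t).
Proof. by move=> t; exact: is_derive_cos. Qed.

Lemma Deriv_sin : Deriv sin cos.
Proof. by move=> t; exact: is_derive_sin. Qed.

Lemma Deriv_sum (I : Type) (r : seq I) (P : pred I) (F F' : I -> R -> R) :
  (forall i, Deriv (F i) (F' i)) ->
  Deriv (fun t => \sum_(i <- r | P i) F i t) (fun t => \sum_(i <- r | P i) F' i t).
Proof.
move=> DF; elim: r => [|i r IH].
  apply: (@Deriv_extl (fun=> 0)); last by move=> t; rewrite big_nil.
  by apply: (Deriv_ext (Deriv_cst 0)) => t; rewrite big_nil.
apply: (@Deriv_extl (fun t => (if P i then F i t else 0) + \sum_(j <- r | P j) F j t)).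
  apply: (@Deriv_ext _ (fun t => (if P i then F' i t else 0) + \sum_(j <- r | P j) F' j t)).
    by apply: DerivD => //; case: (P i) => //; exact: Deriv_cst.
  by move=> t; rewrite big_cons; case: (P i); rewrite ?add0r.
by move=> t; rewrite big_cons; case: (P i); rewrite ?add0r.
Qed.

Lemma Deriv_continuous f f' : Deriv f f' -> continuous f.
Proof.
move=> Df t; have [d _] := Df t.
exact/differentiable_continuous/derivable1_diffP.
Qed.

Lemma Deriv0_cst f x y : Deriv f (fun=> 0) -> f x = f y.
Proof. by move=> Df; apply: is_derive_0_is_cst => t; exact: Df. Qed.

Lemma Deriv_le f f' a b C : a <= b -> Deriv f f' ->
  (forall t, a <= t <= b -> f' t <= C) -> f b - f a <= C * (b - a).
Proof.
move=> ab Df bf; have [c + ->] : exists2 c, c \in `[a, b]%R & f b - f a = f' c * (b - a).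
  apply: MVT_segment => //; apply/continuous_subspaceT.
  exact: Deriv_continuous Df.
by rewrite in_itv/= => /bf; apply: ler_wpM2r; rewrite subr_ge0.
Qed.

Lemma continuous_primitive_right f (a : R) : continuous f ->
  exists F, forall x : R, a < x -> is_derive x (1:R) F (f x).
Proof.
move=> cf; exists (fun x => \int[lebesgue_measure]_(t in `[a, x]) f t)%R => x ax.
have [] := @continuous_FTC1_closed R f a x (x + 1).
- by rewrite ltrDl.
- apply: continuous_compact_integrable; first exact: segment_compact.
  exact: continuous_subspaceT.
- exact: ax.
- exact: cf.
by rewrite derive1E => df <-; split.
Qed.

(** The fundamental theorem of calculus gives an antiderivative only to the right of a base point.
    Those based at [-n], normalized to vanish at 0, agree where both are defined and are glued. *)
Lemma continuous_primitive f : continuous f -> exists F, Deriv F f.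
Proof.
move=> cf.
have /choice [F HF] : forall n : nat, exists F, forall x : R, - n%:R < x -> is_derive x (1:R) F (f x).
  by move=> n; exact: continuous_primitive_right.
pose G n x := F n x - F n 0.
have DG n (x : R) : - n%:R < x -> is_derive x (1:R) (G n) (f x).
  move=> nx; rewrite -[f x]subr0; apply: is_deriveB; exact: HF.
have Gle m n (x : R) : (0 < n <= m)%N -> - n%:R < x -> G m x = G n x.
  move=> /andP[n0 nm] nx.
  have Dz (y : R) : - n%:R < y -> is_derive y (1:R) (G m - G n) 0.
    move=> ny; rewrite -(subrr (f y)); apply: is_deriveB; apply: DG => //.
    by apply: le_lt_trans ny; rewrite lerN2 ler_nat.
  have cst (a b : R) : a <= b -> - n%:R < a -> (G m - G n) b = (G m - G n) a.
    move=> ab na; apply/eqP; rewrite -subr_eq0; apply/eqP.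
    have [||c _ ->] := @MVT_segment R (G m - G n) (fun=> 0) a b ab; rewrite ?mul0r//.
      by move=> y; rewrite in_itv/= => /andP[ay _]; apply: Dz; apply: lt_trans ay.
    apply: derivable_within_continuous => y; rewrite in_itv/= => /andP[ay _].
    by have [] := Dz _ (lt_le_trans na ay).
  have G0 k : G k 0 = 0 by rewrite /G subrr.
  apply/eqP; rewrite -subr_eq0; apply/eqP.
  have [x0|x0] := leP 0 x.
    have := cst 0 x x0; rewrite !fctE !G0 subrr; apply.
    by rewrite oppr_lt0 ltr0n.
  by have := cst x 0 (ltW x0) nx; rewrite !fctE !G0 subrr => <-.
exists (fun x => G (Num.bound `|x|).+1 x) => x.
pose n := (Num.bound (`|x| + 1)).+1.
have xn : `|x| + 1 < n%:R.
  apply: (lt_trans (archi_boundP _)); last by rewrite ltr_nat.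
  by rewrite addr_ge0.
apply: (@near_eq_is_derive _ _ _ (G n)); last first.
  apply: DG; rewrite ltrNl; apply: le_lt_trans xn.
  by rewrite -normrN; apply: (le_trans (ler_norm _)); rewrite lerDl.
near=> y.
have yn : `|y| < n%:R.
  apply: lt_trans xn; rewrite -[y](subrKC x); apply: (le_lt_trans (ler_normD _ _)).
  rewrite ltrD2l distrC; near: y; exact: cvgr_dist_lt.
have yb : `|y| < (Num.bound `|y|).+1%:R.
  by apply: (lt_trans (archi_boundP (normr_ge0 _))); rewrite ltr_nat.
have yN m : `|y| < m%:R -> - m%:R < y.
  by move=> h; rewrite ltrNl; apply: le_lt_trans h; rewrite -normrN ler_norm.
have [nm|/ltnW mn] := leqP n (Num.bound `|y|).+1.
  by apply/esym; apply: Gle; [rewrite nm|exact: yN].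
by apply: Gle; [rewrite mn|exact: yN].
Unshelve. all: by end_near. Qed.

(* Integrals over intervals are increments of an antiderivative; [prim f] is [0] when [f] has none. *)
Definition prim f : R -> R := xget (fun=> 0) [set F | Deriv F f].

Lemma primP F f : Deriv F f -> Deriv (prim f) f.
Proof. by move=> DF; rewrite /prim; case: xgetP => // /(_ F). Qed.

Lemma Deriv_prim f : continuous f -> Deriv (prim f) f.
Proof. by move/continuous_primitive => [F /primP]. Qed.

Definition integ f a b := prim f b - prim f a.

Lemma Deriv_diff_cst F G f a b : Deriv F f -> Deriv G f -> F b - F a = G b - G a.
Proof.
move=> DF DG; have : F b - G b = F a - G a.
  apply: (@Deriv0_cst (fun t => F t - G t)).
  by apply: (Deriv_ext (DerivD DF (DerivN DG))) => t; rewrite subrr.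
lra.
Qed.

Lemma integE F f a b : Deriv F f -> integ f a b = F b - F a.
Proof. by move=> DF; apply: (Deriv_diff_cst _ _ (primP DF) DF). Qed.

Definition per (T : Type) (f : R -> T) := forall t, f (t + 2 * pi) = f t.

Definition mean f := integ f 0 (2 * pi) / (2 * pi).

Lemma tpi_gt0 : 0 < 2 * pi :> R.
Proof. by rewrite mulr_gt0// pi_gt0. Qed.

Lemma tpi_neq0 : 2 * pi != 0 :> R.
Proof. by rewrite gt_eqF// tpi_gt0. Qed.

Lemma eq_mean f g : f =1 g -> mean f = mean g.
Proof. by move/funext ->. Qed.

Lemma meanE F f : Deriv F f -> mean f = (F (2 * pi) - F 0) / (2 * pi).
Proof. by move=> DF; rewrite /mean (integE _ _ DF). Qed.

Lemma mean_cst a : mean (fun=> a) = a.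
Proof.
rewrite (@meanE (fun t => a * t)); first by rewrite mulr0 subr0 mulfK// tpi_neq0.
by apply: (Deriv_ext (DerivM (Deriv_cst a) Deriv_id)) => t; ring.
Qed.

Lemma meanD f g : continuous f -> continuous g ->
  mean (fun t => f t + g t) = mean f + mean g.
Proof.
move=> /Deriv_prim Df /Deriv_prim Dg.
by rewrite (meanE (DerivD Df Dg)) (meanE Df) (meanE Dg); ring.
Qed.

Lemma meanN f : continuous f -> mean (fun t => - f t) = - mean f.
Proof.
by move=> /Deriv_prim Df; rewrite (meanE (DerivN Df)) (meanE Df); ring.
Qed.

Lemma meanB f g : continuous f -> continuous g ->
  mean (fun t => f t - g t) = mean f - mean g.
Proof. by move=> cf cg; rewrite meanD ?meanN//; exact: ctN. Qed.

Lemma meanZ a f : continuous f -> mean (fun t => a * f t) = a * mean f.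
Proof.
move=> /Deriv_prim Df.
have Da : Deriv (fun t => a * prim f t) (fun t => a * f t).
  by apply: (Deriv_ext (DerivM (Deriv_cst a) Df)) => t; ring.
by rewrite (meanE Da) (meanE Df); ring.
Qed.

Lemma mean_sum (I : Type) (r : seq I) (P : pred I) (F : I -> R -> R) :
  (forall i, continuous (F i)) ->
  mean (fun t => \sum_(i <- r | P i) F i t) = \sum_(i <- r | P i) mean (F i).
Proof.
move=> cF; elim: r => [|i r IH].
  by rewrite big_nil -[RHS](mean_cst 0); apply: eq_mean => t; rewrite big_nil.
rewrite big_cons -IH; case: ifPn => Pi.
  rewrite -meanD//; last exact: ct_sum.
  by apply: eq_mean => t; rewrite big_cons Pi.
by apply: eq_mean => t; rewrite big_cons (negbTE Pi).
Qed.

Lemma mean_ge0 f : continuous f -> (forall t : R, 0 <= t <= 2 * pi -> 0 <= f t) -> 0 <= mean f.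
Proof.
move=> /Deriv_prim Df f0; rewrite (meanE Df) divr_ge0 ?(ltW tpi_gt0)//.
have : - prim f (2 * pi) - (- prim f 0) <= 0 * (2 * pi - 0).
  apply: (Deriv_le (ltW tpi_gt0) (DerivN Df)) => t tI; rewrite oppr_le0; exact: f0.
by rewrite mul0r; lra.
Qed.

Lemma mean_le f g : continuous f -> continuous g -> 
  (forall t : R, 0 <= t <= 2 * pi -> f t <= g t) -> mean f <= mean g.
Proof.
move=> cf cg fg; rewrite -subr_ge0 -meanB//.
by apply: mean_ge0 => [|t tI]; [ctn|rewrite subr_ge0 fg].
Qed.

Lemma mean_norm f C : continuous f -> 
  (forall t : R, 0 <= t <= 2 * pi -> `|f t| <= C) -> `|mean f| <= C.
Proof.
move=> cf fC; rewrite ler_norml -{1}(mean_cst (- C)) -{2}(mean_cst C).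
apply/andP; split; apply: mean_le => //; try exact: ct_cst;
  by move=> t /fC; rewrite ler_norml => /andP[].
Qed.

Lemma mean_der F f : Deriv F f -> per F -> mean f = 0.
Proof. by move=> DF pF; rewrite (meanE DF) -[2 * pi]add0r pF subrr mul0r. Qed.

Lemma integ_per f t : continuous f -> per f -> integ f t (t + 2 * pi) = 2 * pi * mean f.
Proof.
move=> cf pf; rewrite /mean [RHS]mulrC divfK ?tpi_neq0//.
have Df := Deriv_prim cf.
rewrite /integ -{2}(add0r (2 * pi)).
apply: (@Deriv0_cst (fun t => prim f (t + 2 * pi) - prim f t)).
apply: (Deriv_ext (DerivD (Deriv_shift (2 * pi) Df) (DerivN Df))) => s.
by rewrite pf subrr.
Qed.

Lemma mean_shift f s : continuous f -> per f -> mean (fun t => f (t + s)) = mean f.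
Proof.
move=> cf pf; have Df := Deriv_prim cf.
rewrite (meanE (Deriv_shift s Df)) add0r (addrC (2 * pi)).
by rewrite -[_ - _]/(integ f s _) integ_per// mulrC mulKf// tpi_neq0.
Qed.

End Derivatives.
Arguments per {R T} f.

(** * Periodic solutions of planar linear systems with constant coefficients *)

Section ScalarPeriodicSystems.
Context {R : realType}.
Implicit Types f g k : R -> R.

(** Since [h] has mean zero, [h t] is the mean of the increments [h t - h (s + t)] over one
    period. *)
Lemma per_mean0_bound (h h' : R -> R) D : 0 <= D -> Deriv h h' -> per h -> mean h = 0 ->
  (forall t, `|h' t| <= D) -> forall t, `|h t| <= 2 * pi * D.
Proof.
move=> D0 Dh ph mh bh t; have ch := Deriv_continuous Dh.
have -> : h t = mean (fun s => h t - h (s + t)).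
  rewrite meanB ?mean_cst ?mean_shift ?mh ?subr0//; last by ctn.
  exact: ct_cst.
apply: mean_norm => [|s /andP[s0 s1]]; first by ctn.
have lip : `|h (s + t) - h t| <= D * s.
  rewrite ler_norml; apply/andP; split.
    rewrite lerNl; have := @Deriv_le _ (fun u => - h u) (fun u => - h' u) t (s + t) D.
    rewrite addrK opprK (addrC (- _)) opprB; apply; first by rewrite lerDr.
      exact: DerivN.
    by move=> u _; apply: le_trans (bh u); rewrite -normrN ler_norm.
  have := @Deriv_le _ h h' t (s + t) D; rewrite addrK; apply; first by rewrite lerDr.
    exact: Dh.
  by move=> u _; apply: le_trans (bh u); rewrite ler_norm.
rewrite distrC; apply: (le_trans lip); rewrite [leRHS]mulrC; exact: ler_wpM2l.
Qed.

(** The antiderivative of [f - mean f] of mean zero; removing the mean of [f] is what makes it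
    periodic. *)
Definition aprim f t := prim f t - t * mean f - mean (fun t => prim f t - t * mean f).

Lemma aprimP f : continuous f -> per f ->
  [/\ per (aprim f), Deriv (aprim f) (fun t => f t - mean f) & mean (aprim f) = 0].
Proof.
move=> cf pf; have Df := Deriv_prim cf; have cp := Deriv_continuous Df.
split.
- move=> t; rewrite /aprim; have := integ_per t cf pf; rewrite /integ => e.
  lra.
- apply: (@Deriv_ext _ _ (fun t => f t - (t * 0 + mean f * 1) - 0)); last by move=> t; ring.
  apply: DerivD; last by apply: DerivN; exact: Deriv_cst.
  by apply: DerivD => //; apply/DerivN/DerivM; [exact: Deriv_id|exact: Deriv_cst].
- rewrite /aprim meanB ?mean_cst ?subrr//; ctn.
Qed.

Lemma aprim_lip f g (B : R) : continuous f -> per f -> continuous g -> per g ->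
  (forall t, `|f t - g t| <= B) -> forall t, `|aprim f t - aprim g t| <= 4 * pi * B.
Proof.
move=> cf pf cg pg fg t.
have [pf1 Df1 mf1] := aprimP cf pf; have [pg1 Dg1 mg1] := aprimP cg pg.
have B0 : 0 <= B by apply: le_trans (fg 0).
have -> : 4 * pi * B = 2 * pi * (B + B) by ring.
apply: (@per_mean0_bound (fun t => aprim f t - aprim g t)
  (fun t => f t - mean f + - (g t - mean g))) => //.
- by rewrite addr_ge0.
- exact: DerivD Df1 (DerivN Dg1).
- by move=> u; rewrite pf1 pg1.
- by rewrite meanB ?mf1 ?mg1 ?subr0//; [exact: Deriv_continuous Df1|exact: Deriv_continuous Dg1].
- move=> u; have -> : f u - mean f - (g u - mean g) = (f u - g u) - mean (fun t => f t - g t).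
    by rewrite meanB//; ring.
  apply: (le_trans (ler_normB _ _)); apply: lerD => //; apply: mean_norm => //; ctn.
Qed.

(** A correlation rather than a convolution: with [f (t + s)] no reflection of the kernel is
    needed. *)
Definition conv k f t := mean (fun s => k s * f (t + s)).

Lemma conv_per k f : per f -> per (conv k f).
Proof. by move=> pf t; apply: eq_mean => s; rewrite addrAC pf. Qed.

Lemma conv_lip k f g (K B : R) : continuous k -> continuous f -> continuous g ->
  (forall t : R, 0 <= t <= 2 * pi -> `|k t| <= K) -> (forall t, `|f t - g t| <= B) ->
  forall t, `|conv k f t - conv k g t| <= K * B.
Proof.
move=> ck cf cg kK fg t.
have cs (h : R -> R) : continuous h -> continuous (fun s => h (t + s)) by move=> ch; ctn.
rewrite /conv -meanB; [|by have := cs _ cf; move=> ?; ctn|by have := cs _ cg; move=> ?; ctn].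
apply: mean_norm => [|s sI]; first by have := cs _ cf; have := cs _ cg; move=> ? ?; ctn.
rewrite -mulrBr normrM; apply: ler_pM => //; exact: kK.
Qed.

(** The kernel [k (x - y)] is separable, so [conv k f t] is a combination of the integrals of [q1 f]
    and [q2 f] over the window [[t, t + 2 pi]]. Differentiating the coefficients gives [conv k' f];
    differentiating the window gives the jump of [k] over a period times [f t]. *)
Lemma conv_deriv k k' f (p1 p2 q1 q2 p1' p2' : R -> R) : continuous f -> per f ->
  Deriv p1 p1' -> Deriv p2 p2' -> continuous q1 -> continuous q2 ->
  (forall x y, k (x - y) = p1 y * q1 x + p2 y * q2 x) ->
  (forall x y, k' (x - y) = p1' y * q1 x + p2' y * q2 x) ->
  Deriv (conv k f) (fun t => conv k' f t + (k (2 * pi) - k 0) / (2 * pi) * f t).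
Proof.
move=> cf pf Dp1 Dp2 cq1 cq2 Hk Hk'.
pose I q t := integ (fun s => q s * f s) t (t + 2 * pi) / (2 * pi).
have convE (h a b : R -> R) : (forall x y, h (x - y) = a y * q1 x + b y * q2 x) ->
    forall t, conv h f t = a t * I q1 t + b t * I q2 t.
  move=> Hh t.
  have D1 : Deriv (prim (fun s => q1 s * f s)) (fun s => q1 s * f s) by apply: Deriv_prim; ctn.
  have D2 : Deriv (prim (fun s => q2 s * f s)) (fun s => q2 s * f s) by apply: Deriv_prim; ctn.
  have D3 : Deriv (fun s => a t * prim (fun s => q1 s * f s) (s + t)
     + b t * prim (fun s => q2 s * f s) (s + t)) (fun s => h s * f (t + s)).
    apply: (Deriv_ext (DerivD (DerivM (Deriv_cst _) (Deriv_shift t D1))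
      (DerivM (Deriv_cst _) (Deriv_shift t D2)))) => s.
    have -> : h s = h (s + t - t) by rewrite addrK.
    by rewrite Hh (addrC t s); ring.
  rewrite /conv (meanE D3) /I /integ add0r (addrC t); ring.
have DI q : continuous q -> Deriv (I q) (fun t => (q (t + 2 * pi) - q t) * f t / (2 * pi)).
  move=> cq.
  have D1 : Deriv (prim (fun s => q s * f s)) (fun s => q s * f s) by apply: Deriv_prim; ctn.
  apply: (Deriv_ext (DerivM (DerivD (Deriv_shift (2 * pi) D1) (DerivN D1)) (Deriv_cst _))) => t.
  by rewrite pf; ring.
apply: (@Deriv_extl _ (fun t => p1 t * I q1 t + p2 t * I q2 t)); last first.
  by move=> t; rewrite (convE _ _ _ Hk).
apply: (Deriv_ext (DerivD (DerivM Dp1 (DI _ cq1)) (DerivM Dp2 (DI _ cq2)))) => t.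
rewrite (convE _ _ _ Hk').
have := Hk (t + 2 * pi) t; have := Hk t t; rewrite subrr addrAC subrr add0r => -> ->.
ring.
Qed.

(* The projection of [(f1, f2)] on the [2 pi]-periodic solutions of the adjoint of the system
   [a' = (1 - s) b], [b' = - (1 + s) a]: its frequency [sqrt (1 - s^2)] is an integer only for
   [s = -1, 0, 1]. *)
Definition res1 (s : R) (f1 f2 : R -> R) t :=
  (s == 1)%:R * mean f1
  + (s == 0)%:R * (cos t * mean (fun t => cos t * f1 t - sin t * f2 t)
                 + sin t * mean (fun t => sin t * f1 t + cos t * f2 t)).

Definition res2 (s : R) (f1 f2 : R -> R) t :=
  (s == -1)%:R * mean f2
  + (s == 0)%:R * (cos t * mean (fun t => sin t * f1 t + cos t * f2 t)
                 - sin t * mean (fun t => cos t * f1 t - sin t * f2 t)).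

(** Solvability up to the residual [res1], [res2], with solution operators that are Lipschitz for
    the uniform norm; this is the form in which a contraction can use them. *)
Definition solver (s : R) (a b : (R -> R) -> (R -> R) -> R -> R) (C : R) :=
  (forall f1 f2, continuous f1 -> per f1 -> continuous f2 -> per f2 ->
    [/\ per (a f1 f2), per (b f1 f2),
       Deriv (a f1 f2) (fun t => (1 - s) * b f1 f2 t + f1 t - res1 s f1 f2 t) &
       Deriv (b f1 f2) (fun t => - (1 + s) * a f1 f2 t + f2 t - res2 s f1 f2 t)]) /\
  (forall f1 f2 g1 g2 (B : R), continuous f1 -> per f1 -> continuous f2 -> per f2 ->
    continuous g1 -> per g1 -> continuous g2 -> per g2 ->
    (forall t, `|f1 t - g1 t| <= B) -> (forall t, `|f2 t - g2 t| <= B) ->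
    forall t, `|a f1 f2 t - a g1 g2 t| <= C * B /\ `|b f1 f2 t - b g1 g2 t| <= C * B).

Lemma mean_lip f g (B : R) : continuous f -> continuous g -> (forall t, `|f t - g t| <= B) ->
  `|mean f - mean g| <= B.
Proof. by move=> cf cg fg; rewrite -meanB//; apply: mean_norm => //; ctn. Qed.

Lemma ctcos : continuous (@cos R). Proof. exact: continuous_cos. Qed.
Lemma ctsin : continuous (@sin R). Proof. exact: continuous_sin. Qed.

Lemma per_cos : per (@cos R).
Proof. by move=> t; rewrite mulr_natl cosD2pi. Qed.

Lemma per_sin : per (@sin R).
Proof. by move=> t; rewrite mulr_natl sinD2pi. Qed.

(** For [s = 1] the system is triangular: [a' = f1 - mean f1] leaves the mean of [a] free, and the
    value [mean f2 / 2] gives [f2 - 2 a] mean zero, so that [b] is periodic. *)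
Lemma solver_1 : exists a b C, 0 <= C /\ solver 1 a b C.
Proof.
pose a (f1 f2 : R -> R) t := aprim f1 t + 2^-1 * mean f2.
pose b f1 f2 := aprim (fun t => f2 t - 2 * a f1 f2 t).
have aP f1 f2 : continuous f1 -> per f1 -> continuous f2 -> per f2 ->
    [/\ continuous (a f1 f2), per (a f1 f2) & mean (a f1 f2) = 2^-1 * mean f2].
  move=> c1 p1 c2 p2; have [pA DA mA] := aprimP c1 p1; have cA := Deriv_continuous DA.
  split; first by rewrite /a; ctn.
    by move=> t; rewrite /a pA.
  by rewrite /a meanD ?mA ?add0r ?mean_cst//; ctn.
have pi0 := pi_ge0 R.
exists a, b, (4 * pi + 1 + 4 * pi * (1 + 2 * (4 * pi + 1))); split.
  by rewrite !addr_ge0// ?mulr_ge0// ?addr_ge0// mulr_ge0// addr_ge0// mulr_ge0.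
split=> [f1 f2 c1 p1 c2 p2|f1 f2 g1 g2 B c1 p1 c2 p2 d1 q1 d2 q2 h1 h2 t].
  have [pA DA mA] := aprimP c1 p1; have [ca pa ma] := aP f1 f2 c1 p1 c2 p2.
  have cb : continuous (fun t => f2 t - 2 * a f1 f2 t) by ctn.
  have pb : per (fun t => f2 t - 2 * a f1 f2 t) by move=> t; rewrite p2 pa.
  have [pB DB mB] := aprimP cb pb.
  have z1 : (1 == 0 :> R) = false by rewrite oner_eq0.
  have zm1 : (1 == -1 :> R) = false by apply/negbTE/eqP; lra.
  split=> //.
    apply: (Deriv_ext (DerivD DA (Deriv_cst _))) => t.
    by rewrite /res1 eqxx z1 !bool_natE; ring.
  apply: (Deriv_ext DB) => t; rewrite /res2 z1 zm1 !bool_natE.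
  rewrite meanB//; last by ctn.
  rewrite meanZ// ma mulrA divff// mul1r; ring.
have B0 : 0 <= B by apply: le_trans (h1 0).
have [ca pa ma] := aP f1 f2 c1 p1 c2 p2; have [cA pA mA] := aP g1 g2 d1 q1 d2 q2.
have la t' : `|a f1 f2 t' - a g1 g2 t'| <= (4 * pi + 1) * B.
  have -> : a f1 f2 t' - a g1 g2 t' =
    (aprim f1 t' - aprim g1 t') + 2^-1 * (mean f2 - mean g2) by rewrite /a; ring.
  apply: (le_trans (ler_normD _ _)); rewrite mulrDl; apply: lerD.
    exact: aprim_lip.
  rewrite normrM mul1r ger0_norm// -[leRHS]mul1r; apply: ler_pM => //; first by lra.
  exact: mean_lip.
split.
  apply: (le_trans (la t)); apply: ler_wpM2r => //; rewrite lerDl mulr_ge0 ?mulr_ge0//.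
  by rewrite addr_ge0// mulr_ge0// addr_ge0// mulr_ge0.
apply: (@le_trans _ _ (4 * pi * ((1 + 2 * (4 * pi + 1)) * B))).
  apply: aprim_lip; [by ctn|by move=> u; rewrite p2 pa|by ctn|by move=> u; rewrite q2 pA|].
  move=> u.
  have -> : f2 u - 2 * a f1 f2 u - (g2 u - 2 * a g1 g2 u) =
    (f2 u - g2 u) - 2 * (a f1 f2 u - a g1 g2 u) by ring.
  apply: (le_trans (ler_normB _ _)); rewrite [leRHS]mulrDl mul1r; apply: lerD => //.
  by rewrite normrM ger0_norm// -mulrA; apply: ler_wpM2l.
rewrite mulrA; apply: ler_wpM2r => //; rewrite lerDr addr_ge0// mulr_ge0//.
Qed.

(** If [(a, b)] solves the system for [s = -1] with data [(f1, f2)], then [(b, - a)] solves the one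
    for [s = 1] with data [(f2, - f1)]. *)
Lemma solver_N1 : exists a b C, 0 <= C /\ solver (-1) a b C.
Proof.
have [a [b [C [C0 [H1 H2]]]]] := solver_1.
exists (fun f1 f2 t => - b f2 (fun t => - f1 t) t), (fun f1 f2 => a f2 (fun t => - f1 t)), C.
have z1 : (1 == 0 :> R) = false by rewrite oner_eq0.
have zm1 : (1 == -1 :> R) = false by apply/negbTE/eqP; lra.
have zn1 : (-1 == 1 :> R) = false by rewrite eq_sym.
have z0 : (-1 == 0 :> R) = false by apply/negbTE/eqP; lra.
split=> //; split.
  move=> f1 f2 c1 p1 c2 p2.
  have cn : continuous (fun t => - f1 t) by ctn.
  have pn : per (fun t => - f1 t) by move=> t; rewrite p1.
  have [pa pb Da Db] := H1 _ _ c2 p2 cn pn.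
  split=> //.
  - by move=> t; rewrite pb.
  - by apply: (Deriv_ext (DerivN Db)) => t; rewrite /res1 /res2 z1 zm1 z0 zn1 !bool_natE; ring.
  - by apply: (Deriv_ext Da) => t; rewrite /res1 /res2 z1 eqxx z0 eqxx !bool_natE; ring.
move=> f1 f2 g1 g2 B c1 p1 c2 p2 d1 q1 d2 q2 h1 h2 t.
have [] := H2 f2 (fun t => - f1 t) g2 (fun t => - g1 t) B c2 p2 _ _ d2 q2 _ _ h2 _ t.
- by ctn.
- by move=> u; rewrite p1.
- by ctn.
- by move=> u; rewrite q1.
- by move=> u; rewrite -opprD normrN.
- by move=> ha hb; split=> //; rewrite -opprD normrN.
Qed.

Lemma rot_bound (c s x y C : R) : `|c| <= 1 -> `|s| <= 1 -> `|x| <= C -> `|y| <= C ->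
  `|c * x + s * y| <= 2 * C.
Proof.
move=> c1 s1 xC yC; apply: (le_trans (ler_normD _ _)); rewrite !normrM.
have -> : 2 * C = 1 * C + 1 * C by ring.
by apply: lerD; apply: ler_pM.
Qed.

(** Variation of constants: for [s = 0] the homogeneous flow is the rotation, and in the rotated
    frame the system reads [V' = F]; subtracting the mean of [F] removes the resonance. *)
Lemma solver_0 : exists a b C, 0 <= C /\ solver 0 a b C.
Proof.
pose F1 (f1 f2 : R -> R) t := cos t * f1 t - sin t * f2 t.
pose F2 (f1 f2 : R -> R) t := sin t * f1 t + cos t * f2 t.
pose V1 f1 f2 := aprim (F1 f1 f2). pose V2 f1 f2 := aprim (F2 f1 f2).
have cc := ctcos; have cs := ctsin.
have pc := per_cos; have ps := per_sin.
exists (fun f1 f2 t => cos t * V1 f1 f2 t + sin t * V2 f1 f2 t),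
  (fun f1 f2 t => cos t * V2 f1 f2 t - sin t * V1 f1 f2 t), (2 * (4 * pi * 2)).
split; first by rewrite !mulr_ge0// pi_ge0.
have FP f1 f2 : continuous f1 -> per f1 -> continuous f2 -> per f2 ->
  [/\ continuous (F1 f1 f2), per (F1 f1 f2), continuous (F2 f1 f2) & per (F2 f1 f2)].
  move=> c1 p1 c2 p2; split; rewrite /F1 /F2; try by ctn.
    by move=> t; rewrite pc ps p1 p2.
  by move=> t; rewrite pc ps p1 p2.
have z1 : (0 == 1 :> R) = false by rewrite eq_sym oner_eq0.
have zm1 : (0 == -1 :> R) = false by apply/negbTE/eqP; lra.
split=> [f1 f2 c1 p1 c2 p2|f1 f2 g1 g2 B c1 p1 c2 p2 d1 q1 d2 q2 h1 h2 t].
  have [cF1 pF1 cF2 pF2] := FP f1 f2 c1 p1 c2 p2.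
  have [pV1 DV1 _] := aprimP cF1 pF1; have [pV2 DV2 _] := aprimP cF2 pF2.
  have cs1 t := cos2Dsin2 (t : R).
  split.
  - by move=> t; rewrite pc ps /V1 /V2 pV1 pV2.
  - by move=> t; rewrite pc ps /V1 /V2 pV1 pV2.
  - apply: (Deriv_ext (DerivD (DerivM Deriv_cos DV1) (DerivM Deriv_sin DV2))) => t.
    rewrite /res1 z1 eqxx -/(F1 f1 f2) -/(F2 f1 f2).
    have e := cs1 t; rewrite /V1 /V2.
    suff : cos t * F1 f1 f2 t + sin t * F2 f1 f2 t = f1 t.
      by move=> <-; rewrite !bool_natE; ring.
    have -> : f1 t = (cos t ^+ 2 + sin t ^+ 2) * f1 t by rewrite e mul1r.
    by rewrite /F1 /F2; ring.
  - apply: (Deriv_ext (DerivD (DerivM Deriv_cos DV2) (DerivN (DerivM Deriv_sin DV1)))) => t.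
    rewrite /res2 zm1 eqxx -/(F1 f1 f2) -/(F2 f1 f2).
    have e := cs1 t; rewrite /V1 /V2.
    suff : cos t * F2 f1 f2 t - sin t * F1 f1 f2 t = f2 t.
      by move=> <-; rewrite !bool_natE; ring.
    have -> : f2 t = (cos t ^+ 2 + sin t ^+ 2) * f2 t by rewrite e mul1r.
    by rewrite /F1 /F2; ring.
have [cF1 pF1 cF2 pF2] := FP f1 f2 c1 p1 c2 p2.
have [cG1 pG1 cG2 pG2] := FP g1 g2 d1 q1 d2 q2.
have l1 u : `|V1 f1 f2 u - V1 g1 g2 u| <= 4 * pi * (2 * B).
  apply: aprim_lip => // w.
  have -> : F1 f1 f2 w - F1 g1 g2 w = cos w * (f1 w - g1 w) + - sin w * (f2 w - g2 w).
    by rewrite /F1; ring.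
  by apply: rot_bound; rewrite ?normrN ?cos_max ?sin_max.
have l2 u : `|V2 f1 f2 u - V2 g1 g2 u| <= 4 * pi * (2 * B).
  apply: aprim_lip => // w.
  have -> : F2 f1 f2 w - F2 g1 g2 w = sin w * (f1 w - g1 w) + cos w * (f2 w - g2 w).
    by rewrite /F2; ring.
  by apply: rot_bound; rewrite ?normrN ?cos_max ?sin_max.
have -> : 2 * (4 * pi * 2) * B = 2 * (4 * pi * (2 * B)) by ring.
split.
  have -> : cos t * V1 f1 f2 t + sin t * V2 f1 f2 t - (cos t * V1 g1 g2 t + sin t * V2 g1 g2 t)
    = cos t * (V1 f1 f2 t - V1 g1 g2 t) + sin t * (V2 f1 f2 t - V2 g1 g2 t) by ring.
  by apply: rot_bound; rewrite ?cos_max ?sin_max.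
have -> : cos t * V2 f1 f2 t - sin t * V1 f1 f2 t - (cos t * V2 g1 g2 t - sin t * V1 g1 g2 t)
    = cos t * (V2 f1 f2 t - V2 g1 g2 t) + - sin t * (V1 f1 f2 t - V1 g1 g2 t) by ring.
by apply: rot_bound; rewrite ?normrN ?cos_max ?sin_max.
Qed.

Lemma continuous_bounded_segment f (x y : R) : continuous f ->
  exists2 K, 0 <= K & forall t : R, x <= t <= y -> `|f t| <= K.
Proof.
move=> cf; have [xy|yx] := leP x y; last first.
  by exists 0 => // t /andP[h1 h2]; have := le_trans h1 h2; rewrite leNgt yx.
have cn : continuous (fun t => `|f t|) by move=> t; exact: cvg_norm (cf t).
have [c _ H] := EVT_max xy (continuous_subspaceT cn).
by exists `|f c| => // t tI; apply: H; rewrite in_itv.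
Qed.

(* [c] and [sg] stand for cos(mu t), sin(mu t)/mu, or cosh(mu t), sinh(mu t)/mu. *)
Lemma solver_green (s : R) (c sg : R -> R) : s != 0 -> s != 1 -> s != -1 ->
  Deriv c (fun t => - ((1 - s ^+ 2) * sg t)) -> Deriv sg c ->
  (forall x y, c (x - y) = c x * c y + (1 - s ^+ 2) * (sg x * sg y)) ->
  (forall x y, sg (x - y) = sg x * c y - c x * sg y) ->
  (forall x, c (- x) = c x) -> (forall x, sg (- x) = - sg x) -> sg pi != 0 ->
  exists a b C, 0 <= C /\ solver s a b C.
Proof.
move=> s0 s1 sm1 Dc Ds Hc Hs ec os sp.
pose kp := 1 - s ^+ 2.
have kp0 : kp != 0.
  rewrite /kp subr_eq0 eq_sym sqrf_eq1 negb_or; exact/andP.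
(* Chosen so that [k'], which is minus the derivative of [k], jumps by [2 pi] over a period, while
   [k] takes the same value at both ends. Hence [y = conv k f] is a periodic solution of
   [y'' + kp y = f]. *)
pose A := pi / (kp * sg pi).
pose k x := A * c (x - pi). pose k' x := A * (kp * sg (x - pi)).
have cc := Deriv_continuous Dc; have cs := Deriv_continuous Ds.
have ck : continuous k by rewrite /k; ctn.
have ck' : continuous k' by rewrite /k'; ctn.
have D1 f : continuous f -> per f -> Deriv (conv k f) (conv k' f).
  move=> cf pf.
  have := @conv_deriv k k' f c (fun t => kp * sg t) (fun x => A * c (x - pi))
    (fun x => A * sg (x - pi)) (fun t => - (kp * sg t)) (fun t => kp * c t) cf pf.
  move=> /(_ Dc).
  have Dk : Deriv (fun t => kp * sg t) (fun t => kp * c t).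
    by apply: (Deriv_ext (DerivM (Deriv_cst _) Ds)) => t; ring.
  move=> /(_ Dk) H; apply: (Deriv_ext (H _ _ _ _)).
  - by ctn.
  - by ctn.
  - by move=> x y; rewrite /k addrAC Hc -/kp; ring.
  - by move=> x y; rewrite /k' addrAC Hs -/kp; ring.
  - move=> t; rewrite /k sub0r ec.
    have -> : 2 * pi - pi = pi :> R by ring.
    by rewrite subrr mul0r mul0r addr0.
have D2 f : continuous f -> per f -> Deriv (conv k' f) (fun t => f t - kp * conv k f t).
  move=> cf pf.
  have := @conv_deriv k' (fun x => - kp * k x) f c (fun t => - sg t)
    (fun x => A * (kp * sg (x - pi))) (fun x => A * (kp * c (x - pi)))
    (fun t => - (kp * sg t)) (fun t => - c t) cf pf Dc (DerivN Ds).
  move=> H; apply: (Deriv_ext (H _ _ _ _)).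
  - by ctn.
  - by ctn.
  - by move=> x y; rewrite /k' addrAC Hs -/kp; ring.
  - by move=> x y; rewrite /k addrAC Hc -/kp; ring.
  - move=> t; rewrite /k' sub0r os.
    have -> : 2 * pi - pi = pi :> R by ring.
    have -> : conv (fun x => - kp * k x) f t = - kp * conv k f t.
      rewrite /conv -meanZ; first by apply: eq_mean => u; ring.
      have cft : continuous (fun u => f (t + u)) by ctn.
      by ctn.
    have -> : (A * (kp * sg pi) - A * (kp * - sg pi)) / (2 * pi) = 1.
      have pn : pi != 0 :> R by rewrite gt_eqF// pi_gt0.
      have alg (K S P : R) : K != 0 -> S != 0 -> P != 0 ->
          (P / (K * S) * (K * S) - P / (K * S) * (K * - S)) / (2 * P) = 1.
        by move=> K0 S0 P0; field; rewrite K0 S0 P0.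
      exact: alg.
    by ring.
have [K K0 HK] := continuous_bounded_segment 0 (2 * pi) ck.
have [K' K0' HK'] := continuous_bounded_segment 0 (2 * pi) ck'.
(* With periodic solutions [y_i] of [y_i'' + kp y_i = f_i], the pair [a = (1 - s) y_2 + y_1'],
   [b = - (1 + s) y_1 + y_2'] solves the first-order system. *)
exists (fun f1 f2 t => (1 - s) * conv k f2 t + conv k' f1 t),
  (fun f1 f2 t => - (1 + s) * conv k f1 t + conv k' f2 t),
  ((1 + `|s|) * K + K').
split; first by rewrite addr_ge0// mulr_ge0// addr_ge0.
split=> [f1 f2 c1 p1 c2 p2|f1 f2 g1 g2 B c1 p1 c2 p2 d1 q1 d2 q2 h1 h2 t].
  split.
  - by move=> t; rewrite !conv_per.
  - by move=> t; rewrite !conv_per.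
  - apply: (Deriv_ext (DerivD (DerivM (Deriv_cst _) (D1 _ c2 p2)) (D2 _ c1 p1))) => t.
    by rewrite /res1 (negbTE s0) (negbTE s1) /kp !bool_natE; ring.
  - apply: (Deriv_ext (DerivD (DerivM (Deriv_cst _) (D1 _ c1 p1)) (D2 _ c2 p2))) => t.
    by rewrite /res2 (negbTE s0) (negbTE sm1) /kp !bool_natE; ring.
have lk f g : continuous f -> continuous g -> (forall t, `|f t - g t| <= B) ->
    forall u, `|conv k f u - conv k g u| <= K * B by move=> *; apply: conv_lip.
have lk' f g : continuous f -> continuous g -> (forall t, `|f t - g t| <= B) ->
    forall u, `|conv k' f u - conv k' g u| <= K' * B by move=> *; apply: conv_lip.
have ab (x X Y : R) : `|x| <= 1 + `|s| -> `|X| <= K * B -> `|Y| <= K' * B ->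
    `|x * X + Y| <= ((1 + `|s|) * K + K') * B.
  move=> xs XB YB; apply: (le_trans (ler_normD _ _)); rewrite mulrDl -mulrA normrM.
  by apply: lerD => //; apply: ler_pM.
split.
  have -> : (1 - s) * conv k f2 t + conv k' f1 t - ((1 - s) * conv k g2 t + conv k' g1 t) =
    (1 - s) * (conv k f2 t - conv k g2 t) + (conv k' f1 t - conv k' g1 t) by ring.
  apply: ab; [|exact: lk|exact: lk'].
  by apply: (le_trans (ler_normB _ _)); rewrite normr1.
have -> : - (1 + s) * conv k f1 t + conv k' f2 t - (- (1 + s) * conv k g1 t + conv k' g2 t) =
    - (1 + s) * (conv k f1 t - conv k g1 t) + (conv k' f2 t - conv k' g2 t) by ring.
apply: ab; [|exact: lk|exact: lk'].
by rewrite normrN; apply: (le_trans (ler_normD _ _)); rewrite normr1.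
Qed.

Lemma Deriv_exp (m : R) : Deriv (fun t => expR (m * t)) (fun t => m * expR (m * t)).
Proof.
have De : Deriv (@expR R) expR by move=> t; exact: is_derive_expR.
apply: (Deriv_ext (Deriv_comp De (DerivM (Deriv_cst m) Deriv_id))) => t; ring.
Qed.

(** Apart from the three resonant values, the fundamental solutions are trigonometric with a
    frequency [m] in [(0, 1)], so that [sin (m pi)] does not vanish, or hyperbolic. *)
Lemma solver_ex (s : R) : exists a b C, 0 <= C /\ solver s a b C.
Proof.
have [->|s0] := eqVneq s 0; first exact: solver_0.
have [->|s1] := eqVneq s 1; first exact: solver_1.
have [->|sm1] := eqVneq s (-1); first exact: solver_N1.
have s2 : 0 < s ^+ 2 by rewrite exprn_even_gt0.
have [sl|sg] := ltP (s ^+ 2) 1.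
  pose m := Num.sqrt (1 - s ^+ 2).
  have m2 : m ^+ 2 = 1 - s ^+ 2 by rewrite sqr_sqrtr// subr_ge0 ltW.
  have m0 : 0 < m by rewrite sqrtr_gt0 subr_gt0.
  have m1 : m < 1.
    rewrite -(@ltr_pXn2r _ 2) ?nnegrE ?ltW// m2 expr1n; lra.
  have mn : m != 0 by rewrite gt_eqF.
  apply: (@solver_green s (fun t => cos (m * t)) (fun t => sin (m * t) / m)) => //; rewrite -?m2.
  - apply: (Deriv_ext (Deriv_comp Deriv_cos (DerivM (Deriv_cst m) Deriv_id))) => t.
    by field.
  - apply: (Deriv_ext (DerivM (Deriv_comp Deriv_sin (DerivM (Deriv_cst m) Deriv_id)) (Deriv_cst _))) => t.
    by field.
  - by move=> x y; rewrite mulrBr cosB; field.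
  - by move=> x y; rewrite mulrBr sinB; field.
  - by move=> x; rewrite mulrN cosN.
  - by move=> x; rewrite mulrN sinN mulNr.
  - rewrite mulf_neq0 ?invr_neq0// gt_eqF// sin_gt0_pi// mulr_gt0 ?pi_gt0//=.
    by rewrite gtr_pMl// pi_gt0.
pose m := Num.sqrt (s ^+ 2 - 1).
have sg1 : 1 < s ^+ 2.
  by rewrite lt_neqAle sg andbT eq_sym sqrf_eq1 negb_or; exact/andP.
have m2 : m ^+ 2 = s ^+ 2 - 1 by rewrite sqr_sqrtr// subr_ge0 ltW.
have m0 : 0 < m by rewrite sqrtr_gt0 subr_gt0.
have mn : m != 0 by rewrite gt_eqF.
have nm2 : 1 - s ^+ 2 = - m ^+ 2 by rewrite m2 opprB.
apply: (@solver_green s (fun t => (expR (m * t) + expR (- m * t)) / 2)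
  (fun t => (expR (m * t) - expR (- m * t)) / (2 * m))) => //; rewrite ?nm2.
- apply: (Deriv_ext (DerivM (DerivD (Deriv_exp m) (Deriv_exp (- m))) (Deriv_cst _))) => t.
  by field.
- apply: (Deriv_ext (DerivM (DerivD (Deriv_exp m) (DerivN (Deriv_exp (- m)))) (Deriv_cst _))) => t.
  by field.
- move=> x y; rewrite !mulrBr !expRD -!mulrN !mulNr !mulrN !opprK.
  by field.
- move=> x y; rewrite !mulrBr !expRD -!mulrN !mulNr !mulrN !opprK.
  by field.
- by move=> x; rewrite !mulrN !mulNr !opprK addrC.
- by move=> x; rewrite !mulrN !mulNr !opprK -[RHS]mulNr opprB.
- rewrite mulf_neq0 ?invr_neq0 ?mulf_neq0//.
  rewrite subr_eq0 gt_eqF// ltr_expR mulNr -subr_gt0 opprK.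
  by rewrite addr_gt0// mulr_gt0// pi_gt0.
Qed.

End ScalarPeriodicSystems.

(** * The plane with its maximum norm *)

Section Plane.
Context {R : realType}.
Implicit Types x y z w v : pt R.

Definition dot x y : R := x.1 * y.1 + x.2 * y.2.
Definition Jr x : pt R := (- x.2, x.1).
Definition cis (t : R) : pt R := (cos t, sin t).
(** In complex notation [phi w = 1 / conj w], the gradient of [log |w|], and
    [dphi w v = - conj v / (conj w)^2] is its differential. *)
Definition phi w : pt R := (csq w)^-1 *: w.
Definition dphi w v : pt R := (csq w)^-1 *: v - (2 * dot w v / csq w ^+ 2) *: w.

Lemma add1 x y : (x + y).1 = x.1 + y.1. Proof. by []. Qed.
Lemma add2 x y : (x + y).2 = x.2 + y.2. Proof. by []. Qed.
Lemma opp1 x : (- x).1 = - x.1. Proof. by []. Qed.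
Lemma opp2 x : (- x).2 = - x.2. Proof. by []. Qed.
Lemma scl1 (a : R) x : (a *: x).1 = a * x.1. Proof. by []. Qed.
Lemma scl2 (a : R) x : (a *: x).2 = a * x.2. Proof. by []. Qed.
Lemma sum1 (I : Type) (r : seq I) (P : pred I) (F : I -> pt R) :
  (\sum_(i <- r | P i) F i).1 = \sum_(i <- r | P i) (F i).1.
Proof. exact: (big_morph (fun x : pt R => x.1) add1 erefl). Qed.
Lemma sum2 (I : Type) (r : seq I) (P : pred I) (F : I -> pt R) :
  (\sum_(i <- r | P i) F i).2 = \sum_(i <- r | P i) (F i).2.
Proof. exact: (big_morph (fun x : pt R => x.2) add2 erefl). Qed.
Lemma Jr1 x : (Jr x).1 = - x.2. Proof. by []. Qed.
Lemma Jr2 x : (Jr x).2 = x.1. Proof. by []. Qed.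
Definition ptE := (add1, add2, opp1, opp2, scl1, scl2, sum1, sum2, Jr1, Jr2).

Lemma pt_eq x y : x.1 = y.1 -> x.2 = y.2 -> x = y.
Proof. by case: x => ? ?; case: y => ? ? /= -> ->. Qed.

(** The norm of [pt R] is the maximum norm, not the Euclidean one; this is where the factors 2 in
    the estimates for [dot] and [csq] come from. *)
Lemma ptnormP x (C : R) : (`|x| <= C) = (`|x.1| <= C) && (`|x.2| <= C).
Proof. by rewrite prod_normE ge_max. Qed.

Lemma norm1_le x : `|x.1| <= `|x|.
Proof. by have := lexx `|x|; rewrite {1}ptnormP => /andP[]. Qed.
Lemma norm2_le x : `|x.2| <= `|x|.
Proof. by have := lexx `|x|; rewrite {1}ptnormP => /andP[]. Qed.

Definition vmean (F : R -> pt R) : pt R := (mean (fun t => (F t).1), mean (fun t => (F t).2)).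

Definition Dv (v v' : R -> pt R) :=
  Deriv (fun t => (v t).1) (fun t => (v' t).1) /\ Deriv (fun t => (v t).2) (fun t => (v' t).2).

End Plane.

(** * The linearization at the rotating polygon *)

Section Linearization.
Context {R : realType}.
Variable N : nat.
Hypothesis N2 : (2 <= N)%N.

Definition th (j : nat) : R := 2 * pi * j%:R / N%:R.
(* In the frame rotating with [cis] the linearized system reads [a' = b + Cop b + f1],
   [b' = - a + Cop a + f2], and [Cop] is multiplication by [- sl l] on the range of the projection
   [Pj l] onto the [l]-th (real) character of the shift by [2 pi / N]. *)
Definition bco j : R := 2 / (N%:R - 1) / (2 - 2 * cos (th j)).
Definition Cop (a : R -> R) t := \sum_(1 <= j < N) bco j * (cos (th j) * a t - a (t + th j)).
Definition sl (l : nat) : R := \sum_(1 <= j < N) bco j * (cos (l%:R * th j) - cos (th j)).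
Definition Pj (l : nat) (a : R -> R) t : R :=
  N%:R^-1 * \sum_(0 <= k < N) cos (l%:R * th k) * a (t + th k).

Let N0 : N%:R != 0 :> R. Proof. by rewrite pnatr_eq0 -lt0n (leq_trans _ N2). Qed.
Let N1 : 1 < N%:R :> R. Proof. by rewrite ltr1n. Qed.

Lemma per_nat (T : Type) (f : R -> T) (n : nat) t : per f -> f (t + n%:R * (2 * pi)) = f t.
Proof.
move=> pf; elim: n => [|n IH]; first by rewrite mul0r addr0.
by rewrite -natr1 mulrDl mul1r addrA pf.
Qed.

Lemma th_add j k : th (j + k) = th j + th k.
Proof. by rewrite /th natrD; ring. Qed.

Lemma th_N : th N = 2 * pi.
Proof. by rewrite /th mulfK. Qed.

Lemma th_rev j : (j <= N)%N -> th (N - j) = 2 * pi - th j.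
Proof. by move=> jN; rewrite -th_N -{2}(subnK jN) th_add addrK. Qed.

Lemma cos_rev l j : (j <= N)%N -> cos (l%:R * th (N - j)) = cos (l%:R * th j).
Proof.
move=> jN; rewrite th_rev// mulrBr addrC per_nat; last exact: per_cos.
by rewrite cosN.
Qed.

Lemma sin_rev l j : (j <= N)%N -> sin (l%:R * th (N - j)) = - sin (l%:R * th j).
Proof.
move=> jN; rewrite th_rev// mulrBr addrC per_nat; last exact: per_sin.
by rewrite sinN.
Qed.

Lemma bco_rev j : (j <= N)%N -> bco (N - j) = bco j.
Proof. by move=> jN; have := cos_rev 1 jN; rewrite !mul1r /bco => ->. Qed.

Lemma sum_rev (F : nat -> R) : \sum_(1 <= j < N) F (N - j)%N = \sum_(1 <= j < N) F j.
Proof.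
by rewrite [RHS]big_nat_rev; apply: eq_bigr => j _; congr F; rewrite add1n subSS.
Qed.

Lemma sum_odd0 (F : nat -> R) : (forall j, (0 < j < N)%N -> F (N - j)%N = - F j) ->
  \sum_(1 <= j < N) F j = 0.
Proof.
move=> FN; suff : \sum_(1 <= j < N) F j = - \sum_(1 <= j < N) F j by lra.
rewrite -{1}sum_rev -sumrN; apply: eq_big_nat => j jI; exact: FN.
Qed.

Lemma cos_th_lt1 j : (0 < j < N)%N -> cos (th j) < 1.
Proof.
move=> /andP[j0 jN]; have -> : th j = (pi * j%:R / N%:R) *+ 2 by rewrite /th; ring.
rewrite cos_mulr2n cos2sin2.
suff s0 : 0 < sin (pi * j%:R / N%:R) ^+ 2 :> R by lra.
rewrite exprn_gt0// sin_gt0_pi// divr_gt0 ?mulr_gt0 ?pi_gt0 ?ltr0n//=; last first.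
  exact: ltn_trans jN.
by rewrite -mulrA gtr_pMr ?pi_gt0// ltr_pdivrMr ?mul1r ?ltr_nat ?ltr0n// (ltn_trans _ jN).
Qed.

Lemma shift_sum (F : nat -> R) j : (forall k, F (k + N)%N = F k) ->
  \sum_(0 <= k < N) F (k + j)%N = \sum_(0 <= k < N) F k.
Proof.
move=> FN; elim: j => [|j IH]; first by apply: eq_bigr => k _; rewrite addn0.
rewrite -IH; case: N FN => [|M] FN; first by rewrite !big_geq.
rewrite big_nat_recr// [RHS]big_nat_recl//=; rewrite addrC; congr (_ + _).
  by rewrite -[RHS]FN; congr F; rewrite add0n addnC addSnnS.
by apply: eq_bigr => k _; rewrite addSnnS.
Qed.

(** The sums [S] and [S2] of cosines and sines do not change when [l] is shifted by one, which
    rotates the vector [(S, S2)] by [th k]; a rotation by a nontrivial angle fixes only 0. *)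
Lemma sum_cos_th k : (0 < k < N)%N -> \sum_(0 <= l < N) cos (l%:R * th k) = 0.
Proof.
move=> kI; set S := (LHS); pose S2 := \sum_(0 <= l < N) sin (l%:R * th k).
have Nk (l : nat) : (l + N)%:R * th k = l%:R * th k + k%:R * (2 * pi).
  by rewrite /th natrD; field.
have e1 : S = cos (th k) * S - sin (th k) * S2.
  transitivity (\sum_(0 <= l < N) cos ((l + 1)%:R * th k)).
    apply/esym/(@shift_sum (fun l => cos (l%:R * th k)) 1) => l.
    by rewrite Nk per_nat//; exact: per_cos.
  rewrite /S /S2 !mulr_sumr -sumrB; apply: eq_bigr => l _.
  by rewrite natrD mulrDl mul1r cosD; ring.
have e2 : S2 = sin (th k) * S + cos (th k) * S2.
  transitivity (\sum_(0 <= l < N) sin ((l + 1)%:R * th k)).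
    apply/esym/(@shift_sum (fun l => sin (l%:R * th k)) 1) => l.
    by rewrite Nk per_nat//; exact: per_sin.
  rewrite /S /S2 !mulr_sumr -big_split; apply: eq_bigr => l _ /=.
  by rewrite natrD mulrDl mul1r sinD; ring.
have c1 := cos_th_lt1 kI; have cs := cos2Dsin2 (th k).
have : S * (2 - 2 * cos (th k)) = 0.
  have -> : S * (2 - 2 * cos (th k)) = (1 - cos (th k)) * (S - cos (th k) * S)
     + sin (th k) * (sin (th k) * S) + S * (1 - (cos (th k) ^+ 2 + sin (th k) ^+ 2)) by ring.
  have -> : S - cos (th k) * S = - sin (th k) * S2 by lra.
  have -> : sin (th k) * S = S2 - cos (th k) * S2 by lra.
  by rewrite cs; ring.
move/eqP; rewrite mulf_eq0 => /orP[/eqP //|/eqP]; lra.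
Qed.

(** Discrete Fourier inversion: by [sum_cos_th] only the shift [k = 0] survives the sum over [l]. *)
Lemma sum_Pj (a : R -> R) t : \sum_(0 <= l < N) Pj l a t = a t.
Proof.
rewrite /Pj -mulr_sumr exchange_big/=.
have Npos : (0 < N)%N by exact: leq_trans N2.
rewrite (big_ltn Npos) /= [X in _ + X]big1_seq; last first.
  move=> k; rewrite mem_index_iota => /andP[_ kI].
  by rewrite -mulr_suml sum_cos_th// mul0r.
rewrite addr0 -mulr_suml; under eq_bigr do rewrite {1}/th mulr0 mul0r mulr0 cos0.
rewrite big_const_nat subn0 iter_addr addr0 /th mulr0 mul0r addr0.
by rewrite mulrA mulVf ?mul1r.
Qed.

(** A shift by [th j] acts on [Pj l a] as a rotation mixing it with its sine companion [Q]. In the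
    sum over [j] the sine terms cancel, since [bco] is even and the sine is odd under
    [j -> N - j]. *)
Lemma Cop_Pj l (a : R -> R) t : per a -> Cop (Pj l a) t = - sl l * Pj l a t.
Proof.
move=> pa; pose Q t := N%:R^-1 * \sum_(0 <= k < N) sin (l%:R * th k) * a (t + th k).
have Pth j : Pj l a (t + th j) = cos (l%:R * th j) * Pj l a t + sin (l%:R * th j) * Q t.
  pose F k := cos (l%:R * (th k - th j)) * a (t + th k).
  have thN k : th (k + N) = th k + 2 * pi by rewrite th_add th_N.
  have FN k : F (k + N)%N = F k.
    rewrite /F thN addrA pa -[th k + _ - _]addrAC mulrDr per_nat//; exact: per_cos.
  have -> : Pj l a (t + th j) = N%:R^-1 * \sum_(0 <= k < N) F (k + j)%N.
    rewrite /Pj; congr (_ * _); apply: eq_bigr => k _.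
    by rewrite /F th_add addrK -addrA (addrC (th j)).
  rewrite (shift_sum _ FN) /Pj /Q mulrCA [X in _ + X]mulrCA -mulrDr; congr (_ * _).
  rewrite !mulr_sumr -big_split; apply: eq_bigr => k _ /=.
  by rewrite /F mulrBr cosB; ring.
rewrite /Cop; under eq_bigr do rewrite Pth.
rewrite (_ : \sum_(1 <= j < N) _ =
  \sum_(1 <= j < N) (- (bco j * (cos (l%:R * th j) - cos (th j))) * Pj l a t
    + - (bco j * sin (l%:R * th j)) * Q t)); last by apply: eq_bigr => j _; ring.
rewrite big_split/= -!mulr_suml [X in _ + X * _]sum_odd0 ?mul0r ?addr0.
  by rewrite sumrN.
move=> j /andP[_ /ltnW jN]; rewrite bco_rev// sin_rev//; ring.
Qed.

Lemma Cop_Pj_comm l (a : R -> R) t : Cop (Pj l a) t = Pj l (Cop a) t.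
Proof.
rewrite /Cop /Pj.
transitivity (N%:R^-1 * \sum_(0 <= k < N) \sum_(1 <= j < N)
  cos (l%:R * th k) * (bco j * (cos (th j) * a (t + th k) - a (t + th k + th j)))); last first.
  by congr (_ * _); apply: eq_bigr => k _; rewrite mulr_sumr.
rewrite [in RHS]exchange_big/= [RHS]mulr_sumr; apply: eq_bigr => j _.
rewrite (mulrCA (cos _)) -mulrBr mulrCA; congr (_ * _).
rewrite mulr_sumr -sumrB mulr_sumr; apply: eq_bigr => k _.
by rewrite -(addrA t (th j)) -(addrA t (th k)) (addrC (th j)); ring.
Qed.

Lemma Pj_lin l (x : R) (a b : R -> R) t :
  Pj l (fun t => x * a t + b t) t = x * Pj l a t + Pj l b t.
Proof.
rewrite /Pj mulrCA -mulrDr; congr (_ * _); rewrite mulr_sumr -big_split.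
by apply: eq_bigr => k _ /=; ring.
Qed.

Lemma Deriv_Pj l (a a' : R -> R) : Deriv a a' -> Deriv (Pj l a) (Pj l a').
Proof.
move=> Da; rewrite /Pj.
have D1 k : Deriv (fun t => cos (l%:R * th k) * a (t + th k))
    (fun t => cos (l%:R * th k) * a' (t + th k)).
  by apply: (Deriv_ext (DerivM (Deriv_cst _) (Deriv_shift (th k) Da))) => t; ring.
apply: (Deriv_ext (DerivM (Deriv_cst _) (Deriv_sum _ _ D1))) => t; ring.
Qed.

Lemma per_Pj l (a : R -> R) : per a -> per (Pj l a).
Proof.
by move=> pa t; rewrite /Pj; congr (_ * _); apply: eq_bigr => k _; rewrite addrAC pa.
Qed.

Lemma Pj_bound l (a : R -> R) B t : (forall t, `|a t| <= B) -> `|Pj l a t| <= B.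
Proof.
move=> aB; rewrite /Pj normrM normfV normr_nat ler_pdivrMl ?ltr0n ?(leq_trans _ N2)//.
apply: (le_trans (ler_norm_sum _ _ _)).
apply: (@le_trans _ _ (\sum_(0 <= k < N) B)).
  apply: ler_sum => k _; rewrite normrM -[leRHS]mul1r; apply: ler_pM => //.
  exact: cos_max.
by rewrite sumr_const_nat subn0 mulr_natl.
Qed.

Lemma Cop_cst t : Cop (fun=> 1) t = -1.
Proof.
rewrite /Cop; transitivity (\sum_(1 <= j < N) - (N%:R - 1)^-1 : R).
  apply: eq_big_nat => j jI; rewrite /bco; have := cos_th_lt1 jI => c1.
  have q0 : 2 - 2 * cos (th j) != 0 by rewrite gt_eqF//; lra.
  have n0 : N%:R - 1 != 0 :> R by rewrite subr_eq0 gt_eqF.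
  have -> : cos (th j) * 1 - 1 = - ((2 - 2 * cos (th j)) / 2) by field.
  move: (2 - 2 * cos (th j)) (N%:R - 1) q0 n0 => q n q0 n0.
  by field; rewrite q0 n0.
rewrite sumr_const_nat -[LHS]mulr_natl natrB ?(leq_trans _ N2)//.
by rewrite mulrN divff// subr_eq0 gt_eqF.
Qed.

Lemma sum_bsin : \sum_(1 <= j < N) bco j * sin (th j) = 0.
Proof.
apply: sum_odd0 => j /andP[_ /ltnW jN]; rewrite bco_rev//.
by have := sin_rev 1 jN; rewrite !mul1r => ->; ring.
Qed.

Lemma Cop_cos t : Cop cos t = 0.
Proof.
rewrite /Cop; transitivity (sin t * \sum_(1 <= j < N) bco j * sin (th j));
  last by rewrite sum_bsin mulr0.
by rewrite mulr_sumr; apply: eq_bigr => j _; rewrite cosD; ring.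
Qed.

Lemma Cop_sin t : Cop sin t = 0.
Proof.
rewrite /Cop; transitivity (- cos t * \sum_(1 <= j < N) bco j * sin (th j));
  last by rewrite sum_bsin mulr0.
by rewrite mulr_sumr; apply: eq_bigr => j _; rewrite sinD; ring.
Qed.

(** [Cop] multiplies the constants by [-1] and the range of [Pj l] by [- sl l], so a constant has a
    component there only if [sl l = 1]. The same argument gives [Pj_ker0], applied below to [cos]
    and [sin]. *)
Lemma Pj_cst0 l : sl l != 1 -> forall t, Pj l (fun=> 1) t = 0.
Proof.
move=> s1 t; have := @Cop_Pj l (fun=> 1) t (fun _ => erefl).
rewrite Cop_Pj_comm (_ : Cop (fun=> 1) = fun=> -1); last by apply/funext => u; exact: Cop_cst.
have := Pj_lin l (-1) (fun=> 1) (fun=> 0) t.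
rewrite (_ : (fun=> -1 * 1 + 0) = fun _ : R => (-1 : R)); last by apply/funext => u; ring.
move=> ->; rewrite (_ : Pj l (fun=> 0) t = 0); last first.
  by rewrite /Pj big1 ?mulr0// => k _; rewrite mulr0.
move=> e; have : (sl l - 1) * Pj l (fun=> 1) t = 0 by lra.
by move/eqP; rewrite mulf_eq0 subr_eq0 (negbTE s1)/= => /eqP.
Qed.

Lemma Pj_ker0 l (a : R -> R) : per a -> (forall t, Cop a t = 0) -> sl l != 0 ->
  forall t, Pj l a t = 0.
Proof.
move=> pa Ca s0 t; have := @Cop_Pj l a t pa; rewrite Cop_Pj_comm.
rewrite (_ : Cop a = fun=> 0); last exact/funext.
rewrite (_ : Pj l (fun=> 0) t = 0); last first.
  by rewrite /Pj big1 ?mulr0// => k _; rewrite mulr0.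
by move/esym/eqP; rewrite mulf_eq0 oppr_eq0 (negbTE s0)/= => /eqP.
Qed.

(** Each component is solved by [solver (sl l)], and the projections of the solutions are added up.
    The residuals combine into the projection on the constants, [cos] and [sin], because these
    functions only have components with [sl l = 1], respectively [sl l = 0]. *)
Lemma linear_rot : exists a b C, 0 <= C /\
  (forall f1 f2 : R -> R, continuous f1 -> per f1 -> continuous f2 -> per f2 ->
    let m1 := mean (fun t => cos t * f1 t - sin t * f2 t) in
    let m2 := mean (fun t => sin t * f1 t + cos t * f2 t) in
    [/\ per (a f1 f2), per (b f1 f2),
      Deriv (a f1 f2) (fun t => b f1 f2 t + Cop (b f1 f2) t + f1 t
        - (mean f1 + cos t * m1 + sin t * m2)) &
      Deriv (b f1 f2) (fun t => - a f1 f2 t + Cop (a f1 f2) t + f2 t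
        - (cos t * m2 - sin t * m1))]) /\
  (forall (f1 f2 g1 g2 : R -> R) (B : R), continuous f1 -> per f1 -> continuous f2 -> per f2 ->
    continuous g1 -> per g1 -> continuous g2 -> per g2 ->
    (forall t, `|f1 t - g1 t| <= B) -> (forall t, `|f2 t - g2 t| <= B) ->
    forall t : R, `|a f1 f2 t - a g1 g2 t| <= C * B /\ `|b f1 f2 t - b g1 g2 t| <= C * B).
Proof.
have /choice[a /choice[b /choice[C HC]]] : forall l : nat,
  exists a b C, 0 <= C /\ solver (sl l) a b C by move=> l; exact: solver_ex.
exists (fun f1 f2 t => \sum_(0 <= l < N) Pj l (a l f1 f2) t),
  (fun f1 f2 t => \sum_(0 <= l < N) Pj l (b l f1 f2) t), (\sum_(0 <= l < N) C l).
split; first by apply: sumr_ge0 => l _; have [] := HC l.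
have sumC (x : nat -> R -> R) t : Cop (fun t => \sum_(0 <= l < N) x l t) t =
    \sum_(0 <= l < N) Cop (x l) t.
  rewrite /Cop exchange_big/=; apply: eq_bigr => j _.
  by rewrite -mulr_sumr sumrB -mulr_sumr.
split=> [f1 f2 c1 p1 c2 p2 m1 m2|f1 f2 g1 g2 B c1 p1 c2 p2 d1 q1 d2 q2 h1 h2 t].
  have H l := (HC l).2.1 f1 f2 c1 p1 c2 p2.
  have pa l : per (a l f1 f2) by have [] := H l.
  have pb l : per (b l f1 f2) by have [] := H l.
  have Da l : Deriv (a l f1 f2) (fun t => (1 - sl l) * b l f1 f2 t + f1 t - res1 (sl l) f1 f2 t).
    by have [] := H l.
  have Db l : Deriv (b l f1 f2) (fun t => - (1 + sl l) * a l f1 f2 t + f2 t - res2 (sl l) f1 f2 t).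
    by have [] := H l.
  have E1 t : \sum_(0 <= l < N) Pj l (res1 (sl l) f1 f2) t = mean f1 + cos t * m1 + sin t * m2.
    have -> : mean f1 + cos t * m1 + sin t * m2 = mean f1 * 1 + (m1 * cos t + m2 * sin t) by ring.
    rewrite -[X in _ * X + _](sum_Pj (fun=> 1) t) -(sum_Pj cos t) -(sum_Pj sin t).
    rewrite !mulr_sumr -!big_split/=; apply: eq_bigr => l _.
    pose e1 : R := (sl l == 1)%:R; pose e0 : R := (sl l == 0)%:R.
    rewrite (_ : res1 _ _ _ = fun t => e1 * mean f1 * 1 + (e0 * m1 * cos t + (e0 * m2 * sin t + 0))); last first.
      by apply/funext => u; rewrite /res1 -/m1 -/m2 -/e1 -/e0; ring.
    rewrite (Pj_lin l _ (fun=> 1)) Pj_lin Pj_lin.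
    rewrite (_ : Pj l (fun=> 0) t = 0); last by rewrite /Pj big1 ?mulr0// => k _; rewrite mulr0.
    congr (_ + _).
      rewrite /e1; case: eqVneq => [_|/Pj_cst0 ->]; first by rewrite bool_natE mul1r.
      by rewrite !mulr0.
    rewrite addr0 /e0; case: eqVneq => [_|s0]; first by rewrite bool_natE !mul1r.
    rewrite (Pj_ker0 per_cos Cop_cos s0) (Pj_ker0 per_sin Cop_sin s0).
    by rewrite !mulr0.
  have E2 t : \sum_(0 <= l < N) Pj l (res2 (sl l) f1 f2) t = cos t * m2 - sin t * m1.
    have -> : cos t * m2 - sin t * m1 = m2 * cos t + - m1 * sin t by ring.
    rewrite -(sum_Pj cos t) -(sum_Pj sin t).
    rewrite !mulr_sumr -!big_split/=; apply: eq_bigr => l _.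
    pose e1 : R := (sl l == -1)%:R; pose e0 : R := (sl l == 0)%:R.
    rewrite (_ : res2 _ _ _ = fun t => e1 * mean f2 * 1 + (e0 * m2 * cos t + (e0 * - m1 * sin t + 0))); last first.
      by apply/funext => u; rewrite /res2 -/m1 -/m2 -/e1 -/e0; ring.
    rewrite (Pj_lin l _ (fun=> 1)) Pj_lin Pj_lin.
    rewrite (_ : Pj l (fun=> 0) t = 0); last by rewrite /Pj big1 ?mulr0// => k _; rewrite mulr0.
    rewrite -[RHS]add0r; congr (_ + _).
      (* A resonance [sl l = -1] leaves no residual: as [sl l] differs from 1, the constants have no
         component there. *)
      rewrite /e1; case: eqVneq => [s1|_]; last by rewrite bool_natE !mul0r.
      by rewrite Pj_cst0 ?mulr0// s1; apply/eqP; lra.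
    rewrite addr0 /e0; case: eqVneq => [_|s0]; first by rewrite bool_natE !mul1r.
    rewrite (Pj_ker0 per_cos Cop_cos s0) (Pj_ker0 per_sin Cop_sin s0).
    by rewrite !mulr0.
  split.
  - by move=> t; apply: eq_bigr => l _; rewrite per_Pj.
  - by move=> t; apply: eq_bigr => l _; rewrite per_Pj.
  - apply: (Deriv_ext (Deriv_sum _ _ (fun l => Deriv_Pj l (Da l)))) => t.
    rewrite -E1 -[in RHS](sum_Pj f1 t) sumC -!big_split -sumrB; apply: eq_bigr => l _ /=.
    rewrite Cop_Pj//.
    rewrite (_ : (fun t => _) = fun t => (1 - sl l) * b l f1 f2 t
      + (-1 * res1 (sl l) f1 f2 t + f1 t)); last by apply/funext => u; ring.
    by rewrite !Pj_lin; ring.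
  - apply: (Deriv_ext (Deriv_sum _ _ (fun l => Deriv_Pj l (Db l)))) => t.
    rewrite -E2 -[in RHS](sum_Pj f2 t) sumC -sumrN -!big_split -sumrB; apply: eq_bigr => l _ /=.
    rewrite Cop_Pj//.
    rewrite (_ : (fun t => _) = fun t => - (1 + sl l) * a l f1 f2 t
      + (-1 * res2 (sl l) f1 f2 t + f2 t)); last by apply/funext => u; ring.
    by rewrite !Pj_lin; ring.
have H l := (HC l).2.2 f1 f2 g1 g2 B c1 p1 c2 p2 d1 q1 d2 q2 h1 h2.
have PB l (x y : R -> R) u : Pj l x u - Pj l y u = Pj l (fun t => -1 * y t + x t) u.
  by rewrite Pj_lin; ring.
split.
  rewrite -sumrB mulr_suml; apply: (le_trans (ler_norm_sum _ _ _)); apply: ler_sum => l _.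
  rewrite PB; apply: Pj_bound => u; rewrite mulN1r addrC; have [] := H l u => //.
rewrite -sumrB mulr_suml; apply: (le_trans (ler_norm_sum _ _ _)); apply: ler_sum => l _.
rewrite PB; apply: Pj_bound => u; rewrite mulN1r addrC; have [] := H l u => //.
Qed.

Definition W j t : pt R := cis t - cis (t + th j).
(* The linearization at [v = 0] of [v |-> (2 / (N - 1)) i S1 (cis + v)]. *)
Definition Lin (v : R -> pt R) t : pt R :=
  (2 / (N%:R - 1)) *: Jr (\sum_(1 <= j < N) dphi (W j t) (v t - v (t + th j))).

Lemma csq_W j t : csq (W j t) = 2 - 2 * cos (th j).
Proof.
rewrite /csq /W !ptE/=.
have -> : (cos t - cos (t + th j)) ^+ 2 + (sin t - sin (t + th j)) ^+ 2 =
  (cos t ^+ 2 + sin t ^+ 2) + (cos (t + th j) ^+ 2 + sin (t + th j) ^+ 2)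
  - 2 * (cos (t + th j) * cos t + sin (t + th j) * sin t) by ring.
by rewrite !cos2Dsin2 -cosB (addrC t) addrK; ring.
Qed.

(** With [w = e^(it) (1 - e^(ih))] and [v = e^(it) V], the formula
    [dphi w v = - conj v / (conj w)^2] gives [e^(it) e^(ih) conj V / (2 - 2 cos h)], since [(1 -
    e^(-ih))^2 = - (2 - 2 cos h) e^(-ih)]. In the rotating frame the coefficients do not depend on
    [t]. *)
Lemma dphi_rot (t h a b a' b' : R) : cos h != 1 ->
  dphi (cis t - cis (t + h))
    ((cos t * a - sin t * b, sin t * a + cos t * b)
     - (cos (t + h) * a' - sin (t + h) * b', sin (t + h) * a' + cos (t + h) * b')) =
  (2 - 2 * cos h)^-1 *:
  (cos t * (cos h * a + sin h * b - a') - sin t * (sin h * a - cos h * b + b'),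
   sin t * (cos h * a + sin h * b - a') + cos t * (sin h * a - cos h * b + b')).
Proof.
move=> c1; have q0 : 2 - 2 * cos h != 0 by rewrite subr_eq0; apply: contra c1 => /eqP ?; apply/eqP; lra.
have qE : csq (cis t - cis (t + h)) = 2 - 2 * cos h.
  rewrite /csq !ptE/=.
  have -> : (cos t - cos (t + h)) ^+ 2 + (sin t - sin (t + h)) ^+ 2 =
    (cos t ^+ 2 + sin t ^+ 2) + (cos (t + h) ^+ 2 + sin (t + h) ^+ 2)
    - 2 * (cos (t + h) * cos t + sin (t + h) * sin t) by ring.
  by rewrite !cos2Dsin2 -cosB (addrC t) addrK; ring.
rewrite /dphi qE.
set p := a - (cos h * a' - sin h * b'); set r := b - (sin h * a' + cos h * b').
have -> : dot (cis t - cis (t + h))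
    ((cos t * a - sin t * b, sin t * a + cos t * b)
     - (cos (t + h) * a' - sin (t + h) * b', sin (t + h) * a' + cos (t + h) * b')) =
  (1 - cos h) * p - sin h * r.
  have -> : (1 - cos h) * p - sin h * r =
    (cos t ^+ 2 + sin t ^+ 2) * ((1 - cos h) * p - sin h * r) by rewrite cos2Dsin2 mul1r.
  by rewrite /dot !ptE/= cosD sinD /p /r; ring.
have cs := cos2Dsin2 h.
have x1 : cos h * p + sin h * r = cos h * a + sin h * b - a'.
  transitivity (cos h * a + sin h * b - (cos h ^+ 2 + sin h ^+ 2) * a'); last by rewrite cs mul1r.
  by rewrite /p /r; ring.
have x2 : sin h * p - cos h * r = sin h * a - cos h * b + b'.
  transitivity (sin h * a - cos h * b + (cos h ^+ 2 + sin h ^+ 2) * b'); last by rewrite cs mul1r.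
  by rewrite /p /r; ring.
rewrite -x1 -x2.
have s2 : sin h ^+ 2 = 1 - cos h ^+ 2 by rewrite sin2cos2.
have y1 : (2 - 2 * cos h)^-1 * p - 2 * ((1 - cos h) * p - sin h * r) / (2 - 2 * cos h) ^+ 2 * (1 - cos h)
   = (2 - 2 * cos h)^-1 * (cos h * p + sin h * r).
  by field.
have y2 : (2 - 2 * cos h)^-1 * r - 2 * ((1 - cos h) * p - sin h * r) / (2 - 2 * cos h) ^+ 2 * (- sin h)
   = (2 - 2 * cos h)^-1 * (sin h * p - cos h * r).
  have -> : (2 - 2 * cos h)^-1 * r - 2 * ((1 - cos h) * p - sin h * r) / (2 - 2 * cos h) ^+ 2 * (- sin h)
    = (2 - 2 * cos h)^-1 * r + (2 * (1 - cos h) * p * sin h - 2 * sin h ^+ 2 * r) / (2 - 2 * cos h) ^+ 2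
    by ring.
  by rewrite s2; field.
apply: pt_eq; rewrite !ptE/=.
  transitivity (cos t * ((2 - 2 * cos h)^-1 * (cos h * p + sin h * r))
    - sin t * ((2 - 2 * cos h)^-1 * (sin h * p - cos h * r))); last by ring.
  by rewrite -y1 -y2 cosD sinD /p /r; ring.
transitivity (sin t * ((2 - 2 * cos h)^-1 * (cos h * p + sin h * r))
    + cos t * ((2 - 2 * cos h)^-1 * (sin h * p - cos h * r))); last by ring.
by rewrite -y1 -y2 cosD sinD /p /r; ring.
Qed.

(** When [dphi_rot] is summed over [j], the terms with [sin (th j)] cancel between [j] and [N - j].
    Two copies of [Cop] remain, exchanged by the factor [i]. *)
Lemma Lin_rot (a b : R -> R) t :
  Lin (fun t => (cos t * a t - sin t * b t, sin t * a t + cos t * b t)) t =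
  (cos t * Cop b t - sin t * Cop a t, sin t * Cop b t + cos t * Cop a t).
Proof.
rewrite /Lin.
rewrite (eq_big_nat _ _ (F2 := fun j => (2 - 2 * cos (th j))^-1 *:
  (cos t * (cos (th j) * a t + sin (th j) * b t - a (t + th j))
    - sin t * (sin (th j) * a t - cos (th j) * b t + b (t + th j)),
   sin t * (cos (th j) * a t + sin (th j) * b t - a (t + th j))
    + cos t * (sin (th j) * a t - cos (th j) * b t + b (t + th j))))); last first.
  by move=> j /cos_th_lt1 c1; apply: dphi_rot; rewrite lt_eqF.
have z := sum_bsin.
apply: pt_eq; rewrite ?scl1 ?scl2 ?Jr1 ?Jr2 ?sum1 ?sum2.
  transitivity (cos t * Cop b t - sin t * Cop a t
    - (sin t * b t + cos t * a t) * \sum_(1 <= j < N) bco j * sin (th j)); last by rewrite z mulr0 subr0.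
  rewrite /Cop !mulr_sumr -sumrN mulr_sumr -!sumrB; apply: eq_bigr => j _.
  by rewrite /bco; set q := (_^-1 *: _).2; rewrite /q scl2 /snd; ring.
transitivity (sin t * Cop b t + cos t * Cop a t
    + (cos t * b t - sin t * a t) * \sum_(1 <= j < N) bco j * sin (th j)); last by rewrite z mulr0 addr0.
rewrite /Cop !mulr_sumr -!big_split; apply: eq_bigr => j _.
by rewrite /bco; set q := (_^-1 *: _).1; rewrite /q scl1 /fst /=; ring.
Qed.

Lemma dphiB w x y : dphi w (x - y) = dphi w x - dphi w y :> pt R.
Proof. by apply: pt_eq; rewrite /dphi /dot !ptE; ring. Qed.

Lemma LinB (v w : R -> pt R) t : Lin (fun t => v t - w t) t = Lin v t - Lin w t.
Proof.
rewrite /Lin -scalerBr; congr (_ *: _).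
transitivity (Jr (\sum_(1 <= j < N) (dphi (W j t) (v t - v (t + th j))
    - dphi (W j t) (w t - w (t + th j))))).
  congr Jr; apply: eq_bigr => j _; rewrite -dphiB; congr dphi.
  by apply: pt_eq; rewrite !ptE; ring.
by rewrite sumrB; apply: pt_eq; rewrite !ptE; ring.
Qed.

Lemma Lin_cst (p : pt R) t : Lin (fun=> p) t = 0.
Proof.
rewrite /Lin big1 => [|j _]; first by apply: pt_eq; rewrite !ptE/= ?oppr0 mulr0.
by rewrite subrr; apply: pt_eq; rewrite /dphi /dot !ptE/=; ring.
Qed.

(** As [(c i cis)' = - c cis], this says that the infinitesimal rotation of the polygon solves the
    homogeneous equation; together with [Lin_cst] it allows solutions to be normalized. *)
Lemma Lin_Jcis (c : R) t : Lin (fun t => c *: Jr (cis t)) t = - c *: cis t.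
Proof.
have := Lin_rot (fun=> 0) (fun=> c) t.
rewrite (_ : (fun t => _) = (fun t => c *: Jr (cis t))); last first.
  by apply/funext => u; apply: pt_eq; rewrite !ptE/=; ring.
move=> ->.
have C0 : Cop (fun=> 0) t = 0 by rewrite /Cop big1// => j _; rewrite mulr0 subr0 mulr0.
have Cc : Cop (fun=> c) t = - c.
  rewrite -[RHS]mulrN1 -(Cop_cst t) /Cop mulr_sumr; apply: eq_bigr => j _; ring.
by rewrite C0 Cc; apply: pt_eq; rewrite !ptE/=; ring.
Qed.

Lemma cis_bound (t : R) : `|cis t| <= 1.
Proof. by rewrite ptnormP/= cos_max sin_max. Qed.

Lemma vmean_lip (F G : R -> pt R) (B : R) : continuous F -> continuous G ->
  (forall t, `|F t - G t| <= B) -> `|vmean F - vmean G| <= B.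
Proof.
move=> cF cG FG; rewrite ptnormP/=; apply/andP; split; apply: mean_lip; try by ctn.
  by move=> t; apply: le_trans (FG t); exact: (norm1_le (F t - G t)).
by move=> t; apply: le_trans (FG t); exact: (norm2_le (F t - G t)).
Qed.

Lemma dot_lip (x y z : pt R) (B : R) : `|z| <= 1 -> `|x - y| <= B ->
  `|dot z x - dot z y| <= 2 * B.
Proof.
move=> z1; rewrite ptnormP => /andP[h1 h2].
have -> : dot z x - dot z y = z.1 * (x - y).1 + z.2 * (x - y).2 by rewrite /dot !ptE; ring.
by apply: rot_bound => //; apply: le_trans z1; rewrite ?norm1_le ?norm2_le.
Qed.

(* The inhomogeneous linear equation modulo its cokernel, spanned by [cis] and the constants. *)
Definition deriv_eq (F v : R -> pt R) :=
  Dv v (fun t => Lin v t + F t - mean (fun t => dot (cis t) (F t)) *: cis t - vmean F).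

(** In the frame rotating with [cis], where [F] has the components [f1] and [f2], the equation
    becomes the system of [linear_rot]. *)
Lemma linear_raw : exists (K : (R -> pt R) -> R -> pt R) (C : R), 0 <= C /\
  (forall F : R -> pt R, continuous F -> per F -> per (K F) /\ deriv_eq F (K F)) /\
  (forall (F G : R -> pt R) (B : R), continuous F -> per F -> continuous G -> per G ->
    (forall t, `|F t - G t| <= B) -> forall t : R, `|K F t - K G t| <= C * B).
Proof.
have [a [b [C [C0 [H1 H2]]]]] := linear_rot.
pose f1 (F : R -> pt R) t := cos t * (F t).1 + sin t * (F t).2.
pose f2 (F : R -> pt R) t := cos t * (F t).2 - sin t * (F t).1.
have cc := @ctcos R; have cs := @ctsin R; have pc := @per_cos R; have ps := @per_sin R.
have fP (F : R -> pt R) : continuous F -> per F ->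
    [/\ continuous (f1 F), per (f1 F), continuous (f2 F) & per (f2 F)].
  move=> cF pF; split; rewrite /f1 /f2; try by ctn.
    by move=> t; rewrite pc ps pF.
  by move=> t; rewrite pc ps pF.
exists (fun F t => (cos t * a (f1 F) (f2 F) t - sin t * b (f1 F) (f2 F) t,
  sin t * a (f1 F) (f2 F) t + cos t * b (f1 F) (f2 F) t)), (4 * C).
split; first by rewrite mulr_ge0.
split=> [F cF pF|F G B cF pF cG pG FG t].
  have [c1 p1 c2 p2] := fP F cF pF.
  have [pa pb Da Db] := H1 _ _ c1 p1 c2 p2.
  have e1 : (fun t => cos t * f1 F t - sin t * f2 F t) = fun t => (F t).1.
    apply/funext => t; transitivity ((cos t ^+ 2 + sin t ^+ 2) * (F t).1).
      by rewrite /f1 /f2; ring.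
    by rewrite cos2Dsin2 mul1r.
  have e2 : (fun t => sin t * f1 F t + cos t * f2 F t) = fun t => (F t).2.
    apply/funext => t; transitivity ((cos t ^+ 2 + sin t ^+ 2) * (F t).2).
      by rewrite /f1 /f2; ring.
    by rewrite cos2Dsin2 mul1r.
  have e3 : mean (f1 F) = mean (fun t => dot (cis t) (F t)) by [].
  rewrite e1 e2 in Da Db; rewrite e3 in Da.
  split; first by move=> t; rewrite pc ps pa pb.
  have e1t t : cos t * f1 F t - sin t * f2 F t = (F t).1 := congr1 (@^~ t) e1.
  have e2t t : sin t * f1 F t + cos t * f2 F t = (F t).2 := congr1 (@^~ t) e2.
  have m1t t : (vmean F).1 = (cos t ^+ 2 + sin t ^+ 2) * (vmean F).1 by rewrite cos2Dsin2 mul1r.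
  have m2t t : (vmean F).2 = (cos t ^+ 2 + sin t ^+ 2) * (vmean F).2 by rewrite cos2Dsin2 mul1r.
  split.
    apply: (Deriv_ext (DerivD (DerivM Deriv_cos Da) (DerivN (DerivM Deriv_sin Db)))) => t.
    by rewrite Lin_rot !ptE -e1t (m1t t)/=; ring.
  apply: (Deriv_ext (DerivD (DerivM Deriv_sin Da) (DerivM Deriv_cos Db))) => t.
  by rewrite Lin_rot !ptE -e2t (m2t t)/=; ring.
have [c1 p1 c2 p2] := fP F cF pF; have [d1 q1 d2 q2] := fP G cG pG.
have FG1 u : `|(F u).1 - (G u).1| <= B.
  by apply: le_trans (FG u); exact: (norm1_le (F u - G u)).
have FG2 u : `|(F u).2 - (G u).2| <= B.
  by apply: le_trans (FG u); exact: (norm2_le (F u - G u)).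
have h1 u : `|f1 F u - f1 G u| <= 2 * B.
  have -> : f1 F u - f1 G u = cos u * ((F u).1 - (G u).1) + sin u * ((F u).2 - (G u).2).
    by rewrite /f1; ring.
  by apply: rot_bound; rewrite ?cos_max ?sin_max.
have h2 u : `|f2 F u - f2 G u| <= 2 * B.
  have -> : f2 F u - f2 G u = cos u * ((F u).2 - (G u).2) + - sin u * ((F u).1 - (G u).1).
    by rewrite /f2; ring.
  by apply: rot_bound; rewrite ?normrN ?cos_max ?sin_max.
have [la lb] := H2 _ _ _ _ _ c1 p1 c2 p2 d1 q1 d2 q2 h1 h2 t.
have -> : 4 * C * B = 2 * (C * (2 * B)) by ring.
rewrite ptnormP !ptE/=; apply/andP; split.
  set x := (X in `|X|).
  have -> : x = cos t * (a (f1 F) (f2 F) t - a (f1 G) (f2 G) t)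
    + - sin t * (b (f1 F) (f2 F) t - b (f1 G) (f2 G) t) by rewrite /x; ring.
  by apply: rot_bound; rewrite ?normrN ?cos_max ?sin_max.
set x := (X in `|X|).
have -> : x = sin t * (a (f1 F) (f2 F) t - a (f1 G) (f2 G) t)
    + cos t * (b (f1 F) (f2 F) t - b (f1 G) (f2 G) t) by rewrite /x; ring.
by apply: rot_bound; rewrite ?cos_max ?sin_max.
Qed.

Lemma Dv_continuous (v v' : R -> pt R) : Dv v v' -> continuous v.
Proof.
move=> [/Deriv_continuous c1 /Deriv_continuous c2].
rewrite (_ : v = fun t => ((v t).1, (v t).2)); last by apply/funext => t; case: (v t).
by ctn.
Qed.

Lemma DvB (v v' w w' : R -> pt R) : Dv v v' -> Dv w w' ->
  Dv (fun t => v t - w t) (fun t => v' t - w' t).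
Proof.
by move=> [h1 h2] [k1 k2]; split; apply: DerivD => //; apply: DerivN.
Qed.

Lemma Dv_ext (v v' w' : R -> pt R) : Dv v v' -> v' =1 w' -> Dv v w'.
Proof. by move=> Dvv /funext <-. Qed.

Lemma mean_cos : mean (@cos R) = 0.
Proof. exact: (mean_der (@Deriv_sin R) per_sin). Qed.

Lemma mean_sin : mean (@sin R) = 0.
Proof.
have : mean (fun t : R => - sin t) = 0 := mean_der (@Deriv_cos R) per_cos.
by rewrite meanN; [move/eqP; rewrite oppr_eq0 => /eqP|exact: ctsin].
Qed.

Lemma linear_solution : exists (K : (R -> pt R) -> R -> pt R) (C : R), 0 <= C /\
  (forall F : R -> pt R, continuous F -> per F -> [/\ per (K F), deriv_eq F (K F),
     vmean (K F) = 0 & mean (fun t => dot (Jr (cis t)) (K F t)) = 0]) /\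
  (forall (F G : R -> pt R) (B : R), continuous F -> per F -> continuous G -> per G ->
    (forall t, `|F t - G t| <= B) -> forall t : R, `|K F t - K G t| <= C * B) /\
  (forall (F : R -> pt R) (B : R), continuous F -> per F ->
    (forall t, `|F t| <= B) -> forall t : R, `|K F t| <= C * B).
Proof.
have [K0 [C [C0 [H1 H2]]]] := linear_raw.
have cz : continuous (fun _ : R => 0 : pt R) by exact: ct_cst.
have pz : per (fun _ : R => 0 : pt R) by [].
have [pK0 DK0] := H1 _ cz pz; have cK0 := Dv_continuous DK0.
(* [K0] is only known to be Lipschitz; subtracting its value at 0 turns the Lipschitz bound into a
   bound on the solution itself. *)
pose w (F : R -> pt R) t := K0 F t - K0 (fun=> 0) t.
have cJ : continuous (fun t : R => Jr (cis t)).
  by rewrite /Jr /cis/=; have := @ctcos R; have := @ctsin R => ? ?; ctn.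
have pJ : per (fun t : R => Jr (cis t)) by move=> t; rewrite /cis per_cos per_sin.
have cdotJ (x : R -> pt R) : continuous x -> continuous (fun t => dot (Jr (cis t)) (x t)).
  by move=> cx; rewrite /dot; ctn.
pose c F := mean (fun t => dot (Jr (cis t)) (w F t)).
(* Removing the components along the kernel fixes the normalization: [Jr (cis t)] is a unit vector,
   and in the mean it is orthogonal to the constants. *)
pose K F t := w F t - vmean (w F) - c F *: Jr (cis t).
have lz : mean (fun t => dot (cis t) ((fun=> 0) t : pt R)) = 0.
  by rewrite -[RHS](mean_cst 0); apply: eq_mean => t; rewrite /dot/=; ring.
have vz : vmean (fun=> 0 : pt R) = 0 by rewrite /vmean !mean_cst.
have wP (F : R -> pt R) : continuous F -> per F -> per (w F) /\ deriv_eq F (w F).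
  move=> cF pF; have [pK DK] := H1 _ cF pF; split; first by move=> t; rewrite /w pK pK0.
  apply: (Dv_ext (DvB DK DK0)) => t.
  by rewrite LinB lz vz; apply: pt_eq; rewrite !ptE/=; ring.
have KP (F : R -> pt R) : continuous F -> per F -> [/\ per (K F), deriv_eq F (K F),
     vmean (K F) = 0 & mean (fun t => dot (Jr (cis t)) (K F t)) = 0].
  move=> cF pF; have [pw Dw] := wP F cF pF; have cw := Dv_continuous Dw.
  have mJ : vmean (fun t : R => Jr (cis t)) = 0.
    have cs := @ctsin R.
    by apply: pt_eq; rewrite /= ?(meanN cs) ?mean_sin ?mean_cos ?oppr0.
  split.
  - by move=> t; rewrite /K pw pJ.
  - have DJ : Dv (fun t => c F *: Jr (cis t)) (fun t => - c F *: cis t).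
      split.
        by apply: (Deriv_ext (DerivM (Deriv_cst _) (DerivN Deriv_sin))) => t; rewrite scl1/=; ring.
      by apply: (Deriv_ext (DerivM (Deriv_cst _) Deriv_cos)) => t; rewrite scl2/=; ring.
    have DC : Dv (fun=> vmean (w F)) (fun=> 0) by split; exact: Deriv_cst.
    apply: (Dv_ext (DvB (DvB Dw DC) DJ)) => t.
    rewrite (_ : Lin (K F) t = Lin (w F) t + c F *: cis t); last first.
      by rewrite /K LinB LinB Lin_cst Lin_Jcis subr0 scaleNr opprK.
    by apply: pt_eq; rewrite !ptE/=; ring.
  - have cJ1 : continuous (fun t : R => c F * (Jr (cis t)).1) by ctn.
    have cJ2 : continuous (fun t : R => c F * (Jr (cis t)).2) by ctn.
    have [mJ1 mJ2] : mean (fun t : R => (Jr (cis t)).1) = 0 /\ mean (fun t : R => (Jr (cis t)).2) = 0.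
      by case: mJ.
    apply: pt_eq; rewrite /= /K.
      transitivity (mean (fun t => (w F t).1 - (vmean (w F)).1 - c F * (Jr (cis t)).1)) => //.
      rewrite meanB; [|by ctn|by ctn].
      rewrite meanB; [|by ctn|by ctn].
      by rewrite mean_cst meanZ ?mJ1 ?mulr0 ?subr0 ?subrr//; ctn.
    transitivity (mean (fun t => (w F t).2 - (vmean (w F)).2 - c F * (Jr (cis t)).2)) => //.
    rewrite meanB; [|by ctn|by ctn].
    rewrite meanB; [|by ctn|by ctn].
    by rewrite mean_cst meanZ ?mJ2 ?mulr0 ?subr0 ?subrr//; ctn.
  - have [mJ1 mJ2] : mean (fun t : R => (Jr (cis t)).1) = 0 /\ mean (fun t : R => (Jr (cis t)).2) = 0.
      by case: mJ.
    have E t : dot (Jr (cis t)) (K F t) = dot (Jr (cis t)) (w F t)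
      - ((vmean (w F)).1 * (Jr (cis t)).1 + (vmean (w F)).2 * (Jr (cis t)).2) - c F.
      transitivity (dot (Jr (cis t)) (w F t)
      - ((vmean (w F)).1 * (Jr (cis t)).1 + (vmean (w F)).2 * (Jr (cis t)).2)
      - c F * (cos t ^+ 2 + sin t ^+ 2)); last by rewrite cos2Dsin2 mulr1.
      by rewrite /K /dot !ptE/=; ring.
    rewrite (eq_mean E) meanB; [|by have := cdotJ _ cw; move=> ?; ctn|by ctn].
    rewrite meanB; [|exact: cdotJ|by ctn].
    rewrite -/(c F) meanD; [|by ctn|by ctn].
    rewrite mean_cst (@meanZ R _ (fun t => (Jr (cis t)).1)); last by ctn.
    rewrite (@meanZ R _ (fun t => (Jr (cis t)).2)); last by ctn.
    by rewrite mJ1 mJ2 !mulr0 addr0 subr0 subrr.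
have KL (F G : R -> pt R) (B : R) : continuous F -> per F -> continuous G -> per G ->
    (forall t, `|F t - G t| <= B) -> forall t : R, `|K F t - K G t| <= 4 * C * B.
  move=> cF pF cG pG FG t.
  have [pw Dw] := wP F cF pF; have cw := Dv_continuous Dw.
  have [pw' Dw'] := wP G cG pG; have cw' := Dv_continuous Dw'.
  have lw u : `|w F u - w G u| <= C * B.
    rewrite /w (_ : _ - _ = K0 F u - K0 G u); last by apply: pt_eq; rewrite !ptE; ring.
    exact: H2.
  have -> : K F t - K G t = (w F t - w G t) - (vmean (w F) - vmean (w G))
     - (c F - c G) *: Jr (cis t) by rewrite /K; apply: pt_eq; rewrite !ptE; ring.
  have -> : 4 * C * B = C * B + C * B + 2 * (C * B) by ring.
  apply: (le_trans (ler_normB _ _)); apply: lerD.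
    by apply: (le_trans (ler_normB _ _)); apply: lerD => //; apply: vmean_lip.
  rewrite normrZ -[leRHS]mulr1; apply: ler_pM => //; last first.
    by have := cis_bound t; rewrite !ptnormP/= normrN => /andP[-> ->].
  apply: mean_lip; [exact: cdotJ|exact: cdotJ|] => u.
  apply: dot_lip => //.
  by have := cis_bound u; rewrite !ptnormP/= normrN => /andP[-> ->].
exists K, (4 * C); split; first by rewrite mulr_ge0.
split; first exact: KP.
split; first exact: KL.
move=> F B cF pF FB t.
have Kz : K (fun=> 0) t = 0.
  have w0 : w (fun=> 0) = fun=> 0 by apply/funext => u; rewrite /w subrr.
  rewrite /K /c w0 vz !subr0.
  rewrite (_ : mean _ = 0) ?scale0r ?subr0//.
  by rewrite -[RHS](mean_cst 0); apply: eq_mean => u; rewrite /dot/=; ring.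
have := KL F (fun=> 0) B cF pF cz pz _ t; rewrite Kz subr0; apply.
by move=> u; rewrite subr0.
Qed.

End Linearization.

(** * Singular chains and the prism operator *)

Section Prism.
Context {R : realType}.
Local Notation pt := (pt R).

(** The affine map of simplices given by a map of vertices. Faces and degeneracies are of this form,
    so their relations reduce to relations between maps of finite ordinals. *)
Definition push m n (f : 'I_m -> 'I_n) (x : 'rV[R]_m) : 'rV[R]_n :=
  \row_j \sum_(i | f i == j) x 0 i.

Lemma push_comp m n p (f : 'I_m -> 'I_n) (h : 'I_n -> 'I_p) x :
  push h (push f x) = push (h \o f) x.
Proof.
apply/rowP => j; rewrite !mxE.
under eq_bigr do rewrite mxE.
rewrite [RHS](partition_big f (fun i => h i == j))//=.
apply: eq_bigr => i /eqP <-; apply: eq_bigl => k.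
by rewrite andbC; case: eqP => // ->; rewrite eqxx.
Qed.

Lemma push_id m (x : 'rV[R]_m) : push id x = x.
Proof. by apply/rowP => j; rewrite mxE (big_pred1 j). Qed.

Lemma face_push n (i : 'I_n.+2) x : @face R n i x = push (lift i) x.
Proof.
apply/rowP => j; rewrite !mxE; case: unliftP => [k ->|->].
  rewrite (big_pred1 k)// => l; exact: (inj_eq lift_inj).
by rewrite big_pred0// => k; apply/negbTE; rewrite eq_sym neq_lift.
Qed.

Lemma sum_push m n (f : 'I_m -> 'I_n) x (P : pred 'I_n) :
  \sum_(j | P j) push f x 0 j = \sum_(i | P (f i)) x 0 i.
Proof.
under eq_bigr do rewrite mxE.
rewrite [RHS](partition_big f P)//=; apply: eq_bigr => j Pj.
by apply: eq_bigl => i; case: eqP => [->|]; rewrite ?Pj ?andbF.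
Qed.

Lemma push_simp m n (f : 'I_m.+1 -> 'I_n.+1) x :
  @stdsimp R m x -> @stdsimp R n (push f x).
Proof.
move=> [x0 x1]; split; last by rewrite (sum_push f x predT).
by move=> j; rewrite mxE; apply: sumr_ge0.
Qed.

(* [Pr D i s] is the [i]-th prism simplex of the homotopy [D] on [s]: [tau i] is the time coordinate on
   the simplex with vertices [v_0 .. v_i, w_i .. w_n]. *)
Definition dgn n (i : 'I_n.+1) (k : 'I_n.+2) : 'I_n.+1 := inord (if (k <= i)%N then (k : nat) else k.-1).

Definition tau n (i : 'I_n.+1) (x : 'rV[R]_n.+2) : R := \sum_(k : 'I_n.+2 | (i < k)%N) x 0 k.

Definition Pr (D : pt -> R -> pt) n (i : 'I_n.+1) (s : simplex R n) : simplex R n.+1 :=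
  fun x => D (s (push (dgn i) x)) (tau i x).

Lemma dgnE n (i : 'I_n.+1) (k : 'I_n.+2) : dgn i k = (if (k <= i)%N then (k : nat) else k.-1) :> nat.
Proof.
by rewrite inordK//; have := ltn_ord i; have := ltn_ord k; case: (leqP k i); lia.
Qed.

Definition tail n (m : nat) (x : 'rV[R]_n.+1) : R := \sum_(k : 'I_n.+1 | (m <= k)%N) x 0 k.

(** Vertices before [m] stay at time 0 and the others are at time 1: the face shared by the prism
    simplices [m - 1] and [m]. The extreme values of [m] give the two ends of the homotopy. *)
Definition Hm (D : pt -> R -> pt) n m (s : simplex R n) : simplex R n :=
  fun x => D (s x) (tail m x).

Lemma dgn_bump_eq (i j k : nat) : (i == j) || (i.+1 == j) ->
  (if ((j <= k) + k <= i)%N then ((j <= k) + k)%N else ((j <= k) + k).-1) = k.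
Proof.
move=> ij; case: ifP; case: (leqP j k) => jk /=; rewrite ?add1n ?add0n => h;
  by case/orP: ij => /eqP e; lia.
Qed.

Lemma dgn_bump_lt (i j k : nat) : (j <= i)%N ->
  (if ((j <= k) + k <= i.+1)%N then ((j <= k) + k)%N else ((j <= k) + k).-1) =
  ((j <= (if (k <= i)%N then k else k.-1)) + (if (k <= i)%N then k else k.-1))%N.
Proof.
move=> ij; case: (leqP k i) => ki; case: (leqP j k) => jk /=; rewrite ?add1n ?add0n;
  case: ifP => h; try (case: leqP); lia.
Qed.

Lemma dgn_bump_gt (i j k : nat) : (i < j)%N ->
  (if ((j.+1 <= k) + k <= i)%N then ((j.+1 <= k) + k)%N else ((j.+1 <= k) + k).-1) =
  ((j <= (if (k <= i)%N then k else k.-1)) + (if (k <= i)%N then k else k.-1))%N.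
Proof.
move=> ij; case: (leqP k i) => ki; case: (leqP j.+1 k) => jk /=; rewrite ?add1n ?add0n;
  case: ifP => h; try (case: leqP); lia.
Qed.

Lemma Pr_face_eq D n (i : 'I_n.+1) (j : 'I_n.+2) (s : simplex R n) :
  (i == j :> nat) || (i.+1 == j :> nat) -> Pr D i s \o face j = Hm D j s.
Proof.
move=> ij; apply/funext => x /=; rewrite /Pr /Hm face_push push_comp.
have -> : dgn i \o lift j = id.
  apply/funext => k; apply/ord_inj; rewrite /= dgnE /= /bump.
  exact: dgn_bump_eq.
rewrite push_id /tau sum_push /tail; congr D; apply: eq_bigl => k /=; rewrite /bump.
by case/orP: ij => /eqP <-; lia.
Qed.

Lemma Pr_face_lt D n (i : 'I_n.+1) (i0 : 'I_n.+2) (j : 'I_n.+3) (j' : 'I_n.+2) (s : simplex R n.+1) :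
  i0 = i.+1 :> nat -> j = j' :> nat -> (j <= i)%N ->
  Pr D i0 s \o face j = Pr D i (s \o face j').
Proof.
move=> e0 ej ji; apply/funext => x /=; rewrite /Pr /= !face_push !push_comp.
congr D; first congr s.
  congr push; apply/funext => k; apply/ord_inj; rewrite /= !dgnE /= ?dgnE /= /bump.
  by rewrite e0 ej; apply: dgn_bump_lt; rewrite -ej.
rewrite /tau sum_push; apply: eq_bigl => k /=; rewrite /bump; lia.
Qed.

Lemma Pr_face_gt D n (i : 'I_n.+1) (i0 : 'I_n.+2) (j : 'I_n.+3) (j' : 'I_n.+2) (s : simplex R n.+1) :
  i0 = i :> nat -> j = j'.+1 :> nat -> (i < j')%N ->
  Pr D i0 s \o face j = Pr D i (s \o face j').
Proof.
move=> e0 ej ji; apply/funext => x /=; rewrite /Pr /= !face_push !push_comp.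
congr D; first congr s.
  congr push; apply/funext => k; apply/ord_inj; rewrite /= !dgnE /= ?dgnE /= /bump.
  by rewrite e0 ej; exact: dgn_bump_gt.
rewrite /tau sum_push; apply: eq_bigl => k /=; rewrite /bump; lia.
Qed.

(** The signs of the prism formula, separated from the topology: [G i j] is the [j]-th face of the
    [i]-th prism simplex, [H] the shared inner faces, which telescope, and [Q] the prism simplices
    over the faces of the base, which come with the opposite sign. *)
Lemma alternating_prism (n : nat) (G Q : nat -> nat -> int) (H : nat -> int) :
  (forall i j, (j < i <= n)%N -> G i j = Q i.-1 j) ->
  (forall i, (i <= n)%N -> G i i = H i) ->
  (forall i, (i <= n)%N -> G i i.+1 = H i.+1) ->
  (forall i j, (i < j <= n)%N -> G i j.+1 = Q i j) ->
  \sum_(0 <= i < n.+1) \sum_(0 <= j < n.+2) (-1) ^+ (i + j) * G i j =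
  H 0 - H n.+1 - \sum_(0 <= i < n) \sum_(0 <= j < n.+1) (-1) ^+ (i + j) * Q i j.
Proof.
move=> G1 G2 G3 G4.
pose A i := \sum_(0 <= j < i) (-1) ^+ (i + j) * Q i.-1 j : int.
pose B i := \sum_(i.+1 <= j < n.+1) (-1) ^+ (i + j) * Q i j : int.
have inner i : (i <= n)%N -> \sum_(0 <= j < n.+2) (-1) ^+ (i + j) * G i j =
    A i + (H i - H i.+1) - B i.
  move=> iN.
  rewrite (@big_cat_nat _ _ _ i)//=; last by rewrite ltnW// ltnW// !ltnS.
  rewrite (@big_ltn _ _ _ i)//=; last by rewrite ltnW// !ltnS.
  rewrite (@big_ltn _ _ _ i.+1)//=.
  rewrite G2// G3// -[(-1) ^+ (i + i)]signr_odd addnn odd_double expr0 mul1r.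
  rewrite -[(-1) ^+ (i + i.+1)]signr_odd addnS addnn oddS odd_double expr1 mulN1r.
  rewrite -addrA; congr (_ + _).
    by apply: eq_big_nat => j /andP[_ ji]; rewrite G1// ji.
  rewrite -addrA; congr (_ + (_ + _)).
  rewrite big_add1/= /B -sumrN; apply: eq_big_nat => j /andP[ij jn].
  by rewrite G4 ?ij// addnS exprS mulN1r mulNr.
rewrite (eq_big_nat _ _ (F2 := fun i => A i + (H i - H i.+1) - B i)); last first.
  by move=> i /andP[_ iN]; rewrite inner.
have T : \sum_(0 <= i < n.+1) (H i - H i.+1) = H 0 - H n.+1.
  elim: (n) => [|k IH]; first by rewrite big_nat1.
  by rewrite big_nat_recr//= IH; ring.
rewrite sumrB big_split/= T.
suff S : \sum_(0 <= i < n.+1) A i - \sum_(0 <= i < n.+1) B i =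
    - \sum_(0 <= i < n) \sum_(0 <= j < n.+1) (-1) ^+ (i + j) * Q i j.
  by rewrite -S; ring.
have A0 : A 0%N = 0 by rewrite /A big_geq.
have Bn : B n = 0 by rewrite /B big_geq.
rewrite big_ltn// A0 add0r big_add1/=.
rewrite [X in _ - X]big_nat_recr//= Bn addr0 -sumrB -sumrN.
apply: eq_big_nat => i /andP[_ iN].
rewrite (@big_cat_nat _ _ _ i.+1)//=; last by rewrite ltnW.
rewrite opprD /A /B; congr (_ + _); rewrite -sumrN; apply: eq_bigr => j _ /=.
by rewrite addSn exprS mulN1r mulNr.
Qed.

Definition seq_s n (s s' : simplex R n) := forall x, @stdsimp R n x -> s x = s' x.

(** A chain is a list, so equal chains may look different; pairing them with functions of simplices
    makes identities additive. [coef] is the pairing with the indicator [dl], and the admissible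
    functions ([resp]) see a simplex only through its values on the standard simplex. *)
Definition ev n (c : chain R n) (psi : simplex R n -> int) : int :=
  \sum_(p <- c) p.1 * psi p.2.

Definition dl n (s : simplex R n) (s' : simplex R n) : int := `[< seq_s s' s >]%:R.

Lemma coef_ev n (c : chain R n) s : coef c s = ev c (dl s).
Proof.
rewrite /coef /ev big_mkcond; apply: eq_bigr => p _; rewrite /dl /seq_s.
by case: asboolP => _; rewrite ?mulr1 ?mulr0.
Qed.

Definition resp n (psi : simplex R n -> int) := forall s s', seq_s s s' -> psi s = psi s'.

Lemma dl_resp n (s : simplex R n) : resp (dl s).
Proof.
move=> s1 s2 e; rewrite /dl; congr (nat_of_bool _)%:R; apply/asboolP/asboolP => h x X.
  by rewrite -e// h.
by rewrite e// h.
Qed.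

Lemma ev_cat n (c d : chain R n) psi : ev (c ++ d) psi = ev c psi + ev d psi.
Proof. by rewrite /ev big_cat. Qed.

(** Induction on the length: the entries that agree with the head on the standard simplex contribute
    a multiple of its coefficient, which is 0, and can be deleted. *)
Lemma ev0 n (c : chain R n) psi : resp psi -> (forall s, coef c s = 0) -> ev c psi = 0.
Proof.
move=> rpsi; have [k] := ubnP (size c); elim: k c => // k IH [|p c] /=.
  by rewrite /ev big_nil.
rewrite ltnS => sc c0.
pose P (q : int * simplex R n) := `[< seq_s q.2 p.2 >].
have Pp : P p by apply/asboolP.
rewrite /ev (bigID P)/=.
have -> : \sum_(i <- p :: c | P i) i.1 * psi i.2 = 0.
  rewrite (eq_bigr (fun i => i.1 * psi p.2)); last by move=> q /asboolP /rpsi ->.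
  by rewrite -mulr_suml -[\sum_(_ <- _ | _) _]/(coef (p :: c) p.2) c0 mul0r.
rewrite add0r big_cons Pp/= -big_filter; apply: IH.
  by rewrite (leq_ltn_trans _ sc)// size_filter count_size.
move=> s; rewrite /coef big_filter_cond/=.
have [sp|sp] := boolP `[< seq_s p.2 s >].
  rewrite big_pred0// => q; apply/negbTE/negP => /andP[/asboolP nq /asboolP qs].
  by apply: nq => x X; rewrite qs// (asboolW sp x X).
have := c0 s; rewrite /coef big_cons.
rewrite (_ : `[< forall x, _ -> p.2 x = s x >] = false); last exact: negbTE sp.
move=> e; rewrite -[RHS]e; apply: eq_bigl => q.
case: (asboolP (forall x, _ -> q.2 x = s x)) => qs; rewrite ?andbF ?andbT//.
apply/negP => /asboolP qp; move/asboolP: sp; apply => x X.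
by rewrite -qp// qs.
Qed.

Lemma ev_opp n (c : chain R n) psi : ev [seq (- p.1, p.2) | p <- c] psi = - ev c psi.
Proof. by rewrite /ev big_map -sumrN; apply: eq_bigr => p _; rewrite mulNr. Qed.

Lemma ev_eq n (c d : chain R n) psi : resp psi -> (forall s, coef c s = coef d s) ->
  ev c psi = ev d psi.
Proof.
move=> rpsi cd; apply/eqP; rewrite -subr_eq0 -ev_opp -ev_cat; apply/eqP.
by apply: ev0 => // s; rewrite coef_ev ev_cat ev_opp -!coef_ev cd subrr.
Qed.

Lemma ev_bdry n (c : chain R n.+1) psi :
  ev (bdry c) psi = \sum_(p <- c) p.1 * \sum_(i < n.+2) (-1) ^+ i * psi (p.2 \o face i).
Proof.
rewrite /ev /bdry big_flatten big_map; apply: eq_bigr => p _.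
rewrite big_map big_enum/= mulr_sumr; apply: eq_bigr => i _ /=; ring.
Qed.

Definition PrC D n (c : chain R n) : chain R n.+1 :=
  flatten [seq [seq (((-1) ^+ (val i)) * p.1, Pr D i p.2) | i : 'I_n.+1] | p <- c].

Lemma ev_PrC D n (c : chain R n) psi :
  ev (PrC D c) psi = \sum_(p <- c) p.1 * \sum_(i < n.+1) (-1) ^+ i * psi (Pr D i p.2).
Proof.
rewrite /ev /PrC big_flatten big_map; apply: eq_bigr => p _.
rewrite big_map big_enum/= mulr_sumr; apply: eq_bigr => i _ /=; ring.
Qed.

Definition mapC n (f : pt -> pt) (c : chain R n) : chain R n := [seq (p.1, f \o p.2) | p <- c].

Lemma ev_mapC n f (c : chain R n) psi : ev (mapC f c) psi = \sum_(p <- c) p.1 * psi (f \o p.2).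
Proof. by rewrite /ev big_map. Qed.

Lemma Hm0 D n (s : simplex R n) : seq_s (Hm D 0 s) (D^~ 1 \o s).
Proof. by move=> x [_ x1]; rewrite /Hm /tail x1. Qed.

Lemma HmS D n (s : simplex R n) : seq_s (Hm D n.+1 s) (D^~ 0 \o s).
Proof.
move=> x _; rewrite /Hm /tail big_pred0// => k.
by apply/negbTE; rewrite -ltnNge.
Qed.

(** The chain homotopy identity [d P = D_1 - D_0 - P d]. In degree 0 there is no boundary, and
    [bdry_Pr0] is the identity without the last term. *)
Lemma bdry_PrS D n (c : chain R n.+1) psi : resp psi ->
  ev (bdry (PrC D c)) psi = ev (mapC (D^~ 1) c) psi - ev (mapC (D^~ 0) c) psi
    - ev (PrC D (bdry c)) psi.
Proof.
move=> rpsi.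
pose psi' (s : simplex R n.+2) := \sum_(i < n.+3) (-1) ^+ i * psi (s \o face i) : int.
have -> : ev (bdry (PrC D c)) psi = ev (PrC D c) psi' by rewrite ev_bdry.
pose psi2 (s : simplex R n) := \sum_(i < n.+1) (-1) ^+ i * psi (Pr D i s) : int.
have -> : ev (PrC D (bdry c)) psi = ev (bdry c) psi2 by rewrite ev_PrC.
rewrite ev_PrC ev_bdry !ev_mapC -!sumrB; apply: eq_bigr => -[k s] _ /=.
rewrite -!mulrBr; congr (_ * _).
pose G i j := psi (Pr D (inord i : 'I_n.+2) s \o face (inord j : 'I_n.+3)).
pose Q i j := psi (Pr D (inord i : 'I_n.+1) (s \o face (inord j : 'I_n.+2))).
pose H m := psi (Hm D m s).
have <- : H 0%N = psi (D^~ 1 \o s) by apply/rpsi/Hm0.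
have <- : H n.+2 = psi (D^~ 0 \o s) by apply/rpsi/HmS.
transitivity (\sum_(0 <= i < n.+2) \sum_(0 <= j < n.+3) (-1) ^+ (i + j) * G i j).
  rewrite big_mkord; apply: eq_bigr => i _; rewrite /psi' mulr_sumr big_mkord.
  by apply: eq_bigr => j _; rewrite mulrA -exprD /G !inord_val.
rewrite (@alternating_prism n.+1 G Q H).
- congr (_ - _); rewrite big_mkord.
  transitivity (\sum_(i < n.+1) \sum_(j < n.+2) (-1) ^+ (i + j) * Q i j).
    by apply: eq_bigr => i _; rewrite big_mkord.
  rewrite exchange_big/=; apply: eq_bigr => j _; rewrite /psi2 mulr_sumr.
  by apply: eq_bigr => i _; rewrite mulrA -exprD addnC /Q !inord_val.
- move=> i j /andP[ji iN]; rewrite /G /Q; congr psi; apply: Pr_face_lt; rewrite ?inordK//; lia.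
- move=> i iN; rewrite /G /H (Pr_face_eq D s); first by rewrite inordK//; lia.
  by rewrite !inordK ?eqxx//; lia.
- move=> i iN; rewrite /G /H (Pr_face_eq D s); first by rewrite inordK//; lia.
  by rewrite !inordK ?eqxx ?orbT//; lia.
- move=> i j /andP[ij jN]; rewrite /G /Q; congr psi; apply: Pr_face_gt; rewrite ?inordK//; lia.
Qed.

Lemma bdry_Pr0 D (c : chain R 0) psi : resp psi ->
  ev (bdry (PrC D c)) psi = ev (mapC (D^~ 1) c) psi - ev (mapC (D^~ 0) c) psi.
Proof.
move=> rpsi.
pose psi' (s : simplex R 1) := \sum_(i < 2) (-1) ^+ i * psi (s \o face i) : int.
have -> : ev (bdry (PrC D c)) psi = ev (PrC D c) psi' by rewrite ev_bdry.
rewrite ev_PrC !ev_mapC -!sumrB; apply: eq_bigr => -[k s] _ /=.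
rewrite -!mulrBr; congr (_ * _).
rewrite /psi' big_ord1 !big_ord_recl big_ord0 /= !expr0 !mul1r addr0 expr1 mulN1r.
by rewrite !(Pr_face_eq D s)//; congr (_ - _); apply: rpsi; [exact: Hm0|exact: HmS].
Qed.

Lemma continuous_push m n (f : 'I_m -> 'I_n) : continuous (push f).
Proof.
move=> x B [P Px PB].
suff : \forall y \near x, forall j : 'I_n, P ord0 j (push f y ord0 j).
  by rewrite nbhs_simpl /=; apply: filterS => y Hy; apply: PB => i j; rewrite ord1; exact: Hy.
have FF : Filter (nbhs (x : 'rV[R]_m)) by exact: nbhs_filter.
apply: (@filter_forall _ _ (fun j y => P ord0 j (push f y ord0 j)) (nbhs x) FF) => j.
have cj : continuous (fun y : 'rV[R]_m => push f y ord0 j).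
  have -> : (fun y : 'rV[R]_m => push f y ord0 j) = fun y => \sum_(i | f i == j) y ord0 i.
    by apply/funext => y; rewrite mxE.
  by apply: ct_sum => i; exact: coord_continuous.
exact: (cj x _ (Px ord0 j)).
Qed.

Lemma continuous_tau n (i : 'I_n.+1) : continuous (@tau n i).
Proof. by apply: ct_sum => k; exact: coord_continuous. Qed.

Lemma tau01 n (i : 'I_n.+1) x : @stdsimp R n.+1 x -> 0 <= tau i x <= 1.
Proof.
move=> [x0 x1]; rewrite /tau sumr_ge0//= -x1 [leRHS](bigID (fun k : 'I_n.+2 => (i < k)%N))/=.
by rewrite lerDl sumr_ge0.
Qed.

(** Continuity is relative to [X] times [[0, 1]]: the final retraction is continuous only on the set
    of points that actually occur. *)
Definition homotopy_on (X Y : set pt) (D : pt -> R -> pt) :=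
  (forall x (t : R), X x -> 0 <= t <= 1 -> Y (D x t)) /\
  forall x (t : R), X x -> 0 <= t <= 1 ->
    (fun p : pt * R => D p.1 p.2) @ within [set p : pt * R | X p.1 /\ 0 <= p.2 <= 1] (nbhs (x, t))
      --> D x t.

Lemma cvg_within_comp (S T U : topologicalType) (A : set S) (B : set T) (f : S -> T) (h : T -> U)
    (x : S) (y : U) :
  (forall z, A z -> B (f z)) -> f @ within A (nbhs x) --> f x ->
  h @ within B (nbhs (f x)) --> y -> (fun z => h (f z)) @ within A (nbhs x) --> y.
Proof.
move=> AB cf ch V /ch; rewrite /= /nbhs /= => VB.
have := cf _ VB; rewrite !nbhs_simpl /= /within /=.
by apply: filterS => z Hz Az; apply: Hz => //; exact: AB.
Qed.

Lemma cvg_withinW (S T : topologicalType) (A : set S) (f : S -> T) (x : S) (y : T) :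
  f @ nbhs x --> y -> f @ within A (nbhs x) --> y.
Proof.
by move=> cf V /cf; rewrite /= !nbhs_simpl /= /within /=; apply: filterS => z Vz _.
Qed.

Lemma cvg_pair_at (S T T' : topologicalType) (F : set_system S) (f : S -> T) (h : S -> T')
    (a : T) (b : T') :
  Filter F -> f @ F --> a -> h @ F --> b -> (fun z => (f z, h z)) @ F --> (a, b).
Proof. by move=> FF cf ch; apply: cvg_pair. Qed.

Lemma sing_in_Pr X Y D n (i : 'I_n.+1) (s : simplex R n) :
  homotopy_on X Y D -> sing_in X s -> {within @stdsimp R n.+1, continuous (Pr D i s)}.
Proof.
move=> [DY cD] [/subspace_continuousP cs sX]; apply/subspace_continuousP => x xs.
have pX z : @stdsimp R n.+1 z -> X (s (push (dgn i) z)).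
  by move=> zs; apply: sX; exists (push (dgn i) z) => //; exact: push_simp.
apply: (@cvg_within_comp _ _ _ _ [set p : pt * R | X p.1 /\ 0 <= p.2 <= 1]
  (fun z => (s (push (dgn i) z), tau i z)) (fun p : pt * R => D p.1 p.2)) => /=.
- by move=> z zs; split; [exact: pX|exact: tau01].
- apply: cvg_pair_at.
    apply: (@cvg_within_comp _ _ _ _ (@stdsimp R n) (push (dgn i)) s).
    + by move=> z; exact: push_simp.
    + by apply: cvg_withinW; exact: @continuous_push _ _ (dgn i) x.
    + by apply: cs; exact: push_simp.
  by apply: cvg_withinW; exact: @continuous_tau _ i x.
- by apply: cD; [exact: pX|exact: tau01].
Qed.

Lemma sing_in_map X Y D n t (s : simplex R n) : 0 <= t <= 1 ->
  homotopy_on X Y D -> sing_in X s -> {within @stdsimp R n, continuous (D^~ t \o s)}.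
Proof.
move=> t01 [DY cD] [/subspace_continuousP cs sX]; apply/subspace_continuousP => x xs.
apply: (@cvg_within_comp _ _ _ _ [set p : pt * R | X p.1 /\ 0 <= p.2 <= 1]
  (fun z => (s z, t)) (fun p : pt * R => D p.1 p.2)) => /=.
- by move=> z zs; split=> //; apply: sX; exists z.
- by apply: cvg_pair_at; [exact: cs|exact: cvg_cst].
- by apply: cD => //; apply: sX; exists x.
Qed.

Lemma sing_in_face X n (i : 'I_n.+2) (s : simplex R n.+1) :
  sing_in X s -> sing_in X (s \o face i).
Proof.
have -> : @face R n i = push (lift i) by apply/funext => x; exact: face_push.
move=> [/subspace_continuousP cs sX]; split; last first.
  by move=> _ [x xs <-]; apply: sX; exists (push (lift i) x) => //; exact: push_simp.
apply/subspace_continuousP => x xs.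
apply: (@cvg_within_comp _ _ _ _ (@stdsimp R n.+1) (push (lift i)) s).
- by move=> z; exact: push_simp.
- by apply: cvg_withinW; exact: @continuous_push _ _ (lift i) x.
- by apply: cs; exact: push_simp.
Qed.

Lemma mem_PrC D n (c : chain R n) q : q \in PrC D c ->
  exists p, p \in c /\ exists i, q.2 = Pr D i p.2.
Proof. by move/flatten_mapP => [p pc /mapP[i _ ->]]; exists p; split=> //; exists i. Qed.

Lemma mem_bdry n (c : chain R n.+1) q : q \in bdry c ->
  exists p, p \in c /\ exists i, q.2 = p.2 \o face i.
Proof. by move/flatten_mapP => [p pc /mapP[i _ ->]]; exists p; split=> //; exists i. Qed.

Definition oppC n (c : chain R n) : chain R n := [seq (- p.1, p.2) | p <- c].

Lemma ev_bdry_opp n (c : chain R n.+1) psi : ev (bdry (oppC c)) psi = - ev (bdry c) psi.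
Proof.
by rewrite !ev_bdry big_map -sumrN; apply: eq_bigr => p _; rewrite mulNr.
Qed.

Lemma chain_in_opp X n (c : chain R n) : chain_in X c -> chain_in X (oppC c).
Proof. by move=> cX _ /mapP[p pc ->]; exact: cX p pc. Qed.

Lemma chain_in_cat X n (c d : chain R n) : chain_in X c -> chain_in X d -> chain_in X (c ++ d).
Proof. by move=> cX dX p; rewrite mem_cat => /orP[/cX|/dX]. Qed.

Definition bdry_pts n : chain R n -> set pt :=
  match n with
  | 0 => fun _ => set0
  | m.+1 => fun c => [set y | exists2 s, coef (bdry c) s != 0 & (s @` @stdsimp R m) y]
  end.

(** By the chain homotopy identity, [c] is [- d P c] plus [D_1 c] minus [P d c]; the second chain
    lies in [A] by the assumption on the end of the homotopy, the third because the boundary never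
    leaves [A]. *)
Lemma homotopy_trivial (X A : set pt) n (c : chain R n) (D : pt -> R -> pt) :
  chain_in X c -> homotopy_on X X D -> (forall x, X x -> D x 0 = x) ->
  (forall x, X x -> A (D x 1)) ->
  (forall y (t : R), bdry_pts c y -> 0 <= t <= 1 -> A (D y t)) ->
  exists (d : chain R n.+1) (e : chain R n), chain_in X d /\ chain_in A e /\
    forall s, coef c s = coef (bdry d) s + coef e s.
Proof.
move=> cX hD D0 D1 Db.
have dX : chain_in X (oppC (PrC D c)).
  apply: chain_in_opp => q /mem_PrC[p [pc [i e]]]; rewrite e; split.
    exact: sing_in_Pr hD (cX _ pc).
  move=> _ [x xs <-]; apply: hD.1; last exact: tau01.
  by have [_ pX] := cX _ pc; apply: pX; exists (push (dgn i) x) => //; exact: push_simp.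
have e1A : chain_in A (mapC (D^~ 1) c).
  move=> _ /mapP[p pc ->]; split.
    by apply: sing_in_map hD (cX _ pc); rewrite ler01 lexx.
  by move=> _ [x xs <-]; apply: D1; have [_ pX] := cX _ pc; apply: pX; exists x.
have c0 psi : resp psi -> ev c psi = ev (mapC (D^~ 0) c) psi.
  move=> rpsi; rewrite ev_mapC /ev big_seq [RHS]big_seq; apply: eq_bigr => p pc; congr (_ * _).
  by apply: rpsi => x xs /=; rewrite D0//; have [_ pX] := cX _ pc; apply: pX; exists x.
case: n c cX D1 Db dX e1A c0 => [|n] c cX D1 Db dX e1A c0.
  exists (oppC (PrC D c)), (mapC (D^~ 1) c); split=> //; split=> // s.
  rewrite !coef_ev ev_bdry_opp bdry_Pr0; last exact: dl_resp.
  by rewrite c0; [ring|exact: dl_resp].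
(* The list [bdry c] may contain simplices that cancel and about which nothing is known; only those
   with nonzero coefficient are kept. The prisms over both lists evaluate equally because all
   coefficients agree. *)
pose e0 := [seq p <- bdry c | coef (bdry c) p.2 != 0].
have eA : chain_in A (oppC (PrC D e0)).
  apply: chain_in_opp => q /mem_PrC[p []]; rewrite mem_filter => /andP[cp pb] [i e].
  have pX : sing_in X p.2.
    by have [p' [pc' [i' ->]]] := mem_bdry pb; apply: sing_in_face; exact: cX.
  rewrite e; split; first exact: sing_in_Pr hD pX.
  move=> _ [x xs <-]; apply: Db; last exact: tau01.
  by exists p.2 => //; exists (push (dgn i) x) => //; exact: push_simp.
exists (oppC (PrC D c)), (mapC (D^~ 1) c ++ oppC (PrC D e0)); split=> //.
split; first exact: chain_in_cat.
move=> s; rewrite !coef_ev ev_bdry_opp ev_cat ev_opp bdry_PrS; last exact: dl_resp.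
rewrite c0; last exact: dl_resp.
have -> : ev (PrC D (bdry c)) (dl s) = ev (PrC D e0) (dl s).
  pose psi2 (s' : simplex R n) := \sum_(i < n.+1) (-1) ^+ i * dl s (Pr D i s') : int.
  rewrite !ev_PrC; apply: (@ev_eq n (bdry c) e0 psi2).
    move=> s1 s2 e; apply: eq_bigr => i _; congr (_ * _); apply: dl_resp => x xs.
    by rewrite /Pr e//; exact: push_simp.
  move=> s'; rewrite /e0 {2}/coef big_filter_cond/=.
  have cs (p : int * simplex R n) : `[< forall x, @stdsimp R n x -> p.2 x = s' x >] -> coef (bdry c) p.2 = coef (bdry c) s'.
    move=> /asboolP ps; rewrite /coef; apply: eq_bigl => q.
    by apply/asboolP/asboolP => h x xs; rewrite h// ps.
  have [z|nz] := eqVneq (coef (bdry c) s') 0.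
    rewrite z big_pred0// => p; apply/negbTE/negP => /andP[+ ps].
    by rewrite (cs p ps) z eqxx.
  rewrite {1}/coef; apply: eq_bigl => p; case: (boolP `[< _ >]) => [ps|_]; last by rewrite andbF.
  by rewrite (cs p ps) nz.
ring.
Qed.

Lemma stdsimp_compact n : compact (@stdsimp R n).
Proof.
pose B := [set x : 'rV[R]_n.+1 | forall i : 'I_n.+1, [set` `[0%R, 1%R]] (x ord0 i)].
have cB : compact B by apply: (@rV_compact R n.+1 (fun=> [set` `[0%R, 1%R]])) => i; exact: segment_compact.
apply: (subclosed_compact _ cB).
  have -> : @stdsimp R n = (\bigcap_(i in [set: 'I_n.+1]) [set x | 0 <= x ord0 i])
      `&` [set x | \sum_i x ord0 i = 1].
    apply/seteqP; split=> x [h1 h2]; split=> //; first by move=> i _; exact: h1.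
    by move=> i; exact: h1.
  apply: closedI.
    apply: closed_bigI => i _.
    apply: (@closed_comp _ _ (fun x : 'rV[R]_n.+1 => x ord0 i) [set y | 0 <= y]).
      by move=> x _; exact: coord_continuous.
    exact: closed_ge.
  apply: (@closed_comp _ _ (fun x : 'rV[R]_n.+1 => \sum_i x ord0 i) [set y | y = 1]).
    by move=> x _; apply: ct_sum => i; exact: coord_continuous.
  exact: closed_eq.
move=> x [x0 x1] i; rewrite /= in_itv/= x0/= -x1 (bigD1 i)//=.
by rewrite lerDl sumr_ge0.
Qed.

(** Each simplex of the boundary with nonzero coefficient has a compact image avoiding [a], and the
    list of these simplices is finite. *)
Lemma bdry_away (X : set pt) (a : pt) n (c : chain R n) :
  chain_in X c -> rel_cycle (X `\ a) c ->
  exists2 sg : R, 0 < sg & forall y, bdry_pts c y -> sg <= `|y - a|.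
Proof.
case: n c => [|n] c cX rc; first by exists 1 => // y [].
have key (l : chain R n) : {subset l <= bdry c} ->
    exists2 sg : R, 0 < sg & forall p, p \in l -> coef (bdry c) p.2 != 0 ->
      forall x, @stdsimp R n x -> sg <= `|p.2 x - a|.
  elim: l => [|p l IH] sub; first by exists 1.
  have [|sg sg0 H] := IH; first by move=> q ql; apply: sub; rewrite in_cons ql orbT.
  have [z|nz] := eqVneq (coef (bdry c) p.2) 0.
    exists sg => // q; rewrite in_cons => /orP[/eqP ->|/H]; rewrite ?z ?eqxx//.
  have pb : p \in bdry c by apply: sub; rewrite mem_head.
  have [cp _] : sing_in X p.2.
    by have [p' [pc' [i' ->]]] := mem_bdry pb; apply: sing_in_face; exact: cX.
  have ne : @stdsimp R n !=set0.
    exists (\row_j (j == ord0)%:R); split=> [i|]; first by rewrite mxE.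
    rewrite (bigD1 ord0)//= mxE eqxx big1 ?addr0// => i /negbTE; rewrite mxE => ->//.
  have cd : {within @stdsimp R n, continuous (fun x => `|p.2 x - a|)}.
    move=> x; apply: cvg_norm; apply: cvgB; [exact: cp|exact: cvg_cst].
  have [x0 x0s min] := EVT_min_rV ne (@stdsimp_compact n) cd.
  have d0 : 0 < `|p.2 x0 - a|.
    rewrite normr_gt0 subr_eq0; apply/eqP => pa.
    by have := rc p.2 nz (p.2 x0); case=> //; exists x0 => //; rewrite inE in x0s.
  exists (Num.min sg `|p.2 x0 - a|); first by rewrite lt_min sg0.
  move=> q; rewrite in_cons => /orP[/eqP -> _ x xs|ql nq x xs].
    by rewrite ge_min min ?orbT// inE.
  by rewrite ge_min H.
have [sg sg0 H] := key (bdry c) (fun _ h => h).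
exists sg => // y [s cs [x xs <-]].
have [p [pb ps]] : exists p, p \in bdry c /\ seq_s p.2 s.
  apply: contrapT => nex; move/eqP: cs; apply; rewrite /coef big_seq_cond big_pred0// => p.
  by apply/negbTE/negP => /andP[pb /asboolP ps]; apply: nex; exists p.
rewrite -ps//; apply: H => //.
suff -> : coef (bdry c) p.2 = coef (bdry c) s by [].
rewrite /coef; apply: eq_bigl => q.
by apply/asboolP/asboolP => h z zs; rewrite h// ps.
Qed.

End Prism.

(** * Uniform limits of plane-valued maps *)

Section UniformLimits.
Context {R : realType}.

(** The limit inherits each Cauchy estimate with the same rank [n0], so that uniformity in a
    parameter survives the passage to the limit. *)
Lemma cauchy_real (u : nat -> R) :
  (forall e : R, 0 < e -> exists n0, forall n, (n0 <= n)%N -> forall p, `|u (n + p)%N - u n| <= e) ->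
  exists l, forall (e : R) n0,
    (forall n, (n0 <= n)%N -> forall p, `|u (n + p)%N - u n| <= e) ->
    forall n, (n0 <= n)%N -> `|l - u n| <= e.
Proof.
move=> cu.
have cvu : cvgn u.
  apply/cauchy_cvgP; apply: cauchy_exP => e e0.
  have e2 : 0 < e / 2 by lra.
  have [n0 H] := cu (e / 2) e2; exists (u n0); exists n0 => // n /= n0n.
  rewrite /ball /= -(subnKC n0n) distrC; apply: le_lt_trans (H _ (leqnn _) _) _; lra.
exists (limn u) => e n0 H n n0n.
have cn : (fun m => `|u m - u n|) @ \oo --> `|limn u - u n|.
  by apply: cvg_norm; apply: cvgB; [exact: cvu|exact: cvg_cst].
apply: (cvgr_to_le cn); exists n => // m /= nm.
by rewrite -(subnKC nm) H.
Qed.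

Lemma uniform_cauchy (T : Type) (V : set T) (u : nat -> T -> pt R) :
  (forall e : R, 0 < e -> exists n0, forall x, V x -> forall n, (n0 <= n)%N ->
     forall p, `|u (n + p)%N x - u n x| <= e) ->
  exists l : T -> pt R, forall e : R, 0 < e ->
    exists n0, forall x, V x -> forall n, (n0 <= n)%N -> `|l x - u n x| <= e.
Proof.
move=> cu.
have /choice[l Hl] : forall x, exists l : pt R, V x -> forall (e : R) n0,
    (forall n, (n0 <= n)%N -> forall p, `|u (n + p)%N x - u n x| <= e) ->
    forall n, (n0 <= n)%N -> `|l - u n x| <= e.
  move=> x; have [Vx|nV] := pselect (V x); last by exists 0.
  have [|l1 H1] := @cauchy_real (fun n => (u n x).1).
    move=> e e0; have [n0 H] := cu e e0; exists n0 => n nn p.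
    exact: le_trans (norm1_le (u (n + p)%N x - u n x)) (H x Vx n nn p).
  have [|l2 H2] := @cauchy_real (fun n => (u n x).2).
    move=> e e0; have [n0 H] := cu e e0; exists n0 => n nn p.
    exact: le_trans (norm2_le (u (n + p)%N x - u n x)) (H x Vx n nn p).
  exists (l1, l2) => _ e n0 H n nn; rewrite ptnormP/=; apply/andP; split.
    apply: (H1 e n0) => // k kn p; exact: le_trans (norm1_le (u (k + p)%N x - u k x)) (H k kn p).
  apply: (H2 e n0) => // k kn p; exact: le_trans (norm2_le (u (k + p)%N x - u k x)) (H k kn p).
exists l => e e0; have [n0 H] := cu e e0; exists n0 => x Vx n nn.
by apply: (Hl x Vx e n0) => // k kn p; exact: H.
Qed.

Lemma uniform_limit_within (T : topologicalType) (V : set T) (u : nat -> T -> pt R) (l : T -> pt R) x :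
  (forall e : R, 0 < e -> exists n0, forall x, V x -> forall n, (n0 <= n)%N -> `|l x - u n x| <= e) ->
  (forall n, u n @ within V (nbhs x) --> u n x) -> V x -> l @ within V (nbhs x) --> l x.
Proof.
move=> ul cu Vx; apply/cvgrPdist_le => e e0.
have e3 : 0 < e / 3 by lra.
have [n0 H] := ul _ e3.
have := cu n0 => /cvgrPdist_le /(_ _ e3); rewrite !near_withinE; apply: filterS => y Hy Vy.
rewrite (_ : l x - l y = (l x - u n0 x) + (u n0 x - u n0 y) - (l y - u n0 y)); last first.
  by apply: pt_eq; rewrite !ptE; ring.
apply: (le_trans (ler_normB _ _)); have -> : e = e / 3 + e / 3 + e / 3 by field.
apply: lerD; last exact: H.
by apply: (le_trans (ler_normD _ _)); apply: lerD; [exact: H|exact: Hy].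
Qed.

Lemma lip_cvg (V W : normedModType R) (g : V -> W) (x : V) (e C : R) : 0 < e ->
  (forall y, `|y - x| < e -> `|g y - g x| <= C * `|y - x|) -> g @ x --> g x.
Proof.
move=> e0 lip; apply/cvgrPdist_le => r r0.
pose C' := Num.max C 1.
have C0 : 0 < C' by rewrite lt_max ltr01 orbT.
have d0 : 0 < Num.min e (r / C') by rewrite lt_min e0 divr_gt0.
have := nbhsx_ballx x _ d0.
apply: filterS => y; rewrite -ball_normE/= distrC lt_min => /andP[h1 h2].
rewrite distrC; apply: (le_trans (lip y h1)).
apply: (@le_trans _ _ (C' * `|y - x|)); first by apply: ler_wpM2r => //; rewrite le_max lexx.
by rewrite mulrC -ler_pdivlMr// ltW.
Qed.

End UniformLimits.

Section PlaneDot.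
Context {R : realType}.
Implicit Types x y : pt R.

Lemma dot_le x y : `|dot x y| <= 2 * (`|x| * `|y|).
Proof.
rewrite /dot; apply: (le_trans (ler_normD _ _)); rewrite !normrM mulr_natl mulr2n.
by apply: lerD; apply: ler_pM; rewrite ?norm1_le ?norm2_le.
Qed.

Lemma dot_self_ge x : `|x| ^+ 2 <= dot x x.
Proof.
rewrite prod_normE /dot -!expr2; have h1 := sqr_ge0 x.1; have h2 := sqr_ge0 x.2.
rewrite maxEle; case: ifP => _; rewrite real_normK ?num_real//; lra.
Qed.

Lemma dotZr (k : R) x y : dot x (k *: y) = k * dot x y.
Proof. by rewrite /dot !ptE; ring. Qed.

Lemma dotNr x y : dot x (- y) = - dot x y.
Proof. by rewrite /dot !ptE; ring. Qed.

Lemma dotBl x y z : dot (x - y) z = dot x z - dot y z.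
Proof. by rewrite /dot !ptE; ring. Qed.

End PlaneDot.

(** * A cutoff function and minima on annuli *)

Section Cutoff.
Context {R : realType}.
Variables (a : pt R) (rho : R).
Hypothesis rho0 : 0 < rho.

Definition pp (u : R) : R := (u + `|u|) / 2.

Lemma ppE u : pp u = if 0 <= u then u else 0.
Proof.
by rewrite /pp; case: (lerP 0 u) => u0; rewrite ?(ger0_norm u0) ?(ltr0_norm u0); lra.
Qed.

Lemma pp_ge0 u : 0 <= pp u.
Proof. by rewrite ppE; case: ifP. Qed.

Lemma continuous_pp : continuous pp.
Proof.
have cn : continuous (fun u : R => `|u|) by exact: norm_continuous.
by rewrite /pp; ctn.
Qed.

(** This is [min 1 (max 0 (2 - 2 |x - a| / rho))], written with the positive part alone. *)
Definition chi (x : pt R) : R := 1 - pp (1 - pp (2 - 2 / rho * `|x - a|)).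

Lemma chi01 x : 0 <= chi x <= 1.
Proof. by rewrite /chi; have := pp_ge0 (1 - pp (2 - 2 / rho * `|x - a|)); rewrite (ppE (1 - _)); case: ifP => h; have := pp_ge0 (2 - 2 / rho * `|x - a|); lra. Qed.

Lemma chi1 x : `|x - a| <= rho / 2 -> chi x = 1.
Proof.
move=> h; have h2 : 2 / rho * `|x - a| <= 1.
  have e : 2 / rho * (rho / 2) = 1 by field; rewrite gt_eqF.
  rewrite -[leRHS]e.
  by apply: ler_wpM2l => //; rewrite divr_ge0// ltW.
rewrite /chi (ppE (2 - _)) ifT; last by lra.
rewrite ppE; case: ifP => h3; lra.
Qed.

Lemma chi0 x : rho <= `|x - a| -> chi x = 0.
Proof.
move=> h; have h2 : 2 <= 2 / rho * `|x - a|.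
  have e : 2 / rho * rho = 2 by rewrite mulfVK ?gt_eqF.
  rewrite -[leLHS]e; apply: ler_wpM2l => //.
  by rewrite divr_ge0// ltW.
rewrite /chi (ppE (2 - _)); case: ifP => h3; last by rewrite subr0 ppE ler01 subrr.
have -> : 2 - 2 / rho * `|x - a| = 0 by lra.
by rewrite subr0 ppE ler01 subrr.
Qed.

(** At the sphere of radius [rho] the cutoff vanishes linearly in the distance to it, so that a
    short step proportional to [chi] cannot cross the sphere. *)
Lemma chi_le x : `|x - a| <= rho -> chi x <= 2 / rho * (rho - `|x - a|).
Proof.
move=> h; have -> : 2 / rho * (rho - `|x - a|) = 2 - 2 / rho * `|x - a|.
  by field; rewrite gt_eqF.
have h2 : 2 / rho * `|x - a| <= 2.
  have e : 2 / rho * rho = 2 by rewrite mulfVK ?gt_eqF.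
  rewrite -[leRHS]e.
  by apply: ler_wpM2l => //; rewrite divr_ge0// ltW.
rewrite /chi (ppE (2 - _)) ifT; last by lra.
rewrite ppE; case: ifP => h3; lra.
Qed.

Lemma continuous_chi : continuous chi.
Proof.
have cp := continuous_pp.
have cn : continuous (fun x : pt R => `|x - a|).
  by move=> x; apply: cvg_norm; apply: cvgB; [exact: cvg_id|exact: cvg_cst].
rewrite /chi; apply: ctD; first by ctn.
by apply: ctN; apply: (ct_comp cp); apply: ctD; [ctn|apply: ctN; apply: (ct_comp cp); ctn].
Qed.

(** [g] is controlled on the ball only; on the sphere its boundedness and the vanishing of [chi]
    give continuity. *)
Lemma cut_continuous (g : pt R -> pt R) (M : R) :
  (forall x, `|x - a| < rho -> g @ x --> g x) ->
  (forall x, `|x - a| <= rho -> `|g x| <= M) -> continuous (fun x => chi x *: g x).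
Proof.
move=> cg gM x; have [xr|xr] := ltP `|x - a| rho.
  by apply: cvgZ; [exact: continuous_chi|exact: cg].
have M0 : 0 <= M by apply: le_trans (gM a _) => //; rewrite subrr normr0 ltW.
rewrite /continuous_at (chi0 xr) scale0r; apply/cvgrPdist_le => e e0.
have e1 : 0 < e / (M + 1) by rewrite divr_gt0//; lra.
have := @continuous_chi x => /cvgrPdist_le /(_ _ e1); apply: filterS => y.
rewrite (chi0 xr) sub0r normrN sub0r normrN normrZ => h.
have [yr|yr] := leP `|y - a| rho; last by rewrite chi0 ?normr0 ?mul0r ?ltW.
apply: (@le_trans _ _ (e / (M + 1) * M)); first by apply: ler_pM => //; exact: gM.
by rewrite mulrAC ler_pdivrMr; [apply: ler_wpM2l; lra|lra].
Qed.

Lemma annulus_compact (s : R) : compact [set x : pt R | s <= `|x - a| <= rho].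
Proof.
have cn : continuous (fun x : pt R => `|x - a|).
  by move=> x; apply: cvg_norm; apply: cvgB; [exact: cvg_id|exact: cvg_cst].
have cB : compact ([set` `[a.1 - rho, a.1 + rho]] `*` [set` `[a.2 - rho, a.2 + rho]]).
  by apply: compact_setX; exact: segment_compact.
apply: (subclosed_compact _ cB).
  have -> : [set x : pt R | s <= `|x - a| <= rho] =
     [set x | s <= `|x - a|] `&` [set x | `|x - a| <= rho].
    by apply/seteqP; split=> x /=; [move=> /andP[]|move=> [-> ->]].
  apply: closedI.
    by apply: (@closed_comp _ _ (fun x : pt R => `|x - a|) [set y | s <= y]) => [x _|];
      [exact: cn|exact: closed_ge].
  by apply: (@closed_comp _ _ (fun x : pt R => `|x - a|) [set y | y <= rho]) => [x _|];
      [exact: cn|exact: closed_le].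
move=> x /= /andP[_]; rewrite ptnormP !ptE => /andP[].
rewrite !ler_norml !in_itv/= => /andP[? ?] /andP[? ?].
by split; lra.
Qed.

Lemma annulus_min (g : pt R -> pt R) (s : R) :
  (forall x, `|x - a| <= rho -> g @ within [set x | `|x - a| <= rho] (nbhs x) --> g x) ->
  (forall x, s <= `|x - a| <= rho -> g x != 0) ->
  exists2 m : R, 0 < m & forall x, s <= `|x - a| <= rho -> m <= `|g x|.
Proof.
move=> cg g0.
have [ne|] := pselect ([set x : pt R | s <= `|x - a| <= rho] !=set0); last first.
  by move=> h; exists 1 => // x hx; case: h; exists x.
have cng : {within [set x : pt R | s <= `|x - a| <= rho], continuous (fun x => `|g x|)}.
  apply/subspace_continuousP => x /andP[_ hx]; apply: cvg_norm.
  move=> V /(cg x hx); rewrite /= !nbhs_simpl /= /within /=.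
  by apply: filterS => y Hy /andP[_ hy]; exact: Hy.
have [x0 x0s H] := compact_EVT_min ne (@annulus_compact s) cng.
exists `|g x0|; first by rewrite normr_gt0; apply: g0; rewrite inE in x0s.
by move=> x hx; apply: H; rewrite inE.
Qed.

End Cutoff.

Lemma sqr_le {R : realType} (x y : R) : 0 <= x -> x <= y -> x ^+ 2 <= y ^+ 2.
Proof. by move=> x0 xy; apply: lerXn2r; rewrite ?nnegrE//; exact: le_trans xy. Qed.

(** * Retraction of a neighbourhood of the critical point onto the sublevel set *)

Section Retraction.
Context {R : realType}.
Variables (h : pt R -> R) (f : pt R -> pt R) (a : pt R) (rho L : R).
Hypotheses (rho0 : 0 < rho) (L0 : 0 < L).
Hypothesis hT : forall x y, `|x - a| <= rho -> `|y - a| <= rho ->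
  `|h y - h x - dot (f x) (y - x)| <= L * `|y - x| ^+ 2.
Hypothesis fL : forall x y, `|x - a| <= rho -> `|y - a| <= rho ->
  `|f y - f x| <= L * `|y - x|.
Hypotheses (ha : h a = 0) (fa : f a = 0).
Hypothesis fn0 : forall x, `|x - a| <= rho -> x != a -> f x != 0.

Let aB : `|a - a| <= rho. Proof. by rewrite subrr normr0 ltW. Qed.

Lemma f_bound x : `|x - a| <= rho -> `|f x| <= L * `|x - a|.
Proof. by move=> xB; have := fL aB xB; rewrite fa subr0. Qed.

Lemma h_bound x : `|x - a| <= rho -> `|h x| <= L * `|x - a| ^+ 2.
Proof.
move=> xB; have := hT aB xB; rewrite fa ha subr0.
by rewrite (_ : dot 0 _ = 0) ?subr0// /dot/= !mul0r addr0.
Qed.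

Lemma h_lip x y : `|x - a| <= rho -> `|y - a| <= rho ->
  `|h y - h x| <= 4 * L * rho * `|y - x|.
Proof.
move=> xB yB; have := hT xB yB; set q := dot _ _ => H.
have q1 : `|q| <= 2 * (L * rho * `|y - x|).
  apply: (le_trans (dot_le _ _)); apply: ler_wpM2l => //; apply: ler_wpM2r => //.
  by apply: (le_trans (f_bound xB)); apply: ler_wpM2l => //; exact: ltW.
have d1 : `|y - x| <= 2 * rho.
  rewrite (_ : y - x = (y - a) - (x - a)); last by apply: pt_eq; rewrite !ptE; ring.
  by apply: (le_trans (ler_normB _ _)); lra.
have d2 : L * `|y - x| ^+ 2 <= L * (2 * rho * `|y - x|).
  by apply: ler_wpM2l; [exact: ltW|rewrite expr2; apply: ler_wpM2r].
rewrite (_ : h y - h x = (h y - h x - q) + q); last by rewrite subrK.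
apply: (le_trans (ler_normD _ _)); lra.
Qed.

Let near_ball x : `|x - a| < rho -> exists2 e : R, 0 < e & forall y, `|y - x| < e -> `|y - a| <= rho.
Proof.
move=> xr; exists (rho - `|x - a|); first by rewrite subr_gt0.
move=> y hy; rewrite (_ : y - a = (y - x) + (x - a)); last by rewrite addrA subrK.
by apply: (le_trans (ler_normD _ _)); lra.
Qed.

Lemma h_cvg x : `|x - a| < rho -> h @ x --> h x.
Proof.
move=> xr; have [e e0 H] := near_ball xr.
by apply: (@lip_cvg _ _ _ h x e (4 * L * rho) e0) => y /H yB; apply: h_lip => //; exact: ltW.
Qed.

Lemma f_cvg x : `|x - a| < rho -> f @ x --> f x.
Proof.
move=> xr; have [e e0 H] := near_ball xr.
by apply: (@lip_cvg _ _ _ f x e L e0) => y /H yB; apply: fL => //; exact: ltW.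
Qed.

Lemma f_min (s : R) : 0 < s ->
  exists2 m : R, 0 < m & forall x, s <= `|x - a| <= rho -> m <= `|f x|.
Proof.
move=> s0; apply: annulus_min => [x xB|x /andP[sx xB]]; last first.
  apply: fn0 => //; apply/eqP => e; move: sx; rewrite e subrr normr0; lra.
apply/cvgrPdist_le => e e0; rewrite near_withinE.
have d0 : 0 < e / L by rewrite divr_gt0.
have := nbhsx_ballx x _ d0; apply: filterS => y; rewrite -ball_normE/= => hy yB.
apply: (le_trans (fL yB xB)).
by rewrite mulrC -ler_pdivlMr// ltW.
Qed.

(* [Sf] is a damped Newton step for [h = 0] along the gradient [f]; it does not move the points of
   [h <= 0], and its iterates retract a neighbourhood of [a] in [h <= h0] onto [h <= 0]. *)
Definition Qf x : R := dot (f x) (f x).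
Definition Tf x : R := pp (h x) / (2 * (Qf x + L * pp (h x))).
Definition Sf x : pt R := x - chi a rho x *: (Tf x *: f x).

Lemma Qf_ge x : `|f x| ^+ 2 <= Qf x. Proof. exact: dot_self_ge. Qed.
Lemma Qf_ge0 x : 0 <= Qf x. Proof. by apply: le_trans (Qf_ge x); exact: exprn_ge0. Qed.

Lemma Qf_gt0 x : `|x - a| <= rho -> x != a -> 0 < Qf x.
Proof.
by move=> xB xa; apply: lt_le_trans (Qf_ge x); rewrite exprn_gt0// normr_gt0 fn0.
Qed.

Lemma Tf_ge0 x : 0 <= Tf x.
Proof.
by rewrite /Tf divr_ge0 ?pp_ge0// mulr_ge0// addr_ge0 ?Qf_ge0// mulr_ge0 ?pp_ge0// ltW.
Qed.

(** The reason for the summand [L * pp (h x)] in the denominator of [Tf]: with this bound the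
    quadratic remainder of [h] along a step is at most half of its linear decrease. *)
Lemma Tf_L x : L * Tf x <= 1 / 2.
Proof.
have h0 := pp_ge0 (h x); have q0 := Qf_ge0 x.
have [e|p] := eqVneq (2 * (Qf x + L * pp (h x))) 0; first by rewrite /Tf e invr0 !mulr0.
have lh : 0 <= L * pp (h x) by rewrite mulr_ge0// ltW.
have p0 : 0 < 2 * (Qf x + L * pp (h x)) by rewrite lt_neqAle eq_sym p/=; lra.
by rewrite /Tf mulrA ler_pdivrMr//; lra.
Qed.

Lemma Tf_Q x : Tf x * Qf x <= pp (h x) / 2.
Proof.
have h0 := pp_ge0 (h x); have q0 := Qf_ge0 x.
have [e|p] := eqVneq (2 * (Qf x + L * pp (h x))) 0.
  by rewrite /Tf e invr0 mulr0 mul0r; lra.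
have lh : 0 <= L * pp (h x) by rewrite mulr_ge0// ltW.
have p0 : 0 < 2 * (Qf x + L * pp (h x)) by rewrite lt_neqAle eq_sym p/=; lra.
rewrite /Tf mulrAC ler_pdivrMr//.
have -> : pp (h x) / 2 * (2 * (Qf x + L * pp (h x))) = pp (h x) * (Qf x + L * pp (h x)) by field.
by apply: ler_wpM2l => //; lra.
Qed.

Lemma Tf_id x : h x <= 0 -> Tf x = 0.
Proof.
move=> hx; rewrite /Tf ppE; case: ifP => hx0; last by rewrite mul0r.
by rewrite (_ : h x = 0) ?mul0r//; apply/eqP; rewrite eq_le hx hx0.
Qed.

Lemma Sf_id x : h x <= 0 -> Sf x = x.
Proof. by move=> hx; rewrite /Sf Tf_id// scale0r scaler0 subr0. Qed.

Lemma Tf_f x : `|x - a| <= rho -> `|Tf x *: f x| <= `|x - a| / 2.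
Proof.
move=> xB; rewrite normrZ ger0_norm ?Tf_ge0//.
apply: (@le_trans _ _ (Tf x * (L * `|x - a|))).
  by apply: ler_wpM2l; [exact: Tf_ge0|exact: f_bound].
have -> : Tf x * (L * `|x - a|) = (L * Tf x) * `|x - a| by ring.
have -> : `|x - a| / 2 = 1 / 2 * `|x - a| by ring.
by apply: ler_wpM2r => //; exact: Tf_L.
Qed.

(** The linear decrease is [Tf x * Qf x], at most [h x / 2], and the remainder is at most half of
    it, so [h] decreases but stays positive. The third bound compares the decrease with the distance
    travelled; the fourth drives [h] to 0. *)
Lemma Sf_step x : `|x - a| <= rho / 2 -> 0 < h x ->
  [/\ 0 < h (Sf x), `|Sf x - a| <= 2 * `|x - a|,
      h (Sf x) <= h x - `|f x| * `|Sf x - x| / 2 &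
      h (Sf x) <= h x - Tf x * Qf x / 2].
Proof.
have rp := rho0; move=> xr hx; have xB : `|x - a| <= rho by lra.
have E : Sf x = x - Tf x *: f x by rewrite /Sf chi1// scale1r.
have tf := Tf_f xB; have t0 := Tf_ge0 x; have tl := Tf_L x; have tq := Tf_Q x; have q0 := Qf_ge0 x.
have n0 : 0 <= `|x - a| by [].
have ya : `|Sf x - a| <= 2 * `|x - a|.
  rewrite E (_ : x - _ - a = (x - a) - Tf x *: f x); last by rewrite addrAC.
  by apply: (le_trans (ler_normB _ _)); lra.
have yB : `|Sf x - a| <= rho by lra.
have := hT xB yB.
have yx : Sf x - x = - (Tf x *: f x) by rewrite E addrAC subrr add0r.
rewrite yx dotNr dotZr -/(Qf x) normrN normrZ ger0_norm//.
have q2 : L * (Tf x * `|f x|) ^+ 2 <= Tf x * Qf x / 2.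
  rewrite exprMn.
  apply: (@le_trans _ _ (L * (Tf x ^+ 2 * Qf x))).
    by apply: ler_wpM2l; [exact: ltW|apply: ler_wpM2l; [exact: exprn_ge0|exact: Qf_ge]].
  have -> : L * (Tf x ^+ 2 * Qf x) = (L * Tf x) * (Tf x * Qf x) by ring.
  have -> : Tf x * Qf x / 2 = (1 / 2) * (Tf x * Qf x) by ring.
  by apply: ler_wpM2r => //; rewrite mulr_ge0.
rewrite ler_norml => /andP[hlo hhi].
have pph : pp (h x) = h x by rewrite ppE ltW.
rewrite pph in tq.
have key : h (Sf x) <= h x - Tf x * Qf x / 2 by lra.
split=> //; first by lra.
apply: (le_trans key); rewrite lerD2l lerN2.
have -> : `|f x| * (Tf x * `|f x|) / 2 = Tf x * `|f x| ^+ 2 / 2 by ring.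
by apply: ler_wpM2r; [rewrite invr_ge0|apply: ler_wpM2l => //; exact: Qf_ge].
Qed.

Lemma Sf_continuous : continuous Sf.
Proof.
have rp := rho0.
have cg : continuous (fun x => chi a rho x *: (Tf x *: f x)).
  apply: (@cut_continuous _ _ _ rho0 _ (rho / 2)) => [x xr|x xB]; last first.
    by apply: (le_trans (Tf_f xB)); lra.
  (* At [a] the denominator of [Tf] is 0; continuity there comes from the bound of the step by
     [|x - a| / 2]. *)
  have [->|xa] := eqVneq x a.
    apply: (@lip_cvg _ _ _ _ a rho (1 / 2) rho0) => y yr.
    by rewrite fa scaler0 subr0; apply: (le_trans (Tf_f (ltW yr))); lra.
  apply: cvgZ; last exact: f_cvg.
  have cp : pp (h y) @[y --> x] --> pp (h x).
    by apply: continuous_comp; [exact: h_cvg|exact: continuous_pp].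
  have f1 : (f y).1 @[y --> x] --> (f x).1.
    by apply: (cvg_comp _ _ (f_cvg xr)); exact: cvg_fst.
  have f2 : (f y).2 @[y --> x] --> (f x).2.
    by apply: (cvg_comp _ _ (f_cvg xr)); exact: cvg_snd.
  apply: cvgM => //; apply: cvgV; last first.
    apply: cvgM; [exact: cvg_cst|apply: cvgD]; last by apply: cvgM; [exact: cvg_cst|].
    by apply: cvgD; apply: cvgM.
  have Q0 := Qf_gt0 (ltW xr) xa.
  have l0 : 0 <= L * pp (h x) by rewrite mulr_ge0 ?pp_ge0// ltW.
  by rewrite gt_eqF//; lra.
move=> x; apply: cvgB; [exact: cvg_id|exact: cg].
Qed.

Lemma iter_Sf_continuous n : continuous (iter n Sf).
Proof.
elim: n => [|n IH]; first exact: ct_id.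
by move=> x; apply: continuous_comp; [exact: IH|exact: Sf_continuous].
Qed.

(** Where [|x - a| >= s] the gradient has a lower bound [m], so a step lowers [h] by at least
    [m / 2] times its length: [pp h] plus [m / 2] times the distance travelled cannot grow there.
    This confines the orbits and makes the iterates uniformly Cauchy, the ball of radius [s]
    contributing only [O(s)]. *)
Lemma retraction : exists2 h0 : R, 0 < h0 & exists ret : pt R -> pt R,
  let V := [set x : pt R | `|x - a| <= rho / 4 /\ h x <= h0] in
  [/\ forall x, V x -> `|ret x - a| <= rho / 2 /\ h (ret x) <= 0,
      forall x, V x -> h x <= 0 -> ret x = x &
      forall x, V x -> ret @ within V (nbhs x) --> ret x].
Proof.
have rp := rho0; have Lp := L0.
have r8 : 0 < rho / 8 by lra.
have [m m0 Hm] := f_min r8.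
pose c := m / 2; have c0 : 0 < c by rewrite /c; lra.
(* With this budget an orbit starting within [rho / 4] can move away from [a] by [rho / 8] more, and
   stays within [rho / 2], where the cutoff is 1. *)
pose h0 := c * (rho / 8); have h00 : 0 < h0 by rewrite /h0 mulr_gt0.
exists h0 => //.
pose Inv x := h x <= h0 /\ pp (h x) + c * `|x - a| <= h0 + c * (rho / 4).
have Invr x : Inv x -> `|x - a| <= rho / 2.
  move=> [_ H]; have p0 := pp_ge0 (h x).
  have : c * `|x - a| <= c * (rho / 2).
    by apply: (le_trans _ (_ : h0 + c * (rho / 4) <= _)); [lra|rewrite /h0 -mulrDr; apply: ler_wpM2l; lra].
  by rewrite ler_pM2l.
have ppos x : 0 < h x -> pp (h x) = h x by move=> hx; rewrite ppE ltW.
have InvS x : Inv x -> Inv (Sf x).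
  move=> Ix; have xr := Invr _ Ix; case: (leP (h x) 0) => hx; first by rewrite Sf_id.
  have [hy ya hd _] := Sf_step xr hx; case: Ix => H1 H2.
  have s0 : 0 <= `|f x| * `|Sf x - x| / 2 by rewrite divr_ge0// mulr_ge0.
  split; first by lra.
  rewrite ppos//; rewrite ppos// in H2.
  have [xd|xd] := leP (rho / 8) `|x - a|.
    have : m <= `|f x| by apply: Hm; rewrite xd; lra.
    move=> mf; have md : c * `|Sf x - x| <= `|f x| * `|Sf x - x| / 2.
      by rewrite /c mulrAC; apply: ler_wpM2r => //; apply: ler_wpM2r.
    have tr : c * `|Sf x - a| <= c * (`|Sf x - x| + `|x - a|).
      apply: ler_wpM2l; first exact: ltW.
      by rewrite (_ : Sf x - a = (Sf x - x) + (x - a)) ?ler_normD// addrA subrK.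
    rewrite mulrDr in tr; lra.
  have : c * `|Sf x - a| <= c * (rho / 4) by apply: ler_wpM2l; [exact: ltW|lra].
  lra.
have InvI n x : Inv x -> Inv (iter n Sf x) by move=> Ix; elim: n => //= n; exact: InvS.
have mono x : Inv x -> pp (h (Sf x)) <= pp (h x).
  move=> Ix; case: (leP (h x) 0) => hx; first by rewrite Sf_id.
  have [hy ya hd _] := Sf_step (Invr _ Ix) hx.
  have s0 : 0 <= `|f x| * `|Sf x - x| / 2 by rewrite divr_ge0// mulr_ge0.
  rewrite !ppos//; lra.
have decay (k : R) : 0 < k -> exists n0, forall x, Inv x -> forall n, (n0 <= n)%N ->
    pp (h (iter n Sf x)) <= k.
  move=> k0.
  pose s := Num.min 1 (k / (2 * L)).
  have kL : 0 < k / (2 * L) by rewrite divr_gt0// mulr_gt0.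
  have s0 : 0 < s by rewrite /s lt_min ltr01.
  have Ls : L * s ^+ 2 < k.
    have s1 : s <= 1 by rewrite /s ge_min lexx.
    have s2 : s <= k / (2 * L) by rewrite /s ge_min lexx orbT.
    apply: (@le_lt_trans _ _ (L * (k / (2 * L)))); last first.
      have -> : L * (k / (2 * L)) = k / 2 by field; rewrite gt_eqF.
      lra.
    apply: ler_wpM2l; first exact: ltW.
    by apply: le_trans s2; rewrite expr2 ger_pMl.
  have [m' m0' Hm'] := f_min s0.
  (* The guaranteed decrease [Tf x * Qf x / 2] at [h x = k] and [Qf x = m' ^+ 2]; it increases with
     both. While [h x > k], the bound [h x <= L |x - a|^2] keeps [x] away from [a]. *)
  pose d := (4 * (k^-1 + L / m' ^+ 2))^-1.
  have m20 : 0 < m' ^+ 2 by rewrite exprn_gt0.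
  have D0 : 0 < k^-1 + L / m' ^+ 2 by rewrite addr_gt0 ?invr_gt0// divr_gt0.
  have d0 : 0 < d by rewrite invr_gt0 mulr_gt0.
  have dec x : Inv x -> k < h x -> pp (h (Sf x)) <= pp (h x) - d.
    move=> Ix hk; have hx : 0 < h x by lra.
    have xr := Invr _ Ix; have xB : `|x - a| <= rho by lra.
    have [hy _ _ hd] := Sf_step xr hx; rewrite !ppos//; apply: (le_trans hd).
    rewrite lerD2l lerN2.
    have sx : s <= `|x - a|.
      rewrite leNgt; apply/negP => xs.
      have := h_bound xB; have := ler_norm (h x).
      have : `|x - a| ^+ 2 <= s ^+ 2 by apply: sqr_le => //; exact: ltW.
      move=> /(ler_wpM2l (ltW L0)); lra.
    have mf : m' <= `|f x| by apply: Hm'; rewrite sx.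
    have mQ : m' ^+ 2 <= Qf x.
      by apply: le_trans (Qf_ge x); apply: sqr_le => //; exact: ltW.
    have Q0 : 0 < Qf x by exact: lt_le_trans mQ.
    have -> : Tf x * Qf x / 2 = (4 * ((h x)^-1 + L / Qf x))^-1.
      by rewrite /Tf ppos//; field; rewrite ?gt_eqF//= addr_gt0// mulr_gt0.
    rewrite /d lef_pV2 ?posrE ?mulr_gt0//; last by rewrite addr_gt0 ?invr_gt0// divr_gt0.
    apply: ler_wpM2l => //; apply: lerD; first by rewrite lef_pV2 ?posrE// ltW.
    by apply: ler_wpM2l; [exact: ltW|rewrite lef_pV2 ?posrE].
  have ind x n : Inv x -> pp (h (iter n Sf x)) <= Num.max k (h0 - n%:R * d).
    move=> Ix; elim: n => [|n IH].
      rewrite mul0r subr0 le_max; apply/orP; right.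
      by rewrite ppE/=; case: ifP => _; [exact: Ix.1|exact: ltW].
    have In := InvI n _ Ix; rewrite iterS; have [hk|hk] := leP (h (iter n Sf x)) k.
      apply: (le_trans (mono _ In)); rewrite le_max; apply/orP; left.
      by rewrite ppE; case: ifP => _ //; exact: ltW.
    apply: (le_trans (dec _ In hk)); move: IH; rewrite ppos//; last by lra.
    rewrite !le_max => /orP[|IH]; first by lra.
    by apply/orP; right; rewrite -natr1 mulrDl mul1r; lra.
  exists (Num.bound (h0 / d)) => x Ix n nn; apply: (le_trans (ind x n Ix)).
  rewrite ge_max lexx/=.
  have : h0 / d < n%:R.
    apply: lt_le_trans (archi_boundP _) _; first by rewrite divr_ge0// ltW.
    by rewrite ler_nat.
  by rewrite ltr_pdivrMr//; lra.
have [e e0|l Hl] := @uniform_cauchy R (pt R) Inv (fun n => iter n Sf).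
  pose s := e / 6; have s0 : 0 < s by rewrite /s; lra.
  have [m' m0' Hm'] := f_min s0; pose c' := m' / 2; have c0' : 0 < c' by rewrite /c'; lra.
  have [n0 Hn0] := decay (c' * s) (mulr_gt0 c0' s0).
  exists n0 => x Ix n nn p; rewrite addnC iterD; set y := iter n Sf x.
  have Iy : Inv y by exact: InvI.
  have hy : pp (h y) <= c' * s by exact: Hn0.
  (* Either the distance from [y] has been paid for by the decrease of [h], or the orbit has come
     within [s] of [a], and then [y] and [z] are both within [3 s] of [a]. In each case
     [|z - y| <= 6 s = e]. *)
  pose Z z := pp (h z) <= c' * s /\ (pp (h z) + c' * `|z - y| <= c' * s \/
    (`|y - a| <= 3 * s /\ pp (h z) + c' * `|z - a| <= 3 * (c' * s))).
  have HZ : Z (iter p Sf y).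
    elim: p => [|p IH] /=; first by split=> //; left; rewrite subrr normr0 mulr0 addr0.
    have := InvI p _ Iy; move: (iter p Sf y) IH => z [hz Zz] Iz.
    case: (leP (h z) 0) => h0z; first by rewrite Sf_id.
    have mz := mono _ Iz; have zr := Invr _ Iz.
    split; first by apply: le_trans hz.
    have [hz' za hd _] := Sf_step zr h0z.
    have [zs|zs] := leP s `|z - a|.
      have mf : m' <= `|f z| by apply: Hm'; rewrite zs; lra.
      have md : c' * `|Sf z - z| <= `|f z| * `|Sf z - z| / 2.
        by rewrite /c' mulrAC; apply: ler_wpM2r => //; apply: ler_wpM2r.
      have tr w : c' * `|Sf z - w| <= c' * `|Sf z - z| + c' * `|z - w|.
        rewrite -mulrDr; apply: ler_wpM2l; first exact: ltW.
        by rewrite (_ : Sf z - w = (Sf z - z) + (z - w)) ?ler_normD// addrA subrK.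
      rewrite ppos// in Zz; rewrite ppos//.
      case: Zz => [Z1|[Z1 Z2]]; [left|right; split=> //].
        by have := tr y; lra.
      by have := tr a; lra.
    right.
    have k1 : c' * `|Sf z - a| <= c' * (2 * s) by apply: ler_wpM2l; [exact: ltW|lra].
    have p0 := pp_ge0 (h z).
    split; last by lra.
    case: Zz => [Z1|[]//].
    have : c' * `|z - y| <= c' * s by lra.
    rewrite ler_pM2l// => zy.
    rewrite (_ : y - a = (z - a) - (z - y)); last by apply: pt_eq; rewrite !ptE; ring.
    by apply: (le_trans (ler_normB _ _)); lra.
  have p0 := pp_ge0 (h (iter p Sf y)).
  case: HZ => _ [Z1|[Z1 Z2]].
    have : c' * `|iter p Sf y - y| <= c' * s by lra.
    by rewrite ler_pM2l// /s; lra.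
  have : c' * `|iter p Sf y - a| <= c' * (3 * s) by lra.
  rewrite ler_pM2l// => Z3.
  rewrite (_ : _ - y = (iter p Sf y - a) - (y - a)); last by apply: pt_eq; rewrite !ptE; ring.
  by apply: (le_trans (ler_normB _ _)); move: Z3 Z1; rewrite /s; lra.
have VInv x : `|x - a| <= rho / 4 -> h x <= h0 -> Inv x.
  move=> xr hx; split=> //; apply: lerD; last by apply: ler_wpM2l => //; exact: ltW.
  by rewrite ppE; case: ifP => _ //; exact: ltW.
have lid x : Inv x -> h x <= 0 -> l x = x.
  move=> Ix hx; apply/eqP; rewrite -subr_eq0 -normr_le0; apply/ler_addgt0Pr => e e0.
  have [n0 H] := Hl e e0; have := H x Ix n0 (leqnn _); rewrite add0r.
  suff -> : iter n0 Sf x = x by [].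
  by elim: (n0) => //= n ->; rewrite Sf_id.
have lr x : Inv x -> `|l x - a| <= rho / 2.
  move=> Ix; apply/ler_addgt0Pr => e e0; have [n0 H] := Hl e e0.
  have h1 := H x Ix n0 (leqnn _); have h2 := Invr _ (InvI n0 _ Ix).
  rewrite (_ : l x - a = (l x - iter n0 Sf x) + (iter n0 Sf x - a)); last by rewrite addrA subrK.
  by apply: (le_trans (ler_normD _ _)); lra.
exists l; split=> [x [xr hx]|x [xr hx] hx0|x [xr hx]].
- have Ix := VInv _ xr hx; split; first exact: lr.
  apply/ler_addgt0Pr => e e0; rewrite add0r.
  pose e' := e / (2 * (4 * L * rho + 1)).
  have q0 : 0 < 4 * L * rho by rewrite !mulr_gt0.
  have e0' : 0 < e' by rewrite divr_gt0//; lra.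
  have e2 : 0 < e / 2 by lra.
  have [n1 H1] := Hl e' e0'; have [n2 H2] := decay (e / 2) e2.
  pose n := maxn n1 n2.
  have h1 := H1 x Ix n (leq_maxl _ _); have h2 := H2 x Ix n (leq_maxr _ _).
  have := @h_lip (iter n Sf x) (l x).
  have b1 := Invr _ (InvI n _ Ix); have b2 := lr _ Ix.
  move=> /(_ ltac:(lra) ltac:(lra)); rewrite ler_norml => /andP[_ h3].
  have h4 : h (iter n Sf x) <= pp (h (iter n Sf x)).
    by rewrite ppE; case: ifP => // /negbT; rewrite -ltNge => /ltW.
  have h5 : 4 * L * rho * `|l x - iter n Sf x| <= 4 * L * rho * e'.
    by apply: ler_wpM2l => //; exact: ltW.
  have h6 : 4 * L * rho * e' <= e / 2.
    rewrite /e' mulrA ler_pdivrMr; last by lra.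
    have : 0 <= e * (4 * L * rho) by rewrite mulr_ge0 ?ltW.
    lra.
  lra.
- by apply: lid => //; exact: VInv.
- apply: (@uniform_limit_within _ _ _ (fun n => iter n Sf)).
  + move=> e e0; have [n0 H] := Hl e e0; exists n0 => z [zr hz] n nn.
    by apply: H => //; exact: VInv.
  + by move=> n; apply: cvg_withinW; exact: iter_Sf_continuous.
  + by [].
Qed.

End Retraction.

(** * Invariants of the discrete descent *)

Section Dynamics.
Context {R : realType}.
Variables (h ph : pt R -> R) (a : pt R) (rho de k eps d : R) (St : R -> pt R -> pt R).
Hypotheses (de0 : 0 < de) (de2 : de <= rho / 32) (k0 : 0 < k) (eps0 : 0 < eps)
  (eps1 : 4 * eps <= k * de) (d0 : 0 < d) (ha : h a = 0).
Hypothesis hle : forall x, `|x - a| < rho -> h x <= ph x + eps /\ ph x <= h x + eps.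
Hypothesis step : forall t x, 0 <= t <= 1 -> `|x - a| < rho ->
  [/\ `|St t x - a| < rho, `|St t x - x| <= de, ph (St t x) <= ph x,
      de <= `|x - a| -> h (St t x) <= h x - k * `|St t x - x| &
      t = 1 -> `|x - a| <= rho / 2 -> ph (St t x) <= ph x - d].

Lemma tri3 (x y z : pt R) : `|y - z| <= `|y - x| + `|x - z|.
Proof. by rewrite (_ : y - z = (y - x) + (x - z)) ?ler_normD// addrA subrK. Qed.

Lemma inb t x j : 0 <= t <= 1 -> `|x - a| < rho -> `|iter j (St t) x - a| < rho.
Proof. by move=> t01 xr; elim: j => //= j IH; have [] := step t01 IH. Qed.

(* Invariant of the descent from [h <= 0]: a point can reach [h > 0] only by passing near [a], and
   then the decrease of [h] along the steps bounds its distance to [a]. *)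
Definition I1 x := h x <= 0 \/ (ph x <= eps /\ h x + k * `|x - a| <= 2 * eps + 2 * (k * de)).

Lemma I1S t x j : 0 <= t <= 1 -> `|x - a| < rho -> h x <= 0 -> I1 (iter j (St t) x).
Proof.
move=> t01 xr hx; elim: j => [|j IH]; first by left.
have yr := inb j t01 xr; move: IH yr; rewrite iterS; move: (iter j (St t) x) => y Iy yr.
have [y'r s1 s2 s3 _] := step t01 yr; have kp := k0; have dp := de0.
have [hy1 hy2] := hle yr; have [hy1' hy2'] := hle y'r.
have [yd|yd] := leP de `|y - a|.
  have kt : k * `|St t y - a| <= k * (`|St t y - y| + `|y - a|).
    by apply: ler_wpM2l; [exact: ltW|exact: tri3].
  rewrite mulrDr in kt.
  have ks : 0 <= k * `|St t y - y| by rewrite mulr_ge0// ltW.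
  have := s3 yd; case: Iy => [Iy|[Iy1 Iy2]] s3'; first by left; slra.
  by right; split; slra.
right; have py : ph y <= eps by case: Iy => [|[]//]; slra.
split; first by slra.
have : k * `|St t y - a| <= k * (2 * de).
  by apply: ler_wpM2l; [exact: ltW|have := tri3 y (St t y) a; slra].
slra.
Qed.

Lemma I1P x : I1 x -> `|x - a| < rho -> h x <= 2 * eps /\ (0 < h x -> `|x - a| < rho / 8).
Proof.
move=> Ix xr; have [h1 h2] := hle xr; have ep := eps0; have dr := de2; have dp := de0; have e1 := eps1.
split; first by case: Ix => [|[]]; slra.
move=> hx; case: Ix => [|[_ H]]; first by slra.
have : k * `|x - a| < k * (3 * de) by slra.
rewrite ltr_pM2l//; slra.
Qed.

(* Invariant of the descent from the boundary of the cycle: the orbit never meets [a]. *)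
Definition Jst x :=
  [/\ de <= `|x - a|, h x <= 0 & h x <= k * (`|x - a| - 2 * de)] \/ ph x <= - (2 * eps).

Lemma JS t x j : 0 <= t <= 1 -> `|x - a| < rho -> Jst x -> Jst (iter j (St t) x).
Proof.
move=> t01 xr Jx; elim: j => [//|j IH].
have yr := inb j t01 xr; move: IH yr; rewrite iterS; move: (iter j (St t) x) => y Jy yr.
have [y'r s1 s2 s3 _] := step t01 yr; have ep := eps0; have e1 := eps1.
have [hy1' hy2'] := hle y'r.
case: Jy => [[yd hy0 hyk]|]; last by right; slra.
have := s3 yd => s3'.
have ks : 0 <= k * `|St t y - y| by rewrite mulr_ge0// ltW.
have kt : k * `|y - a| <= k * (`|St t y - y| + `|St t y - a|).
  apply: ler_wpM2l; first exact: ltW.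
  by rewrite (distrC (St t y) y); exact: tri3.
rewrite mulrDr in kt; rewrite mulrBr in hyk.
have [y'd|y'd] := leP de `|St t y - a|.
  by left; split=> //; [slra|rewrite mulrBr; slra].
right; have : k * `|St t y - a| <= k * de by apply: ler_wpM2l; exact: ltW.
slra.
Qed.

Lemma JP x : Jst x -> `|x - a| < rho -> h x <= 0 /\ x != a.
Proof.
have ep := eps0; have dp := de0.
move=> [[xd hx _]|px] xr.
  by split=> //; apply/eqP => e; move: xd; rewrite e subrr normr0; slra.
have [h1 h2] := hle xr; split; first by slra.
by apply/eqP => e; move: h1 px; rewrite e ha; slra.
Qed.

Lemma Jfar x : h x <= 0 -> 2 * de <= `|x - a| -> Jst x.
Proof.
have dp := de0; move=> hx xd; left; split=> //; first by slra.
by apply: (le_trans hx); rewrite mulr_ge0 ?subr_ge0// ltW.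
Qed.

(** From a start within [2 * de] of [a], [ph] drops by [d] per step while the orbit stays within
    [rho / 2]. If it leaves that ball, [I1P] gives [h <= 0] far from [a], hence [Jst]; otherwise [n]
    steps bring [ph] from at most [eps] down to at most [- 2 * eps]. *)
Lemma Jfin n x : 3 * eps <= n%:R * d -> `|x - a| < rho -> h x <= 0 -> Jst (iter n (St 1) x).
Proof.
move=> nd xr hx; have dp := de0; have dr := de2; have ep := eps0; have e1 := eps1; have dd := d0.
have t01 : 0 <= (1 : R) <= 1 by rewrite ler01 lexx.
have [xd|xd] := leP (2 * de) `|x - a|.
  by apply: JS => //; exact: Jfar.
have Lk j : Jst (iter j (St 1) x) \/
    (ph (iter j (St 1) x) <= eps - j%:R * d /\ `|iter j (St 1) x - a| <= rho / 2).
  elim: j => [|j IH].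
    by right; rewrite mul0r subr0 /=; split; [have [] := hle xr; slra|slra].
  have yr := inb j t01 xr; have yr' := inb j.+1 t01 xr.
  have Iy' := I1S j.+1 t01 xr hx.
  case: IH => [Jy|[py yr2]]; first by left; exact: (@JS 1 _ 1%N t01 yr Jy).
  have [_ s1 s2 s3 s4] := step t01 yr.
  have s4' := s4 erefl yr2.
  rewrite iterS in yr' Iy' *.
  have [hy1' hy2'] := hle yr'.
  have jd : 0 <= j%:R * d by rewrite mulr_ge0// ltW.
  have [y2|y2] := leP `|St 1 (iter j (St 1) x) - a| (rho / 2).
    by right; split=> //; rewrite -natr1 mulrDl mul1r; slra.
  left; left; have [_ Ip] := I1P Iy' yr'.
  have hy' : h (St 1 (iter j (St 1) x)) <= 0.
    by rewrite leNgt; apply/negP => /Ip; slra.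
  split=> //; first by slra.
  apply: (le_trans hy'); rewrite mulr_ge0 ?ltW//; slra.
by case: (Lk n) => // -[pn _]; right; slra.
Qed.

End Dynamics.

(** One explicit descent step along [F], cut off near the sphere. The step is short enough for the
    quadratic remainders of [h] and [ph] to be dominated; [8 * eps <= m] makes [F] a descent
    direction for [h] too, wherever [|f| >= m], and [be * M <= rho / 8] with [chi_le] keeps the step
    inside the ball. *)
Lemma descent_step {R : realType} (h ph : pt R -> R) (f F : pt R -> pt R) (a : pt R)
    (rho L C M m mt eps be de : R) (t : R) (x : pt R) :
  0 < rho -> 0 < L -> 0 <= C -> 0 < M -> 0 < m -> 0 < mt -> 0 < be ->
  (forall x y, `|x - a| <= rho -> `|y - a| <= rho ->
    `|h y - h x - dot (f x) (y - x)| <= L * `|y - x| ^+ 2) ->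
  (forall x y, `|x - a| <= rho -> `|y - a| <= rho ->
    `|ph y - ph x - dot (F x) (y - x)| <= C * `|y - x| ^+ 2) ->
  (de <= `|x - a| -> m <= `|f x|) -> mt <= `|F x| <= M -> `|F x - f x| <= eps ->
  8 * eps <= m -> C * be <= 1 / 2 -> L * (be * M) <= m / 4 -> be * M <= de -> be * M <= rho / 8 ->
  0 <= t <= 1 -> `|x - a| < rho ->
  let y := x - (t * be) *: (chi a rho x *: F x) in
  [/\ `|y - a| < rho, `|y - x| <= de, ph y <= ph x,
      de <= `|x - a| -> h y <= h x - m / 4 * `|y - x| &
      t = 1 -> `|x - a| <= rho / 2 -> ph y <= ph x - be * mt ^+ 2 / 2].
Proof.
move=> rp Lp C0 M0 m0 mt0 be0 hT phT Hm /andP[Hmt FMx] Ff eps3 be1 be2 be3 be4 /andP[t0 t1] xr y.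
have xB := ltW xr.
pose q := t * be * chi a rho x.
have /andP[ch0 ch1] := chi01 a rho x.
have tb : t * be <= be by rewrite -[leRHS]mul1r; apply: ler_wpM2r => //; exact: ltW.
have tb0 : 0 <= t * be by rewrite mulr_ge0// ltW.
have q0 : 0 <= q by rewrite mulr_ge0.
have qb : q <= be by apply: le_trans tb; rewrite -[leRHS]mulr1; apply: ler_wpM2l.
have E : y = x - q *: F x by rewrite /y scalerA.
have yx : y - x = - (q *: F x) by rewrite E addrAC subrr add0r.
have nyx : `|y - x| = q * `|F x| by rewrite yx normrN normrZ ger0_norm.
have qF : q * `|F x| <= be * M by apply: ler_pM.
have qF2 : q * `|F x| <= (rho - `|x - a|) / 4.
  have chl := chi_le rp xB.
  apply: (@le_trans _ _ (be * chi a rho x * M)).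
    by apply: ler_pM => //; exact: ler_wpM2r.
  apply: (@le_trans _ _ (be * (2 / rho * (rho - `|x - a|)) * M)).
    by apply: ler_wpM2r; [exact: ltW|apply: ler_wpM2l => //; exact: ltW].
  have -> : be * (2 / rho * (rho - `|x - a|)) * M = (be * M) * (2 / rho * (rho - `|x - a|)) by ring.
  apply: (@le_trans _ _ (rho / 8 * (2 / rho * (rho - `|x - a|)))).
    by apply: ler_wpM2r => //; rewrite mulr_ge0 ?divr_ge0 ?ltW ?subr_gt0.
  have -> // : rho / 8 * (2 / rho * (rho - `|x - a|)) = (rho - `|x - a|) / 4.
  by field; rewrite gt_eqF.
have yr : `|y - a| < rho by have := tri3 x y a; rewrite nyx; slra.
have yB := ltW yr.
pose QF := dot (F x) (F x).
have QFge : `|F x| ^+ 2 <= QF := dot_self_ge (F x).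
have Fsq : 0 <= `|F x| ^+ 2 by rewrite exprn_ge0.
have z0 : 0 <= q * `|F x| by rewrite mulr_ge0.
have qQ : 0 <= q * QF by rewrite mulr_ge0//; exact: le_trans QFge.
have phd : ph y <= ph x - q * QF / 2.
  have := phT _ _ xB yB; rewrite nyx yx dotNr dotZr -/QF ler_norml => /andP[_ hup].
  have : C * (q * `|F x|) ^+ 2 <= 1 / 2 * (q * QF).
    have -> : C * (q * `|F x|) ^+ 2 = (C * q) * (q * `|F x| ^+ 2) by ring.
    apply: ler_pM => //; first by rewrite mulr_ge0.
    - by rewrite mulr_ge0.
    - by apply: le_trans be1; apply: ler_wpM2l.
    - exact: ler_wpM2l.
  move: hup; clear -R; slra.
split=> //.
- by rewrite nyx; exact: le_trans be3.
- by move: phd qQ; clear -R; slra.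
- move=> dx; have mf := Hm dx.
  have mF : m - eps <= `|F x|.
    by have := ler_normB (F x) (F x - f x); rewrite subKr; move: mf Ff; clear -R; slra.
  have := hT _ _ xB yB; rewrite nyx yx dotNr dotZr ler_norml => /andP[_ hup].
  have dfF : QF - 2 * (eps * `|F x|) <= dot (f x) (F x).
    have -> : dot (f x) (F x) = QF - dot (F x - f x) (F x) by rewrite dotBl /QF; ring.
    rewrite lerD2l lerN2; apply: le_trans (ler_norm _) _; apply: (le_trans (dot_le _ _)).
    by apply: ler_wpM2l => //; exact: ler_wpM2r.
  have lq : L * (q * `|F x|) ^+ 2 <= m / 4 * (q * `|F x|).
    have -> : L * (q * `|F x|) ^+ 2 = (L * (q * `|F x|)) * (q * `|F x|) by ring.
    apply: ler_wpM2r => //.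
    by apply: le_trans be2; apply: ler_wpM2l => //; exact: ltW.
  have d1 : q * (QF - 2 * (eps * `|F x|)) <= q * dot (f x) (F x) by exact: ler_wpM2l.
  have d2 : (m - eps) * (q * `|F x|) <= q * QF.
    apply: (@le_trans _ _ (q * `|F x| ^+ 2)); last exact: ler_wpM2l.
    have -> : q * `|F x| ^+ 2 = `|F x| * (q * `|F x|) by ring.
    exact: ler_wpM2r.
  have d3 : 8 * eps * (q * `|F x|) <= m * (q * `|F x|) by exact: ler_wpM2r.
  have z1 : 0 <= m * (q * `|F x|) by rewrite mulr_ge0// ltW.
  by move: hup lq d1 d2 d3 z0 z1; clear -R; slra.
- move=> te xr2; apply: (le_trans phd); rewrite lerD2l lerN2.
  have -> : q = be by rewrite /q te chi1// mul1r mulr1.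
  apply: ler_wpM2r; first by rewrite invr_ge0.
  apply: ler_wpM2l; first exact: ltW.
  by apply: le_trans QFge; apply: sqr_le; [exact: ltW|].
Qed.

Lemma rel_cycle_bdry {R : realType} (A : set (pt R)) n (c : chain R n) :
  rel_cycle A c -> bdry_pts c `<=` A.
Proof. by case: n c => [c _ y []//|n c rc y [s cs sy]]; exact: rc cs _ sy. Qed.

(** * Persistence of the critical point when the gradient is perturbed *)

Section CriticalPointStability.
Context {R : realType}.
Variables (h : pt R -> R) (f : pt R -> pt R) (a : pt R) (rho L : R).
Hypotheses (rho0 : 0 < rho) (L0 : 0 < L).
Hypothesis hT : forall x y, `|x - a| <= rho -> `|y - a| <= rho ->
  `|h y - h x - dot (f x) (y - x)| <= L * `|y - x| ^+ 2.
Hypothesis fL : forall x y, `|x - a| <= rho -> `|y - a| <= rho ->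
  `|f y - f x| <= L * `|y - x|.
Hypotheses (ha : h a = 0) (fa : f a = 0).
Hypothesis fn0 : forall x, `|x - a| <= rho -> x != a -> f x != 0.

(** [eps] depends on [h] and on the cycle only; the lower bound [mt] of [|F|], and with it the step
    length and the number of steps, may depend on [ph] and [F]. *)
Lemma nontrivial_zero (X : set (pt R)) n (c : chain R n) :
  (forall x, `|x - a| <= rho -> (X x <-> h x <= 0)) ->
  chain_in X c -> rel_cycle (X `\ a) c ->
  ~ (exists (d : chain R n.+1) (e : chain R n), chain_in X d /\ chain_in (X `\ a) e /\
         forall s, coef c s = coef (bdry d) s + coef e s) ->
  exists2 eps : R, 0 < eps & forall (ph : pt R -> R) (F : pt R -> pt R) (C : R), 0 <= C ->
    (forall x, `|x - a| <= rho -> `|ph x - h x| <= eps /\ `|F x - f x| <= eps) ->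
    (forall x y, `|x - a| <= rho -> `|y - a| <= rho ->
      `|ph y - ph x - dot (F x) (y - x)| <= C * `|y - x| ^+ 2) ->
    (forall x y, `|x - a| <= rho -> `|y - a| <= rho -> `|F y - F x| <= C * `|y - x|) ->
    exists2 x, `|x - a| <= rho & F x = 0.
Proof.
move=> Xh cX rc ntriv; have rp := rho0; have Lp := L0.
have [sg sg0 Hsg] := bdry_away cX rc.
have [h0 h00 [ret [ret1 ret2 ret3]]] := retraction rho0 L0 hT fL ha fa fn0.
(* At most half the distance from [a] to the boundary of the cycle, so that [Jfar] applies to its
   points; [rho / 32] leaves room for the radii in [I1P] and [Jfin]. *)
pose de := Num.min (sg / 2) (rho / 32).
have de0 : 0 < de by rewrite lt_min; apply/andP; split; slra.
have de1 : 2 * de <= sg by have : de <= sg / 2 by [rewrite ge_min lexx]; slra.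
have de2 : de <= rho / 32 by rewrite ge_min lexx orbT.
have [m m0 Hm] := f_min L0 fL fn0 de0.
pose k := m / 4; have k0 : 0 < k by rewrite /k; slra.
(* In this order: the room required by the invariants [I1] and [Jst], the range [h <= h0] of the
   retraction, the descent of [h] along [F], and the bound [M] of [|F|]. *)
pose eps := Num.min (Num.min (k * de / 4) (h0 / 2)) (Num.min (m / 8) 1).
have kde : 0 < k * de by rewrite mulr_gt0.
have eps0 : 0 < eps by rewrite !lt_min ltr01 andbT; apply/andP; split; [apply/andP; split|]; slra.
have eps1 : 4 * eps <= k * de by have : eps <= k * de / 4 by [rewrite !ge_min lexx]; slra.
have eps2 : 2 * eps <= h0 by have : eps <= h0 / 2 by [rewrite !ge_min lexx orbT]; slra.
have eps3 : 8 * eps <= m by have : eps <= m / 8 by [rewrite !ge_min lexx !orbT]; slra.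
have eps4 : eps <= 1 by rewrite !ge_min lexx !orbT.
exists eps => // ph F C C0 close phT FL; apply: contrapT => nz.
have Fn0 x : `|x - a| <= rho -> F x != 0.
  by move=> xB; apply/eqP => Fx; apply: nz; exists x.
have [mt mt0 Hmt] : exists2 m : R, 0 < m & forall x, 0 <= `|x - a| <= rho -> m <= `|F x|.
  apply: annulus_min => [x xB|x /andP[_]]; last exact: Fn0.
  apply/cvgrPdist_le => e e0; rewrite near_withinE.
  have d0 : 0 < e / (C + 1) by rewrite divr_gt0//; slra.
  have := nbhsx_ballx x _ d0; apply: filterS => y; rewrite -ball_normE/= => hy yB.
  apply: (le_trans (FL _ _ yB xB)); apply: (@le_trans _ _ ((C + 1) * `|x - y|)).
    by apply: ler_wpM2r => //; slra.
  by rewrite mulrC -ler_pdivlMr ?ltW//; slra.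
pose M := L * rho + 1.
have Lr : 0 < L * rho by rewrite mulr_gt0.
have M0 : 0 < M by rewrite /M; slra.
have FM x : `|x - a| <= rho -> `|F x| <= M.
  move=> xB; have [_ cl] := close x xB.
  rewrite (_ : F x = (F x - f x) + f x); last by rewrite subrK.
  apply: (le_trans (ler_normD _ _)); have := f_bound rho0 fL fa xB.
  have : L * `|x - a| <= L * rho by apply: ler_wpM2l => //; exact: ltW.
  rewrite /M; slra.
pose be := Num.min (Num.min (1 / (2 * (C + 1))) (m / (4 * L * M))) (Num.min (de / M) (rho / (8 * M))).
have C1 : 0 < 2 * (C + 1) by slra.
have LM : 0 < 4 * L * M by rewrite !mulr_gt0.
have be0 : 0 < be.
  rewrite !lt_min; apply/andP; split; apply/andP; split; apply: divr_gt0 => //; last by rewrite mulr_gt0.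
have be1 : C * be <= 1 / 2.
  have : be <= 1 / (2 * (C + 1)) by rewrite !ge_min lexx.
  rewrite ler_pdivlMr//; slra.
have be2 : L * (be * M) <= m / 4.
  have : be <= m / (4 * L * M) by rewrite !ge_min lexx !orbT.
  rewrite ler_pdivlMr//; slra.
have be3 : be * M <= de.
  have : be <= de / M by rewrite !ge_min lexx !orbT.
  by rewrite ler_pdivlMr.
have be4 : be * M <= rho / 8.
  have : be <= rho / (8 * M) by rewrite !ge_min lexx !orbT.
  rewrite ler_pdivlMr ?mulr_gt0//; slra.
pose G x := chi a rho x *: F x.
have cG : continuous G.
  apply: (@cut_continuous _ _ _ rho0 _ M) => [x xr|]; last exact: FM.
  apply: (@lip_cvg _ _ _ _ x (rho - `|x - a|) C); first by slra.
  move=> y hy; apply: FL; first exact: ltW.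
  rewrite (_ : y - a = (y - x) + (x - a)); last by rewrite addrA subrK.
  by apply: (le_trans (ler_normD _ _)); slra.
pose St (t : R) x := x - (t * be) *: G x.
have hle x : `|x - a| < rho -> h x <= ph x + eps /\ ph x <= h x + eps.
  move=> /ltW xB; have [+ _] := close x xB; rewrite ler_norml; clear -R => /andP[? ?]; slra.
pose d := be * mt ^+ 2 / 2.
have d0 : 0 < d by rewrite divr_gt0// mulr_gt0// exprn_gt0.
have step t x : 0 <= t <= 1 -> `|x - a| < rho ->
  [/\ `|St t x - a| < rho, `|St t x - x| <= de, ph (St t x) <= ph x,
      de <= `|x - a| -> h (St t x) <= h x - k * `|St t x - x| &
      t = 1 -> `|x - a| <= rho / 2 -> ph (St t x) <= ph x - d].
  move=> t01 xr; have xB := ltW xr; have [_ Ff] := close x xB.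
  apply: (@descent_step R h ph f F a rho L C M m mt eps be de t x) => //.
  - by move=> dx; apply: Hm; rewrite dx.
  - by rewrite FM// andbT; apply: Hmt; rewrite normr_ge0.
have out t x j : rho <= `|x - a| -> iter j (St t) x = x.
  by move=> xr; elim: j => //= j ->; rewrite /St /G chi0// scale0r scaler0 subr0.
pose nn := Num.bound (3 * eps / d).
have nd : 3 * eps <= nn%:R * d.
  rewrite -ler_pdivrMr//; apply: ltW; apply: archi_boundP; rewrite divr_ge0 ?ltW//; slra.
have inb' t x j : 0 <= t <= 1 -> `|x - a| < rho -> `|iter j (St t) x - a| < rho.
  by move=> *; apply: (inb step).
(* The retraction is switched on only near [a]. This causes no jump at the points that occur: end
   points of the descent with [h > 0] lie within [rho / 8], and the retraction fixes those with
   [h <= 0]. *)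
pose ret' y := if `|y - a| < rho / 4 then ret y else y.
have ret'J y : `|y - a| < rho -> h y <= 0 -> ret' y = y.
  move=> yr hy; rewrite /ret'; case: ifP => // yr4.
  by apply: ret2 => //; split; [exact: ltW|slra].
pose D x t := ret' (iter nn (St t) x).
have XA y : `|y - a| < rho -> Jst h ph a de k eps y -> (X `\ a) (ret' y).
  move=> yr Jy; have [hy ya] := JP de0 eps0 ha hle Jy yr.
  by rewrite ret'J//; split; [apply/Xh => //; exact: ltW|exact/eqP].
have Dout x t : rho <= `|x - a| -> D x t = x.
  by move=> xr; rewrite /D out// /ret' ifF//; apply/negbTE; rewrite -leNgt; slra.
have aout x : rho <= `|x - a| -> x <> a by move=> xr e; move: xr; rewrite e subrr normr0; slra.
(* A set containing all end points of the descent from [X], on which the two branches of [ret']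
   agree between the radii [rho / 8] and [rho / 4]. *)
pose Y := [set y : pt R | `|y - a| < rho -> h y <= h0 /\ (0 < h y -> `|y - a| < rho / 8)].
have cret y : Y y -> ret' @ within Y (nbhs y) --> ret' y.
  move=> Yy; have [yr|yr] := ltP `|y - a| (rho / 4).
    have Vy : `|y - a| <= rho / 4 /\ h y <= h0.
      by split; [exact: ltW|have [] := Yy ltac:(slra)].
    have := ret3 y Vy; rewrite /ret' yr => H W /H; rewrite /= !nbhs_simpl /= /within /= => HW.
    have e0 : 0 < rho / 4 - `|y - a| by slra.
    have HB := nbhsx_ballx y _ e0.
    apply: filterS2 HW HB => z Hz; rewrite -ball_normE/= => hz Yz.
    have zr : `|z - a| < rho / 4 by have := tri3 y z a; rewrite (distrC z y); slra.
    by rewrite zr; apply: Hz; split; [exact: ltW|have [] := Yz ltac:(slra)].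
  have -> : ret' y = y by rewrite /ret' ltNge yr.
  move=> W Wy; rewrite /= !nbhs_simpl /= /within /=.
  have e0 : 0 < rho / 16 by slra.
  have HB := nbhsx_ballx y _ e0.
  apply: filterS2 Wy HB => z Wz; rewrite -ball_normE/= => hz Yz.
  have zr : rho / 8 < `|z - a| by have := tri3 z y a; slra.
  have [zr2|zr2] := ltP `|z - a| rho; last by rewrite /ret' ifF//; apply/negbTE; rewrite -leNgt; slra.
  rewrite ret'J//; have [_ Yz2] := Yz zr2.
  by rewrite leNgt; apply/negP => /Yz2; slra.
have IY x t : X x -> 0 <= t <= 1 -> Y (iter nn (St t) x).
  move=> Xx t01 yr; have [xr|xr] := ltP `|x - a| rho; last first.
    by move: yr; rewrite out//; slra.
  have hx : h x <= 0 by apply/Xh => //; exact: ltW.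
  have [h1 h2] := I1P de0 de2 k0 eps0 eps1 hle (I1S de0 k0 hle step nn t01 xr hx) yr.
  by split=> //; exact: le_trans eps2.
have cSt : continuous (fun p : pt R * R => St p.2 p.1).
  move=> p; rewrite /St; apply: cvgB; first exact: cvg_fst.
  apply: cvgZ; first by apply: cvgM; [exact: cvg_snd|exact: cvg_cst].
  by apply: continuous_comp; [exact: cvg_fst|exact: cG].
have cit j : continuous (fun p : pt R * R => iter j (St p.2) p.1).
  elim: j => [|j IH]; first by move=> p; exact: cvg_fst.
  move=> p; apply: (@continuous_comp _ _ _ (fun p : pt R * R => (iter j (St p.2) p.1, p.2))
    (fun p : pt R * R => St p.2 p.1)); last exact: cSt.
  by apply: cvg_pair_at; [exact: IH|exact: cvg_snd].
have hD : homotopy_on X X D.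
  split=> [x t Xx t01|x t Xx t01].
    have [xr|xr] := ltP `|x - a| rho; last by rewrite Dout.
    have hx : h x <= 0 by apply/Xh => //; exact: ltW.
    have yr := inb' t x nn t01 xr.
    have [hy Ip] := IY x t Xx t01 yr.
    rewrite /D /ret'; case: ifP => yr4.
      have [|r1 r2] := ret1 (iter nn (St t) x); first by split=> //; exact: ltW.
      by apply/Xh => //; slra.
    apply/Xh; first exact: ltW.
    by rewrite leNgt; apply/negP => /Ip; move/negbT: yr4; rewrite -leNgt; slra.
  apply: (@cvg_within_comp _ _ _ _ Y (fun p : pt R * R => iter nn (St p.2) p.1) ret').
  - by move=> [x' t'] /= [Xx' t01']; exact: IY.
  - by apply: cvg_withinW; exact: cit.
  - by apply: cret; exact: IY.
apply: ntriv; apply: (@homotopy_trivial _ X (X `\ a) n c D) => //.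
- move=> x Xx; have it0 j : iter j (St 0) x = x.
    by elim: j => //= j ->; rewrite /St mul0r scale0r subr0.
  have [xr|xr] := ltP `|x - a| rho; last by rewrite Dout.
  by rewrite /D it0 ret'J//; apply/Xh => //; exact: ltW.
- move=> x Xx; have [xr|xr] := ltP `|x - a| rho; last by rewrite Dout//; split=> //; exact: aout.
  have t01 : 0 <= (1 : R) <= 1 by rewrite ler01 lexx.
  by apply: XA; [exact: inb'|apply: (Jfin de0 de2 k0 eps0 eps1 d0 hle step) => //; apply/Xh => //; exact: ltW].
- move=> y t yb t01; have ysg := Hsg y yb.
  have [Xy _] := rel_cycle_bdry rc yb.
  have [yr|yr] := ltP `|y - a| rho; last by rewrite Dout//; split=> //; exact: aout.
  apply: XA; [exact: inb'|apply: (JS k0 eps0 eps1 hle step) => //; apply: Jfar => //].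
    by apply/Xh => //; exact: ltW.
  exact: le_trans ysg.
Qed.

End CriticalPointStability.

(** * Mean value and Taylor estimates on a box *)

Section LocalTaylor.
Context {R : realType}.

Lemma MVT_ball (f f' : R -> R) (m rho a b : R) :
  (forall s : R, `|s - m| <= rho -> is_derive s 1 f (f' s)) ->
  `|a - m| <= rho -> `|b - m| <= rho ->
  exists s : R, [/\ `|s - m| <= rho, `|s - a| <= `|b - a| & f b - f a = f' s * (b - a)].
Proof.
have key (c d : R) : c < d -> (forall s : R, `|s - m| <= rho -> is_derive s 1 f (f' s)) ->
  `|c - m| <= rho -> `|d - m| <= rho ->
  exists2 s : R, c <= s <= d & f d - f c = f' s * (d - c).
  move=> cd df cm dm.
  have inb (s : R) : c <= s <= d -> `|s - m| <= rho.
    by move: cm dm; rewrite !ler_norml => /andP[? ?] /andP[? ?] /andP[? ?]; apply/andP; split; lra.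
  have [s||s sI E] := @MVT R f f' c d cd.
  - by rewrite in_itv/= => /andP[? ?]; apply/df/inb; rewrite !ltW.
  - apply: continuous_in_subspaceT => s; rewrite inE/= in_itv/= => sI.
    have := df _ (inb s sI) => H; apply: differentiable_continuous; apply/derivable1_diffP.
    exact: ex_derive.
  - by exists s => //; move: sI; rewrite in_itv/= => /andP[? ?]; rewrite !ltW.
move=> df am bm; have [ab|ba|->] := ltgtP a b.
- have [s /andP[s1 s2] E] := key _ _ ab df am bm; exists s; split=> //.
    by move: am bm; rewrite !ler_norml => /andP[? ?] /andP[? ?]; apply/andP; split; lra.
  by rewrite !ger0_norm; lra.
- have [s /andP[s1 s2] E] := key _ _ ba df bm am; exists s; split=> //; last by lra.
    by move: am bm; rewrite !ler_norml => /andP[? ?] /andP[? ?]; apply/andP; split; lra.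
  by rewrite !ler0_norm; lra.
- by exists b; split=> //; lra.
Qed.

Variables (m1 m2 m3 m4 rho : R).
Definition box (x1 x2 x3 x4 : R) :=
  [/\ `|x1 - m1| <= rho, `|x2 - m2| <= rho, `|x3 - m3| <= rho & `|x4 - m4| <= rho].

Definition partials (F F1 F2 F3 F4 : R -> R -> R -> R -> R) :=
  forall x1 x2 x3 x4 : R, box x1 x2 x3 x4 ->
  [/\ is_derive x1 1 (fun s => F s x2 x3 x4) (F1 x1 x2 x3 x4),
      is_derive x2 1 (fun s => F x1 s x3 x4) (F2 x1 x2 x3 x4),
      is_derive x3 1 (fun s => F x1 x2 s x4) (F3 x1 x2 x3 x4) &
      is_derive x4 1 (fun s => F x1 x2 x3 s) (F4 x1 x2 x3 x4)].

(** Only partial derivatives along the axes are given, so the coordinates are changed one at a time,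
    each time with the mean value theorem in one variable. *)
Lemma box_increment F F1 F2 F3 F4 (x1 x2 x3 x4 y1 y2 y3 y4 : R) :
  partials F F1 F2 F3 F4 -> box x1 x2 x3 x4 -> box y1 y2 y3 y4 ->
  exists s1 s2 s3 s4 : R,
  [/\ [/\ `|s1 - x1| <= `|y1 - x1|, `|s2 - x2| <= `|y2 - x2|, `|s3 - x3| <= `|y3 - x3| &
         `|s4 - x4| <= `|y4 - x4|],
      [/\ box s1 x2 x3 x4, box y1 s2 x3 x4, box y1 y2 s3 x4 & box y1 y2 y3 s4] &
      F y1 y2 y3 y4 - F x1 x2 x3 x4 = F1 s1 x2 x3 x4 * (y1 - x1) + F2 y1 s2 x3 x4 * (y2 - x2)
         + F3 y1 y2 s3 x4 * (y3 - x3) + F4 y1 y2 y3 s4 * (y4 - x4)].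
Proof.
move=> pF [x1b x2b x3b x4b] [y1b y2b y3b y4b].
have [s1 [s1b s1x E1]] := @MVT_ball (fun s => F s x2 x3 x4) (fun s => F1 s x2 x3 x4) m1 rho x1 y1
  (fun s sb => let: And4 h _ _ _ := pF s x2 x3 x4 (And4 sb x2b x3b x4b) in h) x1b y1b.
have [s2 [s2b s2x E2]] := @MVT_ball (fun s => F y1 s x3 x4) (fun s => F2 y1 s x3 x4) m2 rho x2 y2
  (fun s sb => let: And4 _ h _ _ := pF y1 s x3 x4 (And4 y1b sb x3b x4b) in h) x2b y2b.
have [s3 [s3b s3x E3]] := @MVT_ball (fun s => F y1 y2 s x4) (fun s => F3 y1 y2 s x4) m3 rho x3 y3
  (fun s sb => let: And4 _ _ h _ := pF y1 y2 s x4 (And4 y1b y2b sb x4b) in h) x3b y3b.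
have [s4 [s4b s4x E4]] := @MVT_ball (fun s => F y1 y2 y3 s) (fun s => F4 y1 y2 y3 s) m4 rho x4 y4
  (fun s sb => let: And4 _ _ _ h := pF y1 y2 y3 s (And4 y1b y2b y3b sb) in h) x4b y4b.
exists s1, s2, s3, s4; split; [by split|by split|].
by rewrite -E1 -E2 -E3 -E4; ring.
Qed.

Definition close (e x1 x2 x3 x4 y1 y2 y3 y4 : R) :=
  [/\ `|y1 - x1| <= e, `|y2 - x2| <= e, `|y3 - x3| <= e & `|y4 - x4| <= e].

Lemma norm_sum4 (M e u1 u2 u3 u4 v1 v2 v3 v4 : R) :
  `|u1| <= M -> `|u2| <= M -> `|u3| <= M -> `|u4| <= M ->
  `|v1| <= e -> `|v2| <= e -> `|v3| <= e -> `|v4| <= e ->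
  `|u1 * v1 + u2 * v2 + u3 * v3 + u4 * v4| <= 4 * M * e.
Proof.
move=> h1 h2 h3 h4 c1 c2 c3 c4.
have P (u v : R) : `|u| <= M -> `|v| <= e -> `|u * v| <= M * e by rewrite normrM => *; apply: ler_pM.
have := P _ _ h1 c1; have := P _ _ h2 c2; have := P _ _ h3 c3; have := P _ _ h4 c4.
rewrite !ler_norml => /andP[? ?] /andP[? ?] /andP[? ?] /andP[? ?]; apply/andP; split; lra.
Qed.

Lemma box_lip F F1 F2 F3 F4 (M e x1 x2 x3 x4 y1 y2 y3 y4 : R) :
  partials F F1 F2 F3 F4 ->
  (forall x1 x2 x3 x4, box x1 x2 x3 x4 -> [/\ `|F1 x1 x2 x3 x4| <= M, `|F2 x1 x2 x3 x4| <= M,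
     `|F3 x1 x2 x3 x4| <= M & `|F4 x1 x2 x3 x4| <= M]) ->
  box x1 x2 x3 x4 -> box y1 y2 y3 y4 -> close e x1 x2 x3 x4 y1 y2 y3 y4 ->
  `|F y1 y2 y3 y4 - F x1 x2 x3 x4| <= 4 * M * e.
Proof.
move=> pF bF bx b_y [c1 c2 c3 c4].
have [s1 [s2 [s3 [s4 [_ [b1 b2 b3 b4] ->]]]]] := box_increment pF bx b_y.
have [h1 _ _ _] := bF _ _ _ _ b1; have [_ h2 _ _] := bF _ _ _ _ b2.
have [_ _ h3 _] := bF _ _ _ _ b3; have [_ _ _ h4] := bF _ _ _ _ b4.
exact: norm_sum4.
Qed.

Lemma box_taylor F F1 F2 F3 F4 (M e x1 x2 x3 x4 y1 y2 y3 y4 : R) :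
  0 <= e -> partials F F1 F2 F3 F4 ->
  (forall Fi, [\/ Fi = F1, Fi = F2, Fi = F3 | Fi = F4] ->
    forall x1 x2 x3 x4 y1 y2 y3 y4, box x1 x2 x3 x4 -> box y1 y2 y3 y4 ->
    close e x1 x2 x3 x4 y1 y2 y3 y4 ->
    `|Fi y1 y2 y3 y4 - Fi x1 x2 x3 x4| <= M * e) ->
  box x1 x2 x3 x4 -> box y1 y2 y3 y4 -> close e x1 x2 x3 x4 y1 y2 y3 y4 ->
  `|F y1 y2 y3 y4 - F x1 x2 x3 x4 - (F1 x1 x2 x3 x4 * (y1 - x1) + F2 x1 x2 x3 x4 * (y2 - x2)
         + F3 x1 x2 x3 x4 * (y3 - x3) + F4 x1 x2 x3 x4 * (y4 - x4))| <= 4 * M * e ^+ 2.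
Proof.
move=> e0 pF lF bx b_y [c1 c2 c3 c4].
have [s1 [s2 [s3 [s4 [[s1x s2x s3x s4x] [b1 b2 b3 b4] ->]]]]] := box_increment pF bx b_y.
rewrite (_ : _ - _ = (F1 s1 x2 x3 x4 - F1 x1 x2 x3 x4) * (y1 - x1)
  + (F2 y1 s2 x3 x4 - F2 x1 x2 x3 x4) * (y2 - x2)
  + (F3 y1 y2 s3 x4 - F3 x1 x2 x3 x4) * (y3 - x3)
  + (F4 y1 y2 y3 s4 - F4 x1 x2 x3 x4) * (y4 - x4)); last by ring.
rewrite (_ : 4 * M * e ^+ 2 = 4 * (M * e) * e); last by ring.
have z (x : R) : `|x - x| <= e by rewrite subrr normr0.
apply: norm_sum4 => //; apply: lF => //; rewrite /close; try (by constructor);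
  split; rewrite ?z//; exact: le_trans c1 || exact: le_trans c2 || exact: le_trans c3 || exact: le_trans c4.
Qed.

End LocalTaylor.

(** * The Taylor estimate for the regular part of the Hamiltonian *)

Section LocalRegularity.
Context {R : realType}.

Lemma line_derive (V : normedModType R) (f : V -> R) (c : R -> V) (e : V) (s : R) :
  (forall h : R, c (h + s) = h *: e + c s) -> derivable f (c s) e ->
  is_derive s 1 (fun s => f (c s)) ('D_e f (c s)).
Proof.
move=> ce df.
have E : (fun h : R => h^-1 *: (f (c (h *: 1 + s)) - f (c s))) =
  (fun h : R => h^-1 *: ((f \o shift (c s)) (h *: e) - f (c s))).
  by apply/funext => h /=; rewrite [h *: 1]mulr1 ce.
by split; rewrite /derivable /derive /= E.
Qed.

Definition q4 k (k4 : (k < 4)%N) : 'I_4 := Ordinal k4.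

Definition grad1 (g : pt2 R -> R) (x y : pt R) : pt R :=
  ('D_(e4 R (@q4 0 isT)) g (x, y), 'D_(e4 R (@q4 1 isT)) g (x, y)).

(** The form in which the later parts use the regularity and the symmetry of [g] near [(a, a)]: a
    quadratic remainder and a Lipschitz gradient. By symmetry [D1 y x] stands for the gradient in
    the second variable. *)
Definition taylor2 (g : pt2 R -> R) (D1 : pt R -> pt R -> pt R) (a : pt R) (rho L : R) :=
  forall x y x' y' (e : R), 0 <= e ->
    `|x - a| <= rho -> `|y - a| <= rho -> `|x' - a| <= rho -> `|y' - a| <= rho ->
    `|x' - x| <= e -> `|y' - y| <= e ->
    `|g (x', y') - g (x, y) - dot (D1 x y) (x' - x) - dot (D1 y x) (y' - y)| <= L * e ^+ 2 /\
    `|D1 x' y' - D1 x y| <= L * e.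

Lemma cont_ext_bounded (Om : set (pt R)) (f : pt2 R -> R) (a : pt R) :
  open Om -> Om a -> cont_ext (Om `*` Om) (closure Om `*` Om) f ->
  exists M : R, \forall p \near ((a, a) : pt2 R), `|f p| <= M.
Proof.
move=> oOm Oma [G [cG GE]]; exists (`|G (a, a)| + 1).
have nOm : nbhs a Om by apply: open_nbhs_nbhs; split.
have nU : \forall p \near ((a, a) : pt2 R), (Om `*` Om) p by exists (Om, Om).
have UD : Om `*` Om `<=` closure Om `*` Om by move=> p [p1 p2]; split=> //; exact: subset_closure.
have UA : (closure Om `*` Om) (a, a) by apply: UD; split.
move/subspace_continuousP : cG => /(_ (a, a) UA) /cvgrPdist_le /(_ 1 ltr01); rewrite near_withinE => H.
apply: filterS2 nU H => p pU Hp; rewrite -GE//.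
have := Hp (UD _ pU); have := ler_distD (G (a, a)) (G p) 0; rewrite !subr0 (distrC (G p)); lra.
Qed.

Lemma grad2E (Om : set (pt R)) (g : pt2 R -> R) (x y : pt R) :
  open Om -> Om x -> Om y -> (forall w z, Om w -> Om z -> g (w, z) = g (z, w)) ->
  grad1 g y x = ('D_(e4 R (@q4 2 isT)) g (x, y), 'D_(e4 R (@q4 3 isT)) g (x, y)).
Proof.
move=> oOm Ox Oy sg.
have key (e : pt R) : 'D_((e, 0) : pt2 R) g (y, x) = 'D_((0, e) : pt2 R) g (x, y).
  transitivity ('D_((0, e) : pt2 R) (fun p => g (p.2, p.1)) (x, y)); first by [].
  apply: near_eq_derive; exists (Om, Om).
    by split; apply: open_nbhs_nbhs; split.
  by move=> p [p1 p2]; rewrite [p in RHS]surjective_pairing; exact: sg.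
by congr (_, _); exact: key.
Qed.

Lemma near_forall2 (I : finType) (T : topologicalType) (p : T) (P : I -> I -> T -> Prop) :
  (forall i j, \forall q \near p, P i j q) -> \forall q \near p, forall i j, P i j q.
Proof. by move=> H; apply: filter_forall => i; apply: (@filter_forall _ _ (P i)) => j; exact: H. Qed.

Lemma near_ball (p : pt2 R) (P : set (pt2 R)) :
  nbhs p P -> exists2 r : R, 0 < r & forall q, ball p r q -> P q.
Proof. by move=> /nbhs_ballP[r /= r0 H]; exists r. Qed.

Lemma local_taylor (Om : set (pt R)) (g : pt2 R -> R) (a : pt R) :
  open Om -> Om a -> C2_closO_O Om g ->
  (forall w z, Om w -> Om z -> g (w, z) = g (z, w)) ->
  exists rho L : R, [/\ 0 < rho, 0 < L, forall x, `|x - a| <= rho -> Om x &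
    taylor2 g (grad1 g) a rho L].
Proof.
move=> oOm Oma [dg _ _ cg] sg.
have [M HM] : exists M : 'I_4 -> 'I_4 -> R, forall i j,
    \forall p \near ((a, a) : pt2 R), `|'D_(e4 R j) ('D_(e4 R i) g) p| <= M i j.
  have H i j := cid (cont_ext_bounded oOm Oma (cg i j)).
  by exists (fun i j => projT1 (H i j)) => i j; exact: (projT2 (H i j)).
pose K := \sum_i \sum_j `|M i j| + 1.
have K0 : 0 < K by rewrite ltr_wpDl// sumr_ge0// => i _; rewrite sumr_ge0.
have MK i j : M i j <= K.
  apply: (le_trans (ler_norm _)); rewrite /K (bigD1 i)//= (bigD1 j)//= -!addrA lerDl.
  by rewrite !addr_ge0// sumr_ge0// => i' _; rewrite sumr_ge0.
have nOm : nbhs a Om by apply: open_nbhs_nbhs; split.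
have nU : \forall p \near ((a, a) : pt2 R), (Om `*` Om) p by exists (Om, Om).
have : \forall p \near ((a, a) : pt2 R), forall i, forall j, `|'D_(e4 R j) ('D_(e4 R i) g) p| <= M i j.
  exact: near_forall2.
move=> nP; have [r r0 Hr] := near_ball (filterI nU nP).
pose rho := r / 2; have rho0 : 0 < rho by rewrite divr_gt0.
pose bx := box a.1 a.2 a.1 a.2 rho.
have Hb x1 x2 x3 x4 : bx x1 x2 x3 x4 -> (Om `*` Om) ((x1, x2), (x3, x4)) /\
    forall i j, `|'D_(e4 R j) ('D_(e4 R i) g) ((x1, x2), (x3, x4))| <= K.
  move=> [h1 h2 h3 h4].
  have [|H1 H2] := Hr ((x1, x2), (x3, x4)).
    have h (u v : R) : `|u - v| <= rho -> ball v r u.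
      by rewrite -ball_normE /ball_ /= distrC /rho => ?; lra.
    by split; split; exact: h.
  by split=> // i j; exact: le_trans (MK i j).
pose cu (f : pt2 R -> R) x1 x2 x3 x4 := f ((x1, x2), (x3, x4)).
pose i0 := @q4 0 isT; pose i1 := @q4 1 isT; pose i2 := @q4 2 isT; pose i3 := @q4 3 isT.
have par (f : pt2 R -> R) : (forall p, (Om `*` Om) p -> forall j, derivable f p (e4 R j)) ->
    partials a.1 a.2 a.1 a.2 rho (cu f) (cu ('D_(e4 R i0) f)) (cu ('D_(e4 R i1) f))
      (cu ('D_(e4 R i2) f)) (cu ('D_(e4 R i3) f)).
  move=> df x1 x2 x3 x4 /Hb[HU _]; have dfx := df _ HU.
  split.
  - apply: (@line_derive _ f (fun s => ((s, x2), (x3, x4))) (e4 R i0)) => //.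
    by move=> h; rewrite /e4 /=; congr ((_, _), (_, _)) => /=; rewrite ?scaler0 ?add0r// [_ *: _]mulr1.
  - apply: (@line_derive _ f (fun s => ((x1, s), (x3, x4))) (e4 R i1)) => //.
    by move=> h; rewrite /e4 /=; congr ((_, _), (_, _)) => /=; rewrite ?scaler0 ?add0r// [_ *: _]mulr1.
  - apply: (@line_derive _ f (fun s => ((x1, x2), (s, x4))) (e4 R i2)) => //.
    by move=> h; rewrite /e4 /=; congr ((_, _), (_, _)) => /=; rewrite ?scaler0 ?add0r// [_ *: _]mulr1.
  - apply: (@line_derive _ f (fun s => ((x1, x2), (x3, s))) (e4 R i3)) => //.
    by move=> h; rewrite /e4 /=; congr ((_, _), (_, _)) => /=; rewrite ?scaler0 ?add0r// [_ *: _]mulr1.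
have parg := par g (fun p hp j => (dg p hp j j).1).
have lipD i (e x1 x2 x3 x4 y1 y2 y3 y4 : R) : bx x1 x2 x3 x4 -> bx y1 y2 y3 y4 ->
    close e x1 x2 x3 x4 y1 y2 y3 y4 ->
    `|cu ('D_(e4 R i) g) y1 y2 y3 y4 - cu ('D_(e4 R i) g) x1 x2 x3 x4| <= 4 * K * e.
  apply: (box_lip (par ('D_(e4 R i) g) (fun p hp j => (dg p hp i j).2))).
  by move=> u1 u2 u3 u4 /Hb[_ H]; split; exact: H.
exists rho, (16 * K); split=> //; first by lra.
  move=> x xa; have [|[]//] := Hb x.1 x.2 x.1 x.2.
    by have := norm1_le (x - a); have := norm2_le (x - a); rewrite !ptE => ? ?; split; exact: le_trans xa.
  by move=> + _ _; rewrite -surjective_pairing.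
have n1 (u v : pt R) (d : R) : `|u - v| <= d -> `|u.1 - v.1| <= d.
  by move=> h; have := norm1_le (u - v); rewrite !ptE => ?; exact: le_trans h.
have n2 (u v : pt R) (d : R) : `|u - v| <= d -> `|u.2 - v.2| <= d.
  by move=> h; have := norm2_le (u - v); rewrite !ptE => ?; exact: le_trans h.
move=> x y x' y' e e0 xa ya x'a y'a xx yy.
have bx1 : bx x.1 x.2 y.1 y.2 by split; [exact: n1|exact: n2|exact: n1|exact: n2].
have bx2 : bx x'.1 x'.2 y'.1 y'.2 by split; [exact: n1|exact: n2|exact: n1|exact: n2].
have cl : close e x.1 x.2 y.1 y.2 x'.1 x'.2 y'.1 y'.2.
  by split; [exact: n1|exact: n2|exact: n1|exact: n2].
have [[Ox Oy] _] := Hb _ _ _ _ bx1; rewrite /= -!surjective_pairing in Ox Oy.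
split.
  rewrite (@grad2E Om _ x y)//.
  have := @box_taylor _ _ _ _ _ _ _ _ _ _ _ (4 * K) e _ _ _ _ _ _ _ _ e0 parg _ bx1 bx2 cl.
  rewrite /cu -!surjective_pairing.
  rewrite (_ : 4 * (4 * K) = 16 * K); last by ring.
  move=> H; apply: le_trans (H _).
    rewrite le_eqVlt; apply/orP; left; apply/eqP; congr `|_|; rewrite /dot /grad1 /= -/i0 -/i1 -/i2 -/i3.
    move: ('D_(e4 R i0) g (x, y)) ('D_(e4 R i1) g (x, y)) ('D_(e4 R i2) g (x, y)) ('D_(e4 R i3) g (x, y)) (g (x, y)) (g (x', y')) => d0 d1 d2 d3 ? ?; clear; ring.
  by move=> Fi HFi *; case: HFi => ->; exact: lipD.
have l1 := lipD i0 _ _ _ _ _ _ _ _ _ bx1 bx2 cl.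
have l2 := lipD i1 _ _ _ _ _ _ _ _ _ bx1 bx2 cl.
have Ke : 0 <= K * e by rewrite mulr_ge0// ltW.
rewrite /cu -!surjective_pairing in l1 l2.
have KK : 4 * K * e <= 16 * K * e by move: Ke; clear -R; lra.
by rewrite ptnormP !ptE /grad1 /=; apply/andP; split; [apply: le_trans l1 KK|apply: le_trans l2 KK].
Qed.

End LocalRegularity.

(** * Estimates for the logarithmic interaction *)

Section KernelEstimates.
Context {R : realType}.
Implicit Types x y h w : pt R.


Lemma csq_dot x : csq x = dot x x.
Proof. by rewrite /csq /dot !expr2. Qed.

Lemma csq_le x : csq x <= 2 * `|x| ^+ 2.
Proof. by rewrite csq_dot; apply: (le_trans (ler_norm _)); rewrite expr2; exact: dot_le. Qed.

Lemma csq_ge0 x : 0 <= csq x.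
Proof. by rewrite /csq addr_ge0// sqr_ge0. Qed.

Lemma norm_csq x (k : R) : 0 <= k -> csq x <= k ^+ 2 -> `|x| <= k.
Proof.
move=> k0 H; have : `|x| ^+ 2 <= k ^+ 2 by apply: le_trans H; rewrite csq_dot; exact: dot_self_ge.
by rewrite ler_sqr ?nnegrE.
Qed.

(** With [phi x = 1 / conj x], this identity and the next two compute exactly the squared moduli of
    [1/x - 1/y], of [1/(x+h) - 1/x + h/x^2] and of [h/x^2 - h/y^2]. *)
Lemma csq_phiB x y : csq x != 0 -> csq y != 0 ->
  csq (phi x - phi y) = csq (x - y) / (csq x * csq y).
Proof.
rewrite /phi /csq !ptE; move: x y => [a b] [c d] /= h1 h2; field.
by rewrite h1 h2.
Qed.

Lemma csq_phi_taylor x h : csq x != 0 -> csq (x + h) != 0 ->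
  csq (phi (x + h) - phi x - dphi x h) = csq h ^+ 2 / (csq x ^+ 2 * csq (x + h)).
Proof.
rewrite /phi /dphi /dot /csq !ptE; move: x h => [a b] [c d] /= h1 h2; field.
by rewrite h1 h2.
Qed.

Lemma csq_dphiB x y h : csq x != 0 -> csq y != 0 ->
  csq (dphi x h - dphi y h) = csq (x - y) * csq (x + y) * csq h / (csq x ^+ 2 * csq y ^+ 2).
Proof.
rewrite /dphi /dot /csq !ptE; move: x y h => [a b] [c d] [e f] /= h1 h2; field.
by rewrite h1 h2.
Qed.

Variable mu : R.
Hypotheses (mu0 : 0 < mu) (mu1 : mu <= 1).

Lemma far_neq0 x : mu <= csq x -> csq x != 0.
Proof. by move=> h; rewrite gt_eqF//; exact: lt_le_trans h. Qed.

Lemma phi_lip x y : mu <= csq x -> mu <= csq y -> `|phi x - phi y| <= 2 / mu * `|x - y|.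
Proof.
move=> hx hy; have m0 := mu0.
apply: norm_csq; first by rewrite !mulr_ge0// invr_ge0 ltW.
rewrite csq_phiB; [|exact: far_neq0|exact: far_neq0].
rewrite ler_pdivrMr; last by rewrite mulr_gt0//; exact: lt_le_trans mu0 _.
apply: (le_trans (csq_le _)).
have -> : (2 / mu * `|x - y|) ^+ 2 * (csq x * csq y) = `|x - y| ^+ 2 * (4 * (csq x / mu) * (csq y / mu)).
  by field; rewrite gt_eqF.
rewrite mulrC; apply: ler_wpM2l; first by rewrite exprn_ge0.
have h1 : 1 <= csq x / mu by rewrite ler_pdivlMr// mul1r.
have h2 : 1 <= csq y / mu by rewrite ler_pdivlMr// mul1r.
have : 1 * 1 <= (csq x / mu) * (csq y / mu) by apply: ler_pM.
lra.
Qed.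

Lemma phi_taylor x y : mu <= csq x -> mu <= csq y ->
  `|phi y - phi x - dphi x (y - x)| <= 2 / mu ^+ 2 * `|y - x| ^+ 2.
Proof.
move=> hx; have m0 := mu0; have m1 := mu1.
have [h ->] : exists h, y = x + h by exists (y - x); rewrite addrC subrK.
rewrite (addrC x h) addrK (addrC h x) => hy.
apply: norm_csq; first by rewrite !mulr_ge0// ?invr_ge0 exprn_ge0// ltW.
rewrite csq_phi_taylor; [|exact: far_neq0|exact: far_neq0].
have p1 : 0 < csq x by exact: lt_le_trans mu0 _.
have p2 : 0 < csq (x + h) by exact: lt_le_trans mu0 _.
rewrite ler_pdivrMr; last by rewrite mulr_gt0// exprn_gt0.
apply: (@le_trans _ _ ((2 * `|h| ^+ 2) ^+ 2)).
  by rewrite ler_sqr ?nnegrE ?csq_ge0 ?csq_le// mulr_ge0// exprn_ge0.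
have -> : (2 / mu ^+ 2 * `|h| ^+ 2) ^+ 2 * (csq x ^+ 2 * csq (x + h)) =
   (2 * `|h| ^+ 2) ^+ 2 * ((csq x / mu) ^+ 2 * ((csq (x + h) / mu) / mu)).
  by field; rewrite gt_eqF.
rewrite -[leLHS]mulr1; apply: ler_wpM2l; first by rewrite exprn_ge0// mulr_ge0// exprn_ge0.
have h1 : 1 <= csq x / mu by rewrite ler_pdivlMr// mul1r.
have h2 : 1 <= csq (x + h) / mu by rewrite ler_pdivlMr// mul1r.
have h3 : 1 <= csq (x + h) / mu / mu by rewrite ler_pdivlMr// mul1r; exact: le_trans h2.
rewrite -[leLHS]mulr1; apply: ler_pM => //; first by rewrite exprn_ege1.
Qed.

Lemma dphi_lip x y h : mu <= csq x -> mu <= csq y -> `|x| <= 4 -> `|y| <= 4 ->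
  `|dphi x h - dphi y h| <= 32 / mu ^+ 2 * (`|x - y| * `|h|).
Proof.
move=> hx hy x4 y4; have m0 := mu0; have m1 := mu1.
apply: norm_csq; first by rewrite !mulr_ge0// ?invr_ge0 exprn_ge0// ltW.
rewrite csq_dphiB; [|exact: far_neq0|exact: far_neq0].
have p1 : 0 < csq x by exact: lt_le_trans mu0 _.
have p2 : 0 < csq y by exact: lt_le_trans mu0 _.
rewrite ler_pdivrMr; last by rewrite mulr_gt0// exprn_gt0.
have xy : `|x + y| ^+ 2 <= 64.
  have -> : 64 = (8 : R) ^+ 2 by ring.
  by rewrite ler_sqr ?nnegrE//; apply: (le_trans (ler_normD _ _)); lra.
apply: (@le_trans _ _ ((2 * `|x - y| ^+ 2) * 128 * (2 * `|h| ^+ 2))).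
  apply: ler_pM; rewrite ?mulr_ge0 ?csq_ge0 ?csq_le//.
  apply: ler_pM; rewrite ?mulr_ge0 ?csq_ge0 ?csq_le//.
  by apply: (le_trans (csq_le _)); lra.
have -> : (32 / mu ^+ 2 * (`|x - y| * `|h|)) ^+ 2 * (csq x ^+ 2 * csq y ^+ 2) =
   (2 * `|x - y| ^+ 2 * 128 * (2 * `|h| ^+ 2)) * (2 * ((csq x / mu) ^+ 2 * (csq y / mu) ^+ 2)).
  by field; rewrite gt_eqF.
rewrite -[leLHS]mulr1; apply: ler_wpM2l; first by rewrite !mulr_ge0// exprn_ge0.
have h1 : 1 <= csq x / mu by rewrite ler_pdivlMr// mul1r.
have h2 : 1 <= csq y / mu by rewrite ler_pdivlMr// mul1r.
have : 1 * 1 <= (csq x / mu) ^+ 2 * (csq y / mu) ^+ 2 by apply: ler_pM => //; rewrite exprn_ege1.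
lra.
Qed.

(** The upper bound is [ln (1 + s) <= s]; the same inequality for [(1 + s)^-1] gives the lower bound
    [s / (1 + s)]. *)
Lemma ln_expansion (s : R) : -1 < s -> `|ln (1 + s) - s| <= s ^+ 2 / (1 + s).
Proof.
move=> s1; have p : 0 < 1 + s by lra.
have up := le_ln1Dx s1.
have lo : s / (1 + s) <= ln (1 + s).
  have : - (s / (1 + s)) > -1.
    by rewrite ltrN2 ltr_pdivrMr//; lra.
  move=> /le_ln1Dx; rewrite (_ : 1 + - (s / (1 + s)) = (1 + s)^-1); last by field; rewrite gt_eqF.
  by rewrite lnV ?posrE// lerN2.
have e : s / (1 + s) = s - s ^+ 2 / (1 + s) by field; rewrite gt_eqF.
by rewrite ler_norml; apply/andP; split; move: up lo; rewrite e; have : 0 <= s ^+ 2 / (1 + s) by [rewrite divr_ge0 ?sqr_ge0// ltW]; lra.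
Qed.

(** [dot (phi x) (y - x)] is half the relative increment [s] of [csq], up to
    [csq (y - x) / (2 * csq x)], so that the estimate reduces to [ln_expansion]. *)
Lemma ln_taylor x y : mu <= csq x -> mu <= csq y -> `|x| <= 4 -> `|y| <= 4 ->
  `|ln (csq y) / 2 - ln (csq x) / 2 - dot (phi x) (y - x)| <= 129 / mu ^+ 2 * `|y - x| ^+ 2.
Proof.
move=> hx hy x4 y4; have m0 := mu0; have m1 := mu1.
have p1 : 0 < csq x by exact: lt_le_trans mu0 _.
have p2 : 0 < csq y by exact: lt_le_trans mu0 _.
pose s := csq y / csq x - 1.
have s1 : 1 + s = csq y / csq x by rewrite /s; ring.
have sg : -1 < s by have : 0 < csq y / csq x by [rewrite divr_gt0]; rewrite /s; lra.
have := ln_expansion sg; rewrite s1 ln_div ?posrE//.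
have -> : s ^+ 2 / (csq y / csq x) = dot (x + y) (y - x) ^+ 2 / (csq x * csq y).
  have -> : dot (x + y) (y - x) = csq y - csq x by rewrite /dot /csq !ptE; ring.
  by rewrite /s; field; rewrite !gt_eqF.
have -> : ln (csq y) / 2 - ln (csq x) / 2 - dot (phi x) (y - x) =
   (ln (csq y) - ln (csq x) - s) / 2 + csq (y - x) / (2 * csq x).
  have -> : dot (phi x) (y - x) = (csq y - csq x - csq (y - x)) / (2 * csq x).
    by move: (gt_eqF p1); rewrite /dot /phi /csq !ptE => /negbT hn; field; rewrite hn.
  by rewrite /s; field; rewrite gt_eqF.
move=> H; apply: (le_trans (ler_normD _ _)).
have i1 : dot (x + y) (y - x) ^+ 2 / (csq x * csq y) <= 256 / mu ^+ 2 * `|y - x| ^+ 2.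
  rewrite ler_pdivrMr ?mulr_gt0//.
  apply: (@le_trans _ _ (256 * `|y - x| ^+ 2)).
    have -> : 256 * `|y - x| ^+ 2 = (16 * `|y - x|) ^+ 2 by ring.
    rewrite -[leLHS]real_normK ?num_real// ler_sqr ?nnegrE ?normr_ge0 ?mulr_ge0//.
    apply: (le_trans (dot_le _ _)).
    have : `|x + y| * `|y - x| <= 8 * `|y - x|.
      by apply: ler_wpM2r => //; apply: (le_trans (ler_normD _ _)); lra.
    lra.
  have -> : 256 / mu ^+ 2 * `|y - x| ^+ 2 * (csq x * csq y) =
    (256 * `|y - x| ^+ 2) * ((csq x / mu) * (csq y / mu)) by field; rewrite gt_eqF.
  rewrite -[leLHS]mulr1; apply: ler_wpM2l; first by rewrite mulr_ge0// exprn_ge0.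
  have h1 : 1 <= csq x / mu by rewrite ler_pdivlMr// mul1r.
  have h2 : 1 <= csq y / mu by rewrite ler_pdivlMr// mul1r.
  by rewrite -[leLHS]mulr1; apply: ler_pM.
have i2 : csq (y - x) / (2 * csq x) <= 1 / mu ^+ 2 * `|y - x| ^+ 2.
  rewrite ler_pdivrMr ?mulr_gt0//; apply: (le_trans (csq_le _)).
  have -> : 1 / mu ^+ 2 * `|y - x| ^+ 2 * (2 * csq x) =
    (2 * `|y - x| ^+ 2) * ((csq x / mu) / mu) by field; rewrite gt_eqF.
  rewrite -[leLHS]mulr1; apply: ler_wpM2l; first by rewrite mulr_ge0// exprn_ge0.
  have h1 : 1 <= csq x / mu by rewrite ler_pdivlMr// mul1r.
  by rewrite ler_pdivlMr// mul1r; exact: le_trans h1.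
rewrite [X in _ + X]ger0_norm; last by rewrite divr_ge0 ?csq_ge0// mulr_ge0// ltW.
rewrite normrM (_ : `|2^-1| = 2^-1); last by rewrite ger0_norm.
have -> : 129 / mu ^+ 2 * `|y - x| ^+ 2 = (256 / mu ^+ 2 * `|y - x| ^+ 2) / 2 + 1 / mu ^+ 2 * `|y - x| ^+ 2.
  by field; rewrite gt_eqF.
apply: lerD => //; apply: ler_wpM2r => //; exact: le_trans i1.
Qed.

End KernelEstimates.

(** * Continuity of plane-valued maps *)

Section VectorContinuity.
Context {R : realType} {T : topologicalType}.
Implicit Types f g : T -> pt R.

Lemma vctD f g : continuous f -> continuous g -> continuous (fun t => f t + g t).
Proof. by move=> cf cg x; exact: cvgD (cf x) (cg x). Qed.

Lemma vctN f : continuous f -> continuous (fun t => - f t).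
Proof. by move=> cf x; exact: cvgN (cf x). Qed.

Lemma vctZ (k : T -> R) f : continuous k -> continuous f -> continuous (fun t => k t *: f t).
Proof. by move=> ck cf x; exact: cvgZ (ck x) (cf x). Qed.

Lemma vctJ f : continuous f -> continuous (fun t => Jr (f t)).
Proof. by move=> cf; rewrite /Jr; ctn. Qed.

Lemma vct_dot (F G : T -> pt R) : continuous F -> continuous G ->
  continuous (fun t => dot (F t) (G t)).
Proof. by move=> cF cG; rewrite /dot; ctn. Qed.

(** Continuity is asked for indices in the range alone, since the separation of the vortices is
    known for [0 < j < N] only. *)
Lemma vct_sum m n (F : nat -> T -> pt R) :
  (forall j, (m <= j < n)%N -> continuous (F j)) -> continuous (fun t => \sum_(m <= j < n) F j t).
Proof.
move=> cF; rewrite (_ : (fun t => _) = fun t => \sum_(m <= j < n) (if (m <= j < n)%N then F j t else 0)).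
  elim: (index_iota m n) => [|i r IH].
    by rewrite (_ : (fun t => _) = fun=> 0); [exact: ct_cst|apply/funext => t; rewrite big_nil].
  under [X in continuous X]funext do rewrite big_cons.
  have ci : continuous (fun t => if (m <= i < n)%N then F i t else 0).
    by have [h|h] := boolP (m <= i < n)%N; [exact: cF|exact: ct_cst].
  exact: vctD.
by apply/funext => t; rewrite big_nat [RHS]big_nat; apply: eq_bigr => j ->.
Qed.

Lemma norm_sum_nat (V : normedModType R) m n (F : nat -> V) (B : R) : 0 <= B ->
  (forall j, (m <= j < n)%N -> `|F j| <= B) -> `|\sum_(m <= j < n) F j| <= n%:R * B.
Proof.
move=> B0 FB; apply: (le_trans (ler_norm_sum _ _ _)).
apply: (@le_trans _ _ (\sum_(m <= j < n) B)).
  by rewrite big_nat [leRHS]big_nat; apply: ler_sum => j; exact: FB.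
by rewrite sumr_const_nat -[leLHS]mulr_natl; apply: ler_wpM2r => //; rewrite ler_nat leq_subr.
Qed.

Lemma normZ_gt0 (k : R) (x : pt R) : 0 < k -> `|k *: x| = k * `|x|.
Proof. by move=> k0; rewrite normrZ gtr0_norm. Qed.

Lemma normJ (x : pt R) : `|Jr x| = `|x|.
Proof. by rewrite !prod_normE /= normrN maxC. Qed.

Lemma half_pow (B e : R) : 0 <= B -> 0 < e ->
  exists n0, forall n, (n0 <= n)%N -> 2^-1 ^+ n * B <= e.
Proof.
move=> B0 e0; exists (Num.bound (B / e)) => n nn.
have n1 : B / e < n%:R.
  by apply: lt_le_trans (archi_boundP _) _; [exact: divr_ge0 (ltW e0)|rewrite ler_nat].
rewrite exprVn mulrC ler_pdivrMr ?exprn_gt0//; rewrite ltr_pdivrMr// in n1.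
apply: (le_trans (ltW n1)); rewrite mulrC; apply: ler_wpM2l; first exact: ltW.
by rewrite -natrX ler_nat ltnW// ltn_expl.
Qed.

Lemma finite_min (f : nat -> R) n : (forall j, (0 < j < n)%N -> 0 < f j) ->
  exists2 m : R, 0 < m <= 1 & forall j, (0 < j < n)%N -> m <= f j.
Proof.
elim: n => [|n IH] fp; first by exists 1; rewrite ?ltr01 ?lexx// => j; rewrite ltn0 andbF.
have [|m /andP[m0 m1] H] := IH.
  by move=> j /andP[j0 jn]; apply: fp; rewrite j0 ltnW.
have [n0|n0] := posnP n.
  by exists m; rewrite ?m0// n0 => j /andP[]; case: j.
have fn : 0 < f n by apply: fp; rewrite n0 ltnSn.
exists (Num.min m (f n)); first by rewrite lt_min m0 fn ge_min m1.
move=> j /andP[j0]; rewrite ltnS leq_eqVlt => /orP[/eqP->|jn]; first by rewrite ge_min lexx orbT.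
by rewrite ge_min H// j0.
Qed.

End VectorContinuity.

Ltac vctn := repeat match goal with
  | H : ?P |- ?P => exact H
  | |- continuous (fun _ => ?c) => exact: (@ct_cst _ _ c)
  | |- continuous (fun x => @?k x *: @?f x) => apply: (@vctZ _ _ k f)
  | |- continuous (fun x => Jr (@?f x)) => apply: (@vctJ _ _ f)
  | |- continuous (fun x => dot (@?f x) (@?g x)) => apply: (@vct_dot _ _ f g)
  | |- continuous ?h => match type of h with _ -> ?S =>
     match eval hnf in S with prod _ _ => match goal with
       | |- continuous (fun x => @?f x + @?g x) => apply: (@vctD _ _ f g)
       | |- continuous (fun x => - @?f x) => apply: (@vctN _ _ f)
       end end end
  | _ => progress ctn
  end.

(** * The contraction that produces the correction [v] *)

Section Contraction.
Context {R : realType} (N : nat) (N2 : (2 <= N)%N).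
Local Notation th := (@th R N).
Local Notation W := (@W R N).
Variables (D : pt R -> pt R -> pt R) (a0 : pt R) (rho L mu : R).
Hypotheses (rho0 : 0 < rho) (L0 : 0 < L) (mu0 : 0 < mu) (mu1 : mu <= 1).
Hypothesis farW : forall j (t : R), (0 < j < N)%N -> 2 * mu <= csq (W j t).
Hypothesis DL : forall x y x' y' (e : R), 0 <= e ->
    `|x - a0| <= rho -> `|y - a0| <= rho -> `|x' - a0| <= rho -> `|y' - a0| <= rho ->
    `|x' - x| <= e -> `|y' - y| <= e -> `|D x' y' - D x y| <= L * e.

(** [2 * pi * cc * r ^+ 2] is the prescribed period [T_r], and [kap = cc / pi] is the strength of
    the logarithmic interaction in the rescaled equation. *)
Definition kap : R := 2 / (N%:R - 1).
Definition cc : R := 2 * pi / (N%:R - 1).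
(** The radius around [cis] within which the vortices stay separated: perturbing [W] by [2 * del]
    lowers [csq] by at most [16 * del = mu]. *)
Definition del : R := mu / 16.
Definition M1 : R := `|D a0 a0| + L * rho.

Lemma N1_gt0 : 0 < N%:R - 1 :> R.
Proof. by rewrite subr_gt0 (ltr_nat _ 1). Qed.

Lemma kap_gt0 : 0 < kap. Proof. by rewrite /kap divr_gt0// N1_gt0. Qed.
Lemma cc_gt0 : 0 < cc. Proof. by rewrite /cc divr_gt0 ?tpi_gt0// N1_gt0. Qed.
Lemma rc_gt0 (r : R) : 0 < r -> 0 < 2 * r * cc.
Proof. by move=> r0; apply: mulr_gt0; [rewrite mulr_gt0|exact: cc_gt0]. Qed.
Lemma M1_ge0 : 0 <= M1. Proof. by rewrite /M1 addr_ge0// mulr_ge0// ltW. Qed.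

Definition adm (u : R -> pt R) :=
  [/\ continuous u, per u & forall t, `|u t - cis t| <= del].
Definition oka (a : pt R) := `|a - a0| <= rho / 2.
Definition okr (r : R) := [/\ 0 < r, r <= 1 & r <= rho / 4].

(* For [z_k t = a + r u (t / (cc r^2) + th k)], with [D] the gradient of [g] in its first variable,
   the Hamiltonian system is [u' = i Y a r u]. *)
Definition S1 (u : R -> pt R) t := \sum_(1 <= j < N) phi (u t - u (t + th j)).
Definition S2 (a : pt R) (r : R) (u : R -> pt R) t :=
  \sum_(0 <= j < N) D (a + r *: u t) (a + r *: u (t + th j)).
Definition Y a r u t := kap *: S1 u t + (2 * r * cc) *: S2 a r u t.

Lemma adm_bound u t : adm u -> `|u t| <= 2.
Proof.
move=> [_ _ ud]; rewrite -(subrK (cis t) (u t)); apply: (le_trans (ler_normD _ _)).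
by have := ud t; have := cis_bound t; have := mu1; rewrite /del; lra.
Qed.

Lemma adm_far u t j : adm u -> (0 < j < N)%N ->
  mu <= csq (u t - u (t + th j)) /\ `|u t - u (t + th j)| <= 4.
Proof.
move=> au jN; split; last first.
  by apply: (le_trans (ler_normB _ _)); have := adm_bound t au; have := adm_bound (t + th j) au; lra.
have [_ _ ud] := au.
pose V := (u t - cis t) - (u (t + th j) - cis (t + th j)).
have -> : u t - u (t + th j) = W j t + V by apply: pt_eq; rewrite /W /V !ptE; ring.
have V2 : `|V| <= 2 * del.
  by apply: (le_trans (ler_normB _ _)); have := ud t; have := ud (t + th j); lra.
have W2 : `|W j t| <= 2.
  by apply: (le_trans (ler_normB _ _)); have := cis_bound t; have := cis_bound (t + th j); lra.
have -> : csq (W j t + V) = csq (W j t) + 2 * dot (W j t) V + csq V by rewrite /csq /dot !ptE; ring.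
have := csq_ge0 V; have := farW t jN; have := dot_le (W j t) V.
have : `|W j t| * `|V| <= 2 * (2 * del) by apply: ler_pM.
rewrite ler_norml /del; have m0 := mu0.
move: (`|W j t| * `|V|) (dot _ _) (csq _) (csq _) => p q x y h1 /andP[h2 _] h3 h4; lra.
Qed.

Lemma ok_ball a r u t : oka a -> okr r -> adm u -> `|a + r *: u t - a0| <= rho.
Proof.
rewrite /oka => oa [r0 r1 r4] au.
have -> : a + r *: u t - a0 = (a - a0) + r *: u t by rewrite addrAC.
apply: (le_trans (ler_normD _ _)); rewrite normrZ gtr0_norm//.
have : r * `|u t| <= r * 2 by apply: ler_wpM2l; [exact: ltW|exact: adm_bound].
lra.
Qed.

Lemma S1_lip (u u' : R -> pt R) (t s e : R) : adm u -> adm u' -> 0 <= e ->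
  `|u t - u' s| <= e -> (forall j, `|u (t + th j) - u' (s + th j)| <= e) ->
  `|S1 u t - S1 u' s| <= N%:R * (2 / mu * (2 * e)).
Proof.
move=> au au' e0 h h'; rewrite /S1 -sumrB.
have m0 := mu0; have q0 : 0 <= 2 / mu by rewrite divr_ge0// ltW.
apply: norm_sum_nat; first by rewrite !mulr_ge0// invr_ge0 ltW.
move=> j jN; have [f1 _] := adm_far t au jN; have [f2 _] := adm_far s au' jN.
apply: (le_trans (phi_lip mu0 f1 f2)); apply: ler_wpM2l => //.
rewrite (_ : u t - u (t + th j) - (u' s - u' (s + th j)) =
  (u t - u' s) - (u (t + th j) - u' (s + th j))); last by apply: pt_eq; rewrite !ptE; ring.
by apply: (le_trans (ler_normB _ _)); have := h' j; lra.
Qed.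

Lemma S2_lip a a' r (u u' : R -> pt R) (t s e d : R) : adm u -> adm u' -> oka a -> oka a' -> okr r ->
  0 <= e -> `|a - a'| <= d ->
  `|u t - u' s| <= e -> (forall j, `|u (t + th j) - u' (s + th j)| <= e) ->
  `|S2 a r u t - S2 a' r u' s| <= N%:R * (L * (d + r * e)).
Proof.
move=> au au' oa oa' kr e0 hd h h'; rewrite /S2 -sumrB; have [r0 r1 r4] := kr.
have d0 : 0 <= d by exact: le_trans hd.
have e1 : 0 <= d + r * e by rewrite addr_ge0// mulr_ge0// ltW.
apply: norm_sum_nat; first by rewrite mulr_ge0// ltW.
move=> j _; apply: DL => //; try exact: ok_ball.
- rewrite (_ : _ - _ = (a - a') + r *: (u t - u' s)); last by apply: pt_eq; rewrite !ptE; ring.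
  apply: (le_trans (ler_normD _ _)); rewrite normrZ gtr0_norm//; apply: lerD => //.
  by apply: ler_wpM2l => //; exact: ltW.
- rewrite (_ : _ - _ = (a - a') + r *: (u (t + th j) - u' (s + th j))); last by apply: pt_eq; rewrite !ptE; ring.
  apply: (le_trans (ler_normD _ _)); rewrite normrZ gtr0_norm//; apply: lerD => //.
  by apply: ler_wpM2l => //; exact: ltW.
Qed.

Lemma S2_bound a r u t : adm u -> oka a -> okr r -> `|S2 a r u t| <= N%:R * M1.
Proof.
move=> au oa kr; apply: norm_sum_nat; first exact: M1_ge0.
move=> j _; rewrite -(subrK (D a0 a0) (D _ _)) /M1 addrC; apply: (le_trans (ler_normD _ _)).
have z : `|a0 - a0| <= rho by rewrite subrr normr0 ltW.
by rewrite lerD2l; apply: DL => //; [exact: ltW|exact: ok_ball..].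
Qed.

Lemma adm_cis : adm cis.
Proof.
split; first by rewrite /cis; ctn.
  by move=> t; rewrite /cis per_cos per_sin.
by move=> t; rewrite subrr normr0 /del; have := mu0; lra.
Qed.

Lemma th0 : th 0 = 0. Proof. by rewrite /th mulr0 mul0r. Qed.

Lemma S1_continuous u : adm u -> continuous (S1 u).
Proof.
move=> au; have [cu _ _] := au; apply: vct_sum => j jN; rewrite /phi.
apply: vctZ; last by vctn.
apply: ctV; first by move=> t; have [f _] := adm_far t au jN; exact: far_neq0 f.
by rewrite /csq; vctn.
Qed.

Lemma D_continuous (z z' : R -> pt R) : continuous z -> continuous z' ->
  (forall t, `|z t - a0| <= rho /\ `|z' t - a0| <= rho) -> continuous (fun t => D (z t) (z' t)).
Proof.
move=> cz cz' zb t; apply/cvgrPdist_le => e e0; have L_ := L0.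
have d0 : 0 < e / L by rewrite divr_gt0.
have h1 := cz t; move/cvgrPdist_le : h1 => /(_ _ d0) h1.
have h2 := cz' t; move/cvgrPdist_le : h2 => /(_ _ d0) h2.
apply: filterS2 h1 h2 => s h1 h2; have [b1 b2] := zb t; have [b3 b4] := zb s.
have := DL (ltW d0) b3 b4 b1 b2 h1 h2; rewrite (mulrC L) divfK// gt_eqF//.
Qed.

Lemma S2_continuous a r u : adm u -> oka a -> okr r -> continuous (S2 a r u).
Proof.
move=> au oa kr; have [cu pu _] := au; apply: vct_sum => j _.
apply: D_continuous; [by vctn|by vctn|].
by move=> t; split; exact: ok_ball.
Qed.

Lemma Y_continuous a r u : adm u -> oka a -> okr r -> continuous (Y a r u).
Proof.
move=> au oa kr; have c1 := S1_continuous au; have c2 := S2_continuous au oa kr.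
by rewrite /Y; vctn.
Qed.

Lemma per_th (u : R -> pt R) t j : per u -> u (t + 2 * pi + th j) = u (t + th j).
Proof. by move=> pu; rewrite addrAC pu. Qed.

Lemma per_Y a r u : per u -> per (Y a r u).
Proof.
move=> pu t; rewrite /Y /S1 /S2; congr (_ *: _ + _ *: _); apply: eq_bigr => j _;
  by rewrite pu per_th.
Qed.

(** The remainder is of order [d * e], one factor being the distance to [cis] and the other the
    increment; this gives [Nl] a small Lipschitz constant on small balls. *)
Lemma S1_taylor (u u' : R -> pt R) (t d e : R) : adm u -> adm u' -> 0 <= e ->
  (forall t, `|u t - cis t| <= d) -> (forall t, `|u' t - cis t| <= d) ->
  (forall t, `|u t - u' t| <= e) ->
  `|S1 u t - S1 u' t - \sum_(1 <= j < N) dphi (W j t) ((u t - u' t) - (u (t + th j) - u' (t + th j)))|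
    <= N%:R * (144 / mu ^+ 2 * (d * e)).
Proof.
move=> au au' e0 ud ud' uu; rewrite /S1 -!sumrB; have m0 := mu0.
have d0 : 0 <= d by exact: le_trans (ud 0).
have m2 : 0 < mu ^+ 2 by rewrite exprn_gt0.
apply: norm_sum_nat; first by rewrite !mulr_ge0// invr_ge0 ltW.
move=> j jN; have [f1 g1] := adm_far t au jN; have [f2 g2] := adm_far t au' jN.
have [f3 g3] := adm_far t adm_cis jN.
pose x := u t - u (t + th j); pose y := u' t - u' (t + th j).
have xy : `|x - y| <= 2 * e.
  rewrite (_ : x - y = (u t - u' t) - (u (t + th j) - u' (t + th j))); last by apply: pt_eq; rewrite !ptE; ring.
  by apply: (le_trans (ler_normB _ _)); have := uu t; have := uu (t + th j); lra.
have xyd : `|x - y| <= 4 * d.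
  rewrite (_ : x - y = ((u t - cis t) - (u' t - cis t)) - ((u (t + th j) - cis (t + th j)) - (u' (t + th j) - cis (t + th j)))); last by apply: pt_eq; rewrite !ptE; ring.
  apply: (le_trans (ler_normB _ _)).
  have := ler_normB (u t - cis t) (u' t - cis t); have := ler_normB (u (t + th j) - cis (t + th j)) (u' (t + th j) - cis (t + th j)).
  by have := ud t; have := ud' t; have := ud (t + th j); have := ud' (t + th j); lra.
have yW : `|y - W j t| <= 2 * d.
  rewrite (_ : y - W j t = (u' t - cis t) - (u' (t + th j) - cis (t + th j))); last by apply: pt_eq; rewrite /W !ptE; ring.
  by apply: (le_trans (ler_normB _ _)); have := ud' t; have := ud' (t + th j); lra.
rewrite (_ : u t - u' t - _ = x - y); last by apply: pt_eq; rewrite !ptE; ring.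
rewrite -/x -/y in f1 f2 g1 g2 *.
rewrite (_ : phi x - phi y - dphi (W j t) (x - y) =
  (phi x - phi y - dphi y (x - y)) + (dphi y (x - y) - dphi (W j t) (x - y))); last first.
  by rewrite addrA subrK.
apply: (le_trans (ler_normD _ _)).
have e1 := phi_taylor mu0 mu1 f2 f1.
have e2 := dphi_lip mu0 mu1 (x - y) f2 f3 g2 g3.
have e3 : `|x - y| ^+ 2 <= (4 * d) * (2 * e) by rewrite expr2; apply: ler_pM.
have e4 : `|y - W j t| * `|x - y| <= (2 * d) * (2 * e) by apply: ler_pM.
apply: (@le_trans _ _ (2 / mu ^+ 2 * ((4 * d) * (2 * e)) + 32 / mu ^+ 2 * ((2 * d) * (2 * e)))).
  apply: lerD.
    by apply: (le_trans e1); apply: ler_wpM2l => //; rewrite divr_ge0// ltW.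
  by apply: (le_trans e2); apply: ler_wpM2l => //; rewrite divr_ge0// ltW.
rewrite (_ : _ + _ = 144 / mu ^+ 2 * (d * e)) //; field; by rewrite gt_eqF.
Qed.

(** The regular polygon is a relative equilibrium: each term has radial part [(N - 1)^-1], and the
    tangential parts cancel between [j] and [N - j]. *)
Lemma kap_S1_cis t : kap *: S1 cis t = cis t.
Proof.
have n1 := N1_gt0.
have E j : (1 <= j < N)%N -> kap *: phi (W j t) =
    (N%:R - 1)^-1 *: cis t - (bco N j * sin (th j)) *: Jr (cis t).
  move=> jN; have c1 : cos (th j) < 1 := cos_th_lt1 jN.
  rewrite /phi csq_W /bco /kap.
  have -> : W j t = (1 - cos (th j)) *: cis t - sin (th j) *: Jr (cis t).
    by apply: pt_eq; rewrite /W !ptE /= ?cosD ?sinD; ring.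
  move: (cis t) (Jr _) => p q; apply: pt_eq; rewrite !ptE; field; rewrite gt_eqF//; lra.
rewrite /S1 scaler_sumr (eq_big_nat _ _ E) big_split /= sumr_const_nat sumrN.
rewrite -scaler_suml sum_bsin// scale0r subr0 -scaler_nat scalerA natrB ?(ltnW N2)//.
by rewrite mulfV ?scale1r// gt_eqF.
Qed.

(** What the linearization at [r = 0] leaves of the equation: [cis + v] solves [u' = i Y a r u]
    exactly when [v' = Lin v + Nl a r v]. *)
Definition Nl a r (v : R -> pt R) t := Jr (Y a r (fun t => cis t + v t) t) - Lin N v t - Jr (cis t).

Definition small (d : R) (v : R -> pt R) := [/\ continuous v, per v & forall t, `|v t| <= d].

Lemma adm_small d v : d <= del -> small d v -> adm (fun t => cis t + v t).
Proof.
move=> dd [cv pv vd]; have [cc pc _] := adm_cis; split; [exact: vctD|by move=> t; rewrite pc pv|].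
by move=> t; rewrite addrC addKr; exact: le_trans dd.
Qed.

Lemma Lin_continuous (v : R -> pt R) : continuous v -> continuous (Lin N v).
Proof.
move=> cv; rewrite /Lin; apply: vctZ; first exact: ct_cst.
apply: vctJ; apply: vct_sum => j jN; rewrite /dphi.
have [cc _ _] := adm_cis.
have cW : continuous (fun t => W j t) by rewrite /W; vctn.
have W0 t : csq (W j t) != 0 by have [f _] := adm_far t adm_cis jN; exact: (far_neq0 mu0 f).
have cs : continuous (fun t => csq (W j t)) by rewrite /csq; vctn.
have ci : continuous (fun t => (csq (W j t))^-1) by exact: ctV.
have ci2 : continuous (fun t => (csq (W j t) ^+ 2)^-1).
  by apply: ctV; [move=> t; rewrite expf_neq0|ctn].
by vctn.
Qed.

Lemma Nl_continuous a r d v : d <= del -> small d v -> oka a -> okr r -> continuous (Nl a r v).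
Proof.
move=> dd sv oa kr; have cY := Y_continuous (adm_small dd sv) oa kr.
have [cv _ _] := sv; have cL := Lin_continuous cv; have [cc _ _] := adm_cis.
by rewrite /Nl; vctn.
Qed.

Lemma per_Nl a r v : per v -> per (Nl a r v).
Proof.
move=> pv t; have [_ pc _] := adm_cis; rewrite /Nl; congr (_ - _ - _).
- by congr Jr; apply: per_Y => s; rewrite pc pv.
- rewrite /Lin; congr (_ *: Jr _); apply: eq_bigr => j _.
  by rewrite /W pv pc !per_th.
- by rewrite pc.
Qed.

Definition ANl : R := kap * (N%:R * (144 / mu ^+ 2)) + 2 * cc * (N%:R * L).

Lemma Nl_lip a r d e v v' t : d <= del -> small d v -> small d v' -> oka a -> okr r -> 0 <= e ->
  (forall t, `|v t - v' t| <= e) -> `|Nl a r v t - Nl a r v' t| <= ANl * (d + r) * e.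
Proof.
move=> dd sv sv' oa kr e0 vv; have [r0 r1 _] := kr.
have au := adm_small dd sv; have au' := adm_small dd sv'.
have [_ _ vd] := sv; have [_ _ vd'] := sv'.
have d0 : 0 <= d by exact: le_trans (vd 0).
set u := fun t => cis t + v t; set u' := fun t => cis t + v' t.
have uu s : u s - u' s = v s - v' s by apply: pt_eq; rewrite /u /u' !ptE; ring.
have E : Nl a r v t - Nl a r v' t = Jr (kap *: (S1 u t - S1 u' t -
     \sum_(1 <= j < N) dphi (W j t) ((u t - u' t) - (u (t + th j) - u' (t + th j))))
     + (2 * r * cc) *: (S2 a r u t - S2 a r u' t)).
  have := LinB N v v' t; rewrite {1}/Lin -/kap => LB.
  rewrite /Nl -/u -/u' /Y.
  transitivity (Jr (kap *: (S1 u t - S1 u' t) + (2 * r * cc) *: (S2 a r u t - S2 a r u' t))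
     - (Lin N v t - Lin N v' t)).
    by apply: pt_eq; rewrite !ptE; ring.
  rewrite -LB; under eq_bigr do rewrite -!uu.
  by move: (\sum_(1 <= j < N) _) => S; apply: pt_eq; rewrite !ptE; ring.
rewrite E normJ; apply: (le_trans (ler_normD _ _)).
have k0 := kap_gt0; have c0 := cc_gt0.
have rc := rc_gt0 r0.
rewrite (normZ_gt0 _ k0) (normZ_gt0 _ rc).
have h1 : kap * `|S1 u t - S1 u' t - \sum_(1 <= j < N) dphi (W j t) ((u t - u' t) - (u (t + th j) - u' (t + th j)))|
   <= kap * (N%:R * (144 / mu ^+ 2 * (d * e))).
  apply: ler_wpM2l; first exact: ltW.
  apply: S1_taylor => // s; rewrite ?uu//; by rewrite /u /u' addrC addKr.
have h2 : 2 * r * cc * `|S2 a r u t - S2 a r u' t| <= 2 * r * cc * (N%:R * (L * (0 + r * e))).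
  apply: ler_wpM2l; first exact: ltW.
  apply: S2_lip => //; first by rewrite subrr normr0.
    by rewrite uu.
  by move=> j; rewrite uu.
apply: (le_trans (lerD h1 h2)); rewrite add0r.
have -> : kap * (N%:R * (144 / mu ^+ 2 * (d * e))) + 2 * r * cc * (N%:R * (L * (r * e))) =
  (kap * (N%:R * (144 / mu ^+ 2)) * d + 2 * cc * (N%:R * L) * (r * r)) * e by ring.
apply: ler_wpM2r => //; rewrite /ANl.
have p1 : 0 <= kap * (N%:R * (144 / mu ^+ 2)) * r.
  apply: mulr_ge0; last exact: ltW.
  apply: mulr_ge0; first exact: ltW.
  by rewrite !mulr_ge0// invr_ge0 exprn_ge0// ltW.
have p2 : 0 <= 2 * cc * (N%:R * L).
  by apply: mulr_ge0; apply: mulr_ge0 => //; exact: ltW.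
have p3 : 2 * cc * (N%:R * L) * (r * r) <= 2 * cc * (N%:R * L) * r.
  by apply: ler_wpM2l => //; rewrite -[leRHS]mulr1; apply: ler_wpM2l => //; exact: ltW.
have p4 : 0 <= 2 * cc * (N%:R * L) * d by rewrite mulr_ge0.
by move: p1 p2 p3 p4; move: (kap * (N%:R * (144 / mu ^+ 2))) (2 * cc * (N%:R * L)) => A B; lra.
Qed.

Lemma Nl0_bound a r t : oka a -> okr r -> `|Nl a r (fun=> 0) t| <= 2 * cc * (N%:R * M1) * r.
Proof.
move=> oa kr; have [r0 r1 _] := kr; rewrite /Nl Lin_cst.
rewrite (_ : (fun t => cis t + 0) = cis); last by apply/funext => s; rewrite addr0.
rewrite /Y kap_S1_cis (_ : _ - _ = (2 * r * cc) *: Jr (S2 a r cis t)); last first.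
  by apply: pt_eq; rewrite !ptE; ring.
have c0 := cc_gt0.
have rc := rc_gt0 r0.
rewrite (normZ_gt0 _ rc) normJ.
rewrite (_ : 2 * cc * (N%:R * M1) * r = 2 * r * cc * (N%:R * M1)); last by ring.
apply: ler_wpM2l; first exact: ltW.
by apply: S2_bound => //; exact: adm_cis.
Qed.

Lemma Nl_lip_a a a' r d v t : d <= del -> small d v -> oka a -> oka a' -> okr r ->
  `|Nl a r v t - Nl a' r v t| <= 2 * cc * (N%:R * L) * r * `|a - a'|.
Proof.
move=> dd sv oa oa' kr; have [r0 r1 _] := kr; have c0 := cc_gt0.
have au := adm_small dd sv.
rewrite /Nl /Y (_ : _ - _ = (2 * r * cc) *: Jr (S2 a r (fun t => cis t + v t) t - S2 a' r (fun t => cis t + v t) t)); last first.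
  by apply: pt_eq; rewrite !ptE; ring.
have rc := rc_gt0 r0.
rewrite (normZ_gt0 _ rc) normJ.
rewrite (_ : 2 * cc * (N%:R * L) * r * `|a - a'| = 2 * r * cc * (N%:R * (L * (`|a - a'| + r * 0)))); last by ring.
apply: ler_wpM2l; first exact: ltW.
by apply: S2_lip => //; rewrite ?subrr ?normr0// => j; rewrite subrr normr0.
Qed.

Lemma Nl_bound a r d v t : d <= del -> small d v -> oka a -> okr r ->
  `|Nl a r v t| <= ANl * (d + r) * d + 2 * cc * (N%:R * M1) * r.
Proof.
move=> dd sv oa kr; have [cv pv vd] := sv; have d0 : 0 <= d by exact: le_trans (vd 0).
have s0 : small d (fun=> 0) by split; [exact: ct_cst| |move=> s; rewrite normr0].
rewrite -(subrK (Nl a r (fun=> 0) t) (Nl a r v t)).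
apply: (le_trans (ler_normD _ _)); apply: lerD; last exact: Nl0_bound.
by apply: (@Nl_lip a r d d v (fun=> 0)) => // s; rewrite subr0.
Qed.

Lemma ANl_ge0 : 0 <= ANl.
Proof.
apply: addr_ge0; apply: mulr_ge0; rewrite ?(ltW kap_gt0)//.
- by rewrite !mulr_ge0// invr_ge0 exprn_ge0// ltW.
- by apply: mulr_ge0 => //; exact: (ltW cc_gt0).
- by rewrite mulr_ge0// ltW.
Qed.

Lemma small_limit d (u : nat -> R -> pt R) (l : R -> pt R) :
  (forall n, small d (u n)) ->
  (forall e : R, 0 < e -> exists n0, forall x, setT x -> forall n, (n0 <= n)%N -> `|l x - u n x| <= e) ->
  small d l.
Proof.
move=> su ul.
have bnd (x : R) (B : R) : (forall e : R, 0 < e -> x <= B + e) -> x <= B.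
  by move=> H; apply/ler_addgt0Pr => e e0; exact: H.
split.
- move=> t; have := @uniform_limit_within R R setT u l t ul.
  rewrite /= !withinET; apply=> // n; have [cu _ _] := su n; exact: cu.
- move=> t; apply/eqP; rewrite -subr_eq0 -normr_le0; apply: bnd => e e0.
  have e2 : 0 < e / 2 by rewrite divr_gt0.
  have [n0 H] := ul _ e2; have [_ pu _] := su n0.
  rewrite add0r -(subrK (u n0 t) (l (t + 2 * pi))) -addrA; apply: (le_trans (ler_normD _ _)).
  have := H (t + 2 * pi) I n0 (leqnn _); have := H t I n0 (leqnn _); rewrite pu (distrC (l t)).
  by move: (`|_|) (`|_|) => x y; lra.
- move=> t; apply: bnd => e e0; have [n0 H] := ul _ e0; have [_ _ ub] := su n0.
  rewrite -(subrK (u n0 t) (l t)); apply: (le_trans (ler_normD _ _)).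
  by rewrite addrC; apply: lerD; [exact: ub|exact: H].
Qed.

(** A fixed point of [v |-> K (Nl a r v)] in the ball of radius [C1 * r]. There [Nl] is [O(r)] at
    [v = 0], with Lipschitz constants [O(r)] in both [v] and [a], so for small [r] the map is a
    contraction with factor [1 / 2]. *)
Lemma fixed_point : exists r1 C1 : R, [/\ 0 < r1, 0 <= C1 & exists V : pt R -> R -> R -> pt R,
  (forall a r, oka a -> 0 < r <= r1 ->
    [/\ okr r /\ C1 * r <= del, small (C1 * r) (V a r), deriv_eq N (Nl a r (V a r)) (V a r),
        vmean (V a r) = 0 & mean (fun t => dot (Jr (cis t)) (V a r t)) = 0]) /\
  (forall a a' r t, oka a -> oka a' -> 0 < r <= r1 ->
    `|V a r t - V a' r t| <= C1 * r * `|a - a'|)].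
Proof.
have [K [CK [CK0 [KP [KL KB]]]]] := @linear_solution R N N2.
have c0 := cc_gt0; have M0 := M1_ge0; have A0 := ANl_ge0.
have N0 : 0 <= N%:R :> R by [].
pose B0 := 2 * cc * (N%:R * M1); have B00 : 0 <= B0.
  by apply: mulr_ge0; apply: mulr_ge0 => //; exact: ltW.
pose B1 := 2 * cc * (N%:R * L); have B10 : 0 <= B1.
  by apply: mulr_ge0; apply: mulr_ge0 => //; exact: ltW.
(* The first term controls the size of the fixed point, the second its Lipschitz constant in [a];
   the factors 2 come from the contraction factor [1 / 2]. *)
pose C1 := 2 * CK * B0 + 2 * CK * B1.
have CB0 : 0 <= CK * B0 by exact: mulr_ge0.
have CB1 : 0 <= CK * B1 by exact: mulr_ge0.
have C10 : 0 <= C1 by rewrite /C1 -!mulrA; lra.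
have CA0 : 0 <= CK * ANl * (C1 + 1) by rewrite !mulr_ge0// addr_ge0.
have r4 : 0 < rho / 4 by have := rho0; lra.
have de0 : 0 < del by rewrite /del divr_gt0.
pose r1 := Num.min (Num.min 1 (rho / 4)) (Num.min (del / (C1 + 1)) (1 / (2 * (CK * ANl * (C1 + 1) + 1)))).
have r10 : 0 < r1.
  by rewrite !lt_min ltr01 r4 !divr_gt0//; [rewrite mulr_gt0//; lra|lra].
have rP r : 0 < r <= r1 -> [/\ okr r, C1 * r <= del & CK * ANl * (C1 * r + r) <= 1 / 2].
  move=> /andP[r0 rr].
  have q1 : r <= 1 by apply: (le_trans rr); rewrite !ge_min lexx.
  have q2 : r <= rho / 4 by apply: (le_trans rr); rewrite !ge_min lexx !orbT.
  have q3 : r <= del / (C1 + 1) by apply: (le_trans rr); rewrite !ge_min lexx !orbT.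
  have q4 : r <= 1 / (2 * (CK * ANl * (C1 + 1) + 1)) by apply: (le_trans rr); rewrite !ge_min lexx !orbT.
  split; first by split.
    by move: q3; rewrite ler_pdivlMr; [lra|lra].
  move: q4; rewrite ler_pdivlMr; last by lra.
  rewrite (_ : C1 * r + r = (C1 + 1) * r); last by ring.
  by rewrite mulrA; lra.
pose vn a r n := iter n (fun v => K (Nl a r v)) (fun=> 0 : pt R).
have sv a r n : oka a -> 0 < r <= r1 -> small (C1 * r) (vn a r n).
  move=> oa rr; have [kr rd rA] := rP r rr; have [r0 _ _] := kr.
  have d0 : 0 <= C1 * r by rewrite mulr_ge0// ltW.
  elim: n => [|n IH]; first by split; [exact: ct_cst| |move=> t; rewrite normr0].
  have cN := Nl_continuous rd IH oa kr; have pN : per (Nl a r (vn a r n)).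
    by have [_ pv _] := IH; exact: per_Nl.
  have [pK dK _ _] := KP _ cN pN.
  split; [exact: (Dv_continuous dK)|exact: pK|].
  move=> t; apply: (le_trans (KB _ _ cN pN (fun t => Nl_bound t rd IH oa kr) t)).
  rewrite -/B0 mulrDr.
  have : CK * ANl * (C1 * r + r) * (C1 * r) <= 1 / 2 * (C1 * r) by exact: ler_wpM2r.
  have : 0 <= CK * B1 * r by rewrite mulr_ge0// ltW.
  have : C1 * r = 2 * (CK * (B0 * r)) + 2 * (CK * B1 * r) by rewrite /C1; ring.
  rewrite !mulrA; lra.
have step a r n : oka a -> 0 < r <= r1 -> forall t, `|vn a r n.+1 t - vn a r n t| <= 2^-1 ^+ n * (C1 * r).
  move=> oa rr; have [kr rd rA] := rP r rr; have [r0 _ _] := kr.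
  elim: n => [|n IH] t.
    by rewrite expr0 mul1r subr0; have [_ _] := sv a r 1%N oa rr; apply.
  have s1 := sv a r n oa rr; have s2 := sv a r n.+1 oa rr.
  have [_ p1 _] := s1; have [_ p2 _] := s2.
  have e0 : 0 <= 2^-1 ^+ n * (C1 * r) by exact: le_trans (IH 0).
  apply: (le_trans (KL _ _ _ (Nl_continuous rd s2 oa kr) (per_Nl _ _ p2) (Nl_continuous rd s1 oa kr) (per_Nl _ _ p1)
    (fun t => Nl_lip t rd s2 s1 oa kr e0 IH) t)).
  rewrite exprS mulrA mulrA -(mulrA 2^-1); apply: ler_wpM2r => //.
  by move: rA; lra.
(* The negative term of the geometric sum is kept, so that the induction on [p] closes. *)
have cauchy a r n p : oka a -> 0 < r <= r1 -> forall t,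
    `|vn a r (n + p)%N t - vn a r n t| <= 2^-1 ^+ n * (2 * (C1 * r)) - 2^-1 ^+ (n + p) * (2 * (C1 * r)).
  move=> oa rr t; elim: p => [|p IH]; first by rewrite addn0 !subrr normr0.
  rewrite addnS -(subrK (vn a r (n + p)%N t) (vn a r (n + p).+1 t)) -addrA.
  apply: (le_trans (ler_normD _ _)); have := step a r (n + p)%N oa rr t.
  by rewrite exprS; lra.
have /choice[V HV] : forall ar : pt R * R, exists l : R -> pt R, oka ar.1 -> 0 < ar.2 <= r1 ->
    forall e : R, 0 < e -> exists n0, forall x : R, setT x -> forall n, (n0 <= n)%N ->
      `|l x - vn ar.1 ar.2 n x| <= e.
  move=> [a r] /=; have [[oa rr]|H] := pselect (oka a /\ 0 < r <= r1); last first.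
    by exists (fun=> 0) => oa rr; exfalso; apply: H.
  have [kr rd _] := rP r rr; have [r0 _ _] := kr.
  have [|l Hl] := @uniform_cauchy R R setT (vn a r); last by exists l.
  move=> e e0; have B0' : 0 <= 2 * (C1 * r) by rewrite !mulr_ge0// ltW.
  have [n0 Hn] := half_pow B0' e0.
  exists n0 => t _ n nn p; apply: (le_trans (cauchy a r n p oa rr t)); have := Hn n nn.
  have : 0 <= 2^-1 ^+ (n + p) * (2 * (C1 * r)) by rewrite mulr_ge0// exprn_ge0.
  by lra.
exists r1, C1; split=> //; exists (fun a r => V (a, r)).
have bnd (x : R) (B : R) : (forall e : R, 0 < e -> x <= B + e) -> x <= B.
  by move=> H; apply/ler_addgt0Pr => e e0; exact: H.
split=> [a r oa rr|a a' r t oa oa' rr].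
  have [kr rd rA] := rP r rr; have [r0 _ _] := kr.
  have HVa := HV (a, r) oa rr.
  have sV : small (C1 * r) (V (a, r)) by apply: small_limit HVa => n; exact: sv.
  have [_ pV _] := sV.
  have cN := Nl_continuous rd sV oa kr; have pN := per_Nl a r pV.
  have E : K (Nl a r (V (a, r))) = V (a, r).
    apply/funext => t; apply/eqP; rewrite -subr_eq0 -normr_le0; apply: bnd => e e0.
    have e2 : 0 < e / 2 by rewrite divr_gt0.
    have [n0 Hn] := HVa _ e2; have sn := sv a r n0 oa rr; have [_ pn _] := sn.
    have := KL _ _ _ cN pN (Nl_continuous rd sn oa kr) (per_Nl _ _ pn)
      (fun t => Nl_lip t rd sV sn oa kr (ltW e2) (fun t => Hn t I n0 (leqnn _))) t.
    have := Hn t I n0.+1 (leqnSn _); rewrite /= distrC add0r => h1 h2.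
    rewrite (_ : K (Nl a r (V (a, r))) t - V (a, r) t = (K (Nl a r (V (a, r))) t - K (Nl a r (vn a r n0)) t)
      + (K (Nl a r (vn a r n0)) t - V (a, r) t)); last by rewrite addrA subrK.
    apply: (le_trans (ler_normD _ _)).
    have : CK * ANl * (C1 * r + r) * (e / 2) <= 1 / 2 * (e / 2) by apply: ler_wpM2r => //; exact: ltW.
    by move: h1 h2; rewrite !mulrA; move: (`|_|) (`|_|) => x y; lra.
  have [_ dK K1 K2] := KP _ cN pN; rewrite E in dK K1 K2.
  by split.
have [kr rd rA] := rP r rr; have [r0 _ _] := kr.
(* The fixed value of the recursion [q = q / 2 + CK * B1 * r * |a - a'|] satisfied by the bound on
   the distance of the iterates. *)
pose Q := 2 * (CK * B1 * r * `|a - a'|).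
have Q0 : 0 <= Q.
  by rewrite /Q; apply: mulr_ge0 => //; apply: mulr_ge0 => //; apply: mulr_ge0 => //; exact: ltW.
have lipn n s : `|vn a r n s - vn a' r n s| <= Q.
  elim: n s => [|n IH] s; first by rewrite subrr normr0.
  have s1 := sv a r n oa rr; have s2 := sv a' r n oa' rr.
  have [_ p1 _] := s1; have [_ p2 _] := s2.
  have NN s' : `|Nl a r (vn a r n) s' - Nl a' r (vn a' r n) s'| <= ANl * (C1 * r + r) * Q + B1 * r * `|a - a'|.
    rewrite -(subrK (Nl a r (vn a' r n) s') (Nl a r (vn a r n) s')) -addrA.
    apply: (le_trans (ler_normD _ _)); apply: lerD.
      by apply: (@Nl_lip a r (C1 * r) Q).
    exact: (@Nl_lip_a a a' r (C1 * r)).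
  apply: (le_trans (KL _ _ _ (Nl_continuous rd s1 oa kr) (per_Nl _ _ p1) (Nl_continuous rd s2 oa' kr) (per_Nl _ _ p2) NN s)).
  have : CK * ANl * (C1 * r + r) * Q <= 1 / 2 * Q by apply: ler_wpM2r.
  have -> : CK * (ANl * (C1 * r + r) * Q + B1 * r * `|a - a'|) = CK * ANl * (C1 * r + r) * Q + Q / 2.
    by rewrite /Q; field.
  by lra.
apply: (@le_trans _ _ Q); last first.
  have : 0 <= CK * B0 * (r * `|a - a'|) by apply: mulr_ge0 => //; apply: mulr_ge0 => //; exact: ltW.
  by rewrite /Q /C1 !mulrDl !mulrA; lra.
apply: bnd => e e0; have e2 : 0 < e / 2 by rewrite divr_gt0.
have [n1 H1] := HV (a, r) oa rr _ e2; have [n2 H2] := HV (a', r) oa' rr _ e2.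
have := H1 t I (maxn n1 n2) (leq_maxl _ _); have := H2 t I (maxn n1 n2) (leq_maxr _ _).
have := lipn (maxn n1 n2) t; rewrite /=; move: (maxn n1 n2) => n h1 h2 h3.
rewrite (_ : V (a, r) t - V (a', r) t = (V (a, r) t - vn a r n t) - (V (a', r) t - vn a' r n t) + (vn a r n t - vn a' r n t)); last first.
  by apply: pt_eq; rewrite !ptE; ring.
apply: (le_trans (ler_normD _ _)); have := ler_normB (V (a, r) t - vn a r n t) (V (a', r) t - vn a' r n t).
by lra.
Qed.

End Contraction.

(** * The mean scalar product of periodic curves *)

Section MeanProducts.
Context {R : realType}.
Implicit Types F G : R -> pt R.

Lemma ct_ln (T : topologicalType) (f : T -> R) : (forall x, 0 < f x) -> continuous f ->
  continuous (fun x => ln (f x)).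
Proof. by move=> f0 cf x; apply: continuous_comp; [exact: cf|exact: continuous_ln]. Qed.

Definition ip F G : R := mean (fun t => dot (F t) (G t)).

Lemma ipDl F F' G : continuous F -> continuous F' -> continuous G ->
  ip (fun t => F t + F' t) G = ip F G + ip F' G.
Proof.
move=> cF cF' cG; rewrite /ip -meanD; [|exact: vct_dot..].
by apply: eq_mean => t; rewrite /dot !ptE; ring.
Qed.

Lemma ipDr F G G' : continuous F -> continuous G -> continuous G' ->
  ip F (fun t => G t + G' t) = ip F G + ip F G'.
Proof.
move=> cF cG cG'; rewrite /ip -meanD; [|exact: vct_dot..].
by apply: eq_mean => t; rewrite /dot !ptE; ring.
Qed.

Lemma ipZl (k : R) F G : continuous F -> continuous G -> ip (fun t => k *: F t) G = k * ip F G.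
Proof.
move=> cF cG; rewrite /ip -meanZ; last exact: vct_dot.
by apply: eq_mean => t; rewrite /dot !ptE; ring.
Qed.

Lemma ipZr (k : R) F G : continuous F -> continuous G -> ip F (fun t => k *: G t) = k * ip F G.
Proof.
move=> cF cG; rewrite /ip -meanZ; last exact: vct_dot.
by apply: eq_mean => t; rewrite /dot !ptE; ring.
Qed.

Lemma ip_cstr F p : continuous F -> ip F (fun=> p) = dot (vmean F) p.
Proof.
move=> cF; have c1 : continuous (fun t => (F t).1) by ctn.
have c2 : continuous (fun t => (F t).2) by ctn.
rewrite /ip /dot /vmean /= [_ * p.1]mulrC [_ * p.2]mulrC -!meanZ// -meanD; [|by ctn..].
by apply: eq_mean => t; ring.
Qed.

Lemma ip_cstl F p : continuous F -> ip (fun=> p) F = dot p (vmean F).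
Proof.
move=> cF; transitivity (ip F (fun=> p)); first by apply: eq_mean => t; rewrite /dot; ring.
by rewrite ip_cstr// /dot; ring.
Qed.

Lemma ip_suml m n (F : nat -> R -> pt R) G :
  (forall j, (m <= j < n)%N -> continuous (F j)) -> continuous G ->
  ip (fun t => \sum_(m <= j < n) F j t) G = \sum_(m <= j < n) ip (F j) G.
Proof.
move=> cF cG.
pose F' j t := if (m <= j < n)%N then F j t else 0.
have cF' j : continuous (F' j) by rewrite /F'; have [/cF//|_] := boolP (m <= j < n)%N; exact: ct_cst.
transitivity (mean (fun t => \sum_(m <= j < n) dot (F' j t) (G t))).
  apply: eq_mean => t; rewrite /dot !ptE !mulr_suml -big_split/=.
  by rewrite big_nat [RHS]big_nat; apply: eq_bigr => j jI; rewrite /F' jI.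
rewrite mean_sum; last by move=> j; exact: vct_dot.
by rewrite big_nat [RHS]big_nat; apply: eq_bigr => j jI; rewrite /ip /F'; apply: eq_mean => t; rewrite jI.
Qed.

Lemma vmeanD F G : continuous F -> continuous G -> vmean (fun t => F t + G t) = vmean F + vmean G.
Proof. by move=> cF cG; rewrite /vmean meanD ?meanD//; ctn. Qed.

Lemma vmeanZ (k : R) F : continuous F -> vmean (fun t => k *: F t) = k *: vmean F.
Proof. by move=> cF; rewrite /vmean !meanZ//; ctn. Qed.

Lemma vmeanJ F : continuous F -> vmean (fun t => Jr (F t)) = Jr (vmean F).
Proof. by move=> cF; rewrite /vmean /Jr /= meanN//; ctn. Qed.

Lemma vmean_cst (p : pt R) : vmean (fun=> p) = p.
Proof. by rewrite /vmean !mean_cst -surjective_pairing. Qed.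

Lemma vmean_Dv (u u1 : R -> pt R) : Dv u u1 -> per u -> vmean u1 = 0.
Proof.
move=> [d1 d2] pu; rewrite /vmean (mean_der d1) ?(mean_der d2)//;
  by move=> t; rewrite pu.
Qed.

Lemma vmean_bound F (B : R) : continuous F -> (forall t, `|F t| <= B) -> `|vmean F| <= B.
Proof.
move=> cF FB; have := @vmean_lip R F (fun=> 0) B cF (@ct_cst _ _ _).
by rewrite vmean_cst subr0; apply=> t; rewrite subr0.
Qed.

Lemma ip_bound F G (A B : R) : continuous F -> continuous G ->
  (forall t, `|F t| <= A) -> (forall t, `|G t| <= B) -> `|ip F G| <= 2 * (A * B).
Proof.
move=> cF cG FA GB; apply: mean_norm; first exact: vct_dot.
by move=> t _; apply: (le_trans (dot_le _ _)); apply: ler_wpM2l => //; apply: ler_pM.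
Qed.

(** Integration by parts: the bilinear form behind the action is symmetric. *)
Lemma ip_parts (u u1 w w1 : R -> pt R) : Dv u u1 -> Dv w w1 -> continuous u1 -> continuous w1 ->
  per u -> per w -> ip w1 (fun t => Jr (u t)) = ip u1 (fun t => Jr (w t)).
Proof.
move=> Du Dw c1 c2 pu pw; have cu := Dv_continuous Du; have cw := Dv_continuous Dw.
have [du1 du2] := Du; have [dw1 dw2] := Dw.
apply/eqP; rewrite -subr_eq0 -meanB; [|by apply: vct_dot => //; exact: vctJ..].
apply/eqP; apply: (@mean_der R (fun t => dot (w t) (Jr (u t)))); last by move=> t; rewrite pu pw.
by rewrite /dot; apply: (Deriv_ext (DerivD (DerivM dw1 (DerivN du2)) (DerivM dw2 du1))) => t /=; ring.
Qed.

End MeanProducts.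

Section SwapMean.
Context {R : realType} (N : nat) (N2 : (2 <= N)%N).
Local Notation th := (@th R N).

Lemma shift_rev (T : Type) (u : R -> T) j t : per u -> (j <= N)%N -> u (t + th j + th (N - j)) = u t.
Proof. by move=> pu jN; rewrite (th_rev N2 jN) -addrA subrKC pu. Qed.

(** Replacing [j] by [N - j] and shifting time by [th j] exchanges the two vortices of a pair. *)
Lemma swap_mean (G H : nat -> R -> R) :
  (forall j, (0 < j < N)%N -> continuous (G j) /\ per (G j)) ->
  (forall j t, (0 < j < N)%N -> G (N - j)%N (t + th j) = H j t) ->
  \sum_(1 <= j < N) mean (G j) = \sum_(1 <= j < N) mean (H j).
Proof.
move=> cG GH; rewrite -sum_rev; apply: eq_big_nat => j jN.
have jN' : (0 < N - j < N)%N.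
  by move: jN => /andP[j0 jN]; rewrite subn_gt0 jN ltn_subrL j0; exact: leq_trans N2.
have [c p] := cG _ jN'; rewrite -(mean_shift (th j) c p).
by apply: eq_mean => t; exact: GH.
Qed.

End SwapMean.

(** * First variation of the action functional *)

Section Functional.
Context {R : realType} (N : nat) (N2 : (2 <= N)%N).
Local Notation th := (@th R N).
Local Notation W := (@W R N).
Variables (g : pt2 R -> R) (D : pt R -> pt R -> pt R) (a0 : pt R) (rho L mu : R).
Hypotheses (rho0 : 0 < rho) (L0 : 0 < L) (mu0 : 0 < mu) (mu1 : mu <= 1).
Hypothesis farW : forall j (t : R), (0 < j < N)%N -> 2 * mu <= csq (W j t).
Hypothesis tay : taylor2 g D a0 rho L.

Lemma DL x y x' y' (e : R) : 0 <= e ->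
    `|x - a0| <= rho -> `|y - a0| <= rho -> `|x' - a0| <= rho -> `|y' - a0| <= rho ->
    `|x' - x| <= e -> `|y' - y| <= e -> `|D x' y' - D x y| <= L * e.
Proof. by move=> e0 h1 h2 h3 h4 h5 h6; have [] := tay e0 h1 h2 h3 h4 h5 h6. Qed.

Local Notation adm := (adm mu).
Local Notation oka := (oka a0 rho).
Local Notation okr := (okr rho).
Local Notation S1 := (S1 N).
Local Notation S2 := (S2 N D).
Local Notation Y := (Y N D).
Local Notation cc := (@cc R N).
Local Notation kap := (@kap R N).

Definition lnpair j (u : R -> pt R) t : R := ln (csq (u t - u (t + th j))) / 2.
Definition gpair j (a : pt R) (r : R) (u : R -> pt R) t : R := g (a + r *: u t, a + r *: u (t + th j)).

(* [Phi] is the action functional, per vortex and up to constants, on the curves [z] above;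
   [u1] stands for the derivative of [u]. *)
Definition action (u u1 : R -> pt R) : R := ip u1 (fun t => Jr (u t)) / 2.
Definition logen (u : R -> pt R) : R := \sum_(1 <= j < N) mean (lnpair j u).
Definition gen (a : pt R) (r : R) (u : R -> pt R) : R := \sum_(0 <= j < N) mean (gpair j a r u).
Definition Phi a r u u1 := action u u1 - (N%:R - 1)^-1 * logen u - cc * gen a r u.

(** [action] is a quadratic form, symmetric by [ip_parts], so the remainder is exactly the action of
    the increment. *)
Lemma action_taylor (u u1 v v1 : R -> pt R) (e : R) : 0 <= e ->
  Dv u u1 -> Dv v v1 -> continuous u1 -> continuous v1 -> per u -> per v ->
  (forall t, `|v t - u t| <= e) -> (forall t, `|v1 t - u1 t| <= e) ->
  `|action v v1 - action u u1 - ip u1 (fun t => Jr (v t - u t))| <= e ^+ 2.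
Proof.
move=> e0 Du Dw cu1 cv1 pu pv uv uv1.
have cu := Dv_continuous Du; have cv := Dv_continuous Dw.
pose w t := v t - u t; pose w1 t := v1 t - u1 t.
have Dww : Dv w w1 by exact: DvB.
have cw : continuous w by exact: Dv_continuous Dww.
have cw1 : continuous w1 by rewrite /w1; vctn.
have pw : per w by move=> t; rewrite /w pu pv.
have cJu := vctJ cu; have cJw := vctJ cw; have cJv := vctJ cv.
have E : ip v1 (fun t => Jr (v t)) =
    ip u1 (fun t => Jr (u t)) + ip u1 (fun t => Jr (w t)) + (ip w1 (fun t => Jr (u t)) + ip w1 (fun t => Jr (w t))).
  rewrite -!ipDr// -ipDl//; [|by apply: vctD..].
  apply: eq_mean => t; rewrite /dot /w /w1 !ptE; ring.
rewrite /action E (ip_parts Du Dww)//.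
rewrite (_ : _ - _ = ip w1 (fun t => Jr (w t)) / 2); last by rewrite -/w; field.
rewrite normrM [`|2^-1|]ger0_norm// ler_pdivrMr// mulrC expr2.
by apply: ip_bound => // t; rewrite normJ; exact: uv.
Qed.

Lemma adm_pair_continuous u j : adm u -> (0 < j < N)%N ->
  continuous (fun t => phi (u t - u (t + th j))).
Proof.
move=> au jN; have [cu _ _] := au; have cp : continuous (fun t => u t - u (t + th j)) by vctn.
rewrite /phi; apply: vctZ => //; apply: ctV.
  by move=> t; have [f _] := adm_far mu0 mu1 farW t au jN; exact: (far_neq0 mu0 f).
by rewrite /csq; ctn.
Qed.

Lemma lnpair_continuous u j : adm u -> (0 < j < N)%N -> continuous (lnpair j u).
Proof.
move=> au jN; have [cu _ _] := au; have cp : continuous (fun t => u t - u (t + th j)) by vctn.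
have cs : continuous (fun t => csq (u t - u (t + th j))) by rewrite /csq; ctn.
have cl : continuous (fun t => ln (csq (u t - u (t + th j)))).
  by apply: ct_ln => // t; have [f _] := adm_far mu0 mu1 farW t au jN; exact: lt_le_trans f.
by rewrite /lnpair; ctn.
Qed.

(** As [phi] is odd, the terms with [w t] and with [w (t + th j)] are one interaction seen from its
    two members; [swap_mean] identifies their sums. *)
Lemma S1_ip (u w : R -> pt R) : adm u -> continuous w -> per w ->
  \sum_(1 <= j < N) ip (fun t => phi (u t - u (t + th j))) (fun t => w t - w (t + th j)) = 2 * ip (S1 u) w.
Proof.
move=> au cw pw; have [cu pu _] := au.
have cp j (jN : (0 < j < N)%N) := adm_pair_continuous au jN.
have cwj j : continuous (fun t => w (t + th j)) by vctn.
rewrite /S1 ip_suml//.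
have E j : (1 <= j < N)%N -> ip (fun t => phi (u t - u (t + th j))) (fun t => w t - w (t + th j)) =
    ip (fun t => phi (u t - u (t + th j))) w + mean (fun t => - dot (phi (u t - u (t + th j))) (w (t + th j))).
  move=> jN; rewrite /ip -meanD; [|by apply: vct_dot => //; exact: cp|by apply: ctN; apply: vct_dot => //; exact: cp].
  by apply: eq_mean => t; rewrite /dot !ptE; ring.
rewrite (eq_big_nat _ _ E) big_split/=.
have <- := @swap_mean R N N2 (fun j t => dot (phi (u t - u (t + th j))) (w t))
  (fun j t => - dot (phi (u t - u (t + th j))) (w (t + th j))).
- by rewrite mulr_natl mulr2n.
- move=> j jN; split; first by apply: vct_dot => //; exact: cp.
  by move=> t; rewrite pu pw addrAC pu.
move=> j t /andP[_ jN]; rewrite shift_rev ?(ltnW jN)//.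
rewrite -(opprB (u t)) /phi (_ : csq (- _) = csq (u t - u (t + th j))); last by rewrite /csq !ptE; ring.
by rewrite /dot !ptE; ring.
Qed.

Lemma logen_taylor (u v : R -> pt R) (e : R) : 0 <= e -> adm u -> adm v -> (forall t, `|v t - u t| <= e) ->
  `|logen v - logen u - 2 * ip (S1 u) (fun t => v t - u t)| <= N%:R * (129 / mu ^+ 2 * (2 * e) ^+ 2).
Proof.
move=> e0 au av uv; have [cu pu _] := au; have [cv pv _] := av.
have cw : continuous (fun t => v t - u t) by vctn.
have pw : per (fun t => v t - u t) by move=> t; rewrite pu pv.
have m2 : 0 < mu ^+ 2 by rewrite exprn_gt0.
rewrite -S1_ip// /logen -!sumrB; apply: norm_sum_nat.
  by rewrite mulr_ge0// ?sqr_ge0// divr_ge0// ltW.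
move=> j jN; have cp := adm_pair_continuous au jN.
have cwj : continuous (fun t => (v t - u t) - (v (t + th j) - u (t + th j))) by vctn.
have c1 := lnpair_continuous au jN; have c2 := lnpair_continuous av jN.
have c3 := vct_dot cp cwj; have c4 := ctD c2 (ctN c1).
rewrite /ip -(meanB c2 c1) -(meanB c4 c3); apply: mean_norm; first by ctn.
move=> t _; have [f1 g1] := adm_far mu0 mu1 farW t au jN; have [f2 g2] := adm_far mu0 mu1 farW t av jN.
rewrite (_ : (v t - u t) - (v (t + th j) - u (t + th j)) = (v t - v (t + th j)) - (u t - u (t + th j))); last first.
  by apply: pt_eq; rewrite !ptE; ring.
apply: (le_trans (ln_taylor mu0 mu1 f1 f2 g1 g2)); apply: ler_wpM2l; first by rewrite divr_ge0// ltW.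
apply: lerXn2r; rewrite ?nnegrE ?mulr_ge0//.
rewrite (_ : (v t - v (t + th j)) - (u t - u (t + th j)) = (v t - u t) - (v (t + th j) - u (t + th j))); last first.
  by apply: pt_eq; rewrite !ptE; ring.
by apply: (le_trans (ler_normB _ _)); have := uv t; have := uv (t + th j); lra.
Qed.

Lemma pair_continuous a r u i j : adm u -> oka a -> okr r ->
  continuous (fun t => D (a + r *: u (t + th i)) (a + r *: u (t + th j))).
Proof.
move=> au oa kr; have [cu _ _] := au; apply: (D_continuous L0 DL); [by vctn|by vctn|].
by move=> t; split; exact: (ok_ball mu1).
Qed.

Lemma add_th0 t : t + th 0 = t. Proof. by rewrite th0 addr0. Qed.

Lemma pos_taylor a a' r (u v : R -> pt R) j t (d e : R) : adm u -> adm v -> oka a -> oka a' -> okr r ->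
  0 <= e -> `|a' - a| <= d -> (forall t, `|v t - u t| <= e) ->
  `|gpair j a' r v t - gpair j a r u t
    - dot (D (a + r *: u t) (a + r *: u (t + th j))) ((a' - a) + r *: (v t - u t))
    - dot (D (a + r *: u (t + th j)) (a + r *: u t)) ((a' - a) + r *: (v (t + th j) - u (t + th j)))|
  <= L * (d + r * e) ^+ 2.
Proof.
move=> au av oa oa' kr e0 ad uv; have [r0 r1 _] := kr.
have E s : (a' - a) + r *: (v s - u s) = (a' + r *: v s) - (a + r *: u s).
  by apply: pt_eq; rewrite !ptE; ring.
have B s : `|(a' + r *: v s) - (a + r *: u s)| <= d + r * e.
  rewrite -E; apply: (le_trans (ler_normD _ _)); rewrite normZ_gt0//; apply: lerD => //.
  by apply: ler_wpM2l => //; exact: ltW.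
have q0 : 0 <= d + r * e by exact: le_trans (B 0).
have b1 s := ok_ball mu1 s oa kr au; have b2 s := ok_ball mu1 s oa' kr av.
have [+ _] := tay q0 (b1 t) (b1 (t + th j)) (b2 t) (b2 (t + th j)) (B t) (B (t + th j)).
by rewrite -!E.
Qed.

(** The pairing argument of [S1_ip]; here the self-interaction [j = 0] occurs and is its own
    partner. *)
Lemma S2_ip a r (u p : R -> pt R) : adm u -> oka a -> okr r -> continuous p -> per p ->
  \sum_(0 <= j < N) (ip (fun t => D (a + r *: u t) (a + r *: u (t + th j))) p +
    ip (fun t => D (a + r *: u (t + th j)) (a + r *: u t)) (fun t => p (t + th j))) = 2 * ip (S2 a r u) p.
Proof.
move=> au oa kr cp pp; have [cu pu _] := au.
have cD j : continuous (fun t => D (a + r *: u t) (a + r *: u (t + th j))).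
  have := @pair_continuous a r u 0 j au oa kr.
  by under [X in continuous X -> _]funext do rewrite add_th0.
rewrite /S2 ip_suml// big_split/= mulr_natl mulr2n; congr (_ + _).
have N0 : (0 < N)%N by exact: leq_trans N2.
rewrite (big_ltn N0) [RHS](big_ltn N0); congr (_ + _).
  by apply: eq_mean => t; rewrite add_th0.
symmetry; apply: swap_mean => //.
  move=> j jN; split; first exact: vct_dot.
  by move=> t; rewrite pu pp addrAC pu.
by move=> j t /andP[_ jN]; rewrite shift_rev ?(ltnW jN).
Qed.

Definition Lg : R := 4 * M1 D a0 rho L + 2 * rho * L.

Lemma g_lip x y x' y' (e : R) : 0 <= e -> e <= 2 * rho ->
    `|x - a0| <= rho -> `|y - a0| <= rho -> `|x' - a0| <= rho -> `|y' - a0| <= rho ->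
    `|x' - x| <= e -> `|y' - y| <= e -> `|g (x', y') - g (x, y)| <= Lg * e.
Proof.
move=> e0 er h1 h2 h3 h4 h5 h6; have [h _] := tay e0 h1 h2 h3 h4 h5 h6.
have z : `|a0 - a0| <= rho by rewrite subrr normr0 ltW.
have DM p q : `|p - a0| <= rho -> `|q - a0| <= rho -> `|D p q| <= M1 D a0 rho L.
  move=> hp hq; rewrite -(subrK (D a0 a0) (D p q)) /M1 addrC; apply: (le_trans (ler_normD _ _)).
  by rewrite lerD2l; apply: DL => //; exact: ltW.
have d1 : `|dot (D x y) (x' - x)| <= 2 * (M1 D a0 rho L * e).
  by apply: (le_trans (dot_le _ _)); apply: ler_wpM2l => //; apply: ler_pM => //; exact: DM.
have d2 : `|dot (D y x) (y' - y)| <= 2 * (M1 D a0 rho L * e).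
  by apply: (le_trans (dot_le _ _)); apply: ler_wpM2l => //; apply: ler_pM => //; exact: DM.
have d3 : L * e ^+ 2 <= 2 * rho * L * e.
  rewrite expr2 mulrA; apply: ler_wpM2r => //; rewrite mulrC; apply: ler_wpM2r => //; exact: ltW.
move: h d1 d2; rewrite /Lg !ler_norml => /andP[h7 h8] /andP[h9 h10] /andP[h11 h12].
move: d3 h7 h8 h9 h10 h11 h12; move: (dot _ _) (dot _ _) (g _) (g _) (L * e ^+ 2) => p q k l m.
by move=> *; apply/andP; split; lra.
Qed.

Lemma gpair_continuous a r u j : adm u -> oka a -> okr r -> continuous (gpair j a r u).
Proof.
move=> au oa kr; have [cu _ _] := au; have M0 := M1_ge0 D a0 rho0 L0.
have Lg0 : 0 <= Lg.
  by rewrite /Lg addr_ge0// mulr_ge0// ?(ltW L0)// mulr_ge0// ltW.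
have c1 : continuous (fun t => a + r *: u t) by vctn.
have c2 : continuous (fun t => a + r *: u (t + th j)) by vctn.
move=> t; apply/cvgrPdist_le => e e0; have rp := rho0.
have d0 : 0 < Num.min (e / (Lg + 1)) rho by rewrite lt_min rho0 divr_gt0//; lra.
have h1 := c1 t; move/cvgrPdist_le : h1 => /(_ _ d0) h1.
have h2 := c2 t; move/cvgrPdist_le : h2 => /(_ _ d0) h2.
apply: filterS2 h1 h2 => s h1 h2.
have q1 : Num.min (e / (Lg + 1)) rho <= 2 * rho.
  by apply: (@le_trans _ _ rho); [rewrite ge_min lexx orbT|lra].
apply: (le_trans (g_lip (ltW d0) q1 _ _ _ _ h1 h2)); try exact: (ok_ball mu1).
apply: (@le_trans _ _ ((Lg + 1) * (e / (Lg + 1)))).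
  apply: ler_pM => //; [exact: ltW|lra|by rewrite ge_min lexx].
by rewrite mulrC divfK// gt_eqF//; lra.
Qed.

Lemma gen_taylor a a' r (u v : R -> pt R) (d e : R) : adm u -> adm v -> oka a -> oka a' -> okr r ->
  0 <= e -> `|a' - a| <= d -> (forall t, `|v t - u t| <= e) ->
  `|gen a' r v - gen a r u
     - 2 * (dot (vmean (S2 a r u)) (a' - a) + r * ip (S2 a r u) (fun t => v t - u t))|
  <= N%:R * (L * (d + r * e) ^+ 2).
Proof.
move=> au av oa oa' kr e0 ad uv; have [r0 r1 _] := kr.
have [cu pu _] := au; have [cv pv _] := av.
have cw : continuous (fun t => v t - u t) by vctn.
have cS := S2_continuous (N := N) L0 mu1 DL au oa kr.
pose p t := (a' - a) + r *: (v t - u t).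
have cp : continuous p by rewrite /p; vctn.
have pp : per p by move=> t; rewrite /p pu pv.
have -> : dot (vmean (S2 a r u)) (a' - a) + r * ip (S2 a r u) (fun t => v t - u t) = ip (S2 a r u) p.
  have ck : continuous (fun _ : R => a' - a) by exact: ct_cst.
  have cz : continuous (fun t => r *: (v t - u t)) by vctn.
  by rewrite /p (ipDr cS ck cz) ip_cstr// ipZr.
have cD1 j : continuous (fun t => D (a + r *: u t) (a + r *: u (t + th j))).
  have := @pair_continuous a r u 0 j au oa kr.
  by under [X in continuous X -> _]funext do rewrite add_th0.
have cD2 j : continuous (fun t => D (a + r *: u (t + th j)) (a + r *: u t)).
  have := @pair_continuous a r u j 0 au oa kr.
  by under [X in continuous X -> _]funext do rewrite add_th0.
have cpj j : continuous (fun t => p (t + th j)) by ctn.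
rewrite -S2_ip// /gen -!sumrB; apply: norm_sum_nat.
  by rewrite mulr_ge0 ?sqr_ge0// ltW.
move=> j _; have c1 := @gpair_continuous a r u j au oa kr; have c2 := @gpair_continuous a' r v j av oa' kr.
have c3 := vct_dot (cD1 j) cp; have c4 := vct_dot (cD2 j) (cpj j).
have c5 := ctD c2 (ctN c1); have c6 := ctD c3 c4.
rewrite /ip -(meanB c2 c1) -(meanD c3 c4) -(meanB c5 c6); apply: mean_norm; first by ctn.
by move=> t _; rewrite opprD addrA; exact: pos_taylor.
Qed.

Definition CT : R := 1 + (N%:R - 1)^-1 * (N%:R * (129 / mu ^+ 2 * 4)) + cc * (N%:R * (L * 4)).

(** The first variation of [Phi] in [u] is [- Jr u1 - Y a r u], which vanishes exactly when
    [u1 = Jr (Y a r u)]; in [a] it is [- 2 * cc] times the mean of [S2]. *)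
Lemma Phi_taylor a a' r (u u1 v v1 : R -> pt R) (e : R) : adm u -> adm v -> oka a -> oka a' -> okr r ->
  0 <= e -> Dv u u1 -> Dv v v1 -> continuous u1 -> continuous v1 ->
  `|a' - a| <= e -> (forall t, `|v t - u t| <= e) -> (forall t, `|v1 t - u1 t| <= e) ->
  `|Phi a' r v v1 - Phi a r u u1
     - (ip (fun t => - Jr (u1 t) - Y a r u t) (fun t => v t - u t)
        - 2 * cc * dot (vmean (S2 a r u)) (a' - a))| <= CT * e ^+ 2.
Proof.
move=> au av oa oa' kr e0 Du Dw cu1 cv1 ae uv uv1; have [r0 r1 _] := kr.
have [cu pu _] := au; have [cv pv _] := av.
have cw : continuous (fun t => v t - u t) by vctn.
have cS2 := S2_continuous (N := N) L0 mu1 DL au oa kr.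
have cS1 := S1_continuous mu0 mu1 farW au.
have t1 := action_taylor e0 Du Dw cu1 cv1 pu pv uv uv1.
have t2 := logen_taylor e0 au av uv.
have t3 := gen_taylor au av oa oa' kr e0 ae uv.
have c0 := @cc_gt0 R N N2; have n0 := @N1_gt0 R N N2.
have E : ip (fun t => - Jr (u1 t) - Y a r u t) (fun t => v t - u t) =
   ip u1 (fun t => Jr (v t - u t)) - kap * ip (S1 u) (fun t => v t - u t)
   - 2 * r * cc * ip (S2 a r u) (fun t => v t - u t).
  rewrite -!ipZl// /ip -!meanB; try by apply: vct_dot => //; vctn.
    by apply: eq_mean => t; rewrite /Y /dot !ptE; ring.
  by apply: ctD; [|apply: ctN]; apply: vct_dot => //; vctn.
rewrite E /Phi.
set A1 := action v v1 - action u u1 - _ in t1.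
set A2 := logen v - logen u - _ in t2.
set A3 := gen a' r v - gen a r u - _ in t3.
rewrite (_ : _ - _ - _ = A1 - (N%:R - 1)^-1 * A2 - cc * A3); last first.
  by rewrite /A1 /A2 /A3 /kap; field; rewrite gt_eqF.
have i0 : 0 <= (N%:R - 1)^-1 :> R by rewrite invr_ge0 ltW.
have u2 : (N%:R - 1)^-1 * `|A2| <= (N%:R - 1)^-1 * (N%:R * (129 / mu ^+ 2 * 4)) * e ^+ 2.
  by rewrite -mulrA; apply: ler_wpM2l => //; apply: (le_trans t2); rewrite le_eqVlt; apply/orP; left; apply/eqP; ring.
have u3 : cc * `|A3| <= cc * (N%:R * (L * 4)) * e ^+ 2.
  rewrite -mulrA; apply: ler_wpM2l; first exact: ltW.
  apply: (le_trans t3); rewrite -mulrA; apply: ler_wpM2l => //.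
  rewrite -mulrA; apply: ler_wpM2l; first exact: ltW.
  have -> : 4 * e ^+ 2 = (2 * e) ^+ 2 by ring.
  have re0 : 0 <= r * e by rewrite mulr_ge0// ltW.
  apply: lerXn2r; rewrite ?nnegrE; [exact: addr_ge0|exact: mulr_ge0|].
  have : r * e <= 1 * e by apply: ler_wpM2r.
  by lra.
apply: (le_trans (ler_normB _ _)); rewrite normrM (gtr0_norm c0) /CT mulrDl; apply: lerD => //.
apply: (le_trans (ler_normB _ _)); rewrite normrM (ger0_norm i0) mulrDl mul1r; exact: lerD.
Qed.

End Functional.

(** * Derivatives obtained from quadratic estimates *)

Section QuadraticDerivative.
Context {R : realType} (V : normedModType R).

Lemma quad_is_derive (f : V -> R) (x v : V) (l e C : R) : 0 < e ->
  (forall h : R, `|h| <= e -> `|f (h *: v + x) - f x - h * l| <= C * h ^+ 2) ->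
  is_derive x v f l.
Proof.
move=> e0 H.
have cv : (fun h : R => h^-1 *: (f (h *: v + x) - f x)) @ 0^' --> l.
  apply/cvgrPdist_le => r r0.
  have C0 : 0 < `|C| + 1 by rewrite ltr_wpDl.
  have d0 : 0 < Num.min e (r / (`|C| + 1)) by rewrite lt_min e0 divr_gt0.
  rewrite near_withinE; have := nbhsx_ballx (0 : R) _ d0; apply: filterS => h.
  rewrite -ball_normE /ball_ /= sub0r normrN lt_min => /andP[h1 h2] hn0.
  have hp : 0 < `|h| by rewrite normr_gt0.
  rewrite -normrN opprB -(ler_pM2l hp) -normrM mulrBr [h * _]mulrA mulfV// mul1r.
  apply: (le_trans (H h (ltW h1))); rewrite -real_normK ?num_real// expr2 mulrA mulrC.
  apply: ler_wpM2l; first exact: normr_ge0.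
  apply: (@le_trans _ _ ((`|C| + 1) * `|h|)).
    by apply: ler_wpM2r => //; have := ler_norm C; lra.
  by rewrite mulrC -ler_pdivlMr// ltW.
by split; [apply/cvg_ex; exists l|exact/cvg_lim].
Qed.

End QuadraticDerivative.

Section DerivPairs.
Context {R : realType}.

(** Comparison with a function [p] of known derivative at [t]; this gives the chain rule along
    curves directly from the Taylor estimates. *)
Lemma quad_is_derive_along (f p : R -> R) (t l e C : R) : 0 < e ->
  is_derive t 1 p l ->
  (forall s : R, `|s - t| <= e -> `|f s - f t - (p s - p t)| <= C * (s - t) ^+ 2) ->
  is_derive t 1 f l.
Proof.
move=> e0 dp H.
have d0 : is_derive t 1 (fun s => f s - p s) 0.
  apply: (@quad_is_derive R R (fun s => f s - p s) t 1 0 e C e0) => h he.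
  have := H (h + t); rewrite addrK => /(_ he).
  rewrite (_ : h *: (1 : R) = h); last by rewrite [_ *: _]mulr1.
  by congr (`|_| <= _); ring.
have := is_deriveD d0 dp; rewrite add0r (_ : (fun s => f s - p s) + p = f)//.
by apply/funext => s; rewrite fctE subrK.
Qed.

Lemma Dv_lip (u u1 : R -> pt R) (B : R) : Dv u u1 -> (forall t, `|u1 t| <= B) ->
  forall s t, `|u s - u t| <= B * `|s - t|.
Proof.
move=> [d1 d2] uB.
have key (f f' : R -> R) : Deriv f f' -> (forall t, `|f' t| <= B) ->
    forall s t, `|f s - f t| <= B * `|s - t|.
  move=> df fB; have K s t : s <= t -> `|f t - f s| <= B * (t - s).
    move=> st; rewrite ler_norml; apply/andP; split.
      have := Deriv_le st (DerivN df) (C := B); rewrite -mulNr => H.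
      have : - f t - - f s <= B * (t - s).
        by apply: H => x _; have := fB x; rewrite ler_norml => /andP[? ?]; lra.
      by lra.
    by apply: (Deriv_le st df) => x _; exact: le_trans (ler_norm _) (fB x).
  move=> s t; have [st|ts] := leP s t.
    by rewrite distrC (distrC s) (ger0_norm (_ : 0 <= t - s)) ?subr_ge0//; exact: K.
  by rewrite (ger0_norm (_ : 0 <= s - t)) ?subr_ge0 ?(ltW ts)//; apply: K; exact: ltW.
move=> s t; rewrite ptnormP !ptE; apply/andP; split.
  by apply: (key _ _ d1) => x; exact: le_trans (norm1_le _) (uB x).
by apply: (key _ _ d2) => x; exact: le_trans (norm2_le _) (uB x).
Qed.

Lemma Dv_shift (u u1 : R -> pt R) s : Dv u u1 -> Dv (fun t => u (t + s)) (fun t => u1 (t + s)).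
Proof. by move=> [d1 d2]; split; [exact: (Deriv_shift s d1)|exact: (Deriv_shift s d2)]. Qed.

Lemma is_derive_dot (u u1 : R -> pt R) (p : pt R) (t : R) : Dv u u1 ->
  is_derive t (1 : R) (fun s => dot p (u s)) (dot p (u1 t)).
Proof.
move=> [d1 d2]; have D1 := DerivD (DerivM (Deriv_cst p.1) d1) (DerivM (Deriv_cst p.2) d2).
have -> : dot p (u1 t) = p.1 * (u1 t).1 + (u t).1 * 0 + (p.2 * (u1 t).2 + (u t).2 * 0) by rewrite /dot; ring.
exact: D1.
Qed.

Lemma Dv_cis : Dv cis (fun t : R => Jr (cis t)).
Proof. by split; [exact: Deriv_cos|exact: Deriv_sin]. Qed.

End DerivPairs.

(** * Vanishing of the multipliers *)

Section Multipliers.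
Context {R : realType} (N : nat) (N2 : (2 <= N)%N).
Local Notation th := (@th R N).
Local Notation W := (@W R N).
Variables (g : pt2 R -> R) (D : pt R -> pt R -> pt R) (a0 : pt R) (rho L mu : R).
Hypotheses (rho0 : 0 < rho) (L0 : 0 < L) (mu0 : 0 < mu) (mu1 : mu <= 1).
Hypothesis farW : forall j (t : R), (0 < j < N)%N -> 2 * mu <= csq (W j t).
Hypothesis tay : taylor2 g D a0 rho L.
Local Notation DL := (DL tay).
Local Notation adm := (adm mu).
Local Notation oka := (oka a0 rho).
Local Notation okr := (okr rho).
Local Notation S1 := (S1 N).
Local Notation S2 := (S2 N D).
Local Notation Y := (Y N D).
Local Notation cc := (@cc R N).
Local Notation kap := (@kap R N).

Lemma Deriv_lnpair u u1 j (B : R) : adm u -> (0 < j < N)%N -> Dv u u1 -> (forall t, `|u1 t| <= B) ->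
  Deriv (lnpair N j u) (fun t => dot (phi (u t - u (t + th j))) (u1 t - u1 (t + th j))).
Proof.
move=> au jN Du uB t.
pose y s := u s - u (s + th j).
have Dy : Dv y (fun s => u1 s - u1 (s + th j)) by exact: DvB (Dv_shift (th j) Du).
have yB s : `|u1 s - u1 (s + th j)| <= 2 * B.
  by apply: (le_trans (ler_normB _ _)); have := uB s; have := uB (s + th j); lra.
have lip := Dv_lip Dy yB.
have e0 : (0 : R) < 1 by [].
apply: (@quad_is_derive_along R _ (fun s => dot (phi (y t)) (y s)) t _ 1 (129 / mu ^+ 2 * (2 * B) ^+ 2) e0).
  exact: (is_derive_dot _ _ Dy).
move=> s _; have [f1 g1] := adm_far mu0 mu1 farW t au jN; have [f2 g2] := adm_far mu0 mu1 farW s au jN.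
have := ln_taylor mu0 mu1 f1 f2 g1 g2; rewrite -/(y s) -/(y t).
have -> : dot (phi (y t)) (y s - y t) = dot (phi (y t)) (y s) - dot (phi (y t)) (y t) by rewrite /dot !ptE; ring.
move=> h; apply: (le_trans h).
rewrite (_ : 129 / mu ^+ 2 * (2 * B) ^+ 2 * (s - t) ^+ 2 = 129 / mu ^+ 2 * (2 * B * (s - t)) ^+ 2); last by ring.
apply: ler_wpM2l.
  by rewrite divr_ge0// ltW// exprn_gt0.
rewrite -[leRHS]real_normK ?num_real// normrM.
apply: lerXn2r; rewrite ?nnegrE ?mulr_ge0//; apply: (le_trans (lip s t)).
by apply: ler_wpM2r => //; exact: ler_norm.
Qed.

Lemma Deriv_gpair a r u u1 j (B : R) : adm u -> oka a -> okr r -> Dv u u1 -> (forall t, `|u1 t| <= B) ->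
  Deriv (gpair N g j a r u) (fun t => r * (dot (D (a + r *: u t) (a + r *: u (t + th j))) (u1 t)
     + dot (D (a + r *: u (t + th j)) (a + r *: u t)) (u1 (t + th j)))).
Proof.
move=> au oa kr Du uB t; have [r0 r1 r4] := kr; have rp := rho0.
have lip := Dv_lip Du uB; have B0 : 0 <= B by exact: le_trans (uB 0).
set P := D _ _; set Q := D (a + r *: u (t + th j)) _.
have e0 : (0 : R) < 1 by [].
apply: (@quad_is_derive_along R _ (fun s => dot (r *: P) (u s) + dot (r *: Q) (u (s + th j))) t _ 1 (L * B ^+ 2) e0).
  have := is_deriveD (is_derive_dot (r *: P) t Du) (is_derive_dot (r *: Q) t (Dv_shift (th j) Du)).
  by rewrite (_ : dot (r *: P) _ + _ = r * (dot P (u1 t) + dot Q (u1 (t + th j)))); last by rewrite /dot !ptE; ring.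
move=> s _.
have b s' := ok_ball mu1 s' oa kr au.
have l s' t' : s' - t' = s - t -> `|(a + r *: u s') - (a + r *: u t')| <= B * `|s - t|.
  move=> e; rewrite (_ : _ - _ = r *: (u s' - u t')); last by apply: pt_eq; rewrite !ptE; ring.
  rewrite normZ_gt0//; apply: (@le_trans _ _ (1 * `|u s' - u t'|)); first exact: ler_wpM2r.
  by rewrite mul1r -e; exact: lip.
have q0 : 0 <= B * `|s - t| by rewrite mulr_ge0.
have st : s + th j - (t + th j) = s - t by ring.
have [+ _] := tay q0 (b t) (b (t + th j)) (b s) (b (s + th j)) (l s t erefl) (l _ _ st).
rewrite -/P -/Q exprMn real_normK ?num_real// mulrA; congr (`|_| <= _); rewrite /gpair.
have E (p x y : pt R) : dot p (a + r *: x - (a + r *: y)) = dot (r *: p) x - dot (r *: p) y.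
  by rewrite /dot !ptE; ring.
rewrite !E; move: (g _) (g _) (dot (r *: P) (u s)) (dot (r *: P) (u t)) (dot (r *: Q) (u (s + th j))) (dot (r *: Q) (u (t + th j))) => *; ring.
Qed.

(** Conservation of energy: [Y] is the gradient of the interaction energies, so its pairing with the
    velocity is a sum of means of derivatives of periodic functions. *)
Lemma ip_speed_Y a r u u1 : adm u -> oka a -> okr r -> Dv u u1 -> continuous u1 -> per u1 ->
  (exists B : R, forall t, `|u1 t| <= B) -> ip (Y a r u) u1 = 0.
Proof.
move=> au oa kr Du cu1 pu1 [B uB]; have [cu pu _] := au.
have cS1 := S1_continuous mu0 mu1 farW au.
have cS2 := S2_continuous (N := N) L0 mu1 DL au oa kr.
rewrite /Y ipDl//; [|by vctn|by vctn].
rewrite !ipZl//.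
have -> : ip (S1 u) u1 = 0.
  have := S1_ip N2 mu0 mu1 farW au cu1 pu1.
  rewrite big1_seq; first by lra.
  move=> j /andP[_]; rewrite mem_index_iota => jN.
  apply: (mean_der (Deriv_lnpair au jN Du uB)).
  by move=> t; rewrite /lnpair pu addrAC pu.
have -> : ip (S2 a r u) u1 = 0; last by rewrite !mulr0 addr0.
have := S2_ip N2 L0 mu1 tay au oa kr cu1 pu1.
rewrite big1_seq; first by lra.
move=> j _; have [r0 _ _] := kr.
have cD1 : continuous (fun t => D (a + r *: u t) (a + r *: u (t + th j))).
  have := pair_continuous (N := N) (i := 0) (j := j) L0 mu1 tay au oa kr.
  by under [X in continuous X -> _]funext do rewrite add_th0.
have cD2 : continuous (fun t => D (a + r *: u (t + th j)) (a + r *: u t)).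
  have := pair_continuous (N := N) (i := j) (j := 0) L0 mu1 tay au oa kr.
  by under [X in continuous X -> _]funext do rewrite add_th0.
have cuj : continuous (fun t => u1 (t + th j)) by ctn.
rewrite /ip -meanD; [|exact: vct_dot..].
have := mean_der (Deriv_gpair j au oa kr Du uB).
rewrite meanZ; last by apply: ctD; exact: vct_dot.
move=> /(_ _)/eqP; rewrite mulf_eq0 (gt_eqF r0)/= => H; apply/eqP; apply: H.
by move=> t; rewrite /gpair pu addrAC pu.
Qed.

(** Translation invariance of the logarithmic interaction: [S1_ip] is tested with constants. *)
Lemma vmean_S1 u : adm u -> vmean (S1 u) = 0.
Proof.
move=> au; have cS1 := S1_continuous mu0 mu1 farW au.
have key p : dot (vmean (S1 u)) p = 0.
  rewrite -ip_cstr//.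
  have := @S1_ip R N N2 mu mu0 mu1 farW u (fun=> p) au (@ct_cst _ _ _) (fun _ => erefl).
  rewrite big1_seq; first by lra.
  move=> j _; rewrite subrr /ip -[RHS](mean_cst 0); apply: eq_mean => t.
  by rewrite /dot /= !mulr0 addr0.
by apply: pt_eq; [have := key (1, 0)|have := key (0, 1)]; rewrite /dot /= !mulr1 !mulr0 ?addr0 ?add0r.
Qed.

(** The mean of the equation: the velocity, [S1] and [cis] all have mean zero. *)
Lemma mult_b a r u (lam : R) b : adm u -> oka a -> okr r ->
  Dv u (fun t => Jr (Y a r u t) - lam *: cis t - b) -> b = (2 * r * cc) *: Jr (vmean (S2 a r u)).
Proof.
move=> au oa kr Du; have [cu pu _] := au.
have cS1 := S1_continuous mu0 mu1 farW au.
have cS2 := S2_continuous (N := N) L0 mu1 DL au oa kr.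
have [ccs _ _] := adm_cis mu0.
have := vmean_Dv Du pu.
have -> : (fun t => Jr (Y a r u t) - lam *: cis t - b) =
   (fun t => kap *: Jr (S1 u t) + ((2 * r * cc) *: Jr (S2 a r u t) + ((- lam) *: cis t + - b))).
  by apply/funext => t; rewrite /Y; apply: pt_eq; rewrite !ptE; ring.
have c1 := vctJ cS1; have c2 := vctJ cS2.
rewrite vmeanD; [|by vctn|by vctn]; rewrite vmeanD; [|by vctn|by vctn].
rewrite vmeanD; [|by vctn|exact: ct_cst].
rewrite !vmeanZ// !vmeanJ// vmean_S1// vmean_cst.
have -> : vmean cis = 0 :> pt R by rewrite /vmean /cis /= mean_cos mean_sin.
move=> H; apply/eqP; rewrite -subr_eq0; apply/eqP; rewrite -[RHS]oppr0 -H.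
by apply: pt_eq; rewrite !ptE /=; ring.
Qed.

Lemma Y_near a r u (d : R) : adm u -> oka a -> okr r -> (forall t, `|u t - cis t| <= d) ->
  forall t, `|Y a r u t - cis t| <= kap * (N%:R * (2 / mu * (2 * d))) + 2 * cc * (N%:R * M1 D a0 rho L) * r.
Proof.
move=> au oa kr ud t; have [r0 r1 _] := kr; have d0 : 0 <= d by exact: le_trans (ud 0).
rewrite -{1}(kap_S1_cis N2 t) (_ : _ - _ = kap *: (S1 u t - S1 cis t) + (2 * r * cc) *: S2 a r u t); last first.
  by apply: pt_eq; rewrite /Y !ptE; ring.
have k0 := @kap_gt0 R N N2; have rc := @rc_gt0 R N N2 r r0.
apply: (le_trans (ler_normD _ _)); rewrite !normZ_gt0//; apply: lerD.
  apply: ler_wpM2l; first exact: ltW.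
  exact: (S1_lip mu0 mu1 farW au (adm_cis mu0)).
rewrite (_ : 2 * cc * (N%:R * M1 D a0 rho L) * r = 2 * r * cc * (N%:R * M1 D a0 rho L)); last by ring.
apply: ler_wpM2l; first exact: ltW.
exact: (S2_bound N rho0 L0 mu1 DL t au oa kr).
Qed.

(** Both the velocity, by [ip_speed_Y], and [Jr Y] are orthogonal to [Y], so [lam] times the pairing
    of [cis] with [Y] is 0. By [ip_parts] that pairing equals the one of [cis] with [u], which is
    positive as [u] is close to [cis]. *)
Lemma mult_lam a r u (lam : R) : adm u -> oka a -> okr r ->
  Dv u (fun t => Jr (Y a r u t) - lam *: cis t) -> lam = 0.
Proof.
move=> au oa kr Du; have [cu pu ud] := au.
have [ccs pc _] := adm_cis mu0.
have cY := Y_continuous L0 mu0 mu1 farW DL au oa kr.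
pose u1 t := Jr (Y a r u t) - lam *: cis t.
have cu1 : continuous u1 by rewrite /u1; vctn.
have pu1 : per u1 by move=> t; rewrite /u1 pc (per_Y N D a r pu).
have bd : exists B : R, forall t, `|u1 t| <= B.
  eexists => t; rewrite /u1; apply: (le_trans (ler_normB _ _)); rewrite normJ normrZ; apply: lerD; last first.
    by apply: ler_wpM2l => //; exact: cis_bound.
  rewrite -(subrK (cis t) (Y a r u t)); apply: (le_trans (ler_normD _ _)); apply: lerD; last exact: cis_bound.
  exact: (Y_near au oa kr ud).
have speed := ip_speed_Y au oa kr Du cu1 pu1 bd.
have Dc := @Dv_cis R.
have cJc := vctJ ccs.
have E : ip (Y a r u) u1 = - lam * ip u1 (fun t => Jr (cis t)).
  rewrite -ipZr//; apply: eq_mean => t; rewrite /u1 /dot !ptE; ring.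
have P := ip_parts Dc Du cJc cu1 pc pu; rewrite P in E.
have pos : 0 < ip (fun t => Jr (cis t)) (fun t => Jr (u t)).
  have m := mu1; have m0 := mu0.
  apply: (@lt_le_trans _ _ (1 / 2)); first by lra.
  rewrite -[leLHS](mean_cst (1 / 2)); apply: mean_le; [exact: ct_cst|by apply: vct_dot; exact: vctJ|].
  move=> t _; have -> : dot (Jr (cis t)) (Jr (u t)) = 1 + dot (cis t) (u t - cis t).
    by have := cos2Dsin2 t; rewrite /dot /cis !ptE /= => <-; ring.
  have := dot_le (cis t) (u t - cis t); have h : `|cis t| * `|u t - cis t| <= 1 * del mu.
    by apply: ler_pM => //; exact: cis_bound.
  rewrite ler_norml => /andP[h2 _]; move: h h2; rewrite /del.
  by move: (dot _ _) (`|cis t| * _) => x y; lra.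
rewrite E in speed; move/eqP: speed; rewrite mulf_eq0 oppr_eq0 (gt_eqF pos) orbF => /eqP//.
Qed.

End Multipliers.

Lemma rot_sub {R : realType} (y y' c b b' : pt R) (l l' : R) :
  (Jr y - l *: c - b) - (Jr y' - l' *: c - b') = Jr (y - y') - (l - l') *: c - (b - b').
Proof. by apply: pt_eq; rewrite !ptE; ring. Qed.

Lemma oka_ball {R : realType} (a0 a : pt R) (rho : R) : 0 < rho -> oka a0 rho a -> `|a - a0| <= rho.
Proof. by move=> rho0; rewrite /oka; lra. Qed.

(** * The reduced action and its gradient *)

Section ReducedProblem.
Context {R : realType} (N : nat) (N2 : (2 <= N)%N).
Local Notation th := (@th R N).
Local Notation W := (@W R N).
Variables (g : pt2 R -> R) (D : pt R -> pt R -> pt R) (a0 : pt R) (rho L mu : R).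
Hypotheses (rho0 : 0 < rho) (L0 : 0 < L) (mu0 : 0 < mu) (mu1 : mu <= 1).
Hypothesis farW : forall j (t : R), (0 < j < N)%N -> 2 * mu <= csq (W j t).
Hypothesis tay : taylor2 g D a0 rho L.
Local Notation DL := (DL tay).
Local Notation adm := (adm mu).
Local Notation oka := (oka a0 rho).
Local Notation okr := (okr rho).
Local Notation S1 := (S1 N).
Local Notation S2 := (S2 N D).
Local Notation Y := (Y N D).
Local Notation Nl := (Nl N D).
Local Notation cc := (@cc R N).
Local Notation kap := (@kap R N).
Local Notation ANl := (ANl N L mu).
Local Notation M1 := (M1 D a0 rho L).
Local Notation Phi := (Phi N g).
Local Notation "'ec' v" := (fun t => cis t + v t) (at level 10).

Variables (C1 r : R).
Hypotheses (C10 : 0 <= C1) (kr : okr r) (rd : C1 * r <= del mu).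

(* The Lyapunov-Schmidt correction: [cis + v] solves the system up to [lamb * cis] and the constant
   [bb]. *)
Definition sol a v :=
  [/\ small (C1 * r) v, deriv_eq N (Nl a r v) v, vmean v = 0 &
      ip (fun t => Jr (cis t)) v = 0].
Definition lamb a v : R := ip cis (Nl a r v).
Definition bb a v : pt R := vmean (Nl a r v).
Definition speed a v t : pt R := Jr (Y a r (ec v) t) - lamb a v *: cis t - bb a v.

Let B0 := 2 * cc * (N%:R * M1).
Let B1 := 2 * cc * (N%:R * L).
(** Constants for [Nl] ([CN0], [CN1]) and for [Y] ([Cc], [CY]). The first of each pair bounds the
    distance to the value at the polygon, 0 or [cis], in units of [r]; the second is a Lipschitz
    constant in [a] that includes the change of [v]. *)
Definition CN0 : R := ANl * (C1 + 1) * C1 + B0.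
Definition CN1 : R := ANl * (C1 + 1) * C1 + B1.
Definition Cc : R := kap * (N%:R * (2 / mu * (2 * C1))) + B0.
Definition CY : R := kap * (N%:R * (2 / mu * (2 * C1))) + 2 * cc * (N%:R * (L * (1 + C1))).

Let r0 : 0 < r. Proof. by case: kr. Qed.
Let r1 : r <= 1. Proof. by case: kr. Qed.
Let A0 : 0 <= ANl. Proof. exact: (ANl_ge0 N2 L0 mu0). Qed.

Lemma sol_adm a v : sol a v -> adm (ec v).
Proof. by move=> [sv _ _ _]; exact: (adm_small mu0 rd sv). Qed.

Lemma sol_Nl a v : oka a -> sol a v -> continuous (Nl a r v) /\ per (Nl a r v).
Proof.
move=> oa [sv _ _ _]; split; first exact: (Nl_continuous L0 mu0 mu1 farW DL rd sv oa kr).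
by have [_ pv _] := sv; apply: per_Nl => //; exact: mu0.
Qed.

Lemma sol_speed a v : oka a -> sol a v -> Dv (ec v) (speed a v) /\ continuous (speed a v).
Proof.
move=> oa sv; have au := sol_adm sv; have cY := Y_continuous L0 mu0 mu1 farW DL au oa kr.
have [ccs _ _] := adm_cis mu0; have [cN _] := sol_Nl oa sv.
split; last by rewrite /speed; vctn.
have [_ Dw _ _] := sv; have [c1 c2] := @Dv_cis R; have [d1 d2] := Dw.
have D' : Dv (ec v) (fun t => Jr (cis t) + (Lin N v t + Nl a r v t - lamb a v *: cis t - bb a v)).
  by split; apply: DerivD.
by apply: (Dv_ext D') => t; rewrite /speed /Nl; apply: pt_eq; rewrite !ptE; ring.
Qed.

Lemma Nl_small a v t : oka a -> sol a v -> `|Nl a r v t| <= CN0 * r.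
Proof.
move=> oa [sv _ _ _]; apply: (le_trans (Nl_bound N2 rho0 L0 mu0 mu1 farW DL t rd sv oa kr)).
rewrite (_ : CN0 * r = ANl * (C1 + 1) * C1 * r + B0 * r); last by rewrite /CN0; ring.
rewrite -/B0 lerD2r.
have rp := r0; have r1' := r1.
rewrite (_ : ANl * (C1 * r + r) * (C1 * r) = ANl * (C1 + 1) * C1 * r * r); last by ring.
rewrite -[leRHS]mulr1; apply: ler_wpM2l => //.
by rewrite !mulr_ge0 ?A0// ?addr_ge0// ltW.
Qed.

Lemma Nl_diff a a' v v' t : oka a -> oka a' -> sol a v -> sol a' v' ->
  (forall t, `|v t - v' t| <= C1 * r * `|a - a'|) ->
  `|Nl a r v t - Nl a' r v' t| <= CN1 * `|a - a'|.
Proof.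
move=> oa oa' [sv _ _ _] [sv' _ _ _] vv; have rp := r0; have r1' := r1.
rewrite -(subrK (Nl a r v' t) (Nl a r v t)) -addrA; apply: (le_trans (ler_normD _ _)).
have e0 : 0 <= C1 * r * `|a - a'| by rewrite !mulr_ge0// ltW.
have h1 := Nl_lip N2 L0 mu0 mu1 farW DL t rd sv sv' oa kr e0 vv.
have h2 := Nl_lip_a N2 L0 mu0 mu1 DL t rd sv' oa oa' kr.
apply: (le_trans (lerD h1 h2)).
rewrite (_ : CN1 * `|a - a'| = ANl * (C1 + 1) * C1 * `|a - a'| + B1 * `|a - a'|); last by rewrite /CN1; ring.
apply: lerD.
  rewrite (_ : ANl * (C1 * r + r) * (C1 * r * `|a - a'|) = ANl * (C1 + 1) * C1 * `|a - a'| * (r * r)); last by ring.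
  rewrite -[leRHS]mulr1; apply: ler_wpM2l.
    by rewrite !mulr_ge0 ?A0// addr_ge0.
  by rewrite -[leRHS]mulr1; apply: ler_pM => //; exact: ltW.
apply: ler_wpM2r => //; rewrite -/B1 -[leRHS]mulr1; apply: ler_wpM2l => //.
have c0 := @cc_gt0 R N N2.
by apply: mulr_ge0; apply: mulr_ge0 => //; exact: ltW.
Qed.

Lemma speed_near a v t : oka a -> sol a v -> `|speed a v t - Jr (cis t)| <= (Cc + 3 * CN0) * r.
Proof.
move=> oa sv; have au := sol_adm sv; have [[_ _ vb] _ _ _] := sv; have rp := r0.
have ud s : `|cis s + v s - cis s| <= C1 * r by rewrite addrC addKr.
have [cN _] := sol_Nl oa sv; have [ccs _ _] := adm_cis mu0.
have h1 := Y_near N2 rho0 L0 mu0 mu1 farW tay au oa kr ud t.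
have h2 : `|lamb a v| <= 2 * (1 * (CN0 * r)).
  by apply: ip_bound => // s; [exact: cis_bound|exact: Nl_small].
have h3 : `|bb a v| <= CN0 * r by apply: vmean_bound => // s; exact: Nl_small.
rewrite (_ : _ - _ = Jr (Y a r (ec v) t - cis t) - lamb a v *: cis t - bb a v); last first.
  by apply: pt_eq; rewrite /speed !ptE; ring.
apply: (le_trans (ler_normB _ _)); have h4 := ler_normB (Jr (Y a r (ec v) t - cis t)) (lamb a v *: cis t).
rewrite normJ normrZ in h4.
have h5 : `|lamb a v| * `|cis t| <= `|lamb a v| * 1 by apply: ler_wpM2l => //; exact: cis_bound.
have h6 : kap * (N%:R * (2 / mu * (2 * (C1 * r)))) = kap * (N%:R * (2 / mu * (2 * C1))) * r by ring.
rewrite -/B0 h6 in h1; rewrite /Cc.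
move: h1 h2 h3 h4 h5; move: (kap * _) => p; move: (`|_ - cis t|) (`|_ - _ *: _|) (`|lamb a v|) (_ * `|cis t|) (`|bb a v|).
by move=> *; lra.
Qed.

Lemma speed_lip a a' v v' t : oka a -> oka a' -> sol a v -> sol a' v' ->
  (forall t, `|v t - v' t| <= C1 * r * `|a - a'|) ->
  `|speed a v t - speed a' v' t| <= (CY + 3 * CN1) * `|a - a'|.
Proof.
move=> oa oa' sv sv' vv; have au := sol_adm sv; have au' := sol_adm sv'.
have rp := r0; have r1' := r1; have c0 := @cc_gt0 R N N2; have k0 := @kap_gt0 R N N2.
have [cN _] := sol_Nl oa sv; have [cN' _] := sol_Nl oa' sv'; have [ccs _ _] := adm_cis mu0.
set d := `|a - a'|; have d0 : 0 <= d by exact: normr_ge0.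
have e0 : 0 <= C1 * d by exact: mulr_ge0.
have uu s : `|(cis s + v s) - (cis s + v' s)| <= C1 * d.
  rewrite (_ : _ - _ = v s - v' s); last by apply: pt_eq; rewrite !ptE; ring.
  apply: (le_trans (vv s)); rewrite -/d mulrAC -[leRHS]mulr1; exact: ler_wpM2l.
have n1 := S1_lip mu0 mu1 farW au au' e0 (uu t) (fun j => uu (t + th j)).
have n2 := S2_lip L0 mu1 DL au au' oa oa' kr e0 (lexx d) (uu t) (fun j => uu (t + th j)).
have hY : `|Y a r (ec v) t - Y a' r (ec v') t| <= CY * d.
  rewrite (_ : _ - _ = kap *: (S1 (ec v) t - S1 (ec v') t) + (2 * r * cc) *: (S2 a r (ec v) t - S2 a' r (ec v') t)); last first.
    by apply: pt_eq; rewrite /Y !ptE; ring.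
  apply: (le_trans (ler_normD _ _)); rewrite !normZ_gt0//; last exact: rc_gt0.
  rewrite (_ : CY * d = kap * (N%:R * (2 / mu * (2 * C1))) * d + 2 * cc * (N%:R * (L * (1 + C1))) * d); last by rewrite /CY; ring.
  apply: lerD.
    rewrite (_ : kap * (N%:R * (2 / mu * (2 * C1))) * d = kap * (N%:R * (2 / mu * (2 * (C1 * d))))); last by ring.
    by apply: ler_wpM2l => //; exact: ltW.
  rewrite (_ : 2 * cc * (N%:R * (L * (1 + C1))) * d = 2 * cc * (N%:R * (L * (d + C1 * d)))); last by ring.
  rewrite (_ : 2 * r * cc = r * (2 * cc)); last by ring.
  have c2 : 0 <= 2 * cc by apply: mulr_ge0 => //; exact: ltW.
  apply: (@le_trans _ _ (1 * (2 * cc) * `|S2 a r (ec v) t - S2 a' r (ec v') t|)).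
    by apply: ler_wpM2r => //; exact: ler_wpM2r.
  rewrite mul1r; apply: ler_wpM2l => //; apply: (le_trans n2).
  apply: ler_wpM2l => //; apply: ler_wpM2l; first exact: ltW.
  by rewrite lerD2l -[leRHS]mul1r; apply: ler_wpM2r.
have hN s := Nl_diff s oa oa' sv sv' vv.
have hl : `|lamb a v - lamb a' v'| <= 2 * (1 * (CN1 * d)).
  have -> : lamb a v - lamb a' v' = ip cis (fun t => Nl a r v t - Nl a' r v' t).
    rewrite /lamb /ip -meanB; [|exact: vct_dot..].
    by apply: eq_mean => s; rewrite /dot !ptE; ring.
  by apply: ip_bound => //; [vctn|exact: cis_bound].
have hb : `|bb a v - bb a' v'| <= CN1 * d by apply: vmean_lip.
rewrite /speed rot_sub.
apply: (le_trans (ler_normB _ _)).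
have h4 := ler_normB (Jr (Y a r (ec v) t - Y a' r (ec v') t)) ((lamb a v - lamb a' v') *: cis t).
rewrite normJ normrZ in h4.
have h5 : `|lamb a v - lamb a' v'| * `|cis t| <= `|lamb a v - lamb a' v'| * 1 by apply: ler_wpM2l => //; exact: cis_bound.
move: hY hl hb h4 h5; move: (`|Y _ _ _ _ - _|) (`|_ - _ *: cis t|) (`|lamb a v - _|) (_ * `|cis t|) (`|bb a v - _|).
by move=> *; lra.
Qed.

(** One constant for the changes of [a], of the curve and of its velocity, since [Phi_taylor] takes
    a single [e] for the three. *)
Definition E1 : R := 1 + C1 + (CY + 3 * CN1).

Lemma CY_ge0 : 0 <= CY.
Proof.
have c0 := @cc_gt0 R N N2; have k0 := @kap_gt0 R N N2.
apply: addr_ge0; apply: mulr_ge0; rewrite ?(ltW k0)//.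
- by rewrite !mulr_ge0// invr_ge0 ltW.
- by apply: mulr_ge0 => //; exact: ltW.
- by rewrite !mulr_ge0 ?addr_ge0// ltW.
Qed.

Lemma CN1_ge0 : 0 <= CN1.
Proof.
have c0 := @cc_gt0 R N N2; apply: addr_ge0.
  by rewrite !mulr_ge0 ?A0// addr_ge0.
by apply: mulr_ge0; apply: mulr_ge0 => //; exact: ltW.
Qed.

(** By the equation for [v], the first variation in [u] is [lamb] times [Jr cis] plus [Jr bb]. It is
    orthogonal to [v' - v], as both corrections have mean zero and are orthogonal to [Jr cis]; only
    the explicit derivative in [a] remains. *)
Lemma Phi_sol a a' v v' : oka a -> oka a' -> sol a v -> sol a' v' ->
  (forall t, `|v t - v' t| <= C1 * r * `|a - a'|) ->
  `|Phi a' r (ec v') (speed a' v') - Phi a r (ec v) (speed a v)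
     + 2 * cc * dot (vmean (S2 a r (ec v))) (a' - a)| <= CT N L mu * (E1 * `|a - a'|) ^+ 2.
Proof.
move=> oa oa' sv sv' vv; have au := sol_adm sv; have au' := sol_adm sv'.
have [Du cu1] := sol_speed oa sv; have [Du' cu1'] := sol_speed oa' sv'.
have hs t := speed_lip t oa oa' sv sv' vv.
have r1' := r1; have y0 := CY_ge0; have n0 := CN1_ge0; have C1' := C10.
set d := `|a - a'| in vv hs *; have d0 : 0 <= d by exact: normr_ge0.
have cd0 : 0 <= C1 * d by exact: mulr_ge0.
have sd0 : 0 <= (CY + 3 * CN1) * d by apply: mulr_ge0 => //; lra.
have Ed : E1 * d = d + C1 * d + (CY + 3 * CN1) * d by rewrite /E1; ring.
have e0 : 0 <= E1 * d by rewrite Ed; lra.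
have h1 : `|a' - a| <= E1 * d by rewrite distrC -/d Ed; lra.
have h2 t : `|cis t + v' t - (cis t + v t)| <= E1 * d.
  rewrite (_ : _ - _ = v' t - v t); last by apply: pt_eq; rewrite !ptE; ring.
  rewrite distrC; apply: (le_trans (vv t)).
  have : C1 * d * r <= C1 * d * 1 by apply: ler_wpM2l.
  by rewrite Ed mulrAC; lra.
have h3 t : `|speed a' v' t - speed a v t| <= E1 * d.
  by rewrite distrC; apply: (le_trans (hs t)); rewrite Ed; lra.
have := Phi_taylor N2 rho0 L0 mu0 mu1 farW tay au au' oa oa' kr e0 Du Du' cu1 cu1' h1 h2 h3.
suff -> : ip (fun t => - Jr (speed a v t) - Y a r (ec v) t) (fun t => cis t + v' t - (cis t + v t)) = 0.
  by rewrite sub0r opprK.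
have [ccs _ _] := adm_cis mu0; have cJ := vctJ ccs.
have [[cv _ _] _ m1 m2] := sv; have [[cv' _ _] _ m1' m2'] := sv'.
transitivity (ip (fun t => lamb a v *: Jr (cis t) + Jr (bb a v)) (fun t => v' t + (- 1) *: v t)).
  apply: eq_mean => t; rewrite /speed; move: (Y a r _ t) (cis t) (bb a v) (lamb a v) => y p b l.
  by rewrite /dot !ptE; ring.
rewrite ipDr; [|by vctn|by vctn|by vctn].
rewrite ipZr; [|by vctn|by vctn].
rewrite !ipDl; [|by vctn..].
by rewrite (ipZl _ cJ cv) (ipZl _ cJ cv') (ip_cstl _ cv) (ip_cstl _ cv') m1 m2 m1' m2' /dot /=; ring.
Qed.

Definition C3 : R := C1 + (Cc + 3 * CN0).
Definition CP : R := 1 + (N%:R - 1)^-1 * (N%:R * (129 / mu ^+ 2 * 4)).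

Lemma CN0_ge0 : 0 <= CN0.
Proof.
have c0 := @cc_gt0 R N N2; apply: addr_ge0.
  by rewrite !mulr_ge0 ?A0// addr_ge0.
by apply: mulr_ge0; apply: mulr_ge0 => //; [exact: ltW|exact: M1_ge0].
Qed.

Lemma Cc_ge0 : 0 <= Cc.
Proof.
have c0 := @cc_gt0 R N N2; have k0 := @kap_gt0 R N N2; apply: addr_ge0.
  by apply: mulr_ge0; [exact: ltW|rewrite !mulr_ge0// invr_ge0 ltW].
by apply: mulr_ge0; apply: mulr_ge0 => //; [exact: ltW|exact: M1_ge0].
Qed.

(** By [kap_S1_cis] the polygon is critical for the part of [Phi] without [g], so the first-order
    terms cancel. *)
Lemma action_near a v : oka a -> sol a v ->
  `|(action (ec v) (speed a v) - (N%:R - 1)^-1 * logen N (ec v))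
    - (action cis (fun t => Jr (cis t)) - (N%:R - 1)^-1 * logen N cis)| <= CP * (C3 * r) ^+ 2.
Proof.
move=> oa sv; have au := sol_adm sv; have [Du cu1] := sol_speed oa sv.
have [[cv pv vb] _ m1 m2] := sv; have ac := @adm_cis R mu mu0; have [ccs pc _] := ac.
have cJ := vctJ ccs; have [cu pu _] := au.
have rp := r0; have n0 := CN0_ge0; have c0 := Cc_ge0; have C1' := C10.
have n1 := @N1_gt0 R N N2.
have i1 : 0 <= C1 * r by rewrite mulr_ge0// ltW.
have i2 : 0 <= (Cc + 3 * CN0) * r by apply: mulr_ge0; [lra|exact: ltW].
have Er : C3 * r = C1 * r + (Cc + 3 * CN0) * r by rewrite /C3; ring.
have e0 : 0 <= C3 * r by rewrite Er; lra.
have h1 t : `|cis t + v t - cis t| <= C3 * r by rewrite addrC addKr; apply: (le_trans (vb t)); rewrite Er; lra.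
have h2 t : `|speed a v t - Jr (cis t)| <= C3 * r by apply: (le_trans (speed_near t oa sv)); rewrite Er; lra.
have t1 := action_taylor e0 (@Dv_cis R) Du cJ cu1 pc pu h1 h2.
have t2 := logen_taylor N2 mu0 mu1 farW e0 ac au h1.
have cS1 := S1_continuous mu0 mu1 farW ac.
have E : ip (fun t => Jr (cis t)) (fun t => Jr (cis t + v t - cis t)) =
   kap * ip (S1 cis) (fun t => cis t + v t - cis t).
  rewrite -ipZl//; last by vctn.
  apply: eq_mean => t; rewrite (kap_S1_cis N2); move: (cis t) => p.
  by rewrite /dot !ptE; ring.
rewrite E in t1.
set I := ip (S1 cis) _ in t1 t2.
set A1 := action (ec v) _ - _ - _ in t1; set A2 := logen N (ec v) - _ - _ in t2.
rewrite (_ : _ - _ = A1 - (N%:R - 1)^-1 * A2); last first.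
  by rewrite /A1 /A2 /kap; field; rewrite gt_eqF.
have i0 : 0 <= (N%:R - 1)^-1 :> R by rewrite invr_ge0 ltW.
apply: (le_trans (ler_normB _ _)); rewrite normrM (ger0_norm i0) /CP mulrDl mul1r; apply: lerD => //.
rewrite -[leRHS]mulrA; apply: ler_wpM2l => //; apply: (le_trans t2).
by rewrite le_eqVlt; apply/orP; left; apply/eqP; ring.
Qed.

Lemma pos_near a v t : sol a v -> `|a + r *: (cis t + v t) - a| <= 2 * r.
Proof.
move=> sv; have au := sol_adm sv; rewrite addrC addKr normZ_gt0// mulrC.
have h := adm_bound mu1 t au.
by apply: ler_wpM2r => //; exact: ltW.
Qed.

Lemma gen_near a v : oka a -> sol a v ->
  `|gen N g a r (ec v) - N%:R * g (a, a)| <= N%:R * (Lg D a0 rho L * (2 * r)).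
Proof.
move=> oa sv; have au := sol_adm sv.
have rp := r0; have rh := rho0; have [_ _ r4] := kr.
have aa := oka_ball rho0 oa.
have q1 : 0 <= 2 * r by lra.
have q2 : 2 * r <= 2 * rho by lra.
have M0 := M1_ge0 D a0 rho0 L0.
have Lg0 : 0 <= Lg D a0 rho L.
  by rewrite /Lg addr_ge0// mulr_ge0// ?(ltW L0)// mulr_ge0// ltW.
have -> : N%:R * g (a, a) = \sum_(0 <= j < N) g (a, a) by rewrite sumr_const_nat subn0 mulr_natl.
rewrite /gen -sumrB; apply: norm_sum_nat; first exact: mulr_ge0.
move=> j _; have cg := gpair_continuous (N := N) (j := j) rho0 L0 mu1 tay au oa kr.
rewrite -[X in `|_ - X|](mean_cst (g (a, a))) -meanB//; last exact: ct_cst.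
apply: mean_norm; first by apply: ctD => //; apply: ctN; exact: ct_cst.
have b s := ok_ball mu1 s oa kr au; have pn s := pos_near s sv.
by move=> t _; apply: (g_lip rho0 L0 tay q1 q2 aa aa (b t) (b (t + th j)) (pn t) (pn (t + th j))).
Qed.

Lemma S2_near a v : oka a -> sol a v ->
  `|vmean (S2 a r (ec v)) - N%:R *: D a a| <= N%:R * (L * (2 * r)).
Proof.
move=> oa sv; have au := sol_adm sv.
have rp := r0; have rh := rho0; have [_ _ r4] := kr.
have aa := oka_ball rho0 oa.
have q1 : 0 <= 2 * r by lra.
have cS2 := S2_continuous (N := N) L0 mu1 DL au oa kr.
rewrite -[X in `|_ - X|]vmean_cst; apply: vmean_lip => //; first exact: ct_cst.
move=> t; have -> : N%:R *: D a a = \sum_(0 <= j < N) D a a by rewrite sumr_const_nat subn0 scaler_nat.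
rewrite /S2 -sumrB; apply: norm_sum_nat; first by rewrite mulr_ge0// ltW.
have b s := ok_ball mu1 s oa kr au; have pn s := pos_near s sv.
by move=> j _; apply: (DL q1 aa aa (b t) (b (t + th j)) (pn t) (pn (t + th j))).
Qed.

Lemma S2_lipa a a' v v' : oka a -> oka a' -> sol a v -> sol a' v' ->
  (forall t, `|v t - v' t| <= C1 * r * `|a - a'|) ->
  `|vmean (S2 a' r (ec v')) - vmean (S2 a r (ec v))| <= N%:R * (L * ((1 + C1) * `|a - a'|)).
Proof.
move=> oa oa' sv sv' vv; have au := sol_adm sv; have au' := sol_adm sv'.
have cS2 := S2_continuous (N := N) L0 mu1 DL au oa kr.
have cS2' := S2_continuous (N := N) L0 mu1 DL au' oa' kr.
have rp := r0; have r1' := r1.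
rewrite distrC; apply: vmean_lip => // t.
set d := `|a - a'| in vv *; have d0 : 0 <= d by exact: normr_ge0.
have uu s : `|(cis s + v s) - (cis s + v' s)| <= C1 * r * d.
  by rewrite (_ : _ - _ = v s - v' s); last by apply: pt_eq; rewrite !ptE; ring.
have e0 : 0 <= C1 * r * d by rewrite !mulr_ge0// ltW.
apply: (le_trans (S2_lip L0 mu1 DL au au' oa oa' kr e0 (lexx d) (uu t) (fun j => uu (t + th j)))).
apply: ler_wpM2l => //; apply: ler_wpM2l; first exact: ltW.
rewrite mulrDl mul1r lerD2l (_ : r * (C1 * r * d) = C1 * d * (r * r)); last by ring.
rewrite -[leRHS]mulr1; apply: ler_wpM2l; first exact: mulr_ge0.
by rewrite -[leRHS]mulr1; apply: ler_pM => //; exact: ltW.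
Qed.

End ReducedProblem.

(** * Comparison of the reduced function with [h] *)

Section ReducedFunction.
Context {R : realType} (N : nat) (N2 : (2 <= N)%N).
Variables (g : pt2 R -> R) (D : pt R -> pt R -> pt R) (a0 : pt R) (rho L mu : R).
Hypotheses (rho0 : 0 < rho) (L0 : 0 < L) (mu0 : 0 < mu) (mu1 : mu <= 1).
Hypothesis farW : forall j (t : R), (0 < j < N)%N -> 2 * mu <= csq (W N j t).
Hypothesis tay : taylor2 g D a0 rho L.
Local Notation "'ec' v" := (fun t => cis t + v t) (at level 10).
Local Notation cc := (@cc R N).

(** [F] is the gradient of [ph] in the sense of an expansion with quadratic remainder, and both
    approach their counterparts for [h - h a0] at rate [r]. At a zero of [F] both multipliers
    vanish, which leaves a genuine solution. *)
Lemma reduced_problem : exists r1 C : R, [/\ 0 < r1, 0 <= C &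
  exists (V : pt R -> R -> R -> pt R) (ph : R -> pt R -> R) (F : R -> pt R -> pt R),
  forall r, 0 < r <= r1 ->
  [/\ okr rho r,
      forall a a', oka a0 rho a -> oka a0 rho a' ->
        `|ph r a' - ph r a - dot (F r a) (a' - a)| <= C * `|a' - a| ^+ 2 /\
        `|F r a' - F r a| <= C * `|a' - a|,
      forall a, oka a0 rho a -> `|ph r a - (g (a, a) - g (a0, a0))| <= C * r /\
        `|F r a - 2 *: D a a| <= C * r &
      forall a, oka a0 rho a -> F r a = 0 ->
        [/\ adm mu (ec (V a r)), Dv (ec (V a r)) (fun t => Jr (Y N D a r (ec (V a r)) t)),
            forall t, `|V a r t| <= C * r &
            forall t, `|Jr (Y N D a r (ec (V a r)) t) - Jr (cis t)| <= C * r]]].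
Proof.
have [r1 [C1 [r10 C10 [V [HV LV]]]]] := fixed_point N2 rho0 L0 mu0 mu1 farW (DL tay).
have c0 := @cc_gt0 R N N2.
have N0 : 0 < N%:R :> R by rewrite ltr0n; exact: leq_trans N2.
have cN : 0 < cc * N%:R by apply: mulr_gt0.
pose u a r := ec (V a r).
pose s a r := speed N D r a (V a r).
(* The limit of the terms of [Phi] without [g]. Subtracting it and dividing by [- cc * N] turns
   [Phi] into an approximation of [g (a, a)]. *)
pose K0 := action (@cis R) (fun t => Jr (cis t)) - (N%:R - 1)^-1 * logen N cis.
pose ph r a := - (Phi N g a r (u a r) (s a r) - K0) / (cc * N%:R) - g (a0, a0).
pose F r a := (2 / N%:R) *: vmean (S2 N D a r (u a r)).
pose K1 := CT N L mu * (E1 N L mu C1) ^+ 2 / (cc * N%:R).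
pose K2 := 2 * (L * (1 + C1)).
pose K3 := CP N mu * (C3 N D a0 rho L mu C1) ^+ 2 / (cc * N%:R).
pose K4 := Lg D a0 rho L * 2.
pose K6 := Cc N D a0 rho L mu C1 + 3 * CN0 N D a0 rho L mu C1.
pose C := `|K1| + `|K2| + (`|K3| + `|K4|) + `|4 * L| + C1 + `|K6|.
have nK1 := normr_ge0 K1; have nK2 := normr_ge0 K2; have nK3 := normr_ge0 K3.
have nK4 := normr_ge0 K4; have nK5 := normr_ge0 (4 * L); have nK6 := normr_ge0 K6.
have C0 : 0 <= C by rewrite /C; slra.
have le1 (K x y : R) : `|K| <= C -> 0 <= y -> x <= K * y -> x <= C * y.
  move=> KC y0 xK; apply: (le_trans xK); apply: ler_wpM2r => //.
  exact: le_trans (ler_norm _) KC.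
have lK1 : `|K1| <= C by rewrite /C; slra.
have lK2 : `|K2| <= C by rewrite /C; slra.
have lK34 : `|K3 + K4| <= C by apply: (le_trans (ler_normD _ _)); rewrite /C; slra.
have lK5 : `|4 * L| <= C by rewrite /C; slra.
have lK6 : `|K6| <= C by rewrite /C; slra.
have lC1 : `|C1| <= C by rewrite ger0_norm// /C; slra.
have HS a r : oka a0 rho a -> 0 < r <= r1 -> [/\ okr rho r, C1 * r <= del mu & sol N D C1 r a (V a r)].
  by move=> oa rr; have [[kr rd] sm de v0 m0] := HV a r oa rr; split.
exists r1, C; split=> //; exists V, ph, F => r rr.
have z : oka a0 rho a0 by rewrite /oka subrr normr0; have := rho0; slra.
have [kr rd _] := HS a0 r z rr; have [rp r1' _] := kr.
split=> //.
- move=> a a' oa oa'; have [_ _ sa] := HS a r oa rr; have [_ _ sa'] := HS a' r oa' rr.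
  have vv t := LV a a' r t oa oa' rr.
  have P1 := Phi_sol N2 rho0 L0 mu0 mu1 farW tay C10 kr rd oa oa' sa sa' vv.
  have P2 := S2_lipa L0 mu0 mu1 tay C10 kr rd oa oa' sa sa' vv.
  rewrite (distrC a a') in P1 P2; split.
    apply: (le1 K1) => //.
    rewrite /ph /F -/(u a r) -/(u a' r) -/(s a r) -/(s a' r) in P1 *.
    move: P1; move: (Phi N g a' r _ _) (Phi N g a r _ _) (vmean _) => p' p w P1.
    have -> : - (p' - K0) / (cc * N%:R) - g (a0, a0) - (- (p - K0) / (cc * N%:R) - g (a0, a0))
        - dot ((2 / N%:R) *: w) (a' - a) = - ((p' - p + 2 * cc * dot w (a' - a)) / (cc * N%:R)).
      have -> : dot ((2 / N%:R) *: w) (a' - a) = 2 / N%:R * dot w (a' - a) by rewrite /dot !ptE; ring.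
      by field; rewrite !gt_eqF.
    rewrite normrN normrM (ger0_norm (_ : 0 <= (cc * N%:R)^-1)); last by rewrite invr_ge0 ltW.
    rewrite ler_pdivrMr//; apply: (le_trans P1).
    rewrite /K1 le_eqVlt; apply/orP; left; apply/eqP; field.
    by rewrite !gt_eqF.
  apply: (le1 K2) => //; rewrite /F -scalerBr normZ_gt0 ?divr_gt0//.
  rewrite (_ : K2 * `|a' - a| = 2 / N%:R * (N%:R * (L * ((1 + C1) * `|a' - a|)))); last first.
    by rewrite /K2; field; rewrite gt_eqF.
  by apply: ler_wpM2l => //; rewrite divr_ge0// ltW.
- move=> a oa; have [_ _ sa] := HS a r oa rr.
  have P1 := action_near N2 rho0 L0 mu0 mu1 farW tay C10 kr rd oa sa.
  have P2 := gen_near rho0 L0 mu0 mu1 tay kr rd oa sa.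
  have P3 := S2_near rho0 L0 mu0 mu1 tay kr rd oa sa.
  split.
    apply: (le1 (K3 + K4)) => //; first exact: ltW.
    rewrite /ph /Phi -/(u a r) -/(s a r) -/K0 in P1 P2 *.
    move: P1 P2; move: (_ - _ * logen N (u a r)) (gen _ _ _ _ _) => p q P1 P2.
    have -> : - (p - cc * q - K0) / (cc * N%:R) - g (a0, a0) - (g (a, a) - g (a0, a0)) =
        - ((p - K0) / (cc * N%:R)) + (q - N%:R * g (a, a)) / N%:R.
      by field; rewrite !gt_eqF.
    apply: (le_trans (ler_normD _ _)); rewrite [leRHS]mulrDl; apply: lerD.
      rewrite normrN normrM (ger0_norm (_ : 0 <= (cc * N%:R)^-1)); last by rewrite invr_ge0 ltW.
      rewrite ler_pdivrMr//; apply: (le_trans P1).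
      have -> : K3 * r * (cc * N%:R) = CP N mu * (C3 N D a0 rho L mu C1) ^+ 2 * r.
        by rewrite /K3; field; rewrite !gt_eqF.
      rewrite exprMn mulrA expr2 mulrA -[leRHS]mulr1; apply: ler_wpM2l => //.
      apply: mulr_ge0; last exact: ltW.
      apply: mulr_ge0; last exact: sqr_ge0.
      have n1 := @N1_gt0 R N N2.
      by rewrite /CP addr_ge0// !mulr_ge0// invr_ge0 ?exprn_ge0// ltW.
    rewrite normrM (ger0_norm (_ : 0 <= (N%:R)^-1)) ?invr_ge0//.
    rewrite ler_pdivrMr//; apply: (le_trans P2).
    by rewrite /K4 le_eqVlt; apply/orP; left; apply/eqP; ring.
  apply: (le1 (4 * L)) => //; first exact: ltW.
  rewrite /F (_ : _ - _ = (2 / N%:R) *: (vmean (S2 N D a r (u a r)) - N%:R *: D a a)); last first.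
    by rewrite scalerBr scalerA divfK// gt_eqF.
  rewrite normZ_gt0 ?divr_gt0//.
  rewrite (_ : 4 * L * r = 2 / N%:R * (N%:R * (L * (2 * r)))); last by field; rewrite gt_eqF.
  by apply: ler_wpM2l => //; rewrite divr_ge0// ltW.
- move=> a oa Fa0; have [_ _ sa] := HS a r oa rr.
  have au := sol_adm mu0 rd sa; have [Du _] := sol_speed L0 mu0 mu1 farW tay kr rd oa sa.
  have S20 : vmean (S2 N D a r (u a r)) = 0.
    move/eqP : Fa0; rewrite /F scaler_eq0 gt_eqF ?divr_gt0//= => /eqP//.
  (* The zero of [F] first kills the constant multiplier; the remaining equation is the one that
     [mult_lam] asks for. *)
  have b0 := mult_b N2 L0 mu0 mu1 farW tay au oa kr Du; rewrite S20 in b0.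
  have b0' : bb N D r a (V a r) = 0.
    by rewrite b0; apply: pt_eq; rewrite !ptE /= ?oppr0 mulr0.
  have Du' : Dv (ec (V a r)) (fun t => Jr (Y N D a r (ec (V a r)) t) - lamb N D r a (V a r) *: cis t).
    by apply: (Dv_ext Du) => t; rewrite /speed b0' subr0.
  have l0 := mult_lam N2 rho0 L0 mu0 mu1 farW tay au oa kr Du'.
  have sE t : speed N D r a (V a r) t = Jr (Y N D a r (ec (V a r)) t).
    by rewrite /speed b0' l0 scale0r !subr0.
  split=> //.
  + by apply: (Dv_ext Du) => t; exact: sE.
  + move=> t; apply: (le1 C1) => //; first exact: ltW.
    by have [[_ _ vb] _ _ _] := sa; exact: vb.
  + move=> t; apply: (le1 K6) => //; first exact: ltW.
    by rewrite -sE; exact: (speed_near N2 rho0 L0 mu0 mu1 farW tay C10 kr rd t oa sa).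
Qed.

End ReducedFunction.

(** * Directional expansions with quadratic remainder *)

Section QuadraticExpansions.
Context {R : realType} (V : normedModType R) (x v : V).

(** A directional derivative with a quadratic error: stable under sums, and given directly by the
    estimates for [g] and for the logarithm. *)
Definition quadr (f : V -> R) (l : R) :=
  exists e C : R, [/\ 0 < e, 0 <= C &
    forall h : R, `|h| <= e -> `|f (h *: v + x) - f x - h * l| <= C * h ^+ 2].

Lemma quadr_derive f l : quadr f l -> is_derive x v f l.
Proof. by move=> [e [C [e0 _ H]]]; exact: quad_is_derive e0 H. Qed.

Lemma quadr_cst (k : R) : quadr (fun=> k) 0.
Proof. by exists 1, 0; split=> // h _; rewrite subrr mulr0 subrr normr0 mul0r. Qed.

Lemma quadrD f f' l l' : quadr f l -> quadr f' l' -> quadr (fun p => f p + f' p) (l + l').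
Proof.
move=> [e [C [e0 C0 H]]] [e' [C' [e0' C0' H']]]; exists (Num.min e e'), (C + C').
split; [by rewrite lt_min e0|exact: addr_ge0|].
move=> h; rewrite le_min => /andP[h1 h2]; have := H h h1; have := H' h h2.
rewrite (_ : _ - h * (l + l') = (f (h *: v + x) - f x - h * l) + (f' (h *: v + x) - f' x - h * l')); last by ring.
by move=> h3 h4; apply: (le_trans (ler_normD _ _)); rewrite mulrDl; exact: lerD.
Qed.

Lemma quadrZ k f l : quadr f l -> quadr (fun p => k * f p) (k * l).
Proof.
move=> [e [C [e0 C0 H]]]; exists e, (`|k| * C); split=> //; first exact: mulr_ge0.
move=> h he; rewrite (_ : _ - _ = k * (f (h *: v + x) - f x - h * l)); last by ring.
by rewrite normrM -mulrA; apply: ler_wpM2l => //; exact: H.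
Qed.

Lemma quadr_sum (I : Type) (s : seq I) (P : pred I) (f : I -> V -> R) (l : I -> R) :
  (forall i, P i -> quadr (f i) (l i)) ->
  quadr (fun p => \sum_(i <- s | P i) f i p) (\sum_(i <- s | P i) l i).
Proof.
move=> Hf; elim: s => [|i s IH].
  rewrite big_nil (_ : (fun p => _) = fun=> 0); first exact: quadr_cst.
  by apply/funext => p; rewrite big_nil.
rewrite big_cons (_ : (fun p => _) = fun p => if P i then f i p + \sum_(j <- s | P j) f j p
   else \sum_(j <- s | P j) f j p); last by apply/funext => p; rewrite big_cons.
by case: ifP => // Pi; apply: quadrD => //; exact: Hf.
Qed.

End QuadraticExpansions.

(** * The gradient of the Hamiltonian *)

Section Gradient.
Context {R : realType}.

(** At 0 both sides are 0 by the conventions for the inverse and the logarithm. *)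
Lemma ln_cabs (p : pt R) : ln ((cabs p)^-1) = - (ln (csq p) / 2).
Proof.
have [z|nz] := eqVneq (csq p) 0.
  by rewrite /cabs z sqrtr0 invr0 !ln0// mul0r oppr0.
have p0 : 0 < csq p by rewrite lt_neqAle eq_sym nz csq_ge0.
have s0 : 0 < cabs p by rewrite /cabs sqrtr_gt0.
rewrite lnV ?posrE//; congr (- _).
by rewrite -[csq p](sqr_sqrtr (csq_ge0 p)) lnXn// -/(cabs p) mulr2n; field.
Qed.

Lemma quadr_ln (c x v : pt R) : 0 < csq (x - c) -> `|x - c| <= 3 -> `|v| <= 1 ->
  quadr x v (fun p => ln ((cabs (p - c))^-1)) (- dot (phi (x - c)) v).
Proof.
move=> w0 w3 v1; pose w := x - c.
(* With [|w| <= 3], a displacement of size at most [csq w / 16] lowers [csq w] by at most three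
   quarters, so [ln_taylor] applies with the bound [m]. *)
pose m := Num.min 1 (csq w / 4); pose e := Num.min 1 (csq w / 16).
have m0 : 0 < m by rewrite lt_min ltr01 divr_gt0.
have m1 : m <= 1 by rewrite ge_min lexx.
have e0 : 0 < e by rewrite lt_min ltr01 divr_gt0.
have mw : m <= csq w / 4 by rewrite ge_min lexx orbT.
have m2 : 0 < m ^+ 2 by rewrite exprn_gt0.
exists e, (129 / m ^+ 2); split=> //; first by rewrite divr_ge0// ltW.
move=> h; rewrite le_min => /andP[h1 h2].
have E : h *: v + x - c = w + h *: v by apply: pt_eq; rewrite /w !ptE; ring.
have hv : `|h *: v| <= `|h| by rewrite normrZ -[leRHS]mulr1; exact: ler_wpM2l.
have f1 : m <= csq w by rewrite -/w in w0; lra.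
have f2 : m <= csq (w + h *: v).
  have -> : csq (w + h *: v) = csq w + 2 * dot w (h *: v) + csq (h *: v) by rewrite /csq /dot !ptE; ring.
  have := csq_ge0 (h *: v); have := dot_le w (h *: v).
  have : `|w| * `|h *: v| <= 3 * `|h| by apply: ler_pM.
  by rewrite ler_norml => q1 /andP[q2 _] q3; rewrite -/w in w0; move: q1 q2 q3; move: (_ * `|h *: v|) (dot _ _) (csq (_ *: _)) => *; lra.
have g1 : `|w| <= 4 by rewrite -/w in w3; lra.
have g2 : `|w + h *: v| <= 4 by apply: (le_trans (ler_normD _ _)); rewrite -/w in w3; lra.
have := ln_taylor m0 m1 f1 f2 g1 g2; rewrite E !ln_cabs -/w (_ : w + h *: v - w = h *: v); last by rewrite addrC addKr.
have -> : dot (phi w) (h *: v) = h * dot (phi w) v by rewrite /dot !ptE; ring.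
rewrite -[X in X <= _]normrN (_ : - (_ - h * dot (phi w) v) = - (ln (csq (w + h *: v)) / 2) - - (ln (csq w) / 2) - h * - dot (phi w) v); last by ring.
move=> T; apply: (le_trans T); apply: ler_wpM2l; first by rewrite divr_ge0// ltW.
by rewrite -[leRHS]real_normK ?num_real//; apply: lerXn2r; rewrite ?nnegrE.
Qed.

Variables (g : pt2 R -> R) (D : pt R -> pt R -> pt R) (a0 : pt R) (rho L : R).
Hypotheses (rho0 : 0 < rho) (L0 : 0 < L).
Hypothesis tay : taylor2 g D a0 rho L.

Lemma line_ball (x v : pt R) (h : R) : `|x - a0| < rho -> `|v| <= 1 -> `|h| <= rho - `|x - a0| ->
  `|h *: v + x - a0| <= rho /\ `|h *: v + x - x| <= `|h|.
Proof.
move=> xr v1 hr.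
have hv : `|h *: v| <= `|h| by rewrite normrZ -[leRHS]mulr1; exact: ler_wpM2l.
split; last by rewrite addrK.
by rewrite -addrA; apply: (le_trans (ler_normD _ _)); lra.
Qed.

Lemma quadr_g2 (x y v w : pt R) : `|x - a0| < rho -> `|y - a0| < rho -> `|v| <= 1 -> `|w| <= 1 ->
  exists e C : R, [/\ 0 < e, 0 <= C & forall h : R, `|h| <= e ->
    `|g (h *: v + x, h *: w + y) - g (x, y) - h * (dot (D x y) v + dot (D y x) w)| <= C * h ^+ 2].
Proof.
move=> xr yr v1 w1; exists (Num.min (rho - `|x - a0|) (rho - `|y - a0|)), L; split; [|exact: ltW|].
  by rewrite lt_min !subr_gt0 xr.
move=> h; rewrite le_min => /andP[h1 h2].
have [b1 c1] := line_ball xr v1 h1; have [b2 c2] := line_ball yr w1 h2.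
have [+ _] := tay (normr_ge0 h) (ltW xr) (ltW yr) b1 b2 c1 c2.
rewrite real_normK ?num_real// !addrK; congr (`|_| <= _).
by move: (g _) (g _) => s t; rewrite /dot !ptE; ring.
Qed.

Lemma quadr_gl (x y v : pt R) : `|x - a0| < rho -> `|y - a0| < rho -> `|v| <= 1 ->
  quadr x v (fun p => g (p, y)) (dot (D x y) v).
Proof.
move=> xr yr v1; have z : `|0 : pt R| <= 1 by rewrite normr0.
have [e [C [e0 C0 H]]] := quadr_g2 xr yr v1 z; exists e, C; split=> // h he.
have := H h he; rewrite scaler0 add0r (_ : dot (D y x) 0 = 0) ?addr0//.
by rewrite /dot /= !mulr0 addr0.
Qed.

Lemma quadr_gr (x y v : pt R) : `|x - a0| < rho -> `|y - a0| < rho -> `|v| <= 1 ->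
  quadr x v (fun p => g (y, p)) (dot (D x y) v).
Proof.
move=> xr yr v1; have z : `|0 : pt R| <= 1 by rewrite normr0.
have [e [C [e0 C0 H]]] := quadr_g2 yr xr z v1; exists e, C; split=> // h he.
have := H h he; rewrite scaler0 add0r (_ : dot (D y x) 0 = 0) ?add0r//.
by rewrite /dot /= !mulr0 addr0.
Qed.

Lemma quadr_gd (x v : pt R) : `|x - a0| < rho -> `|v| <= 1 ->
  quadr x v (fun p => g (p, p)) (2 * dot (D x x) v).
Proof.
move=> xr v1; have [e [C [e0 C0 H]]] := quadr_g2 xr xr v1 v1; exists e, C; split=> // h he.
by have := H h he; rewrite (_ : dot (D x x) v + dot (D x x) v = 2 * dot (D x x) v)//; ring.
Qed.

Lemma basis_grad (f : pt R -> R) (x p : pt R) :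
  (forall v : pt R, `|v| <= 1 -> quadr x v f (dot p v)) -> grad f x = p.
Proof.
move=> H; rewrite /grad.
have n1 : `|(1, 0) : pt R| <= 1 by rewrite ptnormP/= normr1 normr0 lexx ler01.
have n2 : `|(0, 1) : pt R| <= 1 by rewrite ptnormP/= normr1 normr0 lexx ler01.
have d1 := quadr_derive (H _ n1); have d2 := quadr_derive (H _ n2).
rewrite (@derive_val _ _ _ _ _ _ _ d1) (@derive_val _ _ _ _ _ _ _ d2) /dot /=.
by rewrite !mulr1 !mulr0 addr0 add0r -surjective_pairing.
Qed.

Lemma grad_diag (x : pt R) : `|x - a0| < rho -> grad (fun z => g (z, z)) x = 2 *: D x x.
Proof.
move=> xr; apply: basis_grad => v v1.
have -> : dot (2 *: D x x) v = 2 * dot (D x x) v by rewrite /dot !ptE; ring.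
exact: quadr_gd.
Qed.

(** Moving the vortex [k] affects the ordered pairs that contain [k], and each unordered pair is
    counted twice. *)
Lemma sum_pairs N (k : 'I_N) (b : 'I_N -> R) :
  \sum_(i < N) \sum_(j < N | i != j) ((i == k)%:R * b j + (j == k)%:R * b i) = 2 * \sum_(j < N | j != k) b j.
Proof.
transitivity (\sum_(i < N) ((i == k)%:R * (\sum_(j < N | j != k) b j) + (i != k)%:R * b i)).
  apply: eq_bigr => i _; rewrite big_split/= -mulr_sumr -mulr_suml; congr (_ + _).
    by have [->|] := eqVneq i k; rewrite ?mul0r//; congr (_ * _); apply: eq_bigl => j; rewrite eq_sym.
  congr (_ * _); have [->|ik] := eqVneq i k.
    by rewrite big1// => j; rewrite eq_sym => /negbTE ->.
  rewrite (bigD1 k)//= eqxx big1 ?addr0// => j /andP[_ /negbTE ->]//.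
rewrite big_split/= -mulr_suml (bigD1 k)//= eqxx big1 ?addr0; last by move=> i /negbTE ->.
rewrite mul1r mulr_natl mulr2n; congr (_ + _).
rewrite [RHS]big_mkcond; apply: eq_bigr => i _; by case: (i != k); rewrite ?mul1r ?mul0r.
Qed.

Lemma grad_H N (z : 'I_N -> pt R) k :
  (forall j, `|z j - a0| < rho) -> (forall i j, i != j -> 0 < csq (z i - z j)) ->
  (forall i j, `|z i - z j| <= 3) ->
  grad_k (H_Omega g) z k =
    - (pi^-1 *: \sum_(j < N | j != k) phi (z k - z j) + 2 *: \sum_(j < N) D (z k) (z j)).
Proof.
move=> zr zd z3; apply: basis_grad => v v1.
pose A j := - dot (phi (z k - z j)) v; pose B j := dot (D (z k) (z j)) v.
have uk p : upd z k p k = p by rewrite /upd eqxx.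
have un p j : j != k -> upd z k p j = z j by rewrite /upd => /negbTE ->.
have q1 i j : i != j -> quadr (z k) v (fun p => ln ((cabs (upd z k p i - upd z k p j))^-1))
    ((i == k)%:R * A j + (j == k)%:R * A i).
  have [->|ik] := eqVneq i k => ij.
    rewrite eq_sym (negbTE ij) mul1r mul0r addr0.
    rewrite (_ : (fun p => _) = fun p => ln ((cabs (p - z j))^-1)); first by apply: quadr_ln => //; exact: zd.
    by apply/funext => p; rewrite uk un// eq_sym.
  have [->|jk] := eqVneq j k.
    rewrite mul1r mul0r add0r.
    rewrite (_ : (fun p => _) = fun p => ln ((cabs (p - z i))^-1)); first by apply: quadr_ln => //; apply: zd; rewrite eq_sym.
    apply/funext => p; rewrite uk un// !ln_cabs; congr (- (ln _ / 2)); rewrite /csq !ptE; ring.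
  rewrite !mul0r addr0 (_ : (fun p => _) = fun=> ln ((cabs (z i - z j))^-1)); first exact: quadr_cst.
  by apply/funext => p; rewrite !un.
have q2 i j : i != j -> quadr (z k) v (fun p => g (upd z k p i, upd z k p j))
    ((i == k)%:R * B j + (j == k)%:R * B i).
  have [->|ik] := eqVneq i k => ij.
    rewrite eq_sym (negbTE ij) mul1r mul0r addr0.
    rewrite (_ : (fun p => _) = fun p => g (p, z j)); first exact: quadr_gl.
    by apply/funext => p; rewrite uk un// eq_sym.
  have [->|jk] := eqVneq j k.
    rewrite mul1r mul0r add0r.
    rewrite (_ : (fun p => _) = fun p => g (z i, p)); first exact: quadr_gr.
    by apply/funext => p; rewrite uk un.
  rewrite !mul0r addr0 (_ : (fun p => _) = fun=> g (z i, z j)); first exact: quadr_cst.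
  by apply/funext => p; rewrite !un.
have q3 i : quadr (z k) v (fun p => g (upd z k p i, upd z k p i)) ((i == k)%:R * (2 * B k)).
  have [->|ik] := eqVneq i k.
    rewrite mul1r (_ : (fun p => _) = fun p => g (p, p)); first exact: quadr_gd.
    by apply/funext => p; rewrite uk.
  rewrite mul0r (_ : (fun p => _) = fun=> g (z i, z i)); first exact: quadr_cst.
  by apply/funext => p; rewrite !un.
have Q1 := @quadr_sum _ _ (z k) v _ (index_enum 'I_N) xpredT _ _ (fun i _ =>
   @quadr_sum _ _ (z k) v _ (index_enum 'I_N) (fun j => i != j) _ _ (fun j ij => q1 i j ij)).
have Q2 := @quadr_sum _ _ (z k) v _ (index_enum 'I_N) xpredT _ _ (fun i _ =>
   @quadr_sum _ _ (z k) v _ (index_enum 'I_N) (fun j => i != j) _ _ (fun j ij => q2 i j ij)).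
have Q3 := @quadr_sum _ _ (z k) v _ (index_enum 'I_N) xpredT _ _ (fun i _ => q3 i).
have S3 : \sum_(i < N) (i == k)%:R * (2 * B k) = 2 * B k.
  rewrite -mulr_suml (bigD1 k)//= eqxx big1 ?addr0 ?mul1r//.
  by move=> i /negbTE ->.
have := quadrD (quadrD (quadrZ (2 * pi)^-1 Q1) (quadrZ (-1) Q2)) (quadrZ (-1) Q3).
rewrite !sum_pairs S3.
have -> : (2 * pi)^-1 * (2 * \sum_(j < N | j != k) A j) + -1 * (2 * \sum_(j < N | j != k) B j) + -1 * (2 * B k) =
  dot (- (pi^-1 *: \sum_(j < N | j != k) phi (z k - z j) + 2 *: \sum_(j < N) D (z k) (z j))) v.
  have pn : pi != 0 :> R by rewrite gt_eqF// pi_gt0.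
  have -> : \sum_(j < N | j != k) A j = - dot (\sum_(j < N | j != k) phi (z k - z j)) v.
    by rewrite /A sumrN; congr (- _); rewrite /dot !ptE !mulr_suml -big_split.
  have EB : dot (\sum_(j < N) D (z k) (z j)) v = \sum_(j < N | j != k) B j + B k.
    by rewrite (bigD1 k)//= addrC /B /dot !ptE !mulrDl !mulr_suml big_split/= addrACA.
  have ED (p q : pt R) : dot (- (pi^-1 *: p + 2 *: q)) v = - (pi^-1 * dot p v + 2 * dot q v).
    by rewrite /dot !ptE; ring.
  rewrite ED EB; move: pn; move: (@pi R) => P pn; by field.
rewrite (_ : (fun p => _) = fun p : pt R => H_Omega g (upd z k p))//.
by apply/funext => p; rewrite /H_Omega !mulN1r.
Qed.

End Gradient.

(** * Derivatives and the H^1 norm of plane curves *)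

Section CurveDerivatives.
Context {R : realType}.

Lemma Dv_derive1 (v v' : R -> pt R) (t : R) : Dv v v' -> derivable v t 1 /\ derive1 v t = v' t.
Proof.
move=> [d1 d2]; have [e1 l1] := d1 t; have [e2 l2] := d2 t.
have cv : (fun h : R => h^-1 *: (v (h *: 1 + t) - v t)) @ 0^' --> v' t.
  rewrite (surjective_pairing (v' t)) -l1 -l2.
  rewrite (_ : (fun h => _) = fun h : R => (h^-1 *: ((v (h *: 1 + t)).1 - (v t).1), h^-1 *: ((v (h *: 1 + t)).2 - (v t).2)))//.
  by apply: cvg_pair_at; [exact: e1|exact: e2].
split; first by apply/cvg_ex; exists (v' t).
by rewrite derive1E; exact/cvg_lim.
Qed.

Lemma cos_lt1 (t : R) : 0 < t < 2 * pi -> cos t < 1.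
Proof.
move=> /andP[t0 tp]; have -> : t = (t / 2) *+ 2 by rewrite mulr2n; field.
rewrite cos_mulr2n cos2sin2.
suff s0 : 0 < sin (t / 2) ^+ 2 :> R by lra.
by rewrite exprn_gt0// sin_gt0_pi//; apply/andP; split; [rewrite divr_gt0|rewrite ltr_pdivrMr//; lra].
Qed.

(** The integrand is at most [4 * B ^+ 2], as [csq] is at most twice the square of the maximum
    norm. *)
Lemma H1sq_bound (v v' : R -> pt R) (B : R) : Dv v v' -> continuous v' ->
  (forall t, `|v t| <= B) -> (forall t, `|v' t| <= B) ->
  (0 <= H1sq v <= (8 * pi * B ^+ 2)%:E)%E.
Proof.
move=> Dvv cv' vB v'B; have cv := Dv_continuous Dvv.
have E : (fun t => (csq (v t) + csq (derive1 v t))%:E) = fun t => (csq (v t) + csq (v' t))%:E.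
  by apply/funext => t; have [_ ->] := Dv_derive1 t Dvv.
rewrite /H1sq E; apply/andP; split.
  by apply: integral_ge0 => t _; rewrite lee_fin addr_ge0 ?csq_ge0.
have cf : continuous (fun t => csq (v t) + csq (v' t)) by rewrite /csq; ctn.
have B0 : 0 <= B by exact: le_trans (vB 0).
apply: (@le_trans _ _ (\int[lebesgue_measure]_(t in `[0%R, (2 * pi)%R]) (cst (4 * B ^+ 2)%:E) t)%E).
  apply: ge0_le_integral => //=.
  - by move=> t _; rewrite lee_fin addr_ge0 ?csq_ge0.
  - apply/measurable_EFinP; apply: measurable_funTS; exact: continuous_measurable_fun.
  - move=> t _; rewrite lee_fin.
    have c1 : csq (v t) <= 2 * B ^+ 2.
      by apply: (le_trans (csq_le _)); apply: ler_wpM2l => //; apply: lerXn2r; rewrite ?nnegrE.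
    have c2 : csq (v' t) <= 2 * B ^+ 2.
      by apply: (le_trans (csq_le _)); apply: ler_wpM2l => //; apply: lerXn2r; rewrite ?nnegrE.
    by lra.
rewrite integral_cst//= lebesgue_measure_itv/= lte_fin tpi_gt0 -EFinB -EFinM lee_fin.
by rewrite subr0 le_eqVlt; apply/orP; left; apply/eqP; move: (@pi R) => P; ring.
Qed.

End CurveDerivatives.

(** * From the rescaled curve to a choreography of vortices *)

Section VortexCurves.
Context {R : realType} (N : nat) (N2 : (2 <= N)%N).
Local Notation th := (@th R N).
Variables (g : pt2 R -> R) (D : pt R -> pt R -> pt R) (a0 : pt R) (rho L mu : R).
Hypotheses (rho0 : 0 < rho) (L0 : 0 < L) (mu0 : 0 < mu) (mu1 : mu <= 1).
Hypothesis farW : forall j (t : R), (0 < j < N)%N -> 2 * mu <= csq (W N j t).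
Hypothesis tay : taylor2 g D a0 rho L.
Local Notation cc := (@cc R N).

Lemma vshift_sum (F : nat -> pt R) j : (forall k, F (k + N)%N = F k) ->
  \sum_(0 <= k < N) F (k + j)%N = \sum_(0 <= k < N) F k.
Proof.
move=> FN; apply: pt_eq; rewrite !ptE.
  by apply: (@shift_sum R N (fun k => (F k).1)) => k; rewrite FN.
by apply: (@shift_sum R N (fun k => (F k).2)) => k; rewrite FN.
Qed.

Lemma per_thN (u : R -> pt R) t j : per u -> u (t + th (j + N)) = u (t + th j).
Proof.
move=> pu; rewrite th_add addrA.
have -> : th N = 2 * pi.
  by rewrite /th mulfK// pnatr_eq0 -lt0n; exact: leq_trans N2.
exact: pu.
Qed.

Section Curve.
Variables (a : pt R) (r : R) (u : R -> pt R).
Hypotheses (au : adm mu u) (oa : oka a0 rho a) (kr : okr rho r).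
Hypothesis Du : Dv u (fun t => Jr (Y N D a r u t)).

(** The frequency [2 pi / T_r]. *)
Definition omega : R := (cc * r ^+ 2)^-1.
Definition vortex (k : 'I_N) (t : R) : pt R := a + r *: u (omega * t + th k).

Let r0 : 0 < r. Proof. by case: kr. Qed.
Let cu : continuous u. Proof. by case: au. Qed.
Let pu : per u. Proof. by case: au. Qed.
Let c0 : 0 < cc. Proof. exact: cc_gt0. Qed.

Lemma u_bound t : `|u t| <= 17 / 16.
Proof.
have [_ _ ud] := au; rewrite -(subrK (cis t) (u t)); apply: (le_trans (ler_normD _ _)).
by have := ud t; have := cis_bound t; have := mu1; rewrite /del; lra.
Qed.

Lemma u_far (s : R) (i j : 'I_N) : i != j -> mu <= csq (u (s + th i) - u (s + th j)).
Proof.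
have key (i' j' : nat) : (i' < j' < N)%N -> mu <= csq (u (s + th i') - u (s + th j')).
  move=> /andP[ij jN]; have jiN : (0 < j' - i' < N)%N.
    by rewrite subn_gt0 ij (leq_ltn_trans (leq_subr _ _) jN).
  have [h _] := adm_far mu0 mu1 farW (s + th i') au jiN.
  by move: h; rewrite -addrA -th_add subnKC// ltnW.
move=> ij; have [lt|lt|e] := ltngtP i j.
- by apply: key; rewrite lt ltn_ord.
- rewrite (_ : csq _ = csq (u (s + th j) - u (s + th i))); last by rewrite /csq !ptE; ring.
  by apply: key; rewrite lt ltn_ord.
- by move: ij; rewrite (val_inj e) eqxx.
Qed.

Lemma vortex_ball k t : `|vortex k t - a0| < rho.
Proof.
have [rp r1 r4] := kr; rewrite /vortex (_ : _ - a0 = (a - a0) + r *: u (omega * t + th k)); last by rewrite addrAC.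
apply: (le_lt_trans (ler_normD _ _)); rewrite normZ_gt0//.
have : r * `|u (omega * t + th k)| <= r * (17 / 16) by apply: ler_wpM2l; [exact: ltW|exact: u_bound].
by move: oa rho0; rewrite /oka; lra.
Qed.

Lemma vortexB i j t : vortex i t - vortex j t = r *: (u (omega * t + th i) - u (omega * t + th j)).
Proof. by apply: pt_eq; rewrite /vortex !ptE; ring. Qed.

Lemma vortex_far i j t : i != j -> 0 < csq (vortex i t - vortex j t).
Proof.
move=> ij; rewrite vortexB (_ : csq (r *: _) = r ^+ 2 * csq (u (omega * t + th i) - u (omega * t + th j))); last first.
  by rewrite /csq !ptE; ring.
by rewrite mulr_gt0 ?exprn_gt0//; exact: lt_le_trans (u_far _ ij).
Qed.

Lemma vortex_near i j t : `|vortex i t - vortex j t| <= 3.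
Proof.
have [rp r1 r4] := kr; rewrite vortexB normZ_gt0//.
have h : `|u (omega * t + th i) - u (omega * t + th j)| <= 3.
  apply: (le_trans (ler_normB _ _)).
  by have := u_bound (omega * t + th i); have := u_bound (omega * t + th j); lra.
by rewrite -[3]mul1r; apply: ler_pM => //; exact: ltW.
Qed.

Lemma Dv_vortex k : Dv (vortex k) (fun t => (r * omega) *: Jr (Y N D a r u (omega * t + th k))).
Proof.
have [d1 d2] := Du.
have lin : Deriv (fun t => omega * t + th k) (fun=> omega).
  by apply: (Deriv_ext (DerivD (DerivM (Deriv_cst omega) (@Deriv_id R)) (Deriv_cst (th k)))) => t; ring.
split.
  apply: (Deriv_ext (DerivD (Deriv_cst a.1) (DerivM (Deriv_cst r) (Deriv_comp d1 lin)))) => t.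
  by rewrite !ptE; ring.
apply: (Deriv_ext (DerivD (Deriv_cst a.2) (DerivM (Deriv_cst r) (Deriv_comp d2 lin)))) => t.
by rewrite !ptE; ring.
Qed.

Lemma phi0 : phi (0 : pt R) = 0.
Proof. by rewrite /phi scaler0. Qed.

(** The term [j = k] can be added because [phi 0 = 0]; the full sum over the polygon is then
    invariant under shifting the index by [k]. *)
Lemma sum_phi k t : \sum_(j < N | j != k) phi (vortex k t - vortex j t) = r^-1 *: S1 N u (omega * t + th k).
Proof.
have N0 : (0 < N)%N by exact: leq_trans N2.
have phiZ (w : pt R) : phi (r *: w) = r^-1 *: phi w.
  rewrite /phi; have [z|nz] := eqVneq (csq w) 0.
    have -> : w = 0.
      move: z; rewrite /csq => /eqP; rewrite paddr_eq0 ?sqr_ge0// !sqrf_eq0 => /andP[/eqP h1 /eqP h2].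
      by apply: pt_eq.
    by rewrite !scaler0.
  rewrite !scalerA; congr (_ *: _); rewrite (_ : csq (r *: w) = r ^+ 2 * csq w); last by rewrite /csq !ptE; ring.
  by field; rewrite nz gt_eqF.
set s := omega * t + th k.
transitivity (\sum_(0 <= j < N) r^-1 *: phi (u s - u (omega * t + th j))).
  rewrite big_mkord big_mkcond; apply: eq_bigr => j _; have [->|jk] := eqVneq j k.
    by rewrite /= -/s subrr phi0 scaler0.
  by rewrite /= vortexB phiZ.
rewrite -scaler_sumr; congr (_ *: _).
rewrite -(@vshift_sum (fun j => phi (u s - u (omega * t + th j))) k); last by move=> j; rewrite per_thN.
rewrite big_ltn//= add0n subrr phi0 add0r; apply: eq_bigr => j _.
by rewrite addnC th_add addrA.
Qed.

Lemma sum_D k t : \sum_(j < N) D (vortex k t) (vortex j t) = S2 N D a r u (omega * t + th k).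
Proof.
rewrite /S2 -(@big_mkord _ _ _ N xpredT (fun j => D (vortex k t) (a + r *: u (omega * t + th j)))).
rewrite -(@vshift_sum (fun j => D (vortex k t) (a + r *: u (omega * t + th j))) k); last by move=> j; rewrite per_thN.
by apply: eq_bigr => j _; rewrite addnC th_add addrA.
Qed.

Lemma vortex_solves (Om : set (pt R)) : (forall x, `|x - a0| <= rho -> Om x) -> solves_HS Om g vortex.
Proof.
move=> sub t; split; first by move=> k; apply: sub; exact: ltW (vortex_ball k t).
split=> [j k jk|k].
  apply/eqP => e; have := vortex_far t jk; rewrite e subrr.
  by rewrite /csq /= expr0n/= addr0 ltxx.
have [d e] := Dv_derive1 t (Dv_vortex k); split=> //; rewrite e.
rewrite (grad_H L0 tay).
- rewrite sum_phi sum_D /Y /mul_mi; move: (S1 _ _ _) (S2 _ _ _ _ _ _) => p q.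
  have p0 : 0 < pi :> R by exact: pi_gt0.
  have n1 := @N1_gt0 R N N2.
  have cp : cc = 2 * pi / (N%:R - 1) by [].
  have kp : kap N = 2 / (N%:R - 1) :> R by [].
  rewrite /omega cp kp; move: r0 p0 n1; move: (@pi R) (N%:R - 1) => P n rp p0 n1.
  by apply: pt_eq; rewrite !ptE /= ?ptE; field; rewrite !gt_eqF.
- by move=> j; exact: vortex_ball.
- by move=> i j ij; exact: vortex_far.
- by move=> i j; exact: vortex_near.
Qed.

Lemma ip_cis_pos : 0 < ip cis u.
Proof.
have [_ _ ud] := au; have [ccs _ _] := @adm_cis R mu mu0; have m1 := mu1; have m0 := mu0.
apply: (@lt_le_trans _ _ (1 / 2)); first by lra.
rewrite -[leLHS](mean_cst (1 / 2)); apply: mean_le; [exact: ct_cst|exact: vct_dot|].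
move=> t _; have -> : dot (cis t) (u t) = 1 + dot (cis t) (u t - cis t).
  by have := cos2Dsin2 t; rewrite /dot /cis !ptE /= => <-; ring.
have := dot_le (cis t) (u t - cis t); have h : `|cis t| * `|u t - cis t| <= 1 * del mu.
  by apply: ler_pM => //; exact: cis_bound.
rewrite ler_norml => /andP[h2 _]; move: h h2; rewrite /del.
by move: (dot _ _) (`|cis t| * _) => x y; lra.
Qed.

(** Invariance under the shift by [tau] makes the vector [(X, Z)] of first Fourier coefficients a
    fixed vector of the rotation by [tau]. It is nonzero because [u] is close to [cis], whereas
    [cos tau < 1]. *)
Lemma no_small_period (tau : R) : 0 < tau < 2 * pi -> ~ (forall s, u (s + tau) = u s).
Proof.
move=> tI ut; have [ccs pc _] := @adm_cis R mu mu0; have cJ := vctJ ccs.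
pose X := ip cis u; pose Z := ip (fun t => Jr (cis t)) u.
have X0 : 0 < X by exact: ip_cis_pos.
have c1 := cos_lt1 tI.
have sh (F : R -> pt R) : continuous F -> per F -> ip (fun t => F (t - tau)) u = ip F u.
  move=> cF pF; rewrite /ip -[RHS](@mean_shift R _ (- tau)); last by move=> t; rewrite pF pu.
    by apply: eq_mean => t; rewrite -(ut (t - tau)) subrK.
  exact: vct_dot.
have E1 : X = cos tau * X - sin tau * Z.
  rewrite -{1}[X](sh _ ccs pc) /X /Z -!ipZl//.
  rewrite /ip -meanB; [|by apply: vct_dot => //; vctn..].
  by apply: eq_mean => t; rewrite /cis cosB sinB /dot !ptE /=; ring.
have pJ : per (fun t : R => Jr (cis t)) by move=> t; rewrite pc.
have E2 : Z = cos tau * Z + sin tau * X.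
  rewrite -{1}[Z](sh _ cJ pJ) /X /Z -!ipZl//.
  rewrite /ip -meanD; [|by apply: vct_dot => //; vctn..].
  by apply: eq_mean => t; rewrite /cis cosB sinB /dot !ptE /=; ring.
have E3 : ((1 - cos tau) ^+ 2 + sin tau ^+ 2) * X = 0.
  have e1 : (1 - cos tau) * X = - sin tau * Z by lra.
  have e2 : (1 - cos tau) * Z = sin tau * X by lra.
  have -> : ((1 - cos tau) ^+ 2 + sin tau ^+ 2) * X =
    (1 - cos tau) * ((1 - cos tau) * X) + sin tau * (sin tau * X) by ring.
  by rewrite e1 -e2; ring.
have : 0 < ((1 - cos tau) ^+ 2 + sin tau ^+ 2) * X.
  by rewrite mulr_gt0// ltr_pwDl ?sqr_ge0// exprn_gt0//; lra.
by rewrite E3 ltxx.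
Qed.

Lemma vortex_period : minimal_period vortex (4 * pi ^+ 2 * r ^+ 2 / (N%:R - 1)).
Proof.
have n1 := @N1_gt0 R N N2; have p0 := @pi_gt0 R; have rp := r0.
set T := _ / _.
have T0 : 0 < T by rewrite divr_gt0// !mulr_gt0// exprn_gt0.
have om0 : 0 < omega by rewrite invr_gt0 mulr_gt0 ?exprn_gt0.
have oT : omega * T = 2 * pi.
  rewrite /T /omega; have -> : cc = 2 * pi / (N%:R - 1) by [].
  move: n1 p0 rp; move: (@pi R) (N%:R - 1) => P n ? ? ?; field.
  by rewrite !gt_eqF.
split=> //; split=> [k t|T' /andP[T'0 T'T] H].
  by rewrite /vortex mulrDr oT -addrA (addrC (2 * pi)) addrA pu.
apply: (@no_small_period (omega * T')); first by rewrite mulr_gt0//= -oT ltr_pM2l.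
move=> s; have N0 : (0 < N)%N by exact: leq_trans N2.
(* A smaller period is already excluded by the vortex of index 0. *)
have := H (Ordinal N0) (s / omega).
rewrite /vortex /= th0 !addr0 mulrDr [omega * (s / omega)]mulrC divfK ?gt_eqF//.
by move=> /addrI; apply: scalerI; rewrite gt_eqF.
Qed.

Lemma vortex_choreography (k i0 : 'I_N) t : val i0 = 0%N ->
  vortex k t = vortex i0 (t + (val k)%:R * (4 * pi ^+ 2 * r ^+ 2 / (N%:R - 1)) / N%:R).
Proof.
move=> i00; rewrite /vortex i00 th0 addr0; congr (_ + _ *: u _).
have n1 := @N1_gt0 R N N2; have p0 := @pi_gt0 R; have rp := r0.
have N0 : 0 < N%:R :> R by rewrite ltr0n; exact: leq_trans N2.
rewrite /omega /th; have -> : cc = 2 * pi / (N%:R - 1) by [].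
move: n1 p0 rp N0; move: (@pi R) (N%:R : R) (N%:R - 1) => P m n ? ? ? ?; field.
by rewrite !gt_eqF.
Qed.

Lemma vortex_rescale (i0 : 'I_N) t : val i0 = 0%N ->
  r^-1 *: (vortex i0 (4 * pi ^+ 2 * r ^+ 2 / (N%:R - 1) * t / (2 * pi)) - a) = u t.
Proof.
move=> i00; rewrite /vortex i00 th0 addr0 (addrC a) addrK scalerA mulVf ?gt_eqF// scale1r.
congr u; have n1 := @N1_gt0 R N N2; have p0 := @pi_gt0 R; have rp := r0.
rewrite /omega; have -> : cc = 2 * pi / (N%:R - 1) by [].
move: n1 p0 rp; move: (@pi R) (N%:R - 1) => P n ? ? ?; field.
by rewrite !gt_eqF.
Qed.

End Curve.
End VortexCurves.

Lemma taylor2_shrink {R : realType} (g : pt2 R -> R) D (a : pt R) (rho rho' L : R) : rho' <= rho ->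
  taylor2 g D a rho L -> taylor2 g D a rho' L.
Proof.
by move=> h tay x y x' y' e e0 h1 h2 h3 h4; apply: tay => //; exact: le_trans h.
Qed.

(** The infimum of the distances may fail to be attained; a point within [r] of it is enough, as [r]
    tends to 0. *)
Lemma closest_choice {R : realType} (Z : set (pt R)) (a : pt R) (r : R) : 0 < r -> Z !=set0 ->
  exists2 x, Z x & forall y, Z y -> `|x - a| <= `|y - a| + r.
Proof.
move=> r0 [z Zz]; pose E := [set `|y - a| | y in Z].
have hE : has_inf E.
  by split; [exists `|z - a|; exists z|exists 0 => _ [y _ <-]].
have [_ [x Zx <-] xE] := inf_adherent r0 hE; exists x => // y Zy.
have : inf E <= `|y - a| by apply: ge_inf; [exact: hE.2|exists y].
by lra.
Qed.

Theorem theorem2p1 (R : realType) (Omega : set (pt R)) (N : nat)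
    (g : pt2 R -> R) (a0 : pt R) :
  open Omega -> connected Omega -> (2 <= N)%N ->
  C2_closO_O Omega g ->
  (forall w z, Omega w -> Omega z -> g (w, z) = g (z, w)) ->
  stable_crit Omega (fun z => g (z, z)) a0 ->
  exists2 r0 : R, 0 < r0 &
  exists (z : R -> 'I_N -> R -> pt R) (a : R -> pt R),
    let T := fun r : R => 4 * pi ^+ 2 * r ^+ 2 / (N%:R - 1) in
    [/\ forall r, 0 < r <= r0 ->
          [/\ solves_HS Omega g (z r),
              minimal_period (z r) (T r) &
              forall (k i0 : 'I_N), val i0 = 0%N ->
                forall t, z r k t = z r i0 (t + (val k)%:R * T r / N%:R)],
        forall r, 0 < r <= r0 -> Omega (a r),
        a r @[r --> 0^'+] --> a0 &
        forall i0 : 'I_N, val i0 = 0%N ->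
          H1sq (fun t => r^-1 *: (z r i0 (T r * t / (2 * pi)) - a r) - (cos t, sin t))
            @[r --> 0^'+] --> 0%E].
Proof.
move=> oOm _ N2 C2 sym [[Oa [ga [e e0 He]]] [n [c [cX [rc ntriv]]]]].
have [rt [L [rt0 L0 sub tay0]]] := local_taylor oOm Oa C2 sym.
(* Within [rt] the Taylor estimate holds, and within [e] the point [a0] is the only critical point
   of [h]. *)
pose D := grad1 g; pose rho := Num.min rt e.
have rho0 : 0 < rho by rewrite lt_min rt0.
have rt1 : rho <= rt by rewrite ge_min lexx.
have re1 : rho <= e by rewrite ge_min lexx orbT.
have tay : taylor2 g D a0 rho L by exact: taylor2_shrink tay0.
have subO x : `|x - a0| <= rho -> Omega x by move=> h; apply: sub; exact: le_trans rt1.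
(* By [csq_W] the squared distance of two vertices is [2 - 2 cos (th j)] at all times, so a common
   lower bound over finitely many [j] gives the separation. *)
have [j jN|mu /andP[mu0 mu1] Hmu] := @finite_min R (fun j => (2 - 2 * cos (th N j)) / 2) N.
  have c1 : cos (th N j) < 1 :> R := cos_th_lt1 jN.
  by rewrite divr_gt0//; lra.
have farW j (t : R) : (0 < j < N)%N -> 2 * mu <= csq (W N j t).
  by move=> /Hmu; rewrite csq_W; lra.
have gradD x : `|x - a0| < rho -> grad (fun z => g (z, z)) x = 2 *: D x x.
  exact: (grad_diag L0 tay).
have [r1 [C [r10 C0 [V [ph [F HR]]]]]] := reduced_problem N2 rho0 L0 mu0 mu1 farW tay.
(* The reduced gradient has a zero in every small ball around [a0], once [r] is below a threshold
   that depends on the ball. This gives existence and, through the choice below, the convergence of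
   [a r]. *)
have zeros d : 0 < d <= rho / 2 -> exists2 rr : R, 0 < rr & forall r, 0 < r <= rr ->
    r <= r1 /\ exists2 x, `|x - a0| <= d & F r x = 0.
  move=> /andP[d0 d2].
  have inb x : `|x - a0| <= d -> `|x - a0| <= rho by move=> h; have := rho0; lra.
  have ok x : `|x - a0| <= d -> oka a0 rho x by rewrite /oka => h; lra.
  have dot2 (p q : pt R) : dot (2 *: p) q = 2 * dot p q by rewrite /dot !ptE; ring.
  have hT x y : `|x - a0| <= d -> `|y - a0| <= d ->
      `|(g (y, y) - g (a0, a0)) - (g (x, x) - g (a0, a0)) - dot (2 *: D x x) (y - x)| <= 2 * L * `|y - x| ^+ 2.
    move=> /inb xd /inb yd.
    have [+ _] := tay x x y y `|y - x| (normr_ge0 _) xd xd yd yd (lexx _) (lexx _).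
    have -> : (g (y, y) - g (a0, a0)) - (g (x, x) - g (a0, a0)) - dot (2 *: D x x) (y - x) =
       g (y, y) - g (x, x) - dot (D x x) (y - x) - dot (D x x) (y - x).
      rewrite dot2; move: (dot _ _) (g (y, y)) (g (x, x)) (g (a0, a0)) => p q s t; clear; ring.
    move=> h; apply: (le_trans h); apply: ler_wpM2r; first exact: sqr_ge0.
    by lra.
  have fL x y : `|x - a0| <= d -> `|y - a0| <= d -> `|2 *: D y y - 2 *: D x x| <= 2 * L * `|y - x|.
    move=> /inb xd /inb yd; rewrite -scalerBr normZ_gt0// -mulrA; apply: ler_wpM2l => //.
    by have [] := tay x x y y `|y - x| (normr_ge0 _) xd xd yd yd (lexx _) (lexx _).
  have ha : g (a0, a0) - g (a0, a0) = 0 by rewrite subrr.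
  have fa : 2 *: D a0 a0 = 0 by rewrite -gradD// subrr normr0.
  have fn0 x : `|x - a0| <= d -> x != a0 -> 2 *: D x x != 0.
    move=> xd xa; have xr : `|x - a0| < rho by have := rho0; lra.
    by rewrite -gradD//; apply: He => //; [apply: subO; exact: ltW|exact: lt_le_trans re1].
  have Xh x : `|x - a0| <= d -> (sublevel Omega (fun z => g (z, z)) (g (a0, a0)) x <-> g (x, x) - g (a0, a0) <= 0).
    move=> /inb xd; rewrite subr_le0; split; first by case.
    by move=> h; split=> //; exact: subO.
  have L20 : 0 < 2 * L by lra.
  (* The same cycle serves for every radius [d]: it lives in the whole sublevel set, and only the
     ball in which the deformation takes place shrinks. *)
  have [eps eps0 Heps] := @nontrivial_zero R (fun x => g (x, x) - g (a0, a0)) (fun x => 2 *: D x x) a0 d (2 * L)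
    d0 L20 hT fL ha fa fn0 _ n c Xh cX rc ntriv.
  have C1 : 0 < C + 1 by lra.
  exists (Num.min r1 (eps / (C + 1))); first by rewrite lt_min r10 divr_gt0.
  move=> r /andP[rp]; rewrite le_min => /andP[rr1 rr2]; split=> //.
  have rr : 0 < r <= r1 by rewrite rp.
  have [kr lipF nearF _] := HR r rr.
  have Cr : C * r <= eps by move: rr2; rewrite ler_pdivlMr//; lra.
  apply: (Heps (ph r) (F r) C C0).
  - by move=> x xd; have [h1 h2] := nearF x (ok x xd); split; [exact: le_trans h1 Cr|exact: le_trans h2 Cr].
  - by move=> x y xd yd; have [] := lipF x y (ok x xd) (ok y yd).
  - by move=> x y xd yd; have [] := lipF x y (ok x xd) (ok y yd).
have dd : 0 < rho / 2 <= rho / 2 by rewrite lexx divr_gt0.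
have [r0 r00 Hr0] := zeros _ dd.
(* The zero closest to [a0] up to an error [r]: as soon as some zero lies within [d], the chosen one
   lies within [d + r]. Outside the range of [r] the value [a0] is a default. *)
have /choice[a Ha] : forall r, exists x, 0 < r <= r0 ->
    [/\ oka a0 rho x, F r x = 0 & forall y, oka a0 rho y -> F r y = 0 -> `|x - a0| <= `|y - a0| + r].
  move=> r; have [rr|nr] := boolP (0 < r <= r0); last by exists a0.
  have [_ [x xd Fx]] := Hr0 r rr; have /andP[rp _] := rr.
  have [|y [oy Fy] Hy] := @closest_choice R [set y | oka a0 rho y /\ F r y = 0] a0 r rp.
    by exists x.
  by exists y => _; split=> // y' oy' Fy'; exact: Hy.
pose u r t := cis t + V (a r) r t.
have sol r : 0 < r <= r0 -> [/\ okr rho r, oka a0 rho (a r), adm mu (u r), Dv (u r) (fun t => Jr (Y N D (a r) r (u r) t)) &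
    (forall t, `|V (a r) r t| <= C * r) /\ (forall t, `|Jr (Y N D (a r) r (u r) t) - Jr (cis t)| <= C * r)].
  move=> rr; have [oa Fa _] := Ha r rr; have [rr1 _] := Hr0 r rr.
  have rr' : 0 < r <= r1 by case/andP: rr => ->.
  by have [kr _ _ H] := HR r rr'; have [] := H (a r) oa Fa.
exists r0 => //; exists (fun r => @vortex R N (a r) r (u r)), a => T; split.
- move=> r rr; have [kr oa au Du _] := sol r rr; split.
  + exact: (vortex_solves N2 rho0 L0 mu0 mu1 farW tay au oa kr Du subO).
  + exact: (vortex_period N2 mu0 mu1 _ au kr).
  + by move=> k i0 i00 t; exact: (vortex_choreography N2 _ _ kr).
- move=> r rr; have [_ oa _ _ _] := sol r rr; apply: subO.
  by move: oa; rewrite /oka; lra.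
- apply/cvgrPdist_le => eps eps0.
  pose d := Num.min (rho / 2) (eps / 2).
  have d0 : 0 < d <= rho / 2 by rewrite lt_min !divr_gt0//= ge_min lexx.
  have [rr rr0 Hrr] := zeros d d0.
  have m0 : 0 < Num.min (Num.min r0 rr) (eps / 2) by rewrite !lt_min r00 rr0 divr_gt0.
  near=> r.
  have rp : 0 < r by near: r; exact: nbhs_right_gt.
  have : r <= Num.min (Num.min r0 rr) (eps / 2) by near: r; exact: nbhs_right_le.
  rewrite !le_min => /andP[/andP[h1 h2] h3].
  have rr' : 0 < r <= r0 by rewrite rp.
  have [_ _ cl] := Ha r rr'.
  have [|_ [y yd Fy]] := Hrr r; first by rewrite rp.
  have d1 : d <= rho / 2 by rewrite ge_min lexx.
  have d2 : d <= eps / 2 by rewrite ge_min lexx orbT.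
  have oy : oka a0 rho y := le_trans yd d1.
  by rewrite distrC; have := cl y oy Fy; lra.
- move=> i0 i00.
  pose w r t : pt R := r^-1 *: (@vortex R N (a r) r (u r) i0 (T r * t / (2 * pi)) - a r) - (cos t, sin t).
  have key r : 0 < r <= r0 -> (0 <= H1sq (w r) <= (8 * pi * (C * r) ^+ 2)%:E)%E.
    move=> rr; have [kr oa au Du [Vb Yb]] := sol r rr.
    rewrite (_ : w r = V (a r) r); last first.
      by apply/funext => t; rewrite /w (vortex_rescale N2 _ _ kr)// /u /cis addrC addKr.
    have cY := Y_continuous L0 mu0 mu1 farW (DL tay) au oa kr.
    have [ccs _ _] := @adm_cis R mu mu0.
    apply: (@H1sq_bound R _ (fun t => Jr (Y N D (a r) r (u r) t) - Jr (cis t))) => //.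
      have := DvB Du (@Dv_cis R); rewrite (_ : (fun t => u r t - cis t) = V (a r) r)//.
      by apply/funext => t; rewrite /u addrC addKr.
    by vctn.
  apply: (@squeeze_cvge _ _ _ _ (cst 0%E) _ (fun r => (8 * pi * (C * r) ^+ 2)%:E)).
  + near=> r; apply: key.
    by apply/andP; split; near: r; [exact: nbhs_right_gt|exact: nbhs_right_le].
  + exact: cvg_cst.
  + apply: cvg_EFin; first by near=> r.
    have cf : continuous (fun r : R => 8 * pi * (C * r) ^+ 2) by ctn.
    have := cvg_at_right_filter (cf 0); rewrite mulr0 expr0n/= mulr0; apply.
Unshelve. all: by end_near.
Qed.
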